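(* Let $Z$ be the MMBM regulated at level $0$ (with irreducible generator $Q$, drift vector $\boldsymbol\mu$ and positive volatilities $\boldsymbol\sigma$), let $b>0$, and let $\mathcal{H}_0$ be the matrix of first passage probabilities from level $0$ to level $b$: $(\mathcal{H}_0)_{ij}=P[\delta_b<\infty,\kappa(\delta_b)=j\mid Z(0)=0,\kappa(0)=i]$. Consider the linear system in the $m\times m$ matrices $L_b,P_b$: \[ \begin{bmatrix}L_b & P_b\end{bmatrix}\begin{bmatrix} I & e^{Ub}\\ e^{\widehat U b} & I\end{bmatrix}=\Delta_\sigma\begin{bmatrix} -\widehat U e^{\widehat U b} & U\end{bmatrix}. \tag{S} \] Then $\mathcal{H}_0=(-P_b)^{-1}L_b$, where $(L_b,P_b)$ is a solution of (S), and $P_b$ is a nonsingular sub-generator; more precisely: (i) If $\boldsymbol\alpha\boldsymbol\mu\neq 0$, then the system (S) is nonsingular and its solution is \[ L_b=-\Delta_\sigma(U+\widehat U)e^{\widehat U b}(I-e^{Ub}e^{\widehat U b})^{-1},\qquad P_b=\Delta_\sigma(U+\widehat U e^{\widehat U b}e^{Ub})(I-e^{\widehat U b}e^{Ub})^{-1}, \] and $\mathcal{H}_0=e^{\widehat U b}+(e^{-Ub}-e^{\widehat U b})(Ue^{-Ub}+\widehat U e^{\widehat U b})^{-1}\widehat U e^{\widehat U b}$. (ii) If $\boldsymbol\alpha\boldsymbol\mu=0$, then the system (S) is singular, and $L_b,P_b$ are completely characterized by (S) together with the additional equation \[ L_b(b\boldsymbol 1-Q^\#\boldsymbol\mu)-P_bQ^\#\boldsymbol\mu=\boldsymbol\sigma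 . \]
   Context: $\mathcal{E}=\{1,\dots,m\}$, $Q$ an irreducible generator on $\mathcal{E}$ with stationary distribution $\boldsymbol\alpha$ ($\boldsymbol\alpha Q=\boldsymbol 0$, $\boldsymbol\alpha\boldsymbol 1=1$), $\boldsymbol\mu\in\mathbb{R}^m$ (column vector), $\boldsymbol\sigma\in(0,\infty)^m$, $\Delta_\mu=\mathrm{diag}(\mu_i)$, $\Delta_\sigma=\mathrm{diag}(\sigma_i)$. The free MMBM is $X(t)=X(0)+\int_0^t\mu_{\kappa(s)}ds+\int_0^t\sigma_{\kappa(s)}dB(s)$ with $\kappa$ a Markov chain with generator $Q$ and $B$ an independent standard Brownian motion. $Z(t)=X(t)+R_0(t)$ with $R_0$ the minimal continuous nondecreasing process, increasing only when $Z=0$, keeping $Z\ge 0$; $\delta_y=\inf\{t>0:Z(t)=y\}$. The matrices $U$ and $\widehat U$ are the (sub)generators such that, for the free MMBM started at $X(0)=0$ and any $x\ge0$, $P[\text{level } x \text{ is reached},\ \kappa \text{ at that time}=j\mid\kappa(0)=i]=(e^{\widehat U x})_{ij}$ and $P[\text{level } -x \text{ is reached},\ \kappa \text{ at that time}=j\mid\kappa(0)=i]=(e^{Ux})_{ij}$; equivalently $U$ is the minimal solution and $-\widehat U$ the maximal solution of $\Delta_\sigma^2X^2+2\Delta_\mu X+2Q=0$. $Q^\#$ is the group inverse of $Q$, the unique matrix with $Q^\#Q=I-\boldsymbol 1\boldsymbol\alpha$ and $Q^\#\boldsymbol 1=\boldsymbol 0$. A sub-generator is a matrix with nonnegative off-diagonal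 entries and nonpositive row sums. *)

(* Defs.v *)
From HB Require Import structures.
From mathcomp Require Import all_boot all_order all_algebra.
From mathcomp Require Import all_classical all_reals all_analysis.
Set Implicit Arguments. Unset Strict Implicit. Unset Printing Implicit Defensive.
Import Order.TTheory GRing.Theory Num.Theory.
Import numFieldNormedType.Exports.
Local Open Scope classical_set_scope.
Local Open Scope ring_scope.

Section Defs.
Variable R : realType.
Variable m : nat.

Definition expmx (A : 'M[R]_m) : 'M[R]_m :=
  \matrix_(i, j) limn (fun N : nat => \sum_(k < N) (A ^+ k) i j / (k`!)%:R).

Definition is_generator (Q : 'M[R]_m) : Prop :=
  (forall i j, i != j -> 0 <= Q i j) /\ (forall i, \sum_j Q i j = 0).

Definition is_subgenerator (Q : 'M[R]_m) : Prop :=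
  (forall i j, i != j -> 0 <= Q i j) /\ (forall i, \sum_j Q i j <= 0).

Definition irreducible_gen (Q : 'M[R]_m) : Prop :=
  forall i j : 'I_m, connect [rel k l | 0 < Q k l] i j.

(* finite-dimensional laws of the Markov chain started at i:
   weight of the event {kappa(t_1)=j_1,...,kappa(t_n)=j_n} *)
Fixpoint markov_w (Q : 'M[R]_m) (s : R) (i : 'I_m) (l : seq (R * 'I_m)) : R :=
  match l with
  | [::] => 1
  | (t, j) :: l' => expmx ((t - s) *: Q) i j * markov_w Q t j l'
  end.

Fixpoint kev {T : Type} (kappa : R -> T -> 'I_m) (l : seq (R * 'I_m)) : set T :=
  match l with
  | [::] => setT
  | (t, j) :: l' => [set w | kappa t w = j] `&` kev kappa l'
  end.

(* weight of {B(t_1)-B(0) in A_1, ..., B(t_n)-B(t_{n-1}) in A_n} *)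
Fixpoint bm_w (s : R) (l : seq (R * set R)) : \bar R :=
  match l with
  | [::] => 1%E
  | (t, A) :: l' => (normal_prob 0 (Num.sqrt (t - s)) A * bm_w t l')%E
  end.

Fixpoint bev {T : Type} (B : R -> T -> R) (s : R) (l : seq (R * set R)) : set T :=
  match l with
  | [::] => setT
  | (t, A) :: l' => [set w | A (B t w - B s w)] `&` bev B t l'
  end.

Fixpoint all_measurable (l : seq (R * set R)) : Prop :=
  match l with [::] => True | (_, A) :: l' => measurable A /\ all_measurable l' end.

(* The free MMBM X(t) = int_0^t mu_kappa ds + int_0^t sigma_kappa dB, X(0)=0,
   with kappa a Markov chain of generator Q started at i and B an independent
   standard Brownian motion, all defined on the probability space (Omega, P).
   Since kappa has piecewise constant paths with finitely many jumps on compacts,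
   the stochastic integral is the pathwise elementary one; X is characterized by
   its increments on intervals where kappa is constant. *)
Definition free_mmbm (Q : 'M[R]_m) (mu sigma : 'cV[R]_m) (i : 'I_m)
  {d : measure_display} {Omega : measurableType d} (P : probability Omega R)
  (kappa : R -> Omega -> 'I_m) (B X : R -> Omega -> R) : Prop :=
  (forall t j, measurable [set w | kappa t w = j]) /\
  (forall t, measurable_fun setT (B t)) /\
  (forall w, exists tau : nat -> R,
      tau 0%N = 0 /\ (forall n, tau n < tau n.+1) /\ (forall T, exists n, T < tau n) /\
      (forall n t, tau n <= t < tau n.+1 -> kappa t w = kappa (tau n) w)) /\
  (forall w, B 0 w = 0 /\ continuous (fun t => B t w)) /\
  (* joint finite-dimensional laws: kappa Markov(Q) from i, B standard BM, independent *)
  (forall (lk : seq (R * 'I_m)) (lb : seq (R * set R)),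
      path <=%R 0 (map fst lk) -> path <%R 0 (map fst lb) ->
      all_measurable lb ->
      P (kev kappa lk `&` bev B 0 lb) = ((markov_w Q 0 i lk)%:E * bm_w 0 lb)%E) /\
  (forall w, X 0 w = 0) /\
  (forall w s t, 0 <= s <= t -> (forall u, s <= u < t -> kappa u w = kappa s w) ->
      X t w - X s w = mu (kappa s w) 0 * (t - s) + sigma (kappa s w) 0 * (B t w - B s w)).

Definition regulator {Omega : Type} (X R0 : R -> Omega -> R) : Prop :=
  forall w,
    R0 0 w = 0 /\
    continuous (fun t => R0 t w) /\
    (forall s t, 0 <= s <= t -> R0 s w <= R0 t w) /\
    (forall t, 0 <= t -> 0 <= X t w + R0 t w) /\
    (forall s t, 0 <= s <= t -> (forall u, s <= u <= t -> 0 < X u w + R0 u w) ->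
        R0 t w = R0 s w) /\
    (forall R' : R -> R, continuous R' -> (forall s t, 0 <= s <= t -> R' s <= R' t) ->
        (forall t, 0 <= t -> 0 <= X t w + R' t) -> forall t, 0 <= t -> R0 t w <= R' t).

Definition level_ev {Omega : Type} (X : R -> Omega -> R) (kappa : R -> Omega -> 'I_m)
  (y : R) (j : 'I_m) : set Omega :=
  [set w | (exists t, 0 <= t /\ X t w = y) /\
           kappa (inf [set t | 0 <= t /\ X t w = y]) w = j].

Definition hit_ev {Omega : Type} (Z : R -> Omega -> R) (kappa : R -> Omega -> 'I_m)
  (y : R) (j : 'I_m) : set Omega :=
  [set w | (exists t, 0 < t /\ Z t w = y) /\
           kappa (inf [set t | 0 < t /\ Z t w = y]) w = j].

End Defs.

(* Main.v *)
(** The exponentials of [U] and [Uh] are only given as passage probabilities, so an actual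
    free MMBM is needed to learn anything about them: it is built from Levy's construction
    of Brownian motion and a uniformised Markov chain, switching between the lines
    [mu i t + sigma i B t]. Sampling such a process on a fine grid and testing it with
    perturbed solutions of [sigma^2/2 f'' + mu f' + Q f = 0] bounds every exit probability
    from an interval by the value at [0] of a solution; these bounds add up to [1], so they
    are equalities. Exit through the upper end of a growing interval then shows that
    [e^{Uh (b - x)}] is a limit of solutions, hence that [- Uh], and by reflection [U],
    solve the quadratic matrix equation. For the regulated process the same argument
    applies to the Lindley recursion and to solutions with [f'(0) = 0].

    Let [L, P] be the Dirichlet-to-Neumann map of the boundary value problem:
    [Delta_sigma f'(0) = L f(b) + P f(0)] for every solution [f]. Taking [f'(0) = 0] gives
    [H_0 = (- P)^{-1} L]; taking [f] among [e^{U x}] and [e^{Uh (b - x)}] gives (S); and when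
    [alpha mu = 0] the additional equation is the case of the solution [x 1 - Q# mu].
    The maximum principle gives uniqueness and the signs of the entries of [P]. *)

Require Import Defs.
From HB Require Import structures.
From mathcomp Require Import all_boot all_order all_algebra.
From mathcomp Require Import all_classical all_reals all_analysis.
From mathcomp Require Import measurable_realfun.
From mathcomp Require Import ring lra.
Set Implicit Arguments. Unset Strict Implicit. Unset Printing Implicit Defensive.
Import Order.TTheory GRing.Theory Num.Theory.
Import numFieldNormedType.Exports.
Local Open Scope classical_set_scope.
Local Open Scope ring_scope.

(** * The matrix exponential *)

(** The notion of free MMBM asks for continuity and piecewise constancy along every path, not almost
    every one, so exceptional null sets are given constant paths by hand in the construction. No
    stochastic calculus is used: Gaussian increments have explicit exponential moments, and a test
    function that loses on average a fixed multiple of the mesh at each grid step bounds both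
    survival and exit probabilities from above. Two discretisation errors shape the statements. The
    grid path reaches the neighbourhood of an end slightly before the true exit, and the phase may
    jump in between; the phase is therefore read after a small delay s, with boundary data e^{sQ}
    e_j. The grid path may also overshoot, so an exit means entering a window of half-width c around
    an end. The limits are taken in the order mesh, c, s, through iterated lower limits of events.
    Reflection at 0 requires a test function with strictly negative slope there, which an
    exponential barrier supplies. *)

Lemma cvgr_sum (R : realType) (T I : Type) (F : set_system T) (FF : Filter F)
  (r : seq I) (f : I -> T -> R) (l : I -> R) :
  (forall i, f i x @[x --> F] --> l i) ->
  (\sum_(i <- r) f i x) @[x --> F] --> \sum_(i <- r) l i.
Proof.
move=> fl; elim: r => [|i r IH].
  by under eq_fun do rewrite big_nil; rewrite big_nil; exact: cvg_cst.
by under eq_fun do rewrite big_cons; rewrite big_cons; exact: cvgD.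
Qed.

Lemma squeeze_cvg0 (R : realType) (u v : nat -> R) :
  (forall N, `|u N| <= v N) -> v @ \oo --> 0 -> u @ \oo --> 0.
Proof.
move=> uv v0; apply/cvgr0Pnorm_lt => e e0; near=> N.
apply: (le_lt_trans (uv N)); apply: (le_lt_trans (ler_norm _)).
by near: N; apply: cvgr0_norm_lt.
Unshelve. all: end_near. Qed.

Section MatrixExp.
Variable R : realType.

Definition mxabs p q (A : 'M[R]_(p, q)) : R := \sum_i \sum_j `|A i j|.

Lemma mxabs_ge0 p q (A : 'M[R]_(p, q)) : 0 <= mxabs A.
Proof. by apply: sumr_ge0 => i _; apply: sumr_ge0. Qed.

Lemma ler_mxabs p q (A : 'M[R]_(p, q)) i j : `|A i j| <= mxabs A.
Proof.
rewrite /mxabs (bigD1 i) //= (bigD1 j) //= -addrA lerDl.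
by rewrite addr_ge0 ?sumr_ge0 // => *; rewrite sumr_ge0.
Qed.

Lemma ler_mulmx_entry p q r (A : 'M[R]_(p, q)) (B : 'M[R]_(q, r)) (c : R) i j :
  (forall k, `|B k j| <= c) -> `|(A *m B) i j| <= mxabs A * c.
Proof.
move=> Bc; rewrite mxE (le_trans (ler_norm_sum _ _ _)) //.
rewrite (@le_trans _ _ (\sum_k `|A i k| * c)) //.
  by apply: ler_sum => k _; rewrite normrM ler_wpM2l.
rewrite -mulr_suml; case: q A B Bc => [|q] A B Bc.
  by rewrite big_ord0 mul0r /mxabs big1 ?mul0r // => l _; rewrite big_ord0.
have c0 : 0 <= c by rewrite (le_trans _ (Bc ord0)).
rewrite ler_wpM2r // /mxabs [leRHS](bigD1 i) //= lerDl.
by rewrite sumr_ge0 // => *; rewrite sumr_ge0.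
Qed.

Variable n : nat.
Implicit Types A B : 'M[R]_n.

Lemma ler_exp_entry A k i j : `|(A ^+ k) i j| <= mxabs A ^+ k.
Proof.
elim: k i j => [|k IH] i j.
  by rewrite !expr0 mxE; case: eqP => _ /=; rewrite ?normr1 ?normr0.
by rewrite !exprS; apply: ler_mulmx_entry.
Qed.

Definition expmx_sum A N : 'M[R]_n := \sum_(k < N) (k`!%:R)^-1 *: A ^+ k.

Lemma expmx_sumE A i j :
  (fun N : nat => expmx_sum A N i j) = series (fun k => (A ^+ k) i j / k`!%:R).
Proof.
apply/funext => N; rewrite /expmx_sum summxE /series /= big_mkord.
by apply: eq_bigr => k _; rewrite mxE mulrC.
Qed.

Lemma ler_expmx_term A k i j : `|(A ^+ k) i j / k`!%:R| <= exp_coeff (mxabs A) k.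
Proof.
by rewrite normrM normfV [`|_%:R|]normr_nat /exp_coeff /= ler_wpM2r ?ler_exp_entry.
Qed.

Lemma expmx_sum_cvg A i j :
  (fun N : nat => expmx_sum A N i j) @ \oo --> expmx A i j.
Proof.
rewrite /expmx mxE.
have -> : (fun N : nat => \sum_(k < N) (A ^+ k) i j / k`!%:R) =
  (fun N : nat => expmx_sum A N i j).
  apply/funext => N; rewrite /expmx_sum summxE.
  by apply: eq_bigr => k _; rewrite mxE mulrC.
rewrite (expmx_sumE A i j).
apply: (@normed_cvg _ R^o).
apply: series_le_cvg (is_cvg_series_exp_coeff (mxabs A)) => k.
- exact: normr_ge0.
- by apply: exp_coeff_ge0; exact: mxabs_ge0.
- exact: ler_expmx_term.
Qed.

Lemma expR_sum_cvg (x : R) :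
  (fun N : nat => \sum_(k < N) x ^+ k / k`!%:R) @ \oo --> expR x.
Proof.
have := is_cvg_series_exp_coeff x; rewrite -/(expR x) => h.
have -> : (fun N : nat => \sum_(k < N) x ^+ k / k`!%:R) = series (exp_coeff x).
  by apply/funext => N; rewrite /series /= big_mkord.
exact: h.
Qed.

Lemma expmx_unique A (B : 'M[R]_n) :
  (forall i j, (fun N : nat => expmx_sum A N i j) @ \oo --> B i j) -> expmx A = B.
Proof.
move=> h; apply/matrixP => i j.
exact: (cvg_unique _ (expmx_sum_cvg (i := i) (j := j)) (h i j)).
Qed.

Lemma expmx_sum_le (A : 'M[R]_n) N i j : `|expmx_sum A N i j| <= expR (mxabs A).
Proof.
apply: (@le_trans _ _ (\sum_(k < N) mxabs A ^+ k / k`!%:R)).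
  rewrite /expmx_sum summxE (le_trans (ler_norm_sum _ _ _)) //.
  by apply: ler_sum => k _; rewrite mxE mulrC ler_expmx_term.
have := @expR_sum_cvg (mxabs A) => h.
rewrite -(cvg_lim _ h) //; apply: nondecreasing_cvgn_le; last first.
  by apply/cvg_ex; eexists; exact: h.
apply/nondecreasing_seqP => k; rewrite big_ord_recr /= lerDl.
by rewrite divr_ge0 ?exprn_ge0 ?mxabs_ge0.
Qed.

Lemma expmx_le (A : 'M[R]_n) i j : `|expmx A i j| <= expR (mxabs A).
Proof.
have h : (fun N => `|expmx_sum A N i j|) @ \oo --> `|expmx A i j|.
  by apply: cvg_norm; exact: expmx_sum_cvg.
rewrite -(cvg_lim _ h) //; apply: limr_le; first by apply/cvg_ex; eexists; exact: h.
by apply: nearW => N; exact: expmx_sum_le.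
Qed.

Lemma expmx0 : expmx (0 : 'M[R]_n) = 1%:M.
Proof.
apply: expmx_unique => i j; apply: cvg_near_cst.
exists 1%N => // -[|N] // _; rewrite /expmx_sum big_ord_recl /= big1; last first.
  by move=> k _; rewrite exprS mul0r scaler0.
by rewrite addr0 expr0 fact0 invr1 scale1r.
Qed.

(** Binomial theorem on the triangle k + l < N of the Cauchy product. The weight [d] stands for a
    power of order k + l: it is taken to be an entry of A^(k+l), and also the scalar a^(k+l) that
    dominates it. *)
Lemma cauchy_partial (x y : R) (d : nat -> R) N :
  \sum_(k < N) \sum_(l < N | (k + l < N)%N)
     (x ^+ k / k`!%:R) * (y ^+ l / l`!%:R) * d (k + l)%N =
  \sum_(k < N) (x + y) ^+ k / k`!%:R * d k.
Proof.
transitivity (\sum_(k < N) \sum_(s < N | (k <= s)%N)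
   (x ^+ k / k`!%:R) * (y ^+ (s - k) / (s - k)`!%:R) * d s).
  apply: eq_bigr => k _.
  rewrite -(big_mkord (fun l => (k + l < N)%N)
     (fun l => x ^+ k / k`!%:R * (y ^+ l / l`!%:R) * d (k + l)%N)).
  rewrite -(big_mkord (fun s => (k <= s)%N)
     (fun s => x ^+ k / k`!%:R * (y ^+ (s - k) / (s - k)`!%:R) * d s)).
  rewrite [RHS](@big_cat_nat _ _ _ k) /=; last 2 first.
    by []. by rewrite ltnW.
  rewrite [X in _ = X + _]big1_seq ?add0r; last first.
    move=> s /andP[ks]; rewrite mem_index_iota => /andP[_ sk].
    by rewrite leqNgt sk in ks.
  have := big_addn 0 N k (fun s => (k <= s)%N)
     (fun s => x ^+ k / k`!%:R * (y ^+ (s - k) / (s - k)`!%:R) * d s).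
  rewrite add0n => ->.
  rewrite [LHS](@big_cat_nat _ _ _ (N - k)%N) /=; last 2 first.
    by []. by rewrite leq_subr.
  rewrite [X in _ + X = _]big1_seq ?addr0; last first.
    move=> s /andP[ks]; rewrite mem_index_iota => /andP[sk _].
    by rewrite leq_subLR leqNgt ks in sk.
  rewrite [LHS]big_nat_cond [RHS]big_nat_cond; apply: eq_big => [l|l /andP[lN _]].
    by case: ltnP => //= h; rewrite -ltn_subRL h leq_addl.
  by rewrite addnK addnC.
rewrite (exchange_big_dep xpredT) //=; apply: eq_bigr => s _.
rewrite addrC exprDn !mulr_suml.
rewrite -(big_mkord (fun k => (k <= s)%N)
   (fun k => x ^+ k / k`!%:R * (y ^+ (s - k) / (s - k)`!%:R) * d s)).
rewrite (big_cat_nat (n := s.+1)) //=.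
rewrite [X in _ + X]big1_seq ?addr0; last first.
  move=> k /andP[ks]; rewrite mem_index_iota => /andP[sk _].
  by rewrite leqNgt sk in ks.
rewrite big_mkord; apply: eq_big => [k|k _]; first by rewrite -ltnS ltn_ord.
have ks : (k <= s)%N by rewrite -ltnS ltn_ord.
have := bin_fact ks => /(congr1 (fun z => z%:R : R)).
rewrite !natrM => h.
have f1 : k`!%:R != 0 :> R by rewrite pnatr_eq0 -lt0n fact_gt0.
have f2 : (s - k)`!%:R != 0 :> R by rewrite pnatr_eq0 -lt0n fact_gt0.
rewrite -h -mulr_natr.
have f3 : 'C(s, k)%:R != 0 :> R by rewrite pnatr_eq0 -lt0n bin_gt0.
by field; rewrite f1 f2 f3.
Qed.

Lemma cauchy_partial_gap (x y : R) (d : nat -> R) N :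
  (\sum_(k < N) \sum_(l < N) (x ^+ k / k`!%:R) * (y ^+ l / l`!%:R) * d (k + l)%N)
  - \sum_(k < N) (x + y) ^+ k / k`!%:R * d k =
  \sum_(k < N) \sum_(l < N | ~~ (k + l < N)%N)
     (x ^+ k / k`!%:R) * (y ^+ l / l`!%:R) * d (k + l)%N.
Proof.
rewrite -cauchy_partial -sumrB; apply: eq_bigr => k _.
by rewrite (bigID (fun l : 'I_N => (k + l < N)%N)) /= addrAC subrr add0r.
Qed.

Lemma exprmxZ (A : 'M[R]_n) x k : (x *: A) ^+ k = x ^+ k *: A ^+ k.
Proof.
elim: k => [|k IH]; first by rewrite !expr0 scale1r.
rewrite !exprS IH -[LHS]/((x *: A) *m (x ^+ k *: A ^+ k)).
by rewrite -scalemxAl -scalemxAr scalerA.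
Qed.

Lemma expmx_sum_scale (A : 'M[R]_n) x N :
  expmx_sum (x *: A) N = \sum_(k < N) (x ^+ k / k`!%:R) *: A ^+ k.
Proof.
by apply: eq_bigr => k _; rewrite exprmxZ scalerA mulrC.
Qed.

(** The product of the partial sums exceeds the partial sum of the exponential by the corner k + l
    >= N. Entrywise this corner is dominated by the same corner for the scalars |x| a and |y| a,
    which tends to 0 because [expR] turns sums into products. *)
Lemma expmxD (A : 'M[R]_n) x y :
  expmx ((x + y) *: A) = expmx (x *: A) *m expmx (y *: A).
Proof.
apply: expmx_unique => i j.
set a := mxabs A.
pose e (z : R) N := \sum_(k < N) z ^+ k / k`!%:R.
pose P N := (expmx_sum (x *: A) N *m expmx_sum (y *: A) N) i j.
have cP : P @ \oo --> (expmx (x *: A) *m expmx (y *: A)) i j.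
  have -> : P = fun N => \sum_k expmx_sum (x *: A) N i k * expmx_sum (y *: A) N k j.
    by apply/funext => N; rewrite /P mxE.
  rewrite mxE; apply: cvgr_sum => k; apply: cvgM; exact: expmx_sum_cvg.
have cG : (fun N => e (`|x| * a) N * e (`|y| * a) N - e ((`|x| + `|y|) * a) N) @ \oo --> (0 : R).
  have -> : (0 : R) = expR (`|x| * a) * expR (`|y| * a) - expR ((`|x| + `|y|) * a).
    by rewrite mulrDl expRD subrr.
  by apply: cvgB; [apply: cvgM|]; exact: expR_sum_cvg.
have gap N : `|P N - expmx_sum ((x + y) *: A) N i j| <=
   e (`|x| * a) N * e (`|y| * a) N - e ((`|x| + `|y|) * a) N.
  have -> : P N = \sum_(k < N) \sum_(l < N)
      (x ^+ k / k`!%:R) * (y ^+ l / l`!%:R) * (A ^+ (k + l)) i j.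
    rewrite /P !expmx_sum_scale mulmx_suml summxE; apply: eq_bigr => k _.
    rewrite mulmx_sumr summxE; apply: eq_bigr => l _.
    by rewrite -scalemxAl -scalemxAr scalerA mxE exprD.
  have -> : expmx_sum ((x + y) *: A) N i j =
      \sum_(k < N) (x + y) ^+ k / k`!%:R * (A ^+ k) i j.
    by rewrite expmx_sum_scale summxE; apply: eq_bigr => k _; rewrite mxE.
  have -> : e (`|x| * a) N * e (`|y| * a) N = \sum_(k < N) \sum_(l < N)
      (`|x| ^+ k / k`!%:R) * (`|y| ^+ l / l`!%:R) * a ^+ (k + l).
    rewrite /e mulr_suml; apply: eq_bigr => k _; rewrite mulr_sumr.
    by apply: eq_bigr => l _; rewrite !exprMn exprD; ring.
  have -> : e ((`|x| + `|y|) * a) N =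
      \sum_(k < N) (`|x| + `|y|) ^+ k / k`!%:R * a ^+ k.
    by apply: eq_bigr => k _; rewrite exprMn; ring.
  rewrite (cauchy_partial_gap x y (fun k => (A ^+ k) i j)).
  rewrite (cauchy_partial_gap `|x| `|y| (fun k => a ^+ k)).
  rewrite (le_trans (ler_norm_sum _ _ _)) //; apply: ler_sum => k _.
  rewrite (le_trans (ler_norm_sum _ _ _)) //; apply: ler_sum => l _.
  rewrite normrM; have -> : `|x ^+ k / k`!%:R * (y ^+ l / l`!%:R)| =
      `|x| ^+ k / k`!%:R * (`|y| ^+ l / l`!%:R).
    by rewrite !normrM !normfV !normrX ![`|_%:R|]normr_nat.
  apply: ler_wpM2l; last exact: ler_exp_entry.
  by rewrite !mulr_ge0 ?invr_ge0 ?exprn_ge0.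
have c0 : (fun N => P N - expmx_sum ((x + y) *: A) N i j) @ \oo --> (0 : R).
  by apply: squeeze_cvg0 gap cG.
have -> : (fun N : nat => expmx_sum ((x + y) *: A) N i j) =
   (fun N => P N - (P N - expmx_sum ((x + y) *: A) N i j)).
  by apply/funext => N; rewrite subKr.
by rewrite -[X in _ --> X]subr0; apply: cvgB.
Qed.

(** Source of the second order expansions below. The remainder series is at most |y|^3 times a tail
    of the series of [expR (mxabs A)], whence the constant. *)
Lemma expmx_taylor (A : 'M[R]_n) : exists2 K, 0 <= K & forall y, `|y| <= 1 ->
  forall i j, `|(expmx (y *: A) - (1%:M + y *: A + (y ^+ 2 / 2) *: (A *m A))) i j|
     <= K * `|y| ^+ 3.
Proof.
exists (expR (mxabs A)) => [|y y1 i j]; first exact: expR_ge0.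
set L := (_ + _ + _).
have E N : expmx_sum (y *: A) N.+3 - L =
   \sum_(k < N) (y ^+ k.+3 / k.+3`!%:R) *: A ^+ k.+3.
  rewrite expmx_sum_scale !big_ord_recl /= !addrA.
  have -> : (y ^+ 0 / (0`!)%:R) *: A ^+ 0 = 1%:M.
    by rewrite !expr0 fact0 divr1 scale1r.
  have -> : (y ^+ bump 0 0 / ((bump 0 0)`!)%:R) *: A ^+ bump 0 0 = y *: A.
    by rewrite /bump /= !expr1 divr1.
  have -> : (y ^+ bump 0 (bump 0 0) / ((bump 0 (bump 0 0))`!)%:R) *:
      A ^+ bump 0 (bump 0 0) = (y ^+ 2 / 2) *: (A *m A).
    by rewrite /bump.
  by rewrite -/L addrAC subrr add0r.
have cv : (fun N => `|(expmx_sum (y *: A) N.+3 - L) i j|) @ \oo -->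
   `|(expmx (y *: A) - L) i j|.
  apply: cvg_norm; rewrite mxE.
  under eq_fun do rewrite mxE.
  apply: cvgD; last exact: cvg_cst.
  have := @expmx_sum_cvg (y *: A) i j; rewrite -(cvg_shiftn 3) => h.
  by under eq_fun do rewrite -addn3; exact: h.
rewrite -(cvg_lim _ cv) //; apply: limr_le; first by apply/cvg_ex; eexists; exact: cv.
apply: nearW => N; rewrite E summxE.
rewrite (le_trans (ler_norm_sum _ _ _)) //.
apply: (@le_trans _ _ (\sum_(k < N) (mxabs A ^+ k.+3 / k.+3`!%:R) * `|y| ^+ 3)).
  apply: ler_sum => k _; rewrite mxE normrM [`|_ / _|]normrM normfV normrX [`|_%:R|]normr_nat.
  rewrite mulrAC [leRHS]mulrAC; apply: ler_wpM2r => //; rewrite mulrC.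
  apply: ler_pM => //; rewrite ?exprn_ge0 ?ler_exp_entry //.
  by rewrite -addn3 exprD ler_piMl ?exprn_ge0 // exprn_ile1.
rewrite -mulr_suml ler_wpM2r ?exprn_ge0 //.
have h := @expR_sum_cvg (mxabs A).
rewrite -(cvg_lim _ h) //; apply: (@le_trans _ _ (\sum_(k < N.+3) mxabs A ^+ k / k`!%:R)).
  rewrite [leRHS]big_ord_recl [in leRHS]big_ord_recl [in leRHS]big_ord_recl /=.
  rewrite !addrA lerDr !addr_ge0 // ?divr_ge0 ?exprn_ge0 ?mxabs_ge0 //.
apply: nondecreasing_cvgn_le; last by apply/cvg_ex; eexists; exact: h.
apply/nondecreasing_seqP => k; rewrite big_ord_recr /= lerDl.
by rewrite divr_ge0 ?exprn_ge0 ?mxabs_ge0.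
Qed.

End MatrixExp.

(** Rectangular [X] matters: it covers the subspace of the companion matrix spanned by a solvent,
    and a constant vector killed by a generator (with [B] = 0). *)
Lemma expmx_intertwine (R : realType) p q (A : 'M[R]_p) (B : 'M[R]_q) (X : 'M[R]_(p, q)) :
  A *m X = X *m B -> expmx A *m X = X *m expmx B.
Proof.
move=> AX; have pw k : A ^+ k *m X = X *m B ^+ k.
  elim: k => [|k IH]; first by rewrite !expr0 mul1mx mulmx1.
  have -> : A ^+ k.+1 = A *m A ^+ k by rewrite exprS.
  have -> : B ^+ k.+1 = B *m B ^+ k by rewrite exprS.
  by rewrite -mulmxA IH mulmxA AX mulmxA.
have sm N : expmx_sum A N *m X = X *m expmx_sum B N.
  rewrite /expmx_sum mulmx_suml mulmx_sumr; apply: eq_bigr => k _.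
  by rewrite -scalemxAl -scalemxAr pw.
apply/matrixP => i j.
have c1 : (fun N => (expmx_sum A N *m X) i j) @ \oo --> (expmx A *m X) i j.
  have -> : (fun N => (expmx_sum A N *m X) i j) =
      (fun N => \sum_k expmx_sum A N i k * X k j).
    by apply/funext => N; rewrite mxE.
  rewrite mxE; apply: cvgr_sum => k.
  by apply: cvgM; [exact: expmx_sum_cvg|exact: cvg_cst].
have c2 : (fun N => (expmx_sum A N *m X) i j) @ \oo --> (X *m expmx B) i j.
  have -> : (fun N => (expmx_sum A N *m X) i j) =
      (fun N => \sum_k X i k * expmx_sum B N k j).
    by apply/funext => N; rewrite sm mxE.
  rewrite mxE; apply: cvgr_sum => k.
  by apply: cvgM; [exact: cvg_cst|exact: expmx_sum_cvg].
exact: (cvg_unique _ c1 c2).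
Qed.

Lemma expmx1E (R : realType) (x : R) : expmx (x%:M : 'M[R]_1) = (expR x)%:M.
Proof.
apply: expmx_unique => i j.
rewrite !mxE !ord1 eqxx mulr1n.
have -> : (fun N : nat => expmx_sum (x%:M : 'M[R]_1) N 0 0) =
   (fun N : nat => \sum_(k < N) x ^+ k / k`!%:R).
  apply/funext => N; rewrite /expmx_sum summxE; apply: eq_bigr => k _.
  rewrite mxE mulrC; congr (_ / _); elim: (val k) => [|l IH].
    by rewrite !expr0 mxE eqxx.
  by rewrite !exprS mxE big_ord1 IH mxE eqxx mulr1n.
exact: expR_sum_cvg.
Qed.

(** * A maximum principle for coupled second order operators *)

Lemma ge0_first_order (R : realFieldType) (p C d : R) : 0 < d ->
  (forall y, 0 < y -> y <= d -> 0 <= p + y * C) -> 0 <= p.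
Proof.
move=> d0 h; rewrite leNgt; apply/negP => p0.
pose y := Num.min d (- p / (2 * (`|C| + 1))).
have D0 : 0 < 2 * (`|C| + 1) by rewrite mulr_gt0 // ltr_wpDl.
have y0 : 0 < y by rewrite lt_min d0 divr_gt0 // oppr_gt0.
have yd : y <= d by rewrite ge_min lexx.
have := h y y0 yd; apply/negP; rewrite -ltNge.
have yC : y * C <= - p / 2.
  rewrite (le_trans (ler_norm _)) // normrM (gtr0_norm y0).
  apply: (@le_trans _ _ (- p / (2 * (`|C| + 1)) * `|C|)).
    by rewrite ler_wpM2r // ge_min lexx orbT.
  have c1 : 0 < `|C| + 1 by rewrite ltr_wpDl.
  rewrite invfM mulrA -!mulrA [X in _ * X](_ : _ = 2^-1 * (`|C| / (`|C| + 1))); last by ring.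
  apply: ler_wpM2l; first by rewrite oppr_ge0 ltW.
  by rewrite ler_piMr ?invr_ge0 // ler_pdivrMr // mul1r lerDl.
have : p + y * C <= p + - p / 2 by rewrite lerD2l.
lra.
Qed.

Lemma taylor_min_right (R : realFieldType) (p q K d : R) : 0 < d -> 0 <= K ->
  (forall y, 0 < y -> y <= d -> 0 <= y * p + y ^+ 2 / 2 * q + K * y ^+ 3) -> 0 <= p.
Proof.
move=> d0 K0 h; apply: (@ge0_first_order _ _ (`|q| + K) (Num.min d 1)) => [|y y0].
  by rewrite lt_min d0 ltr01.
rewrite le_min => /andP[yd y1].
have := h y y0 yd.
have -> : y * p + y ^+ 2 / 2 * q + K * y ^+ 3 = y * (p + y / 2 * q + K * y ^+ 2) by ring.
rewrite pmulr_rge0 // => /le_trans; apply.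
rewrite -addrA lerD2l mulrDr lerD //.
  rewrite -mulrA ler_wpM2l ?(ltW y0) //.
  by rewrite (le_trans (ler_norm _)) // normrM ler_piMl // ger0_norm // invf_le1 // ler1n.
by rewrite mulrC ler_wpM2r // expr2 ler_piMl // ltW.
Qed.

(** Necessary conditions at an interior minimum, for a function known only through a Taylor
    expansion with cubic error. *)
Lemma taylor_min (R : realFieldType) (p q K d : R) : 0 < d -> 0 <= K ->
  (forall y, `|y| <= d -> 0 <= y * p + y ^+ 2 / 2 * q + K * `|y| ^+ 3) ->
  p = 0 /\ 0 <= q.
Proof.
move=> d0 K0 h.
have p0 : 0 <= p.
  apply: (taylor_min_right d0 K0) => y y0 yd; have := h y.
  by rewrite (gtr0_norm y0) => /(_ yd); exact.
have p1 : 0 <= - p.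
  apply: (@taylor_min_right _ _ q K d) => // y y0 yd; have := h (- y).
  rewrite normrN (gtr0_norm y0) => /(_ yd).
  by rewrite sqrrN mulrN mulNr.
have pe : p = 0 by apply/eqP; rewrite eq_le p0 -oppr_ge0 p1.
split=> //; apply: (@ge0_first_order _ _ (2 * K) d d0) => y y0 yd.
have := h y; rewrite (gtr0_norm y0) pe mulr0 add0r => /(_ yd).
have -> : y ^+ 2 / 2 * q + K * y ^+ 3 = (y ^+ 2 / 2) * (q + y * (2 * K)).
  by field.
by rewrite pmulr_rge0 // divr_gt0 // exprn_gt0.
Qed.

Lemma mxabsZ (R : realType) p q (c : R) (A : 'M[R]_(p, q)) :
  mxabs (c *: A) = `|c| * mxabs A.
Proof.
rewrite /mxabs mulr_sumr; apply: eq_bigr => i _.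
by rewrite mulr_sumr; apply: eq_bigr => j _; rewrite mxE normrM.
Qed.

Section C2.
Variables (R : realType) (m : nat).
Implicit Types f g : R -> 'cV[R]_m.

(** Derivatives enter only through a cubic Taylor remainder whose constant is uniform for [x] in a
    bounded set; [f1] and [f2] play the role of the first two derivatives. Matrix exponentials
    provide such bounds, linear operations preserve them, and the uniformity is what the grid
    estimates require. *)
Definition c2fun f f1 f2 := forall M : R, exists2 K, 0 <= K & forall x y,
  `|x| <= M -> `|y| <= 1 -> forall i,
  `|f (x + y) i 0 - (f x i 0 + y * f1 x i 0 + y ^+ 2 / 2 * f2 x i 0)| <= K * `|y| ^+ 3.

Lemma c2fun_min_right f f1 f2 a d i : c2fun f f1 f2 -> 0 < d -> f a i 0 = 0 ->
  (forall y, 0 < y -> y <= d -> 0 <= f (a + y) i 0) -> 0 <= f1 a i 0.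
Proof.
move=> hf d0 fa fp; have [K K0 hK] := hf `|a|.
apply: (taylor_min_right (q := f2 a i 0) (d := Num.min 1 d) _ K0); first by rewrite lt_min ltr01.
move=> y y0; rewrite le_min => /andP[y1 yd].
have := hK a y (lexx _); rewrite (gtr0_norm y0) => /(_ y1 i).
rewrite fa add0r ler_norml => /andP[_]; have := fp y y0 yd; lra.
Qed.

Lemma c2funD f f1 f2 g g1 g2 : c2fun f f1 f2 -> c2fun g g1 g2 ->
  c2fun (fun x => f x + g x) (fun x => f1 x + g1 x) (fun x => f2 x + g2 x).
Proof.
move=> hf hg M; have [K K0 hK] := hf M; have [L L0 hL] := hg M.
exists (K + L) => [|x y xM y1 i]; first exact: addr_ge0.
rewrite !mxE mulrDl (le_trans _ (lerD (hK x y xM y1 i) (hL x y xM y1 i))) //.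
rewrite (le_trans _ (ler_normD _ _)) // le_eqVlt; apply/orP; left; apply/eqP.
by congr `|_|; ring.
Qed.

Lemma c2funZ c f f1 f2 : c2fun f f1 f2 ->
  c2fun (fun x => c *: f x) (fun x => c *: f1 x) (fun x => c *: f2 x).
Proof.
move=> hf M; have [K K0 hK] := hf M.
exists (`|c| * K) => [|x y xM y1 i]; first by rewrite mulr_ge0.
rewrite !mxE -[leRHS]mulrA (le_trans _ (ler_wpM2l (normr_ge0 c) (hK x y xM y1 i))) //.
by rewrite -normrM le_eqVlt; apply/orP; left; apply/eqP; congr `|_|; ring.
Qed.

Lemma c2funN f f1 f2 : c2fun f f1 f2 ->
  c2fun (fun x => - f x) (fun x => - f1 x) (fun x => - f2 x).
Proof.
have E (g : R -> 'cV[R]_m) : (fun x => - g x) = (fun x => -1 *: g x).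
  by apply/funext => x; rewrite scaleN1r.
by rewrite !E; exact: c2funZ.
Qed.

Lemma c2fun_affine (c d : 'cV[R]_m) : c2fun (fun x => x *: c + d) (fun=> c) (fun=> 0).
Proof.
move=> M; exists 0 => // x y _ _ i; rewrite !mxE.
by rewrite [X in `|X|](_ : _ = 0) ?normr0 ?mul0r //; ring.
Qed.

Lemma c2fun_rev f f1 f2 (c : R) : c2fun f f1 f2 ->
  c2fun (fun x => f (c - x)) (fun x => - f1 (c - x)) (fun x => f2 (c - x)).
Proof.
move=> hf M; have [K K0 hK] := hf (`|c| + M).
exists K => // x y xM y1 i.
have := hK (c - x) (- y); rewrite normrN => /(_ _ y1 i).
have -> : c - x - y = c - (x + y) by ring.
have -> : (- y) ^+ 2 = y ^+ 2 by ring.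
have -> : - y * f1 (c - x) i 0 = y * (- f1 (c - x)) i 0 by rewrite mxE; ring.
by apply; rewrite (le_trans (ler_normB _ _)) // lerD2l.
Qed.

Lemma c2fun_exp k (p : 'M[R]_(m, k)) (A : 'M[R]_k) (v : 'cV[R]_k) :
  c2fun (fun x => p *m expmx (x *: A) *m v)
        (fun x => p *m A *m expmx (x *: A) *m v)
        (fun x => p *m A *m A *m expmx (x *: A) *m v).
Proof.
move=> M; have [K K0 hK] := expmx_taylor A.
have cA x : A *m expmx (x *: A) = expmx (x *: A) *m A.
  by rewrite -(@expmx_intertwine _ _ _ (x *: A) (x *: A)) // -scalemxAl -scalemxAr.
pose E := \sum_(i < k) \sum_(j < k) expR (M * mxabs A) .
exists (mxabs p * (E * (K * mxabs v))) => [|x y xM y1 i].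
  rewrite !mulr_ge0 ?mxabs_ge0 //; apply: sumr_ge0 => *; apply: sumr_ge0 => *.
  exact: expR_ge0.
pose rem := expmx (y *: A) - (1%:M + y *: A + (y ^+ 2 / 2) *: (A *m A)).
have -> : (p *m expmx ((x + y) *: A) *m v) i 0 -
  ((p *m expmx (x *: A) *m v) i 0 + y * (p *m A *m expmx (x *: A) *m v) i 0 +
   y ^+ 2 / 2 * (p *m A *m A *m expmx (x *: A) *m v) i 0) =
  (p *m (expmx (x *: A) *m (rem *m v))) i 0.
  have -> : p *m (expmx (x *: A) *m (rem *m v)) = p *m expmx ((x + y) *: A) *m v -
     (p *m expmx (x *: A) *m v + y *: (p *m A *m expmx (x *: A) *m v) +
      (y ^+ 2 / 2) *: (p *m A *m A *m expmx (x *: A) *m v)).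
    rewrite expmxD /rem mulmxBl !mulmxDl mul1mx -!scalemxAl !mulmxBr !mulmxDr.
    rewrite -!scalemxAr -(mulmxA p A (expmx _)) -(mulmxA (p *m A) A (expmx _)) cA.
    by rewrite !mulmxA -(mulmxA p A (expmx _)) cA !mulmxA.
  by rewrite !mxE.
rewrite -mulrA -mulrA.
apply: (le_trans (@ler_mulmx_entry _ _ _ _ _ _ (E * (K * mxabs v * `|y| ^+ 3)) i 0 _)); last first.
  by rewrite !mulrA.
move=> l.
apply: (@le_trans _ _ (mxabs (expmx (x *: A)) * (K * mxabs v * `|y| ^+ 3))).
  apply: ler_mulmx_entry => l2.
  rewrite mxE (le_trans (ler_norm_sum _ _ _)) // /mxabs mulr_sumr mulr_suml.
  apply: ler_sum => l3 _; rewrite big_ord1 normrM mulrAC ler_wpM2r //.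
  exact: hK.
rewrite ler_wpM2r ?mulr_ge0 ?mxabs_ge0 ?exprn_ge0 //.
apply: ler_sum => a _; apply: ler_sum => b _.
rewrite (le_trans (expmx_le _ _ _)) // ler_expR mxabsZ ler_wpM2r //.
exact: mxabs_ge0.
Qed.

Lemma c2fun_cont f f1 f2 i : c2fun f f1 f2 -> continuous (fun x => f x i 0).
Proof.
move=> hf x; have [K K0 hK] := hf `|x|.
pose C := `|f1 x i 0| + `|f2 x i 0| + K + 1.
have C0 : 0 < C by rewrite ltr_wpDl // !addr_ge0.
have lip y : `|y| <= 1 -> `|f (x + y) i 0 - f x i 0| <= C * `|y|.
  move=> y1; have := hK x y (lexx _) y1 i.
  set F := f (x + y) i 0; set F0 := f x i 0; set p := f1 x i 0; set q := f2 x i 0.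
  move=> h; have -> : F - F0 = (F - (F0 + y * p + y ^+ 2 / 2 * q)) + (y * p + y ^+ 2 / 2 * q).
    by ring.
  rewrite (le_trans (ler_normD _ _)) // (le_trans (lerD h (ler_normD _ _))) //.
  rewrite !normrM normfV [`|2|]ger0_norm // -normrX.
  have y2 : `|y| ^+ 2 <= `|y| by rewrite expr2 ler_piMl.
  have y3 : `|y| ^+ 3 <= `|y| by rewrite exprS (le_trans _ y2) // expr2 ler_wpM2l.
  rewrite normrX /C -/p -/q.
  have a1 : K * `|y| ^+ 3 <= K * `|y| by rewrite ler_wpM2l.
  have a2 : `|y| ^+ 2 / 2 * `|q| <= `|y| * `|q|.
    have h2 : 2^-1 <= 1 :> R by rewrite invf_le1 ?ler1n // ltr0n.
    by rewrite ler_wpM2r // (le_trans _ y2) // ler_piMr ?exprn_ge0.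
  apply: (@le_trans _ _ (K * `|y| + (`|y| * `|p| + `|y| * `|q|))).
    by rewrite lerD // lerD2l.
  have -> : (`|p| + `|q| + K + 1) * `|y| =
     K * `|y| + (`|y| * `|p| + `|y| * `|q|) + `|y| by ring.
  by rewrite lerDl.
apply/cvgrPdist_lt => e e0; exists (Num.min 1 (e / C)) => /=.
  by rewrite lt_min ltr01 divr_gt0.
move=> z /=; rewrite distrC [`|_ - f z _ _|]distrC lt_min => /andP[z1 z2].
rewrite -[z](subrK x) [z - x + x]addrC.
by rewrite (le_lt_trans (lip _ (ltW z1))) // mulrC -ltr_pdivlMr.
Qed.

End C2.

Section MaxPrinciple.
Variables (R : realType) (m : nat) (Q : 'M[R]_m) (sigma : 'cV[R]_m).
Hypothesis genQ : is_generator Q.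
Hypothesis sigma_neq0 : forall i, sigma i 0 != 0.
Implicit Types (mu u : 'cV[R]_m) (f g : R -> 'cV[R]_m).

(** Generator of the pair (level, phase), as a function of the values at one level of a test
    function and of its two derivatives. *)
Definition genop mu u u1 u2 (i : 'I_m) : R :=
  sigma i 0 ^+ 2 / 2 * u2 i 0 + mu i 0 * u1 i 0 + (Q *m u) i 0.

Lemma genopD mu u u1 u2 v v1 v2 i :
  genop mu (u + v) (u1 + v1) (u2 + v2) i = genop mu u u1 u2 i + genop mu v v1 v2 i.
Proof. by rewrite /genop mulmxDr ![(_ + _ : 'cV_m) i 0]mxE; ring. Qed.

Lemma genopZ mu c u u1 u2 i :
  genop mu (c *: u) (c *: u1) (c *: u2) i = c * genop mu u u1 u2 i.
Proof. by rewrite /genop -scalemxAr ![(c *: _ : 'cV_m) i 0]mxE; ring. Qed.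

Lemma genopN mu u u1 u2 i : genop mu (- u) (- u1) (- u2) i = - genop mu u u1 u2 i.
Proof.
have E (v : 'cV[R]_m) : - v = -1 *: v by rewrite scaleN1r.
by rewrite !E genopZ mulN1r.
Qed.

Lemma gen_const (c : R) : Q *m const_mx c = 0 :> 'cV[R]_m.
Proof.
apply/matrixP => i j; rewrite !mxE; under eq_bigr do rewrite mxE.
by rewrite -mulr_suml (proj2 genQ) mul0r.
Qed.

Lemma gen_min_ge0 u i : (forall k, u i 0 <= u k 0) -> 0 <= (Q *m u) i 0.
Proof.
move=> h; have -> : (Q *m u) i 0 = (Q *m (u - const_mx (u i 0))) i 0.
  by rewrite mulmxBr gen_const subr0.
rewrite mxE; apply: sumr_ge0 => k _; rewrite !mxE.
have [->|ik] := eqVneq k i; first by rewrite subrr mulr0.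
by rewrite mulr_ge0 ?subr_ge0 //; apply: (proj1 genQ); rewrite eq_sym.
Qed.

(** Minimise over level and phase together. At a negative minimum inside the interval the slope
    vanishes, the second derivative is nonnegative, and so is the term with [Q], whose off-diagonal
    entries are nonnegative: this contradicts the strict sign. A minimum at [a] has nonnegative
    slope, which the Neumann condition excludes. *)
Lemma max_principle_strict mu f f1 f2 a b : c2fun f f1 f2 -> a < b ->
  (forall x i, a < x -> x < b -> genop mu (f x) (f1 x) (f2 x) i < 0) ->
  ((forall i, 0 <= f a i 0) \/ (forall i, f1 a i 0 < 0)) ->
  (forall i, 0 <= f b i 0) ->
  forall x i, a <= x -> x <= b -> 0 <= f x i 0.
Proof.
move=> hf ab hL ha hb x0 i0 ax0 xb0; rewrite leNgt; apply/negP => fneg.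
have min i : exists c, [/\ a <= c, c <= b & forall t, a <= t -> t <= b ->
    f c i 0 <= f t i 0].
  have cf : {within `[a, b], continuous (fun x => f x i 0)}.
    by apply: continuous_subspaceT => z; exact: (c2fun_cont (i := i) hf).
  have [c cab hc] := EVT_min (ltW ab) cf.
  move: cab; rewrite in_itv /= => /andP[ac cb]; exists c; split => // t at_ tb.
  by apply: hc; rewrite in_itv /= at_ tb.
have [c hc] := choice min.
have [i _ imin] := Order.TotalTheory.arg_minP (fun i => f (c i) i 0) (erefl : predT i0).
set x := c i; have [ax xb fmin] := hc i; rewrite -/x in ax xb fmin.
have fneg' : f x i 0 < 0.
  rewrite (le_lt_trans _ fneg) // (le_trans (imin i0 erefl)) //.
  by have [_ _] := hc i0; exact.
have fmin2 k : f x i 0 <= f x k 0.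
  by rewrite (le_trans (imin k erefl)) //; have [_ _] := hc k; exact.
have xb' : x < b.
  by rewrite lt_neqAle xb andbT; apply/eqP => E; have := hb i; rewrite -E leNgt fneg'.
have [K K0 hK] := hf `|x|.
pose d1 := Num.min 1 (b - x).
have d10 : 0 < d1 by rewrite lt_min ltr01 subr_gt0.
have low y : `|y| <= 1 -> a <= x + y -> x + y <= b ->
    0 <= y * f1 x i 0 + y ^+ 2 / 2 * f2 x i 0 + K * `|y| ^+ 3.
  move=> y1 h1 h2; have := fmin _ h1 h2; have := hK x y (lexx _) y1 i.
  rewrite ler_norml => /andP[_]; set p := y * f1 x i 0; set q := y ^+ 2 / 2 * f2 x i 0.
  set w := K * _; lra.
have right : 0 <= f1 x i 0.
  apply: (taylor_min_right d10 K0) => y y0 yd.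
  move: yd; rewrite le_min => /andP[y1 yb].
  have := low y; rewrite (gtr0_norm y0) => /(_ y1); apply.
    by rewrite (le_trans ax) // lerDl ltW.
  by rewrite -lerBrDl.
have ax' : a < x.
  rewrite lt_neqAle ax andbT; apply/eqP => E.
  case: ha => [/(_ i)|/(_ i)]; first by rewrite E leNgt fneg'.
  by rewrite E ltNge right.
have d20 : 0 < Num.min d1 (x - a) by rewrite lt_min d10 subr_gt0.
have low' y : `|y| <= Num.min d1 (x - a) ->
    0 <= y * f1 x i 0 + y ^+ 2 / 2 * f2 x i 0 + K * `|y| ^+ 3.
  rewrite !le_min => /andP[/andP[y1 yb] ya]; apply: low => //.
    move: ya; rewrite ler_norml => /andP[ya _]; lra.
  move: yb; rewrite ler_norml => /andP[_ yb]; lra.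
have [e1 e2] := taylor_min d20 K0 low'.
have := hL x i ax' xb'; rewrite /genop e1 mulr0 addr0 ltNge => /negP; apply.
by rewrite addr_ge0 ?gen_min_ge0 // mulr_ge0 // divr_ge0 // sqr_ge0.
Qed.

(** A rate for which e^{th x}, constant over phases, is strictly subharmonic in every phase at
    once. *)
Lemma barrier_rate mu : exists2 th : R, 0 < th &
  forall i, 0 < sigma i 0 ^+ 2 / 2 * th + mu i 0.
Proof.
pose th := 1 + \sum_i (2 * `|mu i 0|) / sigma i 0 ^+ 2.
have p i : 0 <= (2 * `|mu i 0|) / sigma i 0 ^+ 2.
  by rewrite divr_ge0 ?sqr_ge0 // mulr_ge0.
exists th => [|i]; first by rewrite ltr_pwDl // sumr_ge0.
have s0 : 0 < sigma i 0 ^+ 2 by rewrite exprn_even_gt0 //= sigma_neq0.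
have th1 : 1 + (2 * `|mu i 0|) / sigma i 0 ^+ 2 <= th.
  by rewrite lerD2l (bigD1 i) //= lerDl sumr_ge0.
have : sigma i 0 ^+ 2 / 2 * (1 + (2 * `|mu i 0|) / sigma i 0 ^+ 2) <=
  sigma i 0 ^+ 2 / 2 * th by rewrite ler_wpM2l // divr_ge0 // ltW.
have -> : sigma i 0 ^+ 2 / 2 * (1 + (2 * `|mu i 0|) / sigma i 0 ^+ 2) =
   sigma i 0 ^+ 2 / 2 + `|mu i 0|.
  by field; exact: sigma_neq0.
have := ler_norm (- mu i 0); rewrite normrN; lra.
Qed.

(** A strict supersolution: it does not depend on the phase, so [Q] kills it, and it decreases in
    [x], so its slope at the left end is strictly negative, as the Neumann case requires. *)
Definition barrier (th k : R) (x : R) : 'cV[R]_m := const_mx (k - expR (th * x)).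
Definition barrier1 (th : R) (x : R) : 'cV[R]_m := const_mx (- (th * expR (th * x))).
Definition barrier2 (th : R) (x : R) : 'cV[R]_m := const_mx (- (th ^+ 2 * expR (th * x))).

Lemma c2fun_expR (th : R) (w : 'cV[R]_m) : c2fun (fun x => expR (th * x) *: w)
  (fun x => (th * expR (th * x)) *: w) (fun x => (th ^+ 2 * expR (th * x)) *: w).
Proof.
have := c2fun_exp w (th%:M : 'M[R]_1) (1%:M : 'cV[R]_1).
have E x : expmx (x *: (th%:M : 'M[R]_1)) = (expR (th * x))%:M.
  by rewrite -scalemx1 scalerA scalemx1 expmx1E mulrC.
set F := c2fun _ _ _; set G := c2fun _ _ _; suff -> : F = G by [].
by congr c2fun; apply/funext => x; rewrite E mulmx1 !mul_mx_scalar ?scalerA //;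
  congr (_ *: _); ring.
Qed.

Lemma c2fun_barrier th k : c2fun (barrier th k) (barrier1 th) (barrier2 th).
Proof.
have := c2funD (c2fun_affine 0 (const_mx k)) (c2funN (c2fun_expR th (const_mx 1))).
set F := c2fun _ _ _; set G := c2fun _ _ _; suff -> : F = G by [].
by congr c2fun; apply/funext => x; apply/matrixP => i j; rewrite !mxE; ring.
Qed.

Lemma genop_barrier mu th k x i : genop mu (barrier th k x) (barrier1 th x) (barrier2 th x) i =
  - (th * expR (th * x) * (sigma i 0 ^+ 2 / 2 * th + mu i 0)).
Proof. by rewrite /genop gen_const !mxE; ring. Qed.

(** A small multiple e of the barrier makes both the operator and the Neumann slope strict; then e
    goes to 0. *)
Lemma max_principle mu f f1 f2 a b : c2fun f f1 f2 -> a < b ->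
  (forall x i, a < x -> x < b -> genop mu (f x) (f1 x) (f2 x) i <= 0) ->
  ((forall i, 0 <= f a i 0) \/ (forall i, f1 a i 0 <= 0)) ->
  (forall i, 0 <= f b i 0) ->
  forall x i, a <= x -> x <= b -> 0 <= f x i 0.
Proof.
move=> hf ab hL ha hb x i ax xb.
have [th th0 hth] := barrier_rate mu.
(* With this [k] the barrier vanishes at [b] and is nonnegative on the interval. *)
pose k := expR (th * b).
have main e : 0 < e -> 0 <= f x i 0 + e * (k - expR (th * x)).
  move=> e0.
  have := @max_principle_strict mu _ _ _ a b
    (c2funD hf (c2funZ e (c2fun_barrier th k))) ab _ _ _ x i ax xb.
  rewrite !mxE; apply.
  - move=> y l ay yb; rewrite genopD genopZ genop_barrier mulrN.
    rewrite subr_lt0 (le_lt_trans (hL y l ay yb)) // mulr_gt0 //.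
    by rewrite mulr_gt0 ?hth // mulr_gt0 ?expR_gt0.
  - case: ha => ha; [left|right] => l; rewrite !mxE.
      rewrite addr_ge0 // mulr_ge0 ?(ltW e0) // subr_ge0 ler_expR.
      by rewrite ler_wpM2l ?ltW.
    rewrite mulrN subr_lt0 (le_lt_trans (ha l)) // mulr_gt0 //.
    by rewrite mulr_gt0 ?expR_gt0.
  - by move=> l; rewrite !mxE /k subrr mulr0 addr0.
rewrite leNgt; apply/negP => fneg.
have k0 : 0 <= k - expR (th * x) by rewrite subr_ge0 ler_expR ler_wpM2l // ltW.
pose e := - f x i 0 / (2 * (k - expR (th * x) + 1)).
have D0 : 0 < 2 * (k - expR (th * x) + 1) by rewrite mulr_gt0 // ltr_wpDl.
have e0 : 0 < e by rewrite divr_gt0 // oppr_gt0.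
have := main e e0; apply/negP; rewrite -ltNge.
set w := k - _ in k0 e e0 D0 *.
have : e * w <= - f x i 0 / 2.
  rewrite /e -mulrA; apply: ler_wpM2l; first by rewrite oppr_ge0 ltW.
  rewrite invfM -mulrA ler_piMr ?invr_ge0 // mulrC ler_pdivrMr ?ltr_wpDl // mul1r lerDl //.
lra.
Qed.

Lemma max_principle_eq0 mu f f1 f2 a b : c2fun f f1 f2 -> a < b ->
  (forall x i, a < x -> x < b -> genop mu (f x) (f1 x) (f2 x) i = 0) ->
  (f a = 0 \/ f1 a = 0) -> f b = 0 ->
  forall x, a <= x -> x <= b -> f x = 0.
Proof.
move=> hf ab hL ha hb x ax xb; apply/matrixP => i j; rewrite (ord1 j) mxE.
apply/eqP; rewrite eq_le; apply/andP; split; last first.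
  apply: (max_principle (mu := mu) hf ab) => //; last by move=> ?; rewrite hb mxE.
    by move=> y l ay yb; rewrite hL.
  by case: ha => ->; [left|right] => ?; rewrite mxE.
rewrite -oppr_ge0; have := @max_principle mu _ _ _ a b (c2funN hf) ab _ _ _ x i ax xb.
rewrite mxE; apply.
- by move=> y l ay yb; rewrite genopN hL ?oppr0.
- by case: ha => ->; [left|right] => ?; rewrite !mxE oppr0.
- by move=> ?; rewrite hb !mxE oppr0.
Qed.

(** Dividing the Taylor expansion by y, and then by y^2, leaves an error of order y, so vanishing on
    one side already determines both coefficients. This turns equality of two solutions on an
    interval into equality of their derivatives at its left end. *)
Lemma c2fun_eq0 f f1 f2 a d : c2fun f f1 f2 -> 0 < d ->
  (forall x, a <= x -> x <= a + d -> f x = 0) -> f1 a = 0 /\ f2 a = 0.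
Proof.
move=> hf d0 h0.
have [K K0 hK] := hf `|a|.
have fa : f a = 0 by apply: h0; rewrite ?lerDl // ltW.
have h y i : 0 < y -> y <= Num.min 1 d ->
    `|y * f1 a i 0 + y ^+ 2 / 2 * f2 a i 0| <= K * y ^+ 3.
  move=> y0; rewrite le_min => /andP[y1 yd].
  have := hK a y (lexx _); rewrite (gtr0_norm y0) => /(_ y1 i).
  rewrite fa h0 ?lerDl ?lerD2l ?(ltW y0) // mxE sub0r normrN add0r; exact.
have m0 : 0 < Num.min 1 d by rewrite lt_min ltr01.
have f10 : f1 a = 0.
  apply/matrixP => i j; rewrite (ord1 j) [RHS]mxE; apply/eqP; rewrite eq_le; apply/andP; split.
    rewrite -oppr_ge0; apply: (@taylor_min_right _ _ (- f2 a i 0) K _ m0 K0) => y y0 yd.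
    have := h y i y0 yd; rewrite ler_norml => /andP[_]; lra.
  apply: (@taylor_min_right _ _ (f2 a i 0) K _ m0 K0) => y y0 yd.
  have := h y i y0 yd; rewrite ler_norml => /andP[]; lra.
split=> //; apply/matrixP => i j; rewrite (ord1 j) [RHS]mxE.
have h2 y : 0 < y -> y <= Num.min 1 d -> `|f2 a i 0| <= y * (2 * K).
  move=> y0 yd; have := h y i y0 yd.
  rewrite f10 mxE mulr0 add0r normrM normrM normrX (gtr0_norm y0) normfV [`|2|]ger0_norm //.
  have -> : K * y ^+ 3 = y ^+ 2 / 2 * (y * (2 * K)) by field.
  by rewrite ler_pM2l // divr_gt0 // exprn_gt0.
apply/eqP; rewrite eq_le; apply/andP; split.
  rewrite -oppr_ge0; apply: (ge0_first_order (C := 2 * K) m0) => y y0 yd.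
  by have := h2 y y0 yd; rewrite ler_norml => /andP[_]; lra.
apply: (ge0_first_order (C := 2 * K) m0) => y y0 yd.
by have := h2 y y0 yd; rewrite ler_norml => /andP[]; lra.
Qed.

End MaxPrinciple.

(** * Boundary value problems and the quadratic matrix equation *)

Lemma unitmx_inj (F : fieldType) k (A : 'M[F]_k) :
  (forall v : 'cV[F]_k, A *m v = 0 -> v = 0) -> A \in unitmx.
Proof.
move=> h; rewrite -unitmx_tr -row_free_unit -kermx_eq0.
apply/eqP/row_matrixP => i; rewrite row0.
have : A *m (row i (kermx A^T))^T = 0.
  apply: trmx_inj; rewrite trmx_mul trmxK trmx0.
  by apply/sub_kermxP; exact: row_sub.
by move/h => /(congr1 trmx); rewrite trmxK trmx0.
Qed.

Lemma expmx_nilp2 (R : realType) k (A : 'M[R]_k) (v : 'cV[R]_k) :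
  A *m (A *m v) = 0 -> expmx A *m v = v + A *m v.
Proof.
move=> A2.
have pw j : A ^+ j.+2 *m v = 0.
  by elim: j => [|j IH]; rewrite exprS -[LHS]mulmxA ?IH ?mulmx0 // exprS expr0 mulr1.
have sm N : expmx_sum A N.+2 *m v = v + A *m v.
  rewrite /expmx_sum mulmx_suml !big_ord_recl /= big1 ?addr0; last first.
    by move=> j _; rewrite -scalemxAl pw scaler0.
  by rewrite /bump /= expr0 expr1 !fact0 invr1 !scale1r mul1mx.
apply/matrixP => i j.
have c1 : (fun N => (expmx_sum A N *m v) i j) @ \oo --> (expmx A *m v) i j.
  have -> : (fun N => (expmx_sum A N *m v) i j) =
      (fun N => \sum_k expmx_sum A N i k * v k j).
    by apply/funext => N; rewrite mxE.
  rewrite mxE; apply: cvgr_sum => l.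
  by apply: cvgM; [exact: expmx_sum_cvg|exact: cvg_cst].
have c2 : (fun N => (expmx_sum A N *m v) i j) @ \oo --> (v + A *m v) i j.
  by apply: cvg_near_cst; exists 2%N => // -[|[|N]] // _; rewrite sm.
exact: (cvg_unique _ c1 c2).
Qed.

Section OdeSol.
Variables (R : realType) (m : nat) (Q : 'M[R]_m) (sigma : 'cV[R]_m).
Hypothesis genQ : is_generator Q.
Hypothesis sigma_neq0 : forall i, sigma i 0 != 0.
Implicit Types (mu u : 'cV[R]_m) (f g : R -> 'cV[R]_m).

(** The equation [genop] = 0 solved for the second derivative: f'' = [ode_zero] f + [ode_one] f'. *)
Definition ode_zero : 'M[R]_m := \matrix_(i, j) (- (2 / sigma i 0 ^+ 2) * Q i j).
Definition ode_one mu : 'M[R]_m := \matrix_(i, j) (- (2 / sigma i 0 ^+ 2) * mu i 0 *+ (i == j)).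
(* Companion matrix: the second order system becomes [(f, f')' = ode_mx (f, f')]. *)
Definition ode_mx mu : 'M[R]_(m + m) := block_mx 0 1%:M ode_zero (ode_one mu).

(** [v] is the pair (f(0), f'(0)): solutions are parametrised by their state at level 0. *)
Definition odesol mu (v : 'cV[R]_(m + m)) (x : R) : 'cV[R]_m :=
  row_mx 1%:M 0 *m expmx (x *: ode_mx mu) *m v.
Definition odesol1 mu (v : 'cV[R]_(m + m)) (x : R) : 'cV[R]_m :=
  row_mx 0 1%:M *m expmx (x *: ode_mx mu) *m v.
Definition odesol2 mu (v : 'cV[R]_(m + m)) (x : R) : 'cV[R]_m :=
  row_mx ode_zero (ode_one mu) *m expmx (x *: ode_mx mu) *m v.

Lemma c2fun_odesol mu v : c2fun (odesol mu v) (odesol1 mu v) (odesol2 mu v).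
Proof.
have := c2fun_exp (row_mx 1%:M 0) (ode_mx mu) v.
have -> : row_mx 1%:M 0 *m ode_mx mu = row_mx 0 1%:M.
  by rewrite mul_row_block mul1mx !mul0mx !addr0 mul1mx.
have -> : row_mx 0 1%:M *m ode_mx mu = row_mx ode_zero (ode_one mu).
  by rewrite mul_row_block !mul0mx !mul1mx !add0r.
by [].
Qed.

Lemma ode_one_mul mu (u : 'cV[R]_m) i :
  (ode_one mu *m u) i 0 = - (2 / sigma i 0 ^+ 2) * mu i 0 * u i 0.
Proof.
rewrite mxE (bigD1 i) //= big1 ?addr0; last first.
  by move=> j ji; rewrite mxE eq_sym (negbTE ji) mulr0n mul0r.
by rewrite mxE eqxx mulr1n.
Qed.

Lemma ode_zero_mul (u : 'cV[R]_m) i :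
  (ode_zero *m u) i 0 = - (2 / sigma i 0 ^+ 2) * (Q *m u) i 0.
Proof.
by rewrite !mxE mulr_sumr; apply: eq_bigr => j _; rewrite mxE mulrA.
Qed.

Lemma genop_eq0 mu (u u1 u2 : 'cV[R]_m) :
  u2 = ode_zero *m u + ode_one mu *m u1 -> forall i, genop Q sigma mu u u1 u2 i = 0.
Proof.
move=> -> i; rewrite /genop mxE ode_zero_mul ode_one_mul.
by field; exact: sigma_neq0.
Qed.

Lemma genop_odesol mu v x i :
  genop Q sigma mu (odesol mu v x) (odesol1 mu v x) (odesol2 mu v x) i = 0.
Proof.
apply: genop_eq0; rewrite /odesol /odesol1 /odesol2 -!mulmxA !mulmxA.
rewrite -!mulmxDl !mul_mx_row !mulmx0 !mulmx1 add_row_mx addr0 add0r //.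
Qed.

Lemma odesol_state mu v x :
  expmx (x *: ode_mx mu) *m v = col_mx (odesol mu v x) (odesol1 mu v x).
Proof.
rewrite -[LHS]vsubmxK /odesol /odesol1 -!mulmxA; set w := expmx _ *m v.
by rewrite -[w]vsubmxK !mul_row_col !mul1mx !mul0mx addr0 add0r vsubmxK.
Qed.

Lemma expmx_inv_mul k (A : 'M[R]_k) x : expmx ((- x) *: A) *m expmx (x *: A) = 1%:M.
Proof. by rewrite -expmxD addNr scale0r expmx0. Qed.

Lemma odesol_eq0 mu v x : odesol mu v x = 0 -> odesol1 mu v x = 0 -> v = 0.
Proof.
move=> h0 h1; have := odesol_state mu v x; rewrite h0 h1 col_mx0.
move=> /(congr1 (mulmx (expmx ((- x) *: ode_mx mu)))).
by rewrite mulmxA expmx_inv_mul mul1mx mulmx0.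
Qed.

Lemma odesol_bvp_inj mu v a b : a < b -> odesol mu v a = 0 -> odesol mu v b = 0 -> v = 0.
Proof.
move=> ab ha hb.
have z := max_principle_eq0 genQ sigma_neq0 (c2fun_odesol mu v) ab
  (fun x i _ _ => genop_odesol mu v x i) (or_introl ha) hb.
apply: (odesol_eq0 (x := a) ha).
have ba : 0 < b - a by rewrite subr_gt0.
have [] := c2fun_eq0 (c2fun_odesol mu v) ba (a := a) => // x ax.
by rewrite addrC subrK; exact: z.
Qed.

(** Uniqueness gives existence, since prescribing the values at both ends is a square linear system
    for the state at 0. *)
Lemma odesol_bvp mu a b (va vb : 'cV[R]_m) : a < b ->
  exists v, odesol mu v a = va /\ odesol mu v b = vb.
Proof.
move=> ab.
pose D : 'M[R]_(m + m) := col_mx (row_mx 1%:M 0 *m expmx (a *: ode_mx mu))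
  (row_mx 1%:M 0 *m expmx (b *: ode_mx mu)).
have De v : D *m v = col_mx (odesol mu v a) (odesol mu v b) by rewrite /D mul_col_mx.
have uD : D \in unitmx.
  apply: unitmx_inj => v; rewrite De => h.
  have : col_mx (odesol mu v a) (odesol mu v b) = col_mx 0 0 by rewrite col_mx0.
  by move=> /eq_col_mx[]; exact: odesol_bvp_inj.
exists (invmx D *m col_mx va vb).
have := De (invmx D *m col_mx va vb); rewrite mulmxA mulmxV // mul1mx.
by move=> /esym /eq_col_mx[].
Qed.

Lemma odesol_nbvp_inj mu v a b : a < b -> odesol1 mu v a = 0 -> odesol mu v b = 0 -> v = 0.
Proof.
move=> ab ha hb.
have z := max_principle_eq0 genQ sigma_neq0 (c2fun_odesol mu v) ab
  (fun x i _ _ => genop_odesol mu v x i) (or_intror ha) hb.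
by apply: (odesol_bvp_inj ab _ hb); apply: z; rewrite ?lexx ?ltW.
Qed.

(** The quadratic equation of the model multiplied by the inverse square of the volatilities; it
    says that e^{xW} c solves the differential equation for every [c]. *)
Definition quadsol mu (W : 'M[R]_m) := W *m W = ode_zero + ode_one mu *m W.

Lemma c2fun_expW (W : 'M[R]_m) (c : 'cV[R]_m) : c2fun (fun x => expmx (x *: W) *m c)
  (fun x => W *m expmx (x *: W) *m c) (fun x => W *m W *m expmx (x *: W) *m c).
Proof.
have := c2fun_exp 1%:M W c; rewrite mul1mx.
by under [X in c2fun X]eq_fun do rewrite mul1mx.
Qed.

Lemma genop_expW mu W c x i : quadsol mu W ->
  genop Q sigma mu (expmx (x *: W) *m c) (W *m expmx (x *: W) *m c)
    (W *m W *m expmx (x *: W) *m c) i = 0.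
Proof.
move=> q; apply: genop_eq0; rewrite q !mulmxDl !mulmxA //.
Qed.

(** The columns of (I, W) span an invariant subspace of the companion matrix, on which it acts as
    [W]. *)
Lemma odesol_expW mu W c x : quadsol mu W ->
  odesol mu (col_mx c (W *m c)) x = expmx (x *: W) *m c /\
  odesol1 mu (col_mx c (W *m c)) x = W *m expmx (x *: W) *m c.
Proof.
move=> q.
have I : ode_mx mu *m col_mx 1%:M W = col_mx 1%:M W *m W.
  rewrite mul_block_col mul_col_mx q !mul0mx !mul1mx add0r mulmx1 //.
have Ix : (x *: ode_mx mu) *m col_mx 1%:M W = col_mx 1%:M W *m (x *: W).
  by rewrite -scalemxAl -scalemxAr I.
have E : expmx (x *: ode_mx mu) *m col_mx c (W *m c) =
   col_mx (expmx (x *: W) *m c) (W *m expmx (x *: W) *m c).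
  have -> : col_mx c (W *m c) = col_mx 1%:M W *m c by rewrite mul_col_mx mul1mx.
  by rewrite mulmxA (expmx_intertwine Ix) mul_col_mx mul1mx mul_col_mx.
by move: E; rewrite odesol_state => /eq_col_mx.
Qed.

End OdeSol.

Arguments odesol {R m}.
Arguments odesol1 {R m}.

Section ColumnEntries.
Variables (R : realType) (m : nat).
Implicit Types u v : 'cV[R]_m.

Lemma colD u v i : (u + v) i 0 = u i 0 + v i 0. Proof. by rewrite mxE. Qed.
Lemma colN u i : (- u) i 0 = - u i 0. Proof. by rewrite mxE. Qed.
Lemma colZ c u i : (c *: u) i 0 = c * u i 0. Proof. by rewrite mxE. Qed.
Lemma colC (c : R) i : (const_mx c : 'cV[R]_m) i 0 = c. Proof. by rewrite mxE. Qed.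
Lemma col0 i : (0 : 'cV[R]_m) i 0 = 0. Proof. by rewrite mxE. Qed.
Definition cventryE := (colD, colN, colZ, colC, col0).
End ColumnEntries.

Definition substoch (R : realType) m (U : 'M[R]_m) := forall x, 0 <= x ->
  (forall i j, 0 <= expmx (x *: U) i j) /\ (forall i, \sum_j expmx (x *: U) i j <= 1).

Lemma substoch_ub (R : realType) m (U : 'M[R]_m) (u : 'cV[R]_m) K x i : substoch U ->
  0 <= x -> 0 <= K -> (forall k, u k 0 <= K) -> (expmx (x *: U) *m u) i 0 <= K.
Proof.
move=> sU x0 K0 uK; have [U0 U1] := sU x x0.
rewrite mxE (@le_trans _ _ (\sum_j expmx (x *: U) i j * K)) //.
  by apply: ler_sum => j _; rewrite ler_wpM2l.
by rewrite -mulr_suml ler_piMl.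
Qed.

(** * Solutions and the mean drift: affine, decaying and bounded solutions *)

Section OdeTheory.
Variables (R : realType) (m : nat) (Q : 'M[R]_m) (sigma : 'cV[R]_m).
Variables (alpha : 'rV[R]_m) (Qs : 'M[R]_m).
Hypothesis genQ : is_generator Q.
Hypothesis irrQ : irreducible_gen Q.
Hypothesis sigma_neq0 : forall i, sigma i 0 != 0.
Hypothesis alphaQ : alpha *m Q = 0.
Hypothesis alpha1 : \sum_i alpha 0 i = 1.
Hypothesis QsQ : Qs *m Q = 1%:M - (const_mx 1 : 'cV[R]_m) *m alpha.
Hypothesis Qs1 : Qs *m (const_mx 1 : 'cV[R]_m) = 0.

Local Notation one := (const_mx 1 : 'cV[R]_m).

Definition mean_drift (mu : 'cV[R]_m) : R := \sum_i alpha 0 i * mu i 0.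

Lemma alpha_one : alpha *m one = 1%:M.
Proof.
apply/matrixP => i j; rewrite !ord1 !mxE eqxx -[RHS]alpha1.
by apply: eq_bigr => k _; rewrite mxE mulr1.
Qed.

Lemma Q_one : Q *m one = 0. Proof. exact: gen_const. Qed.

(** The group inverse is given by the identity on the other side. The defect multiplied by [Q] and
    by 1 gives 0, hence also by Q + 1 alpha, which is invertible. *)
Lemma QQs : Q *m Qs = 1%:M - one *m alpha.
Proof.
have uN : Q + one *m alpha \in unitmx.
  apply: unitmx_inj => v Nv.
  have av : alpha *m v = 0.
    move: Nv => /(congr1 (mulmx alpha)).
    by rewrite mulmx0 mulmxDl mulmxDr !mulmxA alphaQ mul0mx add0r alpha_one mul1mx.
  have Qv : Q *m v = 0 by move: Nv; rewrite mulmxDl -mulmxA av mulmx0 addr0.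
  have := congr1 (mulmx^~ v) QsQ; rewrite -mulmxA Qv mulmx0 mulmxBl mul1mx -mulmxA av.
  by rewrite mulmx0 subr0.
apply/eqP; rewrite -subr_eq0; apply/eqP.
set D := _ - _; suff DN : D *m (Q + one *m alpha) = 0.
  by rewrite -[D]mulmx1 -(mulmxV uN) mulmxA DN mul0mx.
have DQ : D *m Q = 0.
  rewrite /D mulmxBl mulmxBl mul1mx -!mulmxA alphaQ mulmx0 QsQ mulmxBr mulmx1 mulmxA Q_one.
  by rewrite mul0mx !subr0 subrr.
have D1 : D *m one = 0.
  rewrite /D mulmxBl mulmxBl mul1mx -!mulmxA alpha_one mulmx1 Qs1 mulmx0 subrr subr0 //.
by rewrite mulmxDr DQ add0r mulmxA D1 mul0mx.
Qed.

(** The generator takes on this function the constant value [mean_drift mu], so it is an unbounded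
    solution when the drift is 0. *)
Definition affine_sol mu (x : R) : 'cV[R]_m := x *: one - Qs *m mu.

Lemma Q_affine mu x i : (Q *m affine_sol mu x) i 0 = mean_drift mu - mu i 0.
Proof.
rewrite /affine_sol mulmxBr -scalemxAr Q_one scaler0 sub0r mulmxA QQs mulmxBl mul1mx.
rewrite -mulmxA !cventryE opprB; congr (_ - _).
by rewrite mxE big_ord1 mxE mul1r mxE.
Qed.

Lemma genop_affine mu x i : genop Q sigma mu (affine_sol mu x) one 0 i = mean_drift mu.
Proof. by rewrite /genop Q_affine !mxE; ring. Qed.

Lemma expW_one (W : 'M[R]_m) x : W *m one = 0 -> expmx (x *: W) *m one = one.
Proof.
by move=> W1; rewrite expmx_nilp2 -?scalemxAl W1 ?scaler0 ?addr0 // mulmx0 scaler0.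
Qed.

(** With mean drift 0, g = e^{xU} 1 - 1 is a bounded solution vanishing at 0. A multiple e of an
    affine solution dominates both g and -g on an interval of length 1/e, and letting e go to 0
    leaves g = 0 and so g'(0) = U 1 = 0. *)
Lemma substoch_recurrent mu U : mean_drift mu = 0 -> quadsol Q sigma mu U -> substoch U ->
  U *m one = 0.
Proof.
move=> am q sU.
pose g x := expmx (x *: U) *m one + (-1) *: one.
pose g1 x := U *m expmx (x *: U) *m one.
pose g2 x := U *m U *m expmx (x *: U) *m one.
have hg : c2fun g g1 g2.
  have := c2funD (c2fun_expW U one) (c2fun_affine 0 (- one)).
  set F := c2fun _ _ _; set G := c2fun _ _ _; suff -> : F = G by [].
  by congr c2fun; apply/funext => x; rewrite ?scaler0 ?add0r ?addr0 // /g scaleN1r.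
have Lg x i : genop Q sigma mu (g x) (g1 x) (g2 x) i = 0.
  rewrite -[g1 x]addr0 -[g2 x]addr0 genopD genop_expW // add0r.
  by rewrite /genop -scalemxAr Q_one scaler0 !mxE; ring.
have ge1 x i : 0 <= x -> `|g x i 0| <= 1.
  move=> x0; have [U0 U1] := sU x x0.
  have -> : g x i 0 = (\sum_j expmx (x *: U) i j) - 1.
    rewrite /g !cventryE mulr1 mxE; congr (_ - _).
    by apply: eq_bigr => j _; rewrite cventryE mulr1.
  have s0 : 0 <= \sum_j expmx (x *: U) i j by exact: sumr_ge0.
  have := U1 i; rewrite ler_norml; lra.
pose k := mxabs (Qs *m mu).
have kb i : `|(Qs *m mu) i 0| <= k by exact: ler_mxabs.
have main (s : R) x i e : (s = 1 \/ s = -1) -> 0 <= x -> 0 < e -> e * x <= 1 ->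
   0 <= e * (x + 2 * k) + s * g x i 0.
  move=> s1 x0 e0 ex.
  (* Adding [k] makes the affine part nonnegative at 0; at level 1/e it is at least 1, which is the
     bound of |g|. *)
  pose h y := e *: (y *: one + (k *: one - Qs *m mu)) + s *: g y.
  have hh := c2funD (c2funZ e (c2fun_affine one (k *: one - Qs *m mu))) (c2funZ s hg).
  have N0 : 0 < e^-1 by rewrite invr_gt0.
  have sg y l : 0 <= y -> -1 <= s * g y l 0.
    move=> y0; have := ge1 y l y0; rewrite ler_norml.
    by case: s1 => ->; lra.
  have := max_principle genQ sigma_neq0 (mu := mu) hh N0 _ _ _ i x0.
  rewrite -[e^-1]mulr1 ler_pdivlMl // => /(_ _ _ _ ex) H.
  have : 0 <= (e *: (x *: one + (k *: one - Qs *m mu)) + s *: g x) i 0.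
    apply: H.
    - move=> y l _ _; rewrite genopD !genopZ Lg mulr0 addr0.
      have -> : y *: one + (k *: one - Qs *m mu) = affine_sol mu (y + k).
        by rewrite /affine_sol scalerDl addrA.
      by rewrite genop_affine am mulr0.
    - left=> l; rewrite /g scale0r scale0r expmx0 mul1mx scaleN1r subrr scaler0 addr0 add0r.
      rewrite !cventryE mulr1; apply: mulr_ge0; first exact: ltW.
      by rewrite subr_ge0 (le_trans (ler_norm _)).
    - move=> l; rewrite mulr1.
      have := sg e^-1 l (ltW N0); have := kb l; have := ltW e0; have e1 : e * e^-1 = 1.
        by rewrite divff // gt_eqF.
      set G := g _; rewrite !cventryE !mulr1.
      move=> a1; rewrite ler_norml => /andP[_ a2] a3; rewrite mulrDr e1.
      have : 0 <= e * (k - (Qs *m mu) l 0) by rewrite mulr_ge0 // subr_ge0.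
      lra.
  set G := g _; rewrite !cventryE !mulr1 /G => /le_trans; apply.
  rewrite lerD2r ler_wpM2l ?(ltW e0) //.
  have := kb i; rewrite ler_norml => /andP[]; lra.
have g0 x : 0 <= x -> x <= 0 + 1 -> g x = 0.
  move=> x0 x1; apply/matrixP => i j; rewrite (ord1 j) [RHS]mxE.
  have k0 : 0 <= k := mxabs_ge0 _.
  have D0 : 0 < x + 2 * k + 1 by rewrite ltr_wpDl // addr_ge0 // mulr_ge0.
  apply/eqP; rewrite -normr_eq0 eq_le normr_ge0 andbT; apply/ler_addgt0Pr => e e0.
  rewrite add0r.
  have e1 : 0 < Num.min (e / (x + 2 * k + 1)) 1 by rewrite lt_min ltr01 divr_gt0.
  set d := Num.min _ _ in e1.
  have dx : d * x <= 1.
    apply: mulr_ile1 => //; [exact: ltW|by rewrite /d ge_min lexx orbT|by rewrite add0r in x1].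
  have de : d * (x + 2 * k) <= e.
    apply: (@le_trans _ _ (e / (x + 2 * k + 1) * (x + 2 * k))).
      by rewrite ler_wpM2r ?ge_min ?lexx // addr_ge0 // mulr_ge0.
    by rewrite mulrAC ler_pdivrMr // ler_wpM2l ?(ltW e0) // lerDl.
  have := main 1 x i d (or_introl erefl) x0 e1 dx.
  have := main (-1) x i d (or_intror erefl) x0 e1 dx.
  rewrite ler_norml; lra.
have [] := c2fun_eq0 hg ltr01 g0.
by rewrite /g1 scale0r expmx0 mulmx1.
Qed.

(** For positive drift, e^{-th x} (1 + th om) is a supersolution for small th: the choice of [om]
    makes the terms of first order in th add up to minus the mean drift in every phase, and the rest
    is of second order. The bound does not depend on [N]. *)
Lemma dirichlet_decay mu : 0 < mean_drift mu -> exists th C : R, [/\ 0 < th, 0 < C &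
  forall N v, 0 < N -> odesol Q sigma mu v 0 = one -> odesol Q sigma mu v N = 0 ->
  forall x i, 0 <= x -> x <= N -> odesol Q sigma mu v x i 0 <= C * expR (- th * x)].
Proof.
set am := mean_drift mu => am0.
pose k := mxabs (Qs *m mu).
pose om : 'cV[R]_m := Qs *m mu + k *: one.
have om0 i : 0 <= om i 0.
  have := ler_mxabs (Qs *m mu) i 0; rewrite -/k ler_norml => /andP[h _].
  by rewrite /om !cventryE mulr1; lra.
have om1 i : om i 0 <= 2 * k.
  have := ler_mxabs (Qs *m mu) i 0; rewrite -/k ler_norml => /andP[_ h].
  by rewrite /om !cventryE mulr1; lra.
have k0 : 0 <= k := mxabs_ge0 _.
have Qom i : (Q *m om) i 0 = mu i 0 - am.
  have := Q_affine mu 0 i; rewrite /affine_sol scale0r sub0r mulmxN mxE => /eqP.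
  rewrite eqr_oppLR opprB => /eqP <-.
  by rewrite /om mulmxDr -scalemxAr Q_one scaler0 addr0.
(* [B] bounds the second order coefficient when th <= 1, and th is chosen so that th B is at most
   the drift. *)
pose B := \sum_i (sigma i 0 ^+ 2 / 2 * (1 + 2 * k) + `|mu i 0| * (2 * k)).
have Bp i : 0 <= sigma i 0 ^+ 2 / 2 * (1 + 2 * k) + `|mu i 0| * (2 * k).
  by rewrite addr_ge0 // mulr_ge0 ?divr_ge0 ?sqr_ge0 ?addr_ge0 ?mulr_ge0.
have Bi i : sigma i 0 ^+ 2 / 2 * (1 + 2 * k) + `|mu i 0| * (2 * k) <= B.
  by rewrite /B (bigD1 i) //= lerDl sumr_ge0.
have B0 : 0 <= B by exact: sumr_ge0.
pose th := Num.min 1 (am / (B + 1)).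
have th0 : 0 < th by rewrite lt_min ltr01 divr_gt0 // ltr_wpDl.
have th1 : th <= 1 by rewrite ge_min lexx.
have thB : th * B <= am.
  apply: (@le_trans _ _ (am / (B + 1) * B)); first by rewrite ler_wpM2r // ge_min lexx orbT.
  by rewrite mulrAC ler_pdivrMr ?ltr_wpDl // ler_wpM2l ?(ltW am0) // lerDl.
exists th, (1 + 2 * k); split => //; first by rewrite ltr_pwDl // mulr_ge0.
move=> N v N0 v0 vN x i x0 xN.
pose u : 'cV[R]_m := one + th *: om.
have hh := c2funD (c2fun_expR (- th) u) (c2funN (c2fun_odesol Q sigma mu v)).
have uE l : u l 0 = 1 + th * om l 0 by rewrite /u !cventryE.
have {hh} : 0 <= (expR (- th * x) *: u - odesol Q sigma mu v x) i 0.
  apply: (max_principle genQ sigma_neq0 (mu := mu) hh N0 _ _ _ i x0 xN) => [y l _ _||l].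
  - rewrite genopD genopN genop_odesol // oppr0 addr0 /genop.
    rewrite -scalemxAr ![((_ : R) *: _ : 'cV_m) l 0]colZ uE.
    have -> : (Q *m u) l 0 = th * (mu l 0 - am).
      by rewrite /u mulmxDr Q_one add0r -scalemxAr [LHS]mxE Qom.
    set E := expR _.
    have -> : sigma l 0 ^+ 2 / 2 * ((- th) ^+ 2 * E * (1 + th * om l 0)) +
       mu l 0 * (- th * E * (1 + th * om l 0)) + E * (th * (mu l 0 - am)) =
      E * th * (th * (sigma l 0 ^+ 2 / 2 * (1 + th * om l 0) - mu l 0 * om l 0) - am) by ring.
    apply: mulr_ge0_le0; first by rewrite mulr_ge0 ?expR_ge0 // ltW.
    rewrite subr_le0 (le_trans _ thB) //.
    rewrite ler_wpM2l ?(ltW th0) // (le_trans _ (Bi l)) //.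
    apply: lerD; first rewrite ler_wpM2l ?divr_ge0 ?sqr_ge0 // lerD2l.
      by rewrite -[2 * k]mul1r ler_pM ?(ltW th0).
    rewrite (le_trans (ler_norm _)) // normrN normrM ler_wpM2l // ger0_norm //.
  - left=> l; rewrite v0 mulr0 expR0 colD colZ colN uE colC.
    by rewrite mul1r addrAC subrr add0r mulr_ge0 ?(ltW th0).
  - rewrite vN oppr0 addr0 colZ uE.
    by rewrite mulr_ge0 ?expR_ge0 // addr_ge0 // mulr_ge0 ?(ltW th0).
rewrite colD colZ colN uE subr_ge0 => /le_trans; apply; rewrite mulrC ler_wpM2r ?expR_ge0 // lerD2l.
by rewrite -[2 * k]mul1r ler_pM ?(ltW th0).
Qed.

Section Pair.
Variables (mu : 'cV[R]_m) (U Uh : 'M[R]_m).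
Hypothesis qU : quadsol Q sigma mu U.
Hypothesis qUh : quadsol Q sigma mu (- Uh).
Hypothesis sU : substoch U.
Hypothesis sUh : substoch Uh.

(** At a maximum the level part and the term with [Q] are both nonpositive, so both vanish; every
    phase reachable by one jump is then also at the maximum, and irreducibility reaches them all. *)
Lemma strong_max f f1 f2 M x i0 : c2fun f f1 f2 ->
  (forall i, genop Q sigma mu (f x) (f1 x) (f2 x) i = 0) ->
  (forall y i, f y i 0 <= M) -> f x i0 0 = M -> forall k, f x k 0 = M.
Proof.
move=> hf Lf fM fx0 k.
have step i j : f x i 0 = M -> 0 < Q i j -> f x j 0 = M.
  move=> fi Qij.
  have [K K0 hK] := hf `|x|.
  have [d1 d2] : - f1 x i 0 = 0 /\ 0 <= - f2 x i 0.
    apply: (taylor_min ltr01 K0) => y y1.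
    have := hK x y (lexx _) y1 i; have := fM (x + y) i.
    rewrite -{}fi ler_norml => a1 /andP[a2 _].
    rewrite !mulrN; set p := y * _ in a2 *; set q := _ * f2 x i 0 in a2 *.
    lra.
  have := Lf i; rewrite /genop.
  have -> : f1 x i 0 = 0 by apply/eqP; rewrite -oppr_eq0 d1.
  rewrite mulr0 addr0.
  have e1 : sigma i 0 ^+ 2 / 2 * f2 x i 0 <= 0.
    by rewrite mulr_ge0_le0 ?divr_ge0 ?sqr_ge0 // -oppr_ge0.
  have -> : (Q *m f x) i 0 = - \sum_k Q i k * (M - f x k 0).
    have : (Q *m (M *: one - f x)) i 0 = - (Q *m f x) i 0.
      by rewrite mulmxBr -scalemxAr Q_one scaler0 sub0r mxE.
    move=> /eqP; rewrite -eqr_oppLR => /eqP <-; congr (- _).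
    by rewrite mxE; apply: eq_bigr => l _; rewrite !mxE mulr1.
  have tp l : 0 <= Q i l * (M - f x l 0).
    have [<-|il] := eqVneq i l; first by rewrite fi subrr mulr0.
    by rewrite mulr_ge0 ?subr_ge0 //; exact: (proj1 genQ).
  have : Q i j * (M - f x j 0) <= \sum_k Q i k * (M - f x k 0).
    by rewrite (bigD1 j) //= lerDl sumr_ge0.
  move=> e2 e3; have : Q i j * (M - f x j 0) <= 0 by lra.
  rewrite pmulr_rle0 // subr_le0 => e4; apply/eqP; rewrite eq_le e4 andbT //.
have /connectP[p pp ->] := irrQ i0 k.
elim: p i0 fx0 pp => //= j p IH i0 fi /andP[/= Q0 pp].
by apply: (IH j) => //; exact: step fi Q0.
Qed.

(** The function e^{xU} c = e^{-x Uh} c is controlled to the right by [U] and to the left by [Uh],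
    so it is a bounded solution on the whole line. If some entry of [c] is positive, the maximum is
    attained at every level and the strong maximum principle makes the function constant. *)
Lemma bounded_sol_const (c : 'cV[R]_m) : U *m c = - Uh *m c ->
  exists s, c = const_mx s /\ (s != 0 -> U *m one = 0 /\ Uh *m one = 0).
Proof.
pose g (c : 'cV[R]_m) x := expmx (x *: U) *m c.
suff main (c' : 'cV[R]_m) i0 : U *m c' = - Uh *m c' -> 0 < c' i0 0 ->
    exists s, c' = const_mx s /\ (s != 0 -> U *m one = 0 /\ Uh *m one = 0).
  move=> Uc; have [/existsP[i ci]|] := boolP [exists i, 0 < c i 0]; first exact: main Uc ci.
  rewrite negb_exists => /forallP c0.
  have [/existsP[i ci]|] := boolP [exists i, c i 0 < 0].
    have [||s [cs h]] := main (- c) i; rewrite ?mulmxN ?Uc // ?mxE ?oppr_gt0 //.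
    exists (- s); split; last by rewrite oppr_eq0.
    by rewrite -[c]opprK cs; apply/matrixP => ? ?; rewrite !mxE.
  rewrite negb_exists => /forallP c1; exists 0; split; last by rewrite eqxx.
  apply/matrixP => i j; rewrite (ord1 j) mxE; apply/eqP; rewrite eq_le.
  by rewrite leNgt c0 leNgt c1.
move=> Uc ci.
have ge x : g c' x = expmx (x *: (- Uh)) *m c'.
  have [e1 _] := odesol_expW c' x qU.
  by have [e2 _] := odesol_expW c' x qUh; rewrite /g -e1 -e2 Uc.
have gr x y : y <= x -> g c' x = expmx ((x - y) *: U) *m g c' y.
  by move=> xy; rewrite /g mulmxA -expmxD subrK.
have gl x y : x <= y -> g c' x = expmx ((y - x) *: Uh) *m g c' y.
  move=> xy; rewrite !ge mulmxA.
  have -> : (y - x) *: Uh = (x - y) *: (- Uh) by rewrite scalerN -scaleNr opprB.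
  by rewrite -expmxD subrK.
have gub y M x k : 0 <= M -> (forall i, g c' y i 0 <= M) -> g c' x k 0 <= M.
  move=> M0 h; have [xy|yx] := leP x y.
    by rewrite (gl x y xy); apply: substoch_ub => //; rewrite subr_ge0.
  by rewrite (gr x y (ltW yx)); apply: substoch_ub => //; rewrite subr_ge0 ltW.
have g0 : g c' 0 = c' by rewrite /g scale0r expmx0 mul1mx.
have [i1 _ imax] := Order.TotalTheory.arg_maxP (fun i => c' i 0) (erefl : predT i0).
set M := c' i1 0 in imax.
have M0 : 0 < M by apply: (lt_le_trans ci); exact: imax.
have gM y i : g c' y i 0 <= M.
  by apply: (gub 0); [exact: ltW|move=> l; rewrite g0; exact: imax].
(* If the maximum over phases dropped below [M] at some level, the two semigroups would carry the
   smaller bound back to level 0. *)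
have att x : exists i, g c' x i 0 = M.
  have [i2 _ jmax] := Order.TotalTheory.arg_maxP (fun i => g c' x i 0) (erefl : predT i0).
  exists i2; apply/eqP; rewrite eq_le gM /= leNgt; apply/negP => lt.
  pose M' := Num.max 0 (g c' x i2 0).
  have : g c' 0 i1 0 <= M'.
    apply: (gub x) => [|l]; first by rewrite le_max lexx.
    by rewrite le_max; apply/orP; right; exact: jmax.
  by rewrite g0 -/M leNgt gt_max M0 lt.
have gc x : g c' x = const_mx M.
  have [i2 hi] := att x; apply/matrixP => k j; rewrite (ord1 j) [RHS]mxE.
  apply: (strong_max (c2fun_expW U c') _ gM hi) => l; exact: genop_expW.
exists M; split; first by rewrite -g0 gc.
have cE : c' = M *: one by rewrite -g0 gc; apply/matrixP => ? ?; rewrite !mxE mulr1.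
have U1 : U *m one = 0.
  have h := c2funD (c2fun_expW U c') (c2fun_affine 0 (- c')).
  have [] := c2fun_eq0 h ltr01 (a := 0) => [x _ _|].
    by rewrite scaler0 add0r -/(g c' x) gc -g0 gc subrr.
  rewrite scale0r expmx0 mulmx1 addr0 cE -scalemxAr => /eqP.
  by rewrite scaler_eq0 gt_eqF //= => /eqP.
move=> _; split => //.
move: Uc; rewrite cE -scalemxAr U1 scaler0 => /esym /eqP.
by rewrite -scalemxAr mulNmx scaler_eq0 gt_eqF //= oppr_eq0 => /eqP.
Qed.

End Pair.

End OdeTheory.

(** * The linear system (S) and the Dirichlet-to-Neumann map *)

Lemma eq_mulmx_col (R : comNzRingType) p q (A B : 'M[R]_(p, q)) :
  (forall v : 'cV[R]_q, A *m v = B *m v) -> A = B.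
Proof.
move=> h; apply/matrixP => i j; have := h (delta_mx j 0).
by rewrite -!colE => /matrixP/(_ i 0); rewrite !mxE.
Qed.

Section BlockSystem.
Variables (F : fieldType) (m : nat).
Implicit Types A B D U V X : 'M[F]_m.

Lemma block_unit_sub A B : block_mx 1%:M A B 1%:M \in unitmx -> (1%:M - A *m B) \in unitmx.
Proof.
move=> uM; apply: unitmx_inj => c h.
have z : block_mx 1%:M A B 1%:M *m col_mx c (- (B *m c)) = 0.
  rewrite mul_block_col !mul1mx mulmxN mulmxA subrr.
  by move: h; rewrite mulmxBl mul1mx => ->; rewrite col_mx0.
have : col_mx c (- (B *m c)) = col_mx 0 0.
  by rewrite -[LHS]mul1mx -(mulVmx uM) -mulmxA z mulmx0 col_mx0.
by move=> /eq_col_mx[].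
Qed.

Lemma block_unit_sub_swap A B : block_mx 1%:M A B 1%:M \in unitmx -> (1%:M - B *m A) \in unitmx.
Proof.
move=> uM; apply: unitmx_inj => c h.
have z : block_mx 1%:M A B 1%:M *m col_mx (- (A *m c)) c = 0.
  rewrite mul_block_col !mul1mx mulmxN mulmxA addNr addrC.
  by move: h; rewrite mulmxBl mul1mx => ->; rewrite col_mx0.
have : col_mx (- (A *m c)) c = col_mx 0 0.
  by rewrite -[LHS]mul1mx -(mulVmx uM) -mulmxA z mulmx0 col_mx0.
by move=> /eq_col_mx[].
Qed.

Lemma invmx_swap A B X : A \in unitmx -> B \in unitmx -> A *m X = X *m B ->
  invmx A *m X = X *m invmx B.
Proof.
move=> uA uB e.
by rewrite -[LHS](mulmxK uB) -(mulmxA (invmx A)) -e mulmxA mulVmx // mul1mx.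
Qed.

(** Both block equations follow from the push-through identity (I - BA)^{-1} B = B (I - AB)^{-1} and
    its mirror image. *)
Lemma block_system_solution A B D U V : block_mx 1%:M A B 1%:M \in unitmx ->
  [/\ (1%:M - A *m B) \in unitmx, (1%:M - B *m A) \in unitmx &
   row_mx (- (D *m (U + V) *m B *m invmx (1%:M - A *m B)))
          (D *m (U + V *m B *m A) *m invmx (1%:M - B *m A)) *m block_mx 1%:M A B 1%:M =
   D *m row_mx (- (V *m B)) U].
Proof.
move=> uM; have u1 := block_unit_sub uM; have u2 := block_unit_sub_swap uM; split => //.
have EB : invmx (1%:M - B *m A) *m B = B *m invmx (1%:M - A *m B).
  by apply: invmx_swap => //; rewrite mulmxBr mulmxBl mulmx1 mul1mx mulmxA.
have EA : invmx (1%:M - A *m B) *m A = A *m invmx (1%:M - B *m A).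
  by apply: invmx_swap => //; rewrite mulmxBr mulmxBl mulmx1 mul1mx mulmxA.
rewrite mul_row_block !mulmx1 mul_mx_row; congr row_mx.
  rewrite -[X in _ + X]mulmxA EB !mulmxA -mulNmx -mulmxDl -!mulmxA -mulmxN -mulmxDr.
  rewrite -mulmxA; congr (_ *m _).
  rewrite [X in X *m _](_ : _ = - (V *m B) *m (1%:M - A *m B)).
    by rewrite -mulmxA mulmxV // mulmx1.
  by rewrite mulmxBr mulmx1 !mulmxDl opprD addrACA addNr add0r mulNmx opprK !mulmxA.
rewrite mulNmx -[X in - X + _]mulmxA EA !mulmxA -mulNmx -mulmxDl.
rewrite -!mulmxA -mulmxN -mulmxDr -mulmxA; congr (_ *m _).
rewrite [X in X *m _](_ : _ = U *m (1%:M - B *m A)).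
  by rewrite -mulmxA mulmxV // mulmx1.
by rewrite mulmxBr mulmx1 mulmxDl opprD addrACA addNr addr0 addrC.
Qed.

End BlockSystem.

Section Main.
Variables (R : realType) (m : nat) (Q : 'M[R]_m) (sigma mu : 'cV[R]_m).
Variables (alpha : 'rV[R]_m) (Qs U Uh : 'M[R]_m) (b : R).
Hypothesis genQ : is_generator Q.
Hypothesis irrQ : irreducible_gen Q.
Hypothesis sigma_gt0 : forall i, 0 < sigma i 0.
Hypothesis alphaQ : alpha *m Q = 0.
Hypothesis alpha1 : \sum_i alpha 0 i = 1.
Hypothesis QsQ : Qs *m Q = 1%:M - (const_mx 1 : 'cV[R]_m) *m alpha.
Hypothesis Qs1 : Qs *m (const_mx 1 : 'cV[R]_m) = 0.
Hypothesis qU : quadsol Q sigma mu U.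
Hypothesis qUh : quadsol Q sigma mu (- Uh).
Hypothesis sU : substoch U.
Hypothesis sUh : substoch Uh.
Hypothesis trU : 0 < mean_drift alpha mu -> U *m (const_mx 1 : 'cV[R]_m) != 0.
Hypothesis trUh : mean_drift alpha mu < 0 -> Uh *m (const_mx 1 : 'cV[R]_m) != 0.
Hypothesis rcU : mean_drift alpha mu = 0 -> U *m (const_mx 1 : 'cV[R]_m) = 0.
Hypothesis rcUh : mean_drift alpha mu = 0 -> Uh *m (const_mx 1 : 'cV[R]_m) = 0.
Hypothesis b_gt0 : 0 < b.

Local Notation one := (const_mx 1 : 'cV[R]_m).
Local Notation am := (mean_drift alpha mu).
Local Notation Eu := (expmx (b *: U)).
Local Notation Eh := (expmx (b *: Uh)).
Local Notation Dsig := (diag_mx sigma^T).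
Local Notation sol := (odesol Q sigma mu).
Local Notation sol1 := (odesol1 Q sigma mu).

Let sigma_neq0 i : sigma i 0 != 0. Proof. by rewrite gt_eqF. Qed.

Definition sysmx : 'M[R]_(m + m) := block_mx 1%:M Eu Eh 1%:M.

Lemma Dsig_mul (u : 'cV[R]_m) i : (Dsig *m u) i 0 = sigma i 0 * u i 0.
Proof. by rewrite mul_diag_mx !mxE. Qed.

Lemma Dsig_inj (u : 'cV[R]_m) : Dsig *m u = 0 -> u = 0.
Proof.
move=> h; apply/matrixP => i j; rewrite (ord1 j) [RHS]mxE.
have : (Dsig *m u) i 0 = 0 by rewrite h mxE.
by rewrite Dsig_mul => /eqP; rewrite mulf_eq0 (negbTE (sigma_neq0 i)) => /eqP.
Qed.

(** The factor e^{Uh b} makes the second mode e^{Uh (b - x)} c2, so that the two sides of (S),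
    applied to (c2, c1), involve exactly the values of this function at [b] and 0 and its slope at
    0. *)
Definition expsum (c1 c2 : 'cV[R]_m) x :=
  expmx (x *: U) *m c1 + expmx (x *: (- Uh)) *m (Eh *m c2).
Definition expsum1 (c1 c2 : 'cV[R]_m) x :=
  U *m expmx (x *: U) *m c1 + (- Uh) *m expmx (x *: (- Uh)) *m (Eh *m c2).
Definition expsum2 (c1 c2 : 'cV[R]_m) x :=
  U *m U *m expmx (x *: U) *m c1 + (- Uh) *m (- Uh) *m expmx (x *: (- Uh)) *m (Eh *m c2).

Lemma c2fun_expsum c1 c2 : c2fun (expsum c1 c2) (expsum1 c1 c2) (expsum2 c1 c2).
Proof. by apply: c2funD; exact: c2fun_expW. Qed.

Lemma genop_expsum c1 c2 x i :
  genop Q sigma mu (expsum c1 c2 x) (expsum1 c1 c2 x) (expsum2 c1 c2 x) i = 0.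
Proof. by rewrite genopD !genop_expW // addr0. Qed.

Lemma expsum_at0 c1 c2 : expsum c1 c2 0 = c1 + Eh *m c2.
Proof. by rewrite /expsum !scale0r expmx0 !mul1mx. Qed.

Lemma expsum1_at0 c1 c2 : expsum1 c1 c2 0 = U *m c1 - Uh *m Eh *m c2.
Proof. by rewrite /expsum1 !scale0r expmx0 !mulmx1 mulNmx mulmxA. Qed.

Lemma expmxNK (W : 'M[R]_m) x : expmx (x *: (- W)) *m expmx (x *: W) = 1%:M.
Proof. by rewrite scalerN -scaleNr expmx_inv_mul. Qed.

Lemma expsum_atb c1 c2 : expsum c1 c2 b = Eu *m c1 + c2.
Proof. by rewrite /expsum mulmxA expmxNK mul1mx. Qed.

Lemma sysmx_expsum c1 c2 :
  sysmx *m col_mx c2 c1 = col_mx (expsum c1 c2 b) (expsum c1 c2 0).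
Proof.
by rewrite /sysmx mul_block_col !mul1mx expsum_at0 expsum_atb addrC [X in col_mx _ X]addrC.
Qed.

(** The combination vanishes on the whole interval; its zero value and zero slope at 0 give U c1 = -
    Uh c1, which leaves only constants, and nonzero ones only without drift. The Neumann alternative
    serves the matrix inverted in the formula for H_0. *)
Lemma sysmx_ker c1 c2 : (expsum c1 c2 0 = 0 \/ expsum1 c1 c2 0 = 0) -> expsum c1 c2 b = 0 ->
  exists s : R, [/\ c1 = const_mx s, c2 = const_mx (- s) & s != 0 -> am = 0].
Proof.
move=> h0 hb.
have z := max_principle_eq0 genQ sigma_neq0 (c2fun_expsum c1 c2) b_gt0
  (fun x i _ _ => genop_expsum c1 c2 x i) h0 hb.
have z0 : expsum c1 c2 0 = 0 by apply: z; rewrite ?lexx ?ltW.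
have [z1 _] : expsum1 c1 c2 0 = 0 /\ expsum2 c1 c2 0 = 0.
  by apply: (c2fun_eq0 (c2fun_expsum c1 c2) b_gt0) => x x0; rewrite add0r; exact: z.
have c1E : c1 = - (Eh *m c2) by apply/eqP; rewrite -addr_eq0 -expsum_at0 z0.
have [|s [cs hs]] := bounded_sol_const genQ irrQ sigma_neq0 qU qUh sU sUh (c := c1).
  move: z1; rewrite expsum1_at0 -mulmxA => /eqP; rewrite subr_eq0 => /eqP ->.
  by rewrite c1E mulmxN mulNmx opprK.
have c2E : c2 = - (Eu *m c1) by apply/eqP; rewrite -addr_eq0 addrC -expsum_atb hb.
exists s; have [s0|s0] := eqVneq s 0.
  split => //; rewrite c2E cs s0 oppr0; apply/matrixP => i j; rewrite [RHS]mxE.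
  have -> : const_mx 0 = 0 :> 'cV[R]_m by apply/matrixP => ? ?; rewrite !mxE.
  by rewrite mulmx0 oppr0 mxE.
have [U1 Uh1] := hs s0.
split => //.
  have cE : c1 = s *: one by rewrite cs; apply/matrixP => ? ?; rewrite !mxE mulr1.
  rewrite c2E cE -scalemxAr expW_one //; apply/matrixP => ? ?; rewrite !mxE mulr1 //.
move=> _; apply/eqP; rewrite eq_le !leNgt.
by apply/andP; split; apply/negP => h; [have := trU h|have := trUh h]; rewrite ?U1 ?Uh1 eqxx.
Qed.

Lemma sysmx_unit : am != 0 -> sysmx \in unitmx.
Proof.
move=> am0; apply: unitmx_inj => v; rewrite -[v]vsubmxK sysmx_expsum => h.
have : col_mx (expsum (dsubmx v) (usubmx v) b) (expsum (dsubmx v) (usubmx v) 0) = col_mx 0 0.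
  by rewrite h col_mx0.
move=> /eq_col_mx[hb h0].
have [s [e1 e2 e3]] := sysmx_ker (or_introl h0) hb.
have s0 : s = 0 by apply/eqP; apply: contraNT am0 => /e3 ->.
by rewrite e1 e2 s0 oppr0; apply/matrixP => i j; rewrite !mxE; case: splitP => k _; rewrite mxE.
Qed.

Lemma sysmx_not_unit : am = 0 -> (0 < m)%N -> sysmx \notin unitmx.
Proof.
move=> am0 m0; apply/negP => u.
have z : sysmx *m col_mx one (- one) = 0.
  rewrite /sysmx mul_block_col !mul1mx !mulmxN !expW_one ?rcU ?rcUh //.
  by rewrite subrr col_mx0.
have : col_mx one (- one) = 0.
  by rewrite -[LHS]mul1mx -(mulVmx u) -mulmxA z mulmx0.
move=> /matrixP/(_ (lshift m (Ordinal m0)) 0); rewrite col_mxEu !mxE => /eqP.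
by rewrite oner_eq0.
Qed.

(* The paper's [L_b, P_b] are the Dirichlet-to-Neumann map at [0] of the boundary
   value problem on the interval from [0] to [b]. *)
Lemma dirichlet_neumann : exists L P : 'M[R]_m, forall f f1 f2, c2fun f f1 f2 ->
  (forall x i, 0 < x -> x < b -> genop Q sigma mu (f x) (f1 x) (f2 x) i = 0) ->
  Dsig *m f1 0 = L *m f b + P *m f 0.
Proof.
have [vL hL] := choice (fun k : 'I_m => odesol_bvp genQ sigma_neq0 mu 0 (delta_mx k 0) b_gt0).
have [vP hP] := choice (fun k : 'I_m => odesol_bvp genQ sigma_neq0 mu (delta_mx k 0) 0 b_gt0).
exists (\matrix_(i, k) (sigma i 0 * sol1 (vL k) 0 i 0)), (\matrix_(i, k) (sigma i 0 * sol1 (vP k) 0 i 0)).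
move=> f f1 f2 hf Lf.
(* The solution with the boundary values of [f]; uniqueness identifies it with [f] on the interval,
   hence also their slopes at 0. *)
pose v := \sum_k f b k 0 *: vL k + \sum_k f 0 k 0 *: vP k.
have lin (p : 'M[R]_(m, m + m)) : p *m v = \sum_k f b k 0 *: (p *m vL k) + \sum_k f 0 k 0 *: (p *m vP k).
  rewrite /v mulmxDr !mulmx_sumr; congr (_ + _); apply: eq_bigr => k _; by rewrite scalemxAr.
have dec (u : 'cV[R]_m) : \sum_k u k 0 *: (delta_mx k 0 : 'cV[R]_m) = u.
  apply/matrixP => i j; rewrite (ord1 j) summxE (bigD1 i) //= big1 ?addr0; last first.
    by move=> k ki; rewrite !mxE eq_sym (negbTE ki) mulr0.
  by rewrite !mxE !eqxx mulr1.
have v0 : sol v 0 = f 0.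
  rewrite /odesol lin big1 ?add0r; last first.
    by move=> k _; rewrite -/(sol (vL k) 0) (proj1 (hL k)) scaler0.
  rewrite -[RHS]dec; apply: eq_bigr => k _; by rewrite -/(sol (vP k) 0) (proj1 (hP k)).
have vb : sol v b = f b.
  rewrite /odesol lin [X in _ + X]big1 ?addr0; last first.
    by move=> k _; rewrite -/(sol (vP k) b) (proj2 (hP k)) scaler0.
  rewrite -[RHS]dec; apply: eq_bigr => k _; by rewrite -/(sol (vL k) b) (proj2 (hL k)).
have hd := c2funD hf (c2funN (c2fun_odesol Q sigma mu v)).
have hd0 : forall x, 0 <= x -> x <= b -> f x - sol v x = 0.
  apply: (max_principle_eq0 genQ sigma_neq0 (mu := mu) hd b_gt0) => [x i x0 xb||].
  - by rewrite genopD genopN Lf // (genop_odesol Q sigma_neq0) oppr0 addr0.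
  - by left; rewrite v0 subrr.
  - by rewrite vb subrr.
have [] : f1 0 - sol1 v 0 = 0 /\ f2 0 - odesol2 Q sigma mu v 0 = 0.
  by apply: (c2fun_eq0 hd b_gt0) => x x0; rewrite add0r; exact: hd0.
move=> /eqP; rewrite subr_eq0 => /eqP -> _.
have S (w : 'I_m -> 'cV[R]_(m + m)) (u : 'cV[R]_m) i :
    sigma i 0 * (\sum_k u k 0 *: sol1 (w k) 0) i 0 =
    ((\matrix_(i, k) (sigma i 0 * sol1 (w k) 0 i 0)) *m u) i 0.
  rewrite summxE mulr_sumr mxE; apply: eq_bigr => k _.
  by rewrite colZ [X in _ = X * _]mxE; ring.
apply/matrixP => i j; rewrite (ord1 j) Dsig_mul.
transitivity (sigma i 0 * (\sum_k f b k 0 *: sol1 (vL k) 0 +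
   \sum_k f 0 k 0 *: sol1 (vP k) 0) i 0); first by rewrite {1}/odesol1 lin.
by rewrite colD mulrDr !S [RHS]colD.
Qed.

Section Solution.
Variables L P : 'M[R]_m.
Hypothesis LP : forall f f1 f2, c2fun f f1 f2 ->
  (forall x i, 0 < x -> x < b -> genop Q sigma mu (f x) (f1 x) (f2 x) i = 0) ->
  Dsig *m f1 0 = L *m f b + P *m f 0.

Let LPsol v : Dsig *m sol1 v 0 = L *m sol v b + P *m sol v 0.
Proof.
by apply: (LP (c2fun_odesol Q sigma mu v)) => *; exact: (genop_odesol Q sigma_neq0).
Qed.

Lemma DN_system : row_mx L P *m sysmx = Dsig *m row_mx (- (Uh *m Eh)) U.
Proof.
apply: eq_mulmx_col => v; rewrite -mulmxA -[v]vsubmxK sysmx_expsum mul_row_col.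
rewrite -(LP (c2fun_expsum _ _)); last by move=> *; exact: genop_expsum.
by rewrite -[RHS]mulmxA mul_row_col expsum1_at0 mulNmx addrC.
Qed.

Lemma DN_extra : am = 0 -> L *m (b *: one - Qs *m mu) - P *m Qs *m mu = sigma.
Proof.
move=> am0.
have c2a : c2fun (affine_sol Qs mu) (fun=> one) (fun=> 0) by exact: c2fun_affine.
have := LP c2a; rewrite /affine_sol scale0r sub0r mulmxN mulmxA => <-.
  by apply/matrixP => i j; rewrite (ord1 j) Dsig_mul mxE mulr1.
by move=> x i _ _; rewrite (genop_affine _ genQ alphaQ alpha1 QsQ Qs1).
Qed.

(** If u >= 0 vanishes in phase i, the solution equal to u at 0 and to 0 at [b] is nonnegative and
    starts from 0 in phase i, so its slope there is nonnegative. The row sums come from comparing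
    the solution started from 1 with the constant 1. *)
Lemma DN_subgenerator : is_subgenerator P.
Proof.
have pos (u : 'cV[R]_m) : (forall k, 0 <= u k 0) -> forall i, u i 0 = 0 -> 0 <= (P *m u) i 0.
  move=> u0 i ui.
  have [v [v0 vb]] := odesol_bvp genQ sigma_neq0 mu u 0 b_gt0.
  have -> : P *m u = Dsig *m sol1 v 0 by rewrite LPsol vb v0 mulmx0 add0r.
  rewrite Dsig_mul mulr_ge0 ?(ltW (sigma_gt0 _)) //.
  have ge0 : forall x k, 0 <= x -> x <= b -> 0 <= sol v x k 0.
    apply: (max_principle genQ sigma_neq0 (mu := mu) (c2fun_odesol Q sigma mu v) b_gt0).
    - by move=> *; rewrite (genop_odesol Q sigma_neq0).
    - by left=> k; rewrite v0.
    - by move=> k; rewrite vb mxE.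
  apply: (c2fun_min_right (c2fun_odesol Q sigma mu v) b_gt0); first by rewrite v0.
  by move=> y y0 yb; rewrite add0r; exact: ge0 (ltW y0) yb.
split=> [i j ij|i].
  have := pos (delta_mx j 0) _ i; rewrite -colE !mxE (negbTE ij) => -> // k.
  by rewrite mxE; case: (_ && _).
have -> : \sum_j P i j = (P *m one) i 0.
  by rewrite mxE; apply: eq_bigr => j _; rewrite colC mulr1.
have [v [v0 vb]] := odesol_bvp genQ sigma_neq0 mu one 0 b_gt0.
have -> : P *m one = Dsig *m sol1 v 0 by rewrite LPsol vb v0 mulmx0 add0r.
rewrite Dsig_mul mulr_ge0_le0 ?(ltW (sigma_gt0 _)) //.
have hd := c2funD (c2fun_affine 0 one) (c2funN (c2fun_odesol Q sigma mu v)).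
have ge0 : forall x k, 0 <= x -> x <= b -> 0 <= (x *: 0 + one - sol v x) k 0.
  apply: (max_principle genQ sigma_neq0 (mu := mu) hd b_gt0).
  - move=> x k _ _; rewrite genopD genopN (genop_odesol Q sigma_neq0) subr0 scaler0 add0r.
    by rewrite /genop Q_one // !mxE; lra.
  - by left=> k; rewrite v0 scale0r add0r subrr mxE.
  - by move=> k; rewrite vb scaler0 add0r subr0 colC.
have h1 : 0 <= (0 + - sol1 v 0) i 0.
  apply: (c2fun_min_right hd b_gt0) => [|y y0 yb]; last by rewrite add0r; exact: ge0 (ltW y0) yb.
  by rewrite v0 scaler0 add0r subrr mxE.
by rewrite -oppr_ge0 -colN -[- sol1 v 0]add0r.
Qed.

(** A kernel vector of [P] is the value at 0 of a solution with zero slope at 0 and zero value at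
    [b]. *)
Lemma DN_unit : P \in unitmx.
Proof.
apply: unitmx_inj => u Pu.
have [v [v0 vb]] := odesol_bvp genQ sigma_neq0 mu u 0 b_gt0.
have v1 : sol1 v 0 = 0 by apply: Dsig_inj; rewrite LPsol vb v0 mulmx0 add0r.
have v00 := odesol_nbvp_inj genQ sigma_neq0 b_gt0 v1 vb.
by rewrite -v0 v00 /odesol mulmx0.
Qed.

Lemma DN_neumann (j : 'I_m) : exists v, [/\ sol v b = delta_mx j 0, sol1 v 0 = 0 &
  sol v 0 = col j (invmx (- P) *m L)].
Proof.
have [v [v0 vb]] := odesol_bvp genQ sigma_neq0 mu (col j (invmx (- P) *m L)) (delta_mx j 0) b_gt0.
exists v; split => //; apply: Dsig_inj; rewrite LPsol v0 vb.
have uP : - P \in unitmx by rewrite -scaleN1r unitmxZ ?unitrN1 // DN_unit.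
rewrite [col j _]colE mulmxA (mulmxA P) -{1}[P]opprK (mulNmx (- P)) mulmxV // mulNmx.
by rewrite mul1mx mulNmx subrr.
Qed.

(** Without drift, (S) determines [row_mx L P] only up to a left kernel. The extra equation fixes
    its product with [w], the values of the affine solution at [b] and 0, and this restores
    uniqueness because [w] is outside the range of [sysmx]: otherwise the affine solution would be a
    combination of the two exponential families, and it grows too fast for that. *)
Lemma DN_unique L' P' : row_mx L' P' *m sysmx = Dsig *m row_mx (- (Uh *m Eh)) U ->
  (am = 0 -> L' *m (b *: one - Qs *m mu) - P' *m Qs *m mu = sigma) ->
  L' = L /\ P' = P.
Proof.
move=> S' E'; apply/eq_row_mx.
apply/eqP; rewrite -subr_eq0; apply/eqP; set D := _ - _.
have DM : D *m sysmx = 0 by rewrite /D mulmxBl S' DN_system subrr.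
have [am0|am0] := eqVneq am 0; last first.
  by rewrite -[D]mulmx1 -(mulmxV (sysmx_unit am0)) mulmxA DM mul0mx.
pose w : 'cV[R]_(m + m) := col_mx (b *: one - Qs *m mu) (- (Qs *m mu)).
have Dw : D *m w = 0.
  have := E' am0; have := DN_extra am0 => h1 h2.
  rewrite /D opp_row_mx add_row_mx mul_row_col 2!mulmxBl.
  have -> : L' *m (b *: one - Qs *m mu) = sigma + P' *m Qs *m mu by rewrite -h2 subrK.
  have -> : L *m (b *: one - Qs *m mu) = sigma + P *m Qs *m mu by rewrite -h1 subrK.
  rewrite !mulmxN !mulmxA opprK; set A := P' *m Qs *m mu; set B := P *m Qs *m mu.
  rewrite (_ : sigma + A - (sigma + B) = A - B); last by rewrite opprD addrACA subrr add0r.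
  by rewrite addrACA subrr addNr addr0.
(* A rank one correction: a left factor that kills [sysmx] and [w] kills [N], and [alpha] on the
   first block detects the right kernel vector (1, -1). *)
pose N : 'M[R]_(m + m) := sysmx + w *m row_mx alpha 0.
suff uN : N \in unitmx.
  by rewrite -[D]mulmx1 -(mulmxV uN) mulmxA /N mulmxDr DM add0r mulmxA Dw !mul0mx.
have U1 := rcU am0; have Uh1 := rcUh am0.
apply: unitmx_inj => z; rewrite -[z]vsubmxK; set z2 := usubmx z; set z1 := dsubmx z.
rewrite mulmxDl -mulmxA mul_row_col mul0mx addr0.
have [t tE] : exists t : R, alpha *m z2 = t%:M.
  by exists ((alpha *m z2) 0 0); rewrite -mx11_scalar.
rewrite tE mul_mx_scalar => Nz.
have [t0|t0] := eqVneq t 0.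
  move: Nz; rewrite t0 scale0r addr0 sysmx_expsum => h.
  have : col_mx (expsum z1 z2 b) (expsum z1 z2 0) = col_mx 0 0 by rewrite h col_mx0.
  move=> /eq_col_mx[hb h0].
  have [s [e1 e2 _]] := sysmx_ker (or_introl h0) hb.
  have s0 : s = 0.
    move: tE; rewrite e2 t0 => /matrixP/(_ 0 0); rewrite !mxE mul0rn => h1.
    apply/eqP; rewrite -oppr_eq0; apply/eqP; rewrite -h1 -[LHS]mul1r -alpha1 mulr_suml.
    by apply: eq_bigr => k _; rewrite mxE.
  rewrite e1 e2 s0 oppr0.
  have -> : const_mx 0 = 0 :> 'cV[R]_m by apply/matrixP => ? ?; rewrite !mxE.
  by rewrite col_mx0.
exfalso; pose c1 := (- t^-1) *: z1; pose c2 := (- t^-1) *: z2.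
have Mw : sysmx *m col_mx c2 c1 = w.
  rewrite /c1 /c2 -scale_col_mx -scalemxAr.
  move/eqP: Nz; rewrite addr_eq0 => /eqP ->.
  by rewrite scalerN scaleNr opprK scalerA mulVf // scale1r.
move: Mw; rewrite sysmx_expsum => /eq_col_mx[Fb F0].
have hd := c2funD (c2fun_expsum c1 c2) (c2funN (c2fun_affine one (- (Qs *m mu)))).
have hd0 : forall x, 0 <= x -> x <= b -> expsum c1 c2 x - (x *: one - Qs *m mu) = 0.
  apply: (max_principle_eq0 genQ sigma_neq0 (mu := mu) hd b_gt0) => [x i x0 xb||].
  - rewrite genopD genopN genop_expsum add0r.
    by rewrite (genop_affine _ genQ alphaQ alpha1 QsQ Qs1) am0 oppr0.
  - by left; rewrite F0 scale0r add0r subrr.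
  - by rewrite Fb subrr.
have F1 : expsum1 c1 c2 0 = one.
  apply/eqP; rewrite -subr_eq0; apply/eqP.
  have [] // := c2fun_eq0 hd b_gt0 (a := 0).
  by move=> x x0; rewrite add0r; exact: hd0.
(* Both sides solve the same linear equation with equal values and slopes at 0, so they agree at
   every level and not only on the interval. *)
have glob x : expsum c1 c2 x = x *: one - Qs *m mu.
  pose C := ode_mx Q sigma mu.
  pose v := col_mx (- (Qs *m mu)) one.
  have Cv : C *m v = col_mx one 0.
    rewrite /C /v mul_block_col mul0mx mul1mx add0r; congr col_mx.
    apply/matrixP => i j; rewrite (ord1 j) colD ode_zero_mul ode_one_mul colC mulr1 [RHS]mxE.
    have := Q_affine genQ alphaQ alpha1 QsQ Qs1 mu 0 i.
    by rewrite /affine_sol scale0r sub0r am0 => ->; ring.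
  have C1 : C *m col_mx one 0 = 0.
    rewrite /C mul_block_col mul0mx mulmx0 addr0 mulmx0 addr0 -col_mx0; congr col_mx.
    by apply/matrixP => i j; rewrite (ord1 j) ode_zero_mul Q_one // !mxE mulr0.
  have -> : x *: one - Qs *m mu = sol v x.
    rewrite /odesol -mulmxA expmx_nilp2 -!scalemxAl ?Cv; last first.
      by rewrite -scalemxAr C1 !scaler0.
    rewrite /v scale_col_mx add_col_mx mul_row_col mul1mx mul0mx addr0 addrC //.
  have [d1 _] := odesol_expW c1 x qU.
  have [d2 _] := odesol_expW (Eh *m c2) x qUh.
  rewrite /expsum -d1 -d2 /odesol -mulmxDr add_col_mx; congr (_ *m col_mx _ _).
    by rewrite -F0 expsum_at0.
  by rewrite -F1 expsum1_at0 mulNmx mulmxA.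
have [i0 _|no] := pickP (fun _ : 'I_m => true); last first.
  have : \sum_i alpha 0 i = 0 by apply: big1 => k; have := no k.
  by rewrite alpha1 => /eqP; rewrite oner_eq0.
pose K := mxabs (Qs *m mu) + mxabs c1.
have K0 : 0 <= K by rewrite addr_ge0 ?mxabs_ge0.
pose x := K + `|(Eh *m c2) i0 0| + 1.
have x0 : 0 <= x by have := normr_ge0 ((Eh *m c2) i0 0); rewrite /x; lra.
(* After multiplication by e^{x Uh} the second mode becomes constant and the other terms stay
   bounded, while the left side is x. *)
have key : x *: one = expmx (x *: Uh) *m (Qs *m mu + expmx (x *: U) *m c1) + Eh *m c2.
  have := congr1 (mulmx (expmx (x *: Uh))) (glob x).
  have h1 : expmx (x *: Uh) *m (x *: one) = x *: one by rewrite -scalemxAr expW_one.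
  rewrite /expsum mulmxDr mulmxBr h1 => h.
  rewrite mulmxDr -addrA [X in _ + X](_ : _ = x *: one - expmx (x *: Uh) *m (Qs *m mu)).
    by rewrite addrC subrK.
  rewrite -h; congr (_ + _); rewrite (mulmxA (expmx (x *: Uh))).
  have -> : x *: Uh = x *: - - Uh by rewrite opprK.
  by rewrite expmxNK mul1mx.
have : (x *: one) i0 0 <= K + `|(Eh *m c2) i0 0|.
  rewrite key colD lerD ?ler_norm //.
  apply: substoch_ub => // k; rewrite colD lerD //.
    by rewrite (le_trans (ler_norm _)) // ler_mxabs.
  apply: substoch_ub => //; first exact: mxabs_ge0.
  by move=> l; rewrite (le_trans (ler_norm _)) // ler_mxabs.
by rewrite colZ colC mulr1 /x; lra.
Qed.

End Solution.

Lemma mulEuK : Eu *m expmx ((- b) *: U) = 1%:M.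
Proof. by rewrite -expmxD subrr scale0r expmx0. Qed.

Lemma exit_den_unit : am != 0 -> (U *m expmx ((- b) *: U) + Uh *m Eh) \in unitmx.
Proof.
move=> am0; apply: unitmx_inj => y Xy.
pose c1 := expmx ((- b) *: U) *m y.
have hb : expsum c1 (- y) b = 0 by rewrite expsum_atb /c1 mulmxA mulEuK mul1mx subrr.
have h1 : expsum1 c1 (- y) 0 = 0.
  by rewrite expsum1_at0 mulmxN opprK /c1 mulmxA -mulmxDl.
have [s [_ e2 e3]] := sysmx_ker (or_intror h1) hb.
have s0 : s = 0 by apply/eqP; apply: contraNT am0 => /e3 ->.
apply/eqP; rewrite -oppr_eq0 e2 s0 oppr0; apply/eqP.
by apply/matrixP => ? ?; rewrite !mxE.
Qed.

Lemma exit_formula (H : 'M[R]_m) : am != 0 ->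
  (forall j : 'I_m, exists v, [/\ sol v b = delta_mx j 0, sol1 v 0 = 0 & sol v 0 = col j H]) ->
  Eh + (expmx ((- b) *: U) - Eh) *m
     invmx (U *m expmx ((- b) *: U) + Uh *m Eh) *m Uh *m Eh = H.
Proof.
move=> am0 hH; set X := _ + Uh *m Eh; have uX : X \in unitmx := exit_den_unit am0.
apply: eq_mulmx_col => u; set G := Eh + _.
suff col_eq j : G *m delta_mx j 0 = H *m (delta_mx j 0 : 'cV[R]_m).
  have -> : G = H by apply/matrixP => i j; have := col_eq j; rewrite -!colE => /matrixP/(_ i 0); rewrite !mxE.
  by [].
have [v [vb v1 v0]] := hH j; rewrite -[RHS]colE -v0.
(* With c1 = e^{-bU} y and c2 = e_j - y the value at [b] is e_j for any y; this y makes the slope at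
   0 vanish. *)
pose y : 'cV[R]_m := invmx X *m (Uh *m Eh *m delta_mx j 0).
pose c1 := expmx ((- b) *: U) *m y; pose c2 : 'cV[R]_m := delta_mx j 0 - y.
have Fb : expsum c1 c2 b = delta_mx j 0.
  by rewrite expsum_atb /c1 mulmxA mulEuK mul1mx /c2 addrC subrK.
have F1 : expsum1 c1 c2 0 = 0.
  rewrite expsum1_at0 /c2 mulmxBr opprB addrA /c1 (mulmxA U) -mulmxDl -/X {1}/y.
  by rewrite (mulmxA X) mulmxV // mul1mx subrr.
have hd := c2funD (c2fun_expsum c1 c2) (c2funN (c2fun_odesol Q sigma mu v)).
have : expsum c1 c2 0 - sol v 0 = 0.
  apply: (max_principle_eq0 genQ sigma_neq0 (mu := mu) hd b_gt0); rewrite ?lexx ?ltW //.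
  - by move=> x i _ _; rewrite genopD genopN genop_expsum (genop_odesol Q sigma_neq0) oppr0 addr0.
  - by right; rewrite F1 v1 subrr.
  - by rewrite Fb vb subrr.
move/eqP; rewrite subr_eq0 => /eqP <-.
rewrite expsum_at0 /G mulmxDl.
have -> : (expmx ((- b) *: U) - Eh) *m invmx X *m Uh *m Eh *m (delta_mx j 0 : 'cV[R]_m) =
   (expmx ((- b) *: U) - Eh) *m y by rewrite /y !mulmxA.
by rewrite /c1 /c2 mulmxBr mulmxBl addrCA.
Qed.

Lemma explicit_system : am != 0 ->
  [/\ (1%:M - Eu *m Eh) \in unitmx, (1%:M - Eh *m Eu) \in unitmx &
   row_mx (- (Dsig *m (U + Uh) *m Eh *m invmx (1%:M - Eu *m Eh)))
          (Dsig *m (U + Uh *m Eh *m Eu) *m invmx (1%:M - Eh *m Eu)) *m sysmx =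
   Dsig *m row_mx (- (Uh *m Eh)) U].
Proof. by move=> am0; apply: block_system_solution; exact: sysmx_unit. Qed.

End Main.

(** * Gaussian laws *)

Section Density.
Local Open Scope ereal_scope.
Import HBNNSimple.
Context d (T : measurableType d) (R : realType) (mu nu : {measure set T -> \bar R}).
Variable p : T -> R.
Hypothesis p_ge0 : forall x, (0 <= p x)%R.
Hypothesis mp : measurable_fun setT p.
Hypothesis nuE : forall A, measurable A -> nu A = \int[mu]_(x in A) (p x)%:E.

Lemma integral_density_nnsfun (f : {nnsfun T >-> R}) :
  \int[nu]_x (f x)%:E = \int[mu]_x ((f x)%:E * (p x)%:E).
Proof.
have mpE : measurable_fun setT (fun x => (p x)%:E) by exact/measurable_EFinP.
under [LHS]eq_integral do rewrite fimfunE -fsumEFin//.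
rewrite [LHS]ge0_integral_fsum//; last 2 first.
  - by move=> r; exact/measurable_EFinP/measurableT_comp.
  - by move=> n x _; rewrite EFinM nnfun_muleindic_ge0.
under [RHS]eq_integral.
  move=> x xD; rewrite fimfunE -fsumEFin// ge0_mule_fsuml; last first.
    by move=> r; rewrite EFinM nnfun_muleindic_ge0.
  over.
rewrite [RHS]ge0_integral_fsum//; last 2 first.
  - move=> r; apply: emeasurable_funM => //.
    by apply/measurable_EFinP; do 2 apply/measurableT_comp => //.
  - move=> n x _; rewrite mule_ge0 ?lee_fin //.
    by rewrite -lee_fin EFinM nnfun_muleindic_ge0.
apply: eq_fsbigr => r _.
have [r0|r0] := ltP r 0%R.
  rewrite preimage_nnfun0 //; under eq_integral do rewrite indic0 mulr0.
  by rewrite integral0 /=; under eq_integral do rewrite indic0 mulr0 mul0e; rewrite integral0.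
have mr : measurable (f @^-1` [set r]) by [].
under eq_integral do rewrite EFinM.
rewrite ge0_integralZl// ; last exact/measurable_EFinP/measurable_indic.
rewrite integral_indic// setIT nuE //.
under [RHS]eq_integral do rewrite EFinM -muleA.
rewrite ge0_integralZl//; last 2 first.
  - by apply: emeasurable_funM => //; exact/measurable_EFinP/measurable_indic.
  - by move=> x _; rewrite mule_ge0 ?lee_fin.
congr (_ * _); rewrite integral_mkcond; apply: eq_integral => x _.
by rewrite patchE indicE; case: ifP => _; rewrite ?mul1e ?mul0e.
Qed.

Lemma ge0_integral_density (f : T -> \bar R) :
  measurable_fun setT f -> (forall x, 0 <= f x) ->
  \int[nu]_x f x = \int[mu]_x (f x * (p x)%:E).
Proof.
move=> mf f0.
have mpE : measurable_fun setT (fun x => (p x)%:E) by exact/measurable_EFinP.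
pose f_ := nnsfun_approx measurableT mf.
transitivity (lim (\int[nu]_x (f_ n x)%:E @[n --> \oo])).
  rewrite -monotone_convergence//=.
  - apply: eq_integral => ? /[!inE] xD; apply/esym/cvg_lim => //=.
    exact: cvg_nnsfun_approx.
  - by move=> n; exact/measurable_EFinP/measurable_funTS.
  - by move=> n ? _; rewrite lee_fin.
  - by move=> ? _ ? ? mn; rewrite lee_fin; exact/lefP/nd_nnsfun_approx.
transitivity (lim (\int[mu]_x ((f_ n x)%:E * (p x)%:E) @[n --> \oo])).
  by apply: congr_lim; apply/funext => n /=; exact: integral_density_nnsfun.
rewrite -monotone_convergence//=.
- apply: eq_integral => x /[!inE] xD; apply/cvg_lim => //=.
  by apply: cvgeZr => //; exact: cvg_nnsfun_approx.
- move=> n; apply: emeasurable_funM => //; exact/measurable_EFinP/measurable_funTS.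
- by move=> n x _; rewrite mule_ge0 ?lee_fin.
- move=> x _ a b ab; rewrite lee_wpmul2r ?lee_fin //.
  exact/lefP/nd_nnsfun_approx.
Qed.

End Density.

Section Normal.
Context (R : realType).
Local Open Scope ereal_scope.
Local Notation mu := (@lebesgue_measure R).
Local Notation N := (normal_prob (0 : R)).

Lemma ge0_integral_normal (m s : R) (f : R -> \bar R) : measurable_fun setT f ->
  (forall x, 0 <= f x) ->
  \int[normal_prob m s]_x f x = \int[mu]_x (f x * (normal_pdf m s x)%:E).
Proof.
move=> mf f0; apply: ge0_integral_density => //.
- exact: normal_pdf_ge0.
- exact: measurable_normal_pdf.
Qed.

(** Completing the square: the exponential factor turns the centred density into the one with mean
    th s^2. *)
Lemma normal_expR (s th : R) : (s != 0)%R ->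
  \int[N s]_x (expR (th * x))%:E = (expR (th ^+ 2 * s ^+ 2 / 2))%:E.
Proof.
move=> s0.
have mexp : measurable_fun setT (fun x : R => expR (th * x)).
  by apply: measurableT_comp => //; exact: measurable_funM.
rewrite ge0_integral_normal; last 2 first.
  - exact/measurable_EFinP.
  - by move=> x; rewrite lee_fin expR_ge0.
transitivity (\int[mu]_x ((expR (th ^+ 2 * s ^+ 2 / 2))%:E * (normal_pdf (th * s ^+ 2) s x)%:E)).
  apply: eq_integral => x _; rewrite -!EFinM; congr EFin.
  rewrite !normal_pdfE // /normal_fun mulrCA [RHS]mulrCA -!expRD; congr (_ * expR _)%R.
  by field; exact: s0.
rewrite ge0_integralZl ?integral_normal_pdf ?mule1 //.
- by apply/measurable_EFinP; exact: measurable_normal_pdf.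
- by move=> x _; rewrite lee_fin normal_pdf_ge0.
Qed.

Definition translate (c : R) : measurableTypeR R -> measurableTypeR R := fun x => (x + c)%R.

Lemma measurable_translate c : measurable_fun setT (translate c).
Proof. exact: measurable_funD. Qed.

HB.instance Definition _ c := isMeasurableFun.Build _ _ _ _ (translate c) (measurable_translate c).

Lemma lebesgue_translate (c : R) A : measurable A ->
  pushforward mu (translate c) A = mu A.
Proof.
move=> mA; apply/esym/lebesgue_measure_unique => //= _ [[a b]] _ <-.
rewrite /pushforward.
have -> : translate c @^-1` `]a, b]%classic = `](a - c)%R, (b - c)%R]%classic.
  by apply/seteqP; split => x /=; rewrite /translate !in_itv /= ltrBlDr lerBrDr.
rewrite !lebesgue_measure_itv /= !lte_fin ltrD2r; case: ifP => // _.
by rewrite -!EFinB; congr EFin; ring.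
Qed.

Lemma ge0_integral_translate (f : R -> \bar R) (c : R) : measurable_fun setT f ->
  (forall x, 0 <= f x) -> \int[mu]_x f (x + c)%R = \int[mu]_x f x.
Proof.
move=> mf f0.
transitivity (\int[pushforward mu (translate c)]_x f x).
  by rewrite ge0_integral_pushforward.
by apply: eq_measure_integral => //= A mA _; exact: lebesgue_translate.
Qed.

Lemma ge0_integral_normalZr (m s : R) (g : R -> \bar R) (k : \bar R) :
  measurable_fun setT g -> (forall x, 0 <= g x) -> 0 <= k ->
  \int[normal_prob m s]_x g x * k = \int[mu]_x (g x * (normal_pdf m s x)%:E * k).
Proof.
move=> mg g0 k0.
have mgp : measurable_fun setT (fun x : R => g x * (normal_pdf m s x)%:E).
  apply: emeasurable_funM => //.
  by apply/measurable_EFinP; exact: measurable_normal_pdf.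
have gp0 (x : R) : setT x -> 0 <= g x * (normal_pdf m s x)%:E.
  by move=> _; rewrite mule_ge0 // lee_fin normal_pdf_ge0.
rewrite (ge0_integral_normal m s mg g0).
by rewrite (@ge0_integralZr _ _ _ mu _ measurableT _ mgp k gp0 k0).
Qed.

Section Shear.
Variables (s t : R).
Hypotheses (s0 : (0 < s)%R) (t0 : (0 < t)%R).
Let S := Num.sqrt (s ^+ 2 + t ^+ 2).
Let r := (s * t / S)%R.
Let lam := (t ^+ 2 / S ^+ 2)%R.

Let S0 : (0 < S)%R.
Proof. by rewrite sqrtr_gt0 addr_gt0 // exprn_gt0. Qed.

Let S2 : (S ^+ 2 = s ^+ 2 + t ^+ 2)%R.
Proof. by rewrite sqr_sqrtr // addr_ge0 // sqr_ge0. Qed.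

Let r0 : (0 < r)%R. Proof. by rewrite divr_gt0 // mulr_gt0. Qed.

(** For independent centred Gaussians x and y with deviations s and t, the sum u = x + y and the
    residual v = y - lam u are independent, with deviations S and r. The change of variables has
    determinant 1. *)
Lemma normal_pdf_shear (u v : R) :
  (normal_pdf 0%R s (u - (v + lam * u)) * normal_pdf 0%R t (v + lam * u) =
   normal_pdf 0%R S u * normal_pdf 0%R r v)%R.
Proof.
rewrite !normal_pdfE ?gt_eqF //= /normal_fun.
rewrite mulrACA [RHS]mulrACA -!expRD.
congr (_ * expR _)%R.
  rewrite /normal_peak -!invfM -!sqrtrM ?mulrn_wge0 ?mulr_ge0 ?sqr_ge0 ?pi_ge0 ?(ltW S0) ?(ltW r0) ?(ltW s0) ?(ltW t0) //.
  congr (Num.sqrt _)^-1%R; rewrite !mulr2n.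
  have rS : (r * S = s * t)%R by rewrite /r divfK // gt_eqF.
  move: (pi : R) => p; transitivity ((s * t) ^+ 2 * (p + p) ^+ 2)%R; first by ring.
  by rewrite -rS; ring.
have r2 : (r ^+ 2 = s ^+ 2 * t ^+ 2 / (s ^+ 2 + t ^+ 2))%R by rewrite /r !exprMn exprVn S2.
rewrite r2 /lam S2.
have s20 : (0 < s ^+ 2)%R by rewrite exprn_gt0.
have t20 : (0 < t ^+ 2)%R by rewrite exprn_gt0.
move: (s ^+ 2)%R (t ^+ 2)%R s20 t20 => a b a0 b0; rewrite !mulr2n.
have ab0 : (0 < a + b)%R by exact: addr_gt0.
field.
by rewrite !lt0r_neq0 ?addr_gt0 ?mulr_gt0.
Qed.

(** The change of variables is a product of two shears, and each shear is a translation in one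
    variable once Tonelli fixes the other. The case s = t is the midpoint splitting; functions of
    the sum alone give convolution. *)
Lemma normal_shear (F : R * R -> \bar R) : measurable_fun setT F ->
  (forall z, 0 <= F z) ->
  \int[N s]_x \int[N t]_y F (x, y) =
  \int[N S]_u \int[N r]_v F (u - (v + lam * u), v + lam * u)%R.
Proof.
move=> mF F0.
have mpdf m a : measurable_fun setT (fun x => (normal_pdf m a x : R)%:E).
  by apply/measurable_EFinP; exact: measurable_normal_pdf.
have pdf0 m a x : 0 <= (normal_pdf m a x : R)%:E by rewrite lee_fin normal_pdf_ge0.
pose Psi z := F z * (normal_pdf 0%R s z.1)%:E * (normal_pdf 0%R t z.2)%:E.
have mPsi : measurable_fun setT Psi.
  apply: emeasurable_funM; first apply: emeasurable_funM => //.
    apply/measurable_EFinP.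
    exact: (measurableT_comp (measurable_normal_pdf 0%R s) measurable_fst).
  apply/measurable_EFinP.
  exact: (measurableT_comp (measurable_normal_pdf 0%R t) measurable_snd).
have Psi0 z : 0 <= Psi z by rewrite /Psi !mule_ge0.
have mF1 x : measurable_fun setT (fun y => F (x, y)).
  exact: (measurableT_comp mF (pair1_measurable x)).
have LHS : \int[N s]_x \int[N t]_y F (x, y) = \int[mu]_x \int[mu]_y Psi (x, y).
  rewrite ge0_integral_normal; last 2 first.
  - exact: (@measurable_fun_fubini_tonelli_F _ _ _ _ _ (N t) F mF F0).
  - by move=> x; exact: integral_ge0.
  apply: eq_integral => x _.
  rewrite (ge0_integral_normalZr 0%R t (mF1 x) (fun=> F0 _) (pdf0 0%R s x)).
  by apply: eq_integral => y _; rewrite /Psi /= muleAC.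
have sub : measurable_fun setT (fun z : R * R => (z.1 - z.2, z.2)%R : R * R).
  apply/measurable_fun_pairP; split => /=; last exact: measurable_snd.
  by apply: measurable_funB; [exact: measurable_fst|exact: measurable_snd].
have add : measurable_fun setT (fun z : R * R => (z.1, z.2 + lam * z.1)%R : R * R).
  apply/measurable_fun_pairP; split => /=; first exact: measurable_fst.
  apply: measurable_funD; first exact: measurable_snd.
  by apply: measurable_funM => //; exact: measurable_fst.
pose Phi (z : R * R) := Psi (z.1 - z.2, z.2)%R.
have mPhi : measurable_fun setT Phi by exact: (measurableT_comp mPsi sub).
have e1 := @fubini_tonelli _ _ _ _ R mu mu Psi mPsi Psi0.
have e2 := @fubini_tonelli _ _ _ _ R mu mu Phi mPhi (fun=> Psi0 _).
rewrite LHS e1.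
transitivity (\int[mu]_y \int[mu]_u Phi (u, y)).
  apply: eq_integral => y _.
  have my : measurable_fun setT (fun x => Psi (x, y)).
    exact: (measurableT_comp mPsi (pair2_measurable y)).
  exact: (esym (ge0_integral_translate (- y)%R my (fun=> Psi0 _))).
rewrite -e2.
have mPhi2 : measurable_fun setT (fun z : R * R => Phi (z.1, z.2 + lam * z.1)%R).
  exact: (measurableT_comp mPhi add).
transitivity (\int[mu]_u \int[mu]_v Phi (u, v + lam * u)%R).
  apply: eq_integral => u _.
  have mu' : measurable_fun setT (fun y => Phi (u, y)).
    exact: (measurableT_comp mPhi (pair1_measurable u)).
  exact: (esym (ge0_integral_translate (lam * u)%R mu' (fun=> Psi0 _))).
have PhiE u v : Phi (u, v + lam * u)%R =
   F (u - (v + lam * u), v + lam * u)%R * (normal_pdf 0%R S u * normal_pdf 0%R r v)%:E.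
  by rewrite /Phi /Psi /= -muleA -EFinM normal_pdf_shear.
have mF2 : measurable_fun setT (fun z : R * R => F (z.1 - (z.2 + lam * z.1), z.2 + lam * z.1)%R).
  exact: (measurableT_comp (measurableT_comp mF sub) add).
rewrite ge0_integral_normal; last 2 first.
- exact: (@measurable_fun_fubini_tonelli_F _ _ _ _ _ (N r) _ mF2 (fun=> F0 _)).
- by move=> u; exact: integral_ge0.
apply: eq_integral => u _.
have mF3 : measurable_fun setT (fun v : R => F ((u : R) - (v + lam * u), v + lam * u)%R).
  exact: (measurableT_comp mF2 (pair1_measurable u)).
rewrite (ge0_integral_normalZr 0%R r mF3 (fun=> F0 _) (pdf0 0%R S u)).
by apply: eq_integral => v _; rewrite PhiE EFinM muleA muleAC.
Qed.

End Shear.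

End Normal.

(** * Random variables on a coin tossing space *)

Lemma g_sigma_measure_eq (T : pointedType) (R : realType) (G : set (set T))
  (m1 m2 : {measure set (g_sigma_algebraType G) -> \bar R}) :
  setI_closed G -> G setT -> (m1 setT < +oo)%E ->
  (forall A, G A -> m1 A = m2 A) -> forall A, measurable A -> m1 A = m2 A.
Proof.
move=> GI GT m1T E A mA.
apply: (@measure_unique _ R (g_sigma_algebraType G) G (fun=> setT) erefl GI (fun=> GT) _ m1 m2 E _ A mA) => //.
by apply/seteqP; split => // x _; exists 0%N.
Qed.

Section Integration.
Local Open Scope ereal_scope.
Context d1 d2 (T1 : measurableType d1) (T2 : measurableType d2) (R : realType).

Lemma ge0_integral_pair d (T : measurableType d) (P : probability T R)
  (P1 : probability T1 R) (P2 : probability T2 R) (f : T -> T1) (g : T -> T2)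
  (F : T1 * T2 -> \bar R) :
  measurable_fun setT f -> measurable_fun setT g ->
  (forall A B, measurable A -> measurable B ->
     P (f @^-1` A `&` g @^-1` B) = P1 A * P2 B) ->
  measurable_fun setT F -> (forall z, 0 <= F z) ->
  \int[P]_w F (f w, g w) = \int[P1]_x \int[P2]_y F (x, y).
Proof.
move=> mf mg ind mF F0.
have mfg : measurable_fun setT (fun w => (f w, g w)) by exact/measurable_fun_pairP.
pose pr : {mfun T >-> (T1 * T2)%type} := 
  HB.pack_for {mfun T >-> (T1 * T2)%type} (fun w => (f w, g w))
   (isMeasurableFun.Build _ _ _ _ _ mfg).
rewrite -(@fubini_tonelli1 _ _ _ _ R P1 P2 F mF F0).
transitivity (\int[distribution P pr]_z F z).
  by rewrite ge0_integral_distribution.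
apply: eq_measure_integral => A mA _.
by apply/esym/product_measure_unique => // B C mB mC; rewrite -ind.
Qed.

End Integration.

Section Coins.

Definition coins := nat -> bool.
HB.instance Definition _ := Pointed.on coins.

Definition ctail (x : coins) : coins := fun k => x k.+1.

(** A word of constraints on the first coins; [xpredT] constrains nothing, so words can be
    padded. *)
Fixpoint cyl (l : seq (bool -> bool)) : set coins :=
  match l with
  | [::] => setT
  | a :: l' => [set x | a (x 0%N) /\ cyl l' (ctail x)]
  end.

Definition cylinders : set (set coins) := [set cyl l | l in setT].
Definition coinT := g_sigma_algebraType cylinders.
HB.instance Definition _ := Measurable.on coinT.

Lemma cylindersI : setI_closed cylinders.
Proof.
move=> _ _ [l1 _ <-] [l2 _ <-].
elim: l1 l2 => [|a l1 IH] [|b l2] /=.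
- by exists [::] => //=; rewrite setTI.
- by exists (b :: l2) => //=; rewrite setTI.
- by exists (a :: l1) => //=; rewrite setIT.
have [l _ El] := IH l2.
exists ((fun c => a c && b c) :: l) => //=.
apply/seteqP; split => x /=; rewrite El.
  by move=> [/andP[-> ->] [? ?]].
by move=> [[-> ?] [-> ?]].
Qed.

Lemma cylindersT : cylinders setT. Proof. by exists [::]. Qed.

Lemma measurable_cyl l : measurable (cyl l : set coinT).
Proof. by apply: sub_sigma_algebra; exists l. Qed.

Lemma measurable_coin k : measurable [set x : coinT | x k].
Proof.
suff -> : [set x : coinT | x k] = cyl (rcons (nseq k xpredT) id) by exact: measurable_cyl.
apply/seteqP; split => x /=.
  elim: k x => [|k IH] x //= xk; split => //; exact: (IH (ctail x)).
by elim: k x => [|k IH] x /= [] // _ /IH.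
Qed.

Lemma measurable_fun_coins d (T : measurableType d) (f : T -> coinT) :
  (forall k, measurable [set x | f x k]) -> measurable_fun setT f.
Proof.
move=> mf; apply: (@measurability _ _ _ coinT setT f cylinders) => // _ [_ [l _ <-] <-]; rewrite setTI.
elim: l f mf => [|a l IH] f mf /=; first by rewrite preimage_setT; exact: measurableT.
have -> : f @^-1` [set x | a (x 0%N) /\ cyl l (ctail x)] =
  [set x | a (f x 0%N)] `&` (fun x => ctail (f x)) @^-1` cyl l by [].
apply: measurableI; last by apply: IH => k; exact: mf.
have [at_|at_] := boolP (a true); have [af|af] := boolP (a false).
- rewrite (_ : [set _ | _] = setT) //; apply/seteqP; split => // x _ /=.
  by case: (f x 0%N).
- rewrite (_ : [set _ | _] = [set x | f x 0%N]) //; apply/seteqP; split => x /=.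
    by case: (f x 0%N) => //; rewrite (negbTE af).
  by case: (f x 0%N).
- rewrite (_ : [set _ | _] = ~` [set x | f x 0%N]); first exact: measurableC.
  apply/seteqP; split => x /=; case: (f x 0%N) => //.
  by rewrite (negbTE at_).
- rewrite (_ : [set _ | _] = set0) //; apply/seteqP; split => x //=.
  by case: (f x 0%N); rewrite ?(negbTE at_) ?(negbTE af).
Qed.

(** Splits one sequence into two independent ones; iterated, it provides unlimited independent
    randomness on a single space. *)
Definition evens (x : coinT) : coinT := fun k => x k.*2.
Definition odds (x : coinT) : coinT := fun k => x k.*2.+1.

Lemma measurable_evens : measurable_fun setT evens.
Proof. by apply: measurable_fun_coins => k; exact: measurable_coin. Qed.

Lemma measurable_odds : measurable_fun setT odds.
Proof. by apply: measurable_fun_coins => k; exact: measurable_coin. Qed.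

Variable R : realType.

Definition heads (a : bool -> bool) : R := ((a true)%:R + (a false)%:R) / 2.

Definition cylw (l : seq (bool -> bool)) : R := \prod_(a <- l) heads a.

(** On [0, 1[ this is doubling modulo 1, whose iterates read off binary digits. *)
Definition tent (x : R) : R := if x < 2^-1 then 2 * x else 2 * x - 1.

Definition digits (x : measurableTypeR R) : coinT := fun k => 2^-1 <= iter k tent x.

Lemma measurable_tent : measurable_fun setT tent.
Proof.
apply: measurable_fun_ifT.
- by apply: measurable_fun_ltr => //; exact: measurable_cst.
- exact: measurable_funM.
- by apply: measurable_funB => //; exact: measurable_funM.
Qed.

Lemma measurable_digits : measurable_fun setT digits.
Proof.
apply: measurable_fun_coins => k.
have mk : measurable_fun setT (iter k tent : R -> R).
  elim: k => [|k IH]; first exact: measurable_id.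
  exact: (measurableT_comp measurable_tent IH).
have := measurable_fun_ler (measurable_cst (2^-1 : R)) mk.
by move=> /(_ measurableT [set true] I); rewrite setTI.
Qed.

HB.instance Definition _ := isMeasurableFun.Build _ _ _ _ digits measurable_digits.

Definition unit_itv : set R := `[0, 1[%classic.
Let m01 : measurable unit_itv. Proof. exact: measurable_itv. Qed.

Definition unif : set (measurableTypeR R) -> \bar R := mrestr (@lebesgue_measure R) m01.
HB.instance Definition _ := Measure.copy unif (mrestr (@lebesgue_measure R) m01).
Let unifT : unif setT = 1%E.
Proof. by rewrite /unif /mrestr setTI lebesgue_measure_itv /= lte_fin ltr01 sube0. Qed.
HB.instance Definition _ := Measure_isProbability.Build _ _ _ unif unifT.

Definition coinP : set coinT -> \bar R := distribution unif digits.
HB.instance Definition _ := Probability.on coinP.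

Fixpoint lo (u : seq bool) : R :=
  if u is b :: u' then ((b%:R : R) + lo u') / 2 else 0.

Lemma lo_bounds u : 0 <= lo u /\ lo u + 2 ^- size u <= 1.
Proof.
elim: u => [|b u [IH0 IH1]] /=; first by rewrite expr0 invr1; split; lra.
by rewrite exprS invfM; case: b => /=; rewrite ?mulr0n ?mulr1n; split; lra.
Qed.

Lemma digits_tent x : ctail (digits x) = digits (tent x).
Proof. by apply/funext => k; rewrite /ctail /digits iterSr. Qed.

(** Induction on the word: doubling modulo 1 maps each half of [0, 1[ onto the whole, so each
    further digit halves the interval. *)
Lemma digits_word u : unit_itv `&` digits @^-1` cyl (map eqb u) =
  `[lo u, lo u + 2 ^- size u[%classic.
Proof.
elim: u => [|b u IH].
  by rewrite /= preimage_setT setIT expr0 invr1 add0r.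
have [l0 l1] := lo_bounds u.
have H x : unit_itv x -> cyl (map eqb u) (digits x) <-> lo u <= x < lo u + 2 ^- size u.
  move=> x01; split => [xc|xb].
    have : (unit_itv `&` digits @^-1` cyl (map eqb u)) x by [].
    by rewrite IH /= in_itv.
  have : [set` `[lo u, lo u + 2 ^- size u[] x by rewrite /= in_itv.
  by rewrite -IH => -[].
apply/seteqP; split => x /=; rewrite !in_itv /=.
  rewrite /unit_itv /= in_itv /= => -[/andP[x0 x1]]; rewrite digits_tent {1}/digits /= => -[].
  rewrite /tent exprS invfM.
  case: ltP => x2; case: b => //= _ /H; rewrite /unit_itv /= in_itv /=.
    by move=> /(_ ltac:(lra)) /andP[? ?]; lra.
  by move=> /(_ ltac:(lra)) /andP[? ?]; lra.
rewrite exprS invfM digits_tent => /andP[xl xu] {IH}.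
have i0 : 0 < 2 ^- size u :> R by rewrite invr_gt0 exprn_gt0.
case: b xl xu => /= xl xu.
  have -> : tent x = 2 * x - 1 by rewrite /tent ltNge; case: leP => // ?; exfalso; lra.
  split; first by rewrite /unit_itv /= in_itv /=; lra.
  split; first by rewrite /digits /=; case: leP => // ?; exfalso; lra.
  by apply/H; rewrite ?/unit_itv /= ?in_itv /=; lra.
have -> : tent x = 2 * x by rewrite /tent ifT //; lra.
split; first by rewrite /unit_itv /= in_itv /=; lra.
split; first by rewrite /digits /=; case: leP => // ?; exfalso; lra.
by apply/H; rewrite ?/unit_itv /= ?in_itv /=; lra.
Qed.

Lemma coinP_cyl l : coinP (cyl l) = (cylw l)%:E.
Proof.
(* A prefix [u] of decided coins makes the induction go through; a constraint on the next coin is a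
   disjoint union of at most two decided values. *)
suff gen u : coinP (cyl (map eqb u ++ l)) = (2 ^- size u * cylw l)%:E.
  by have := gen [::]; rewrite expr0 invr1 mul1r.
elim: l u => [|a l IH] u.
  rewrite cats0 /cylw big_nil mulr1 /coinP /distribution /pushforward /unif /mrestr.
  change (lebesgue_measure ((digits @^-1` cyl [seq eqb i | i <- u]) `&` unit_itv) = (2 ^- size u)%:E).
  rewrite setIC digits_word lebesgue_measure_itv /= lte_fin ltrDl invr_gt0 exprn_gt0 //.
  by rewrite -EFinD addrAC subrr add0r.
have IHr b : coinP (cyl (map eqb u ++ eqb b :: l)) = (2 ^- (size u).+1 * cylw l)%:E.
  by have := IH (rcons u b); rewrite map_rcons cat_rcons size_rcons.
have cylmid (p : bool -> bool) (x : coins) : cyl (map eqb u ++ p :: l) x <->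
    cyl (map eqb u ++ xpredT :: l) x /\ p (x (size u)).
  elim: u x {IH IHr} => [|c u IHu] x /=; first by split=> [[? ?]|[[_ ?] ?]]; repeat split.
  by have := IHu (ctail x); rewrite /ctail /=; tauto.
have mc p : measurable (cyl p : set coinT) by exact: measurable_cyl.
rewrite /cylw big_cons -/(cylw l) /heads.
case Et : (a true); case Ef : (a false).
- have -> : cyl (map eqb u ++ a :: l) = cyl (map eqb u ++ eqb true :: l) `|`
                 cyl (map eqb u ++ eqb false :: l).
    apply/seteqP; split => x; rewrite cylmid.
      move=> [h1 h2]; case E : (x (size u)); [left|right]; apply/cylmid; split => //=; by rewrite E.
    by case => /cylmid [h1]; case: (x (size u)).
  rewrite measureU //; last first.
    by apply/seteqP; split => x //= [/cylmid [_ h1] /cylmid[_]]; move: h1; case: (x _).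
  transitivity ((2 ^- (size u).+1 * cylw l)%:E + (2 ^- (size u).+1 * cylw l)%:E)%E.
    by congr (_ + _)%E; exact: IHr.
  by rewrite -EFinD exprS invfM /=; congr EFin; lra.
- have -> : cyl (map eqb u ++ a :: l) = cyl (map eqb u ++ eqb true :: l).
    apply/seteqP; split => x /cylmid [h1 h2]; apply/cylmid; split => //=.
      by move: h2; case: (x (size u)) => //; rewrite Ef.
    by move: h2; case: (x (size u)).
  by rewrite !IHr exprS invfM /=; congr EFin; lra.
- have -> : cyl (map eqb u ++ a :: l) = cyl (map eqb u ++ eqb false :: l).
    apply/seteqP; split => x /cylmid [h1 h2]; apply/cylmid; split => //=.
      by move: h2; case: (x (size u)) => //; rewrite Et.
    by move: h2; case: (x (size u)).
  by rewrite !IHr exprS invfM /=; congr EFin; lra.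
- have -> : cyl (map eqb u ++ a :: l) = set0.
    apply/seteqP; split => x // /cylmid [_].
    by case: (x (size u)); rewrite ?Et ?Ef.
  by rewrite measure0 /=; congr EFin; lra.
Qed.

Lemma headsT : heads xpredT = 1.
Proof. by rewrite /heads /=; lra. Qed.

(** The two words of constraints are interleaved, the shorter one being padded with [xpredT]. *)
Lemma split_cyl n l1 l2 : (size l1 <= n)%N -> (size l2 <= n)%N ->
  exists l, cyl l = evens @^-1` cyl l1 `&` odds @^-1` cyl l2 /\
    cylw l = cylw l1 * cylw l2.
Proof.
elim: n l1 l2 => [|n IH] l1 l2.
  rewrite !leqn0 !size_eq0 => /eqP -> /eqP ->; exists [::].
  by rewrite /= !preimage_setT setTI /cylw big_nil mulr1.
move=> s1 s2.
have [l [El wl]] := IH (behead l1) (behead l2) ltac:(by rewrite size_behead -subn1 leq_subLR)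
   ltac:(by rewrite size_behead -subn1 leq_subLR).
exists (head xpredT l1 :: head xpredT l2 :: l); split.
  have hb (k : seq (bool -> bool)) x : cyl k x <-> head xpredT k (x 0%N) /\ cyl (behead k) (ctail x).
    by case: k => //=; split.
  apply/seteqP; split => x /=; rewrite El /= (hb l1) (hb l2).
    by move=> [? [? [? ?]]].
  by move=> [[? ?] [? ?]].
have hw (k : seq (bool -> bool)) : cylw k = heads (head xpredT k) * cylw (behead k).
  by case: k => [|a k]; rewrite /cylw /= ?big_cons // !big_nil headsT mulr1.
by rewrite (hw l1) (hw l2) hw /= [cylw (_ :: l)]hw /= wl; ring.
Qed.

(** Agreement on cylinders extends to measurable sets one factor at a time: [step1] frees the first
    factor, and the same uniqueness argument then frees the second. *)
Lemma coin_split (A B : set coinT) : measurable A -> measurable B ->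
  coinP (evens @^-1` A `&` odds @^-1` B) = (coinP A * coinP B)%E.
Proof.
have fin C : measurable C -> coinP C \is a fin_num by move=> ?; exact: fin_num_measure.
pose E : {mfun coinT >-> coinT} := 
  HB.pack_for {mfun coinT >-> coinT} evens (isMeasurableFun.Build _ _ _ _ _ measurable_evens).
pose O : {mfun coinT >-> coinT} := 
  HB.pack_for {mfun coinT >-> coinT} odds (isMeasurableFun.Build _ _ _ _ _ measurable_odds).
have mE C : measurable C -> measurable (evens @^-1` C).
  by move=> mC; rewrite -[X in measurable X]setTI; exact: measurable_evens.
have mO C : measurable C -> measurable (odds @^-1` C).
  by move=> mC; rewrite -[X in measurable X]setTI; exact: measurable_odds.
have sc C (mC : measurable C) : {k : {nonneg R} | coinP C = (k%:num)%:E}.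
  have h : 0 <= fine (coinP C) by rewrite fine_ge0.
  by exists (NngNum h) => /=; rewrite fineK // fin.
have step1 l A' : measurable A' ->
    coinP (evens @^-1` A' `&` odds @^-1` cyl l) = (coinP A' * coinP (cyl l))%E.
  move=> mA.
  have [k kE] := sc _ (measurable_cyl l).
  rewrite muleC kE.
  have mOl := mO _ (measurable_cyl l).
  apply: (@g_sigma_measure_eq _ _ cylinders
    (pushforward (mrestr coinP mOl) E) (mscale k coinP)) => //.
  - exact: cylindersI.
  - exact: cylindersT.
  - rewrite /pushforward /mrestr /= (le_lt_trans (probability_le1 _ _)) ?ltry //.
    by apply: measurableI => //; exact: mE.
  move=> _ [l1 _ <-].
  change (coinP (evens @^-1` cyl l1 `&` odds @^-1` cyl l) = (k%:num)%:E * coinP (cyl l1))%E.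
  rewrite -kE.
  have [l' [<- wl]] := @split_cyl (maxn (size l1) (size l)) l1 l (leq_maxl _ _) (leq_maxr _ _).
  by rewrite !coinP_cyl wl -EFinM mulrC.
move=> mA mB.
have [k kE] := sc _ mA.
rewrite kE setIC.
have mEA := mE _ mA.
apply: (@g_sigma_measure_eq _ _ cylinders
    (pushforward (mrestr coinP mEA) O) (mscale k coinP)) => //.
- exact: cylindersI.
- exact: cylindersT.
- rewrite /pushforward /mrestr /= (le_lt_trans (probability_le1 _ _)) ?ltry //.
  by apply: measurableI => //; exact: mO.
move=> _ [l1 _ <-].
change (coinP (odds @^-1` cyl l1 `&` evens @^-1` A) = (k%:num)%:E * coinP (cyl l1))%E.
rewrite -kE setIC.
by rewrite step1.
Qed.

Definition coinval_n (n : nat) (x : coinT) : R := \sum_(k < n) (x k)%:R * 2 ^- k.+1.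

Lemma digits_partial n x : x = coinval_n n (digits x) + 2 ^- n * iter n tent x.
Proof.
elim: n => [|n IH]; first by rewrite /coinval_n big_ord0 add0r expr0 invr1 mul1r.
rewrite {1}IH /coinval_n big_ord_recr /= -addrA; congr (_ + _).
rewrite /digits /tent exprS invfM; case: ltP => _ /=; lra.
Qed.

Lemma tent_itv n x : unit_itv x -> unit_itv (iter n tent x).
Proof.
move=> x01; elim: n => [|n] //=; rewrite /unit_itv /= !in_itv /= /tent => /andP[? ?].
by case: ltP => ?; lra.
Qed.

(** Left inverse of [digits] on [0, 1[; this suffices for its law to be uniform, although dyadic
    points have two expansions. *)
Definition coinval (x : coinT) : R := limn (coinval_n^~ x).

Lemma coinval_digits x : unit_itv x -> coinval (digits x) = x.
Proof.
move=> x01; apply/cvg_lim => //.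
have -> : coinval_n^~ (digits x) = (fun n => x - 2 ^- n * iter n tent x).
  by apply/funext => n; rewrite {2}(digits_partial n x); ring.
rewrite -[X in _ --> X]subr0; apply: cvgB; first exact: cvg_cst.
apply: (@squeeze_cvgr _ _ _ _ (fun=> 0) (fun n => 2 ^- n)).
- near=> n; have := tent_itv n x01; rewrite /unit_itv /= in_itv /= => /andP[? ?].
  by rewrite mulr_ge0 ?invr_ge0 ?exprn_ge0 //= ler_piMr ?invr_ge0 ?exprn_ge0 // ltW.
- exact: cvg_cst.
- under eq_fun do rewrite -exprVn.
  by apply: cvg_expr; rewrite ger0_norm; lra.
Unshelve. all: by end_near. Qed.

Lemma measurable_coinval : measurable_fun setT coinval.
Proof.
have mn n : measurable_fun setT (coinval_n n).
  rewrite /coinval_n; apply: measurable_sum => k.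
  apply: measurable_funM => //.
  have -> : (fun x : coinT => (x k)%:R) = \1_[set x : coinT | x k] :> (_ -> R).
    by apply/funext => x; rewrite indicE mem_setE.
  by apply: measurable_indic; exact: measurable_coin.
apply: (measurable_fun_cvg mn) => x _.
have h n : coinval_n n x <= 1 - 2 ^- n.
  elim: n => [|n IH]; first by rewrite /coinval_n big_ord0 expr0 invr1; lra.
  rewrite /coinval_n big_ord_recr /= -/(coinval_n n x).
  have : (x n)%:R * 2 ^- n.+1 <= 2 ^- n.+1 :> R.
    by case: (x n); rewrite ?mul1r // mul0r invr_ge0 exprn_ge0.
  by rewrite exprS invfM; lra.
suff : cvgn (coinval_n^~ x) by [].
apply: nondecreasing_is_cvgn.
  apply/nondecreasing_seqP => n; rewrite /coinval_n big_ord_recr /= lerDl.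
  by rewrite mulr_ge0 ?invr_ge0 ?exprn_ge0.
exists 1 => _ [n _ <-]; apply: (le_trans (h n)).
by rewrite gerBl invr_ge0 exprn_ge0.
Qed.

Lemma coinval_unif (A : set R) : measurable A -> coinP (coinval @^-1` A) = unif A.
Proof.
move=> mA; rewrite /coinP /distribution /pushforward /unif /mrestr.
congr (lebesgue_measure _); apply/seteqP; split => x /= [Ax x01]; split => //.
  by rewrite -(coinval_digits x01).
by rewrite coinval_digits.
Qed.

End Coins.

Lemma mfun_exists d1 d2 (T1 : measurableType d1) (T2 : measurableType d2) (X : T1 -> T2) :
  measurable_fun setT X -> exists X' : {mfun T1 >-> T2}, X' = X :> (T1 -> T2).
Proof.
move=> mX.
by exists (HB.pack_for {mfun T1 >-> T2} X (isMeasurableFun.Build _ _ _ _ _ mX)).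
Qed.

Section Law.
Local Open Scope ereal_scope.
Context d1 d2 (T1 : measurableType d1) (T2 : measurableType d2) (R : realType).
Variables (P : probability T1 R) (X : T1 -> T2).
Hypothesis mX : measurable_fun setT X.

Lemma law_exists : exists m : probability T2 R,
  forall A, measurable A -> m A = P (X @^-1` A).
Proof.
pose X' : {mfun T1 >-> T2} :=
  HB.pack_for {mfun T1 >-> T2} X (isMeasurableFun.Build _ _ _ _ _ mX).
by exists (distribution P X').
Qed.

Lemma integral_law (nu : {measure set T2 -> \bar R}) :
  (forall A, measurable A -> P (X @^-1` A) = nu A) ->
  forall f : T2 -> \bar R, measurable_fun setT f -> (forall x, 0 <= f x) ->
  \int[P]_x f (X x) = \int[nu]_x f x.
Proof.
move=> XE f mf f0.
pose X' : {mfun T1 >-> T2} :=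
  HB.pack_for {mfun T1 >-> T2} X (isMeasurableFun.Build _ _ _ _ _ mX).
transitivity (\int[distribution P X']_x f x).
  by rewrite ge0_integral_distribution.
by apply: eq_measure_integral => A mA _; exact: XE.
Qed.

End Law.

(** * Quantile transform *)

Section Quantile.
Variable R : realType.

Lemma measure_eq_half_lines (m1 m2 : {measure set R -> \bar R}) :
  (m1 setT < +oo)%E -> (forall x, m1 `]x, +oo[%classic = m2 `]x, +oo[%classic) ->
  forall A, measurable A -> m1 A = m2 A.
Proof.
move=> m1T E A mA.
apply: (@measure_unique _ R R (@RGenOInfty.G R) (fun k => `](- k%:R)%R, +oo[%classic)) => //.
- exact: RGenOInfty.measurableE.
- move=> _ _ [x ->] [y ->]; exists (Num.max x y); apply/seteqP; split => z /=;
    rewrite !in_itv /= !andbT gt_max.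
    by move=> [-> ->].
  by move=> /andP[-> ->].
- by move=> k; exists (- k%:R).
- apply/seteqP; split => // x _; exists (Num.trunc `|x|).+1 => //=.
  rewrite in_itv /= andbT ltrNl; apply: (le_lt_trans (ler_norm _)).
  by rewrite normrN; exact: truncnS_gt.
- by move=> _ [x ->].
- by move=> k; apply: le_lt_trans m1T; apply: le_measure; rewrite ?inE.
Qed.

Lemma unif_open (A : set R) : measurable A ->
  unif A = lebesgue_measure (A `&` `](0%R : R), 1[%classic).
Proof.
move=> mA; rewrite /unif /mrestr.
have m0 : measurable (A `&` `[(0%R : R), 0%R]%classic) by apply: measurableI.
have mo : measurable (A `&` `](0%R : R), 1[%classic) by apply: measurableI.
have -> : A `&` @unit_itv _ = (A `&` `[(0%R : R), 0%R]%classic) `|` (A `&` `](0%R : R), 1[%classic).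
  rewrite -setIUr; congr (_ `&` _); apply/seteqP; split => x; rewrite /unit_itv /= !in_itv /=.
    by move=> /andP[x0 x1]; case: (ltgtP x 0) x0 => // ? _; [right; apply/andP|left].
  by case=> [/andP[x0 x1]|/andP[/ltW -> -> //]]; rewrite x0 (le_lt_trans x1).
rewrite measureU //; last first.
  apply/seteqP; split => x //=; rewrite !in_itv /= => -[[_ /andP[_ x0]] [_ /andP[x1 _]]].
  by move: (lt_le_trans x1 x0); rewrite ltxx.
rewrite (@subset_measure0 _ _ _ lebesgue_measure (A `&` `[(0%R : R), 0%R]%classic) `[(0%R : R), 0%R]%classic) ?add0e //.
by rewrite set_itv1; exact: lebesgue_measure_set1.
Qed.

(** Generalised inverse of the distribution function: for u in ]0, 1[, x < q u holds exactly when F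
    x < u, so half lines pull back to half lines under the uniform law. *)
Lemma quantile (nu : probability R R) :
  exists q : coinT -> R, measurable_fun setT q /\
    forall A, measurable A -> coinP R (q @^-1` A) = nu A.
Proof.
have [X XE] := mfun_exists (@measurable_id _ R setT).
pose F x : R := fine (@cdf _ R R nu X x).
have FE x : (F x)%:E = @cdf _ R R nu X x by rewrite /F fineK // fin_num_measure.
have F01 x : 0 <= F x <= 1 by rewrite -!lee_fin FE cdf_ge0 cdf_le1.
have Fmono x y : x <= y -> F x <= F y by move=> xy; rewrite -lee_fin !FE cdf_nondecreasing.
have Fy u : u < 1 -> exists t, u < F t.
  move=> u1; have /fine_cvgP [_ /= cv] := @cvg_cdfy1 _ R R nu X.
  have := cvgr_gt _ cv _ u1 => -[M [_ h]].
  by exists (M + 1); apply: h; rewrite ltrDl.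
have FNy u : 0 < u -> exists t, F t < u.
  move=> u1; have /fine_cvgP [_ /= cv] := @cvg_cdfNy0 _ R R nu X.
  have := cvgr_lt _ cv _ u1 => -[M [_ h]].
  by exists (M - 1); apply: h; rewrite gtrBl.
have Frc u x : F x < u -> exists2 t, x < t & F t < u.
  move=> h; have := @cdf_right_continuous _ R R nu X x; rewrite -FE => /fine_cvgP [_ /= cv].
  have [e /= e0 he] := cvgr_lt _ cv _ h.
  exists (x + e / 2); first by rewrite ltrDl divr_gt0.
  apply: he; last by rewrite ltrDl divr_gt0.
  by rewrite /ball_ /= opprD addrA subrr add0r normrN gtr0_norm ?divr_gt0 // ltr_pdivrMr // ltr_pMr // ltr1n.
(* Outside ]0, 1[ the set may be empty or unbounded; the default 0 there only affects a null set. *)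
pose q (u : R) : R := if (0 < u) && (u < 1) then sup [set t | F t < u] else 0.
have qE (u x : R) : 0 < u -> u < 1 -> (x < q u) = (F x < u).
  move=> u0 u1; rewrite /q u0 u1 /=; have [t0 ht0] := FNy _ u0; have [t1 ht1] := Fy _ u1.
  have ub : has_ubound [set t | F t < u].
    exists t1 => t /= ht; rewrite leNgt; apply/negP => /ltW /Fmono.
    by rewrite leNgt (lt_trans ht ht1).
  apply/idP/idP.
    move=> /sup_gt [|t /= ht /ltW /Fmono h]; first by exists t0.
    exact: le_lt_trans h ht.
  by move=> /Frc [t xt ht]; apply: lt_le_trans xt _; apply: ub_le_sup.
have pre x : q @^-1` `]x, +oo[ =
   (`]F x, +oo[ `&` `]0, 1[) `|` ((if x < 0 then setT else set0) `&` ~` `]0, 1[).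
  apply/seteqP; split => u; rewrite /= !in_itv /= !andbT.
    case : (boolP ((0 < u) && (u < 1))) => [/andP[u0 u1]|uN].
      by rewrite qE // => h; left.
    rewrite /q (negbTE uN) => h; right; rewrite h; split => //.
  case=> [[h /andP[u0 u1]]|]; first by rewrite qE.
  move=> [h /negP uN]; rewrite /q (negbTE uN).
  by move: h; case: ifP.
have mpre x : measurable (q @^-1` `]x, +oo[).
  rewrite pre; apply: measurableU; apply: measurableI => //.
  - by case: ifP.
  - exact: measurableC.
have mq : measurable_fun setT q.
  apply: (@measurability _ _ _ _ setT q (@RGenOInfty.G R)).
    exact: RGenOInfty.measurableE.
  by move=> _ [_ [x ->] <-]; rewrite setTI; exact: mpre.
have mqc : measurable_fun setT (q \o coinval R).
  exact: (measurableT_comp mq (@measurable_coinval R)).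
exists (q \o coinval R); split => //.
have [m mE] := law_exists (coinP R) mqc.
move=> A mA; rewrite -mE //.
apply: measure_eq_half_lines => //.
  by rewrite (le_lt_trans (probability_le1 _ _)) ?ltry.
move=> x; rewrite [RHS](_ : _ = (1 - F x)%:E); last first.
  have -> : `]x, +oo[%classic = ~` `]-oo, x]%classic by rewrite setCitvl.
  transitivity (1 - nu `]-oo, x]%classic)%E; first exact: probability_setC.
  by rewrite EFinB FE /cdf /distribution /pushforward XE.
transitivity (coinP R ((q \o coinval R) @^-1` `]x, +oo[%classic)); first exact: mE.
rewrite comp_preimage coinval_unif //.
have /andP[F0 F1] := F01 x.
rewrite unif_open // pre.
have -> : (`]F x, +oo[ `&` `]0, 1[ `|` (if x < 0 then setT else set0) `&` ~` `]0, 1[) `&` `]0, 1[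
  = `]F x, 1[%classic :> set R.
  apply/seteqP; split => u; rewrite /= !in_itv /= !andbT.
    by case => -[[]|[_]] // => -> _ /andP[_ ->].
  by move=> /andP[h ->]; rewrite h (le_lt_trans F0 h); split => //; left.
rewrite lebesgue_measure_itv /= lte_fin; case: ltP => h; first by rewrite EFinB.
have -> : F x = 1 by apply/eqP; rewrite eq_le F1 h.
by rewrite subrr.
Qed.

End Quantile.

Section GaussLaw.
Local Open Scope ereal_scope.
Variable R : realType.

(* [normal_prob] lives on [measurableTypeR R], whose display is not the default one of [R]. *)
Lemma gauss_exists (s : R) : exists m : probability R R,
  forall A, measurable A -> m A = normal_prob 0 s A.
Proof. exact: (@law_exists _ _ (measurableTypeR R) R R (normal_prob 0%R s) id (@measurable_id _ _ _)). Qed.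

Definition gaussP s : probability R R := sval (cid (gauss_exists s)).

Lemma gaussPE s A : measurable A -> gaussP s A = normal_prob 0 s A.
Proof. by move: A; exact: (svalP (cid (gauss_exists s))). Qed.

Lemma integral_gaussP s (f : R -> \bar R) : measurable_fun setT f -> (forall x, 0 <= f x) ->
  \int[gaussP s]_x f x = \int[normal_prob 0 s]_x f x.
Proof.
move=> mf f0.
exact: (esym (@integral_law _ _ (measurableTypeR R) R R (normal_prob 0%R s) id (@measurable_id _ _ _) (gaussP s)
  (fun A mA => esym (gaussPE s mA)) f mf f0)).
Qed.

Lemma gaussP_shear (s t : R) (F : R * R -> \bar R) : (0 < s)%R -> (0 < t)%R ->
  measurable_fun setT F -> (forall z, 0 <= F z) ->
  let S := Num.sqrt (s ^+ 2 + t ^+ 2)%R in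
  let lam := (t ^+ 2 / S ^+ 2)%R in
  \int[gaussP s]_x \int[gaussP t]_y F (x, y) =
  \int[gaussP S]_u \int[gaussP (s * t / S)%R]_v F (u - (v + lam * u), v + lam * u)%R.
Proof.
move=> s0 t0 mF F0 S lam.
have E a b (G : R * R -> \bar R) : measurable_fun setT G -> (forall z, 0 <= G z) ->
   \int[gaussP a]_x \int[gaussP b]_y G (x, y) = \int[normal_prob 0%R a]_x \int[normal_prob 0%R b]_y G (x, y).
  move=> mG G0; rewrite integral_gaussP.
  - apply: eq_integral => x _; rewrite integral_gaussP //.
    exact: (measurableT_comp mG (pair1_measurable x)).
  - exact: (@measurable_fun_fubini_tonelli_F _ _ _ _ _ (gaussP b) G mG G0).
  - by move=> x; exact: integral_ge0.
have sub : measurable_fun setT (fun z : R * R => (z.1 - (z.2 + lam * z.1), z.2 + lam * z.1)%R : R * R).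
  have add : measurable_fun setT (fun z : R * R => (z.2 + lam * z.1)%R).
    by apply: measurable_funD; [exact: measurable_snd|apply: measurable_funM => //; exact: measurable_fst].
  apply/measurable_fun_pairP; split => //=.
  by apply: measurable_funB => //; exact: measurable_fst.
rewrite E // (normal_shear s0 t0 mF F0).
by rewrite -(E _ _ (fun z => F (z.1 - (z.2 + lam * z.1), z.2 + lam * z.1)%R)) //; exact: (measurableT_comp mF sub).
Qed.

End GaussLaw.

(** * Independent sequences *)

Section IidLaw.
Local Open Scope ereal_scope.
Variable R : realType.

Definition test_funs (g : nat -> R -> \bar R) :=
  forall k, measurable_fun setT (g k) /\ forall x, 0 <= g k x.

(** Independence and common law in integral form, against products of nonnegative test functions.
    This form passes directly through Tonelli, where a form with events would call for an extension
    argument each time. *)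
Definition iidlaw d (T : measurableType d) (P : probability T R) (a : T -> nat -> R)
   (nu : probability R R) :=
  (forall k, measurable_fun setT (a^~ k)) /\
  forall K g, test_funs g ->
    \int[P]_w \prod_(k < K) g k (a w k) = \prod_(k < K) \int[nu]_x g k x.

Lemma measurable_prod_test d (T : measurableType d) (a : T -> nat -> R) K g :
  test_funs g -> (forall k, measurable_fun setT (a^~ k)) ->
  measurable_fun setT (fun w => \prod_(k < K) g k (a w k)).
Proof.
move=> tg ma; elim: K => [|K IH].
  by under eq_fun do rewrite big_ord0; exact: measurable_cst.
under eq_fun do rewrite big_ord_recr.
by apply: emeasurable_funM => //; exact: (measurableT_comp (tg _).1 (ma _)).
Qed.

Lemma prod_test_ge0 (a : nat -> R) K g : test_funs g -> 0 <= \prod_(k < K) g k (a k).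
Proof. by move=> tg; apply: prode_ge0 => k _; exact: (tg _).2. Qed.

Lemma test_int_ge0 (nu : {measure set R -> \bar R}) g k :
  test_funs g -> 0 <= \int[nu]_x g k x.
Proof. by move=> tg; apply: integral_ge0 => x _; exact: (tg k).2. Qed.

Lemma coin_integral (F : coinT * coinT -> \bar R) :
  measurable_fun setT F -> (forall z, 0 <= F z) ->
  \int[coinP R]_x F (evens x, odds x) = \int[coinP R]_x \int[coinP R]_y F (x, y).
Proof.
move=> mF F0; apply: ge0_integral_pair => //.
- exact: measurable_evens.
- exact: measurable_odds.
- exact: coin_split.
Qed.

(** The k-th variable reads half of the coins left after k halvings, so distinct variables use
    disjoint sets of coins. *)
Definition stream (q : coinT -> R) (x : coinT) (k : nat) : R := q (evens (iter k odds x)).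

Lemma measurable_iter_odds k : measurable_fun setT (iter k odds).
Proof.
elim: k => [|k IH]; first exact: measurable_id.
exact: (measurableT_comp measurable_odds IH).
Qed.

Lemma measurable_stream q k : measurable_fun setT q ->
  measurable_fun setT (fun x => stream q x k).
Proof.
move=> mq; apply: (measurableT_comp mq).
exact: (measurableT_comp measurable_evens (measurable_iter_odds k)).
Qed.

Lemma iid_stream (q : coinT -> R) (nu : probability R R) :
  measurable_fun setT q -> (forall A, measurable A -> coinP R (q @^-1` A) = nu A) ->
  iidlaw (coinP R) (stream q) nu.
Proof.
move=> mq qnu; split; first by move=> k; exact: measurable_stream.
have intq (f : R -> \bar R) : measurable_fun setT f -> (forall x, 0 <= f x) ->
    \int[coinP R]_x f (q x) = \int[nu]_x f x.
  move=> mf f0.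
  exact: (@integral_law _ _ _ _ _ (coinP R) q mq nu qnu f mf f0).
elim => [|K IH] g tg.
  under eq_integral do rewrite big_ord0.
  by rewrite big_ord0 integral_cst //= mul1e; exact: probability_setT.
pose g' k := g k.+1.
have tg' : test_funs g' by move=> k; exact: tg.
pose F (z : coinT * coinT) := g 0%N (q z.1) * \prod_(k < K) g' k (stream q z.2 k).
have mprod := measurable_prod_test K tg' (fun k => measurable_stream k mq).
have mF : measurable_fun setT F.
  apply: emeasurable_funM.
    apply: (measurableT_comp (tg 0%N).1).
    exact: (measurableT_comp mq measurable_fst).
  exact: (measurableT_comp mprod measurable_snd).
have F0 z : 0 <= F z by rewrite mule_ge0 ?(tg 0%N).2 // prod_test_ge0.
transitivity (\int[coinP R]_x F (evens x, odds x)).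
  apply: eq_integral => x _; rewrite big_ord_recl /F /=; congr (_ * _).
  by apply: eq_bigr => k _; rewrite /g' /stream /= -iterSr.
rewrite (coin_integral mF F0) big_ord_recl.
under eq_integral.
  move=> x _; rewrite /F /= ge0_integralZl //; last 2 first.
  - by move=> y _; exact: prod_test_ge0.
  - exact: (tg 0%N).2.
  over.
rewrite IH // ge0_integralZr //.
- by rewrite intq //; [exact: (tg 0%N).1|exact: (tg 0%N).2].
- exact: (measurableT_comp (tg 0%N).1 mq).
- by move=> x _; exact: (tg 0%N).2.
- by apply: prode_ge0 => k _; exact: test_int_ge0.
Qed.

End IidLaw.

(** * Brownian motion by dyadic refinement *)

Section Levy.
Variable R : realType.

(** Standard deviation of an increment over a dyadic interval of length 2^-n. *)
Definition sd (n : nat) : R := Num.sqrt (2 ^- n).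

Lemma sd_gt0 n : 0 < sd n.
Proof. by rewrite sqrtr_gt0 invr_gt0 exprn_gt0. Qed.

Lemma sd2 n : sd n ^+ 2 = 2 ^- n.
Proof. by rewrite sqr_sqrtr // invr_ge0 exprn_ge0. Qed.

Lemma sdS n : sd n = Num.sqrt (sd n.+1 ^+ 2 + sd n.+1 ^+ 2).
Proof. by rewrite sd2 /sd exprS invfM; congr Num.sqrt; lra. Qed.

Definition gauss_q (s : R) : coinT -> R := sval (cid (quantile (gaussP s))).

Lemma measurable_gauss_q s : measurable_fun setT (gauss_q s).
Proof. by have [] := svalP (cid (quantile (gaussP s))). Qed.

Lemma gauss_q_law s A : measurable A -> coinP R (gauss_q s @^-1` A) = gaussP s A.
Proof. by have [_] := svalP (cid (quantile (gaussP s))); apply. Qed.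

Definition noise (s : R) := stream (gauss_q s).

Lemma noise_law s : iidlaw (coinP R) (noise s) (gaussP s).
Proof. by apply: iid_stream; [exact: measurable_gauss_q|exact: gauss_q_law]. Qed.

(* Levy's midpoint rule: an increment over a dyadic interval is split into the two
   increments over its halves by means of an independent Gaussian. *)
Definition refine (a b : nat -> R) (k : nat) : R :=
  if odd k then a k./2 / 2 + b k./2 else a k./2 / 2 - b k./2.

(** [a] holds the increments at level [n0]. Each level takes its Gaussians from the even coins and
    hands on the odd ones; refining [a] before recursing lets the law be proved by enlarging the
    base space. *)
Fixpoint levels (n0 n : nat) (a : nat -> R) (x : coinT) : nat -> R :=
  if n is n'.+1 then levels n0.+1 n' (refine a (noise (sd n0 / 2) (evens x))) (odds x)
  else a.

Lemma levelsS n0 n a x :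
  levels n0 n.+1 a x = refine (levels n0 n a x) (noise (sd (n0 + n) / 2) (evens (iter n odds x))).
Proof.
elim: n n0 a x => [|n IH] n0 a x; first by rewrite /= addn0.
by rewrite -[LHS]/(levels n0.+1 n.+1 _ _) IH /= addSnnS -iterSr.
Qed.

Lemma measurable_noise s d (T : measurableType d) (x : T -> coinT) k : measurable_fun setT x ->
  measurable_fun setT (fun w => noise s (x w) k).
Proof.
move=> mx.
exact: (measurableT_comp (measurable_stream k (@measurable_gauss_q s)) mx).
Qed.

Lemma measurable_refine d (T : measurableType d) (a b : T -> nat -> R) k :
  (forall k, measurable_fun setT (a^~ k)) -> (forall k, measurable_fun setT (b^~ k)) ->
  measurable_fun setT (fun w => refine (a w) (b w) k).
Proof.
move=> ma mb; rewrite /refine; case: odd.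
  by apply: measurable_funD => //; apply: measurable_funM => //; exact: ma.
by apply: measurable_funB => //; apply: measurable_funM => //; exact: ma.
Qed.

Lemma measurable_levels n0 n d (T : measurableType d) (a : T -> nat -> R) (x : T -> coinT) :
  (forall k, measurable_fun setT (a^~ k)) -> measurable_fun setT x ->
  forall k, measurable_fun setT (fun w => levels n0 n (a w) (x w) k).
Proof.
elim: n n0 a x => [|n IH] n0 a x ma mx k /=; first exact: ma.
apply: (IH n0.+1 (fun w => refine (a w) (noise (sd n0 / 2) (evens (x w)))) (fun w => odds (x w))).
  move=> j; apply: measurable_refine => // i; apply: measurable_noise.
  exact: (measurableT_comp measurable_evens mx).
exact: (measurableT_comp measurable_odds mx).
Qed.

Local Open Scope ereal_scope.

(** The shear with equal deviations: then lam = 1/2 and the residual has deviation [sd n / 2]. *)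
Lemma refine_integral n (g1 g2 : R -> \bar R) :
  measurable_fun setT g1 -> measurable_fun setT g2 ->
  (forall x, 0 <= g1 x) -> (forall x, 0 <= g2 x) ->
  \int[gaussP (sd n)]_u \int[gaussP (sd n / 2)%R]_v (g1 (u / 2 - v)%R * g2 (u / 2 + v)%R) =
  (\int[gaussP (sd n.+1)]_x g1 x) * (\int[gaussP (sd n.+1)]_x g2 x).
Proof.
move=> m1 m2 p1 p2.
pose F (z : R * R) := g1 z.1 * g2 z.2.
have mF : measurable_fun setT F.
  apply: emeasurable_funM.
    exact: (measurableT_comp m1 measurable_fst).
  exact: (measurableT_comp m2 measurable_snd).
have F0 z : 0 <= F z by rewrite mule_ge0.
have := gaussP_shear (sd_gt0 n.+1) (sd_gt0 n.+1) mF F0.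
rewrite /= -sdS -expr2 !sd2.
have -> : (2 ^- n.+1 / sd n = sd n / 2)%R.
  have sn := lt0r_neq0 (sd_gt0 n); apply: (mulIf sn); rewrite divfK // mulrAC -expr2 sd2.
  by rewrite exprS invfM; lra.
have -> : (2 ^- n.+1 / 2 ^- n = 2^-1 :> R)%R.
  by rewrite exprS invfM mulfK // invr_neq0 // expf_neq0.
move=> E; transitivity (\int[gaussP (sd n)]_u \int[gaussP (sd n / 2)%R]_v
     F ((u - (v + 2^-1 * u))%R, (v + 2^-1 * u)%R)).
  apply: eq_integral => u _; apply: eq_integral => v _; rewrite /F /=.
  by congr (g1 _ * g2 _); lra.
refine (etrans (esym E) _); clear E.
transitivity (\int[gaussP (sd n.+1)]_x (g1 x * \int[gaussP (sd n.+1)]_y g2 y)).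
  apply: eq_integral => x _.
  exact: (@ge0_integralZl _ _ _ (gaussP (sd n.+1)) _ measurableT g2 m2 (g1 x) (fun y _ => p2 y) (p1 x)).
apply: (@ge0_integralZr _ _ _ (gaussP (sd n.+1)) _ measurableT g1 m1).
  by move=> x _; exact: p1.
by apply: integral_ge0 => y _; exact: p2.
Qed.

Lemma refine_law n d1 d2 (T1 : measurableType d1) (T2 : measurableType d2)
  (P1 : probability T1 R) (P2 : probability T2 R) (a : T1 -> nat -> R) (b : T2 -> nat -> R) :
  iidlaw P1 a (gaussP (sd n)) -> iidlaw P2 b (gaussP (sd n / 2)%R) ->
  iidlaw (P1 \x P2) (fun z => refine (a z.1) (b z.2)) (gaussP (sd n.+1)).
Proof.
move=> [ma ha] [mb hb].
have ma' k : measurable_fun setT (fun z : T1 * T2 => a z.1 k) by exact: (measurableT_comp (ma k) measurable_fst).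
have mb' k : measurable_fun setT (fun z : T1 * T2 => b z.2 k) by exact: (measurableT_comp (mb k) measurable_snd).
have mr k : measurable_fun setT (fun z : T1 * T2 => refine (a z.1) (b z.2) k).
  exact: (measurable_refine k ma' mb').
split; first exact: mr.
have doub (f : nat -> \bar R) K : \prod_(k < K.*2) f k = \prod_(k < K) (f k.*2 * f k.*2.+1).
  elim: K => [|K IH]; first by rewrite !big_ord0.
  by rewrite doubleS !big_ord_recr /= IH muleA.
have even K g : test_funs g -> \int[P1 \x P2]_z \prod_(k < K.*2) g k (refine (a z.1) (b z.2) k) =
    \prod_(k < K.*2) \int[gaussP (sd n.+1)]_x g k x.
  move=> tg.
  pose F z := \prod_(k < K.*2) g k (refine (a z.1) (b z.2) k).
  have mF : measurable_fun setT F by exact: (@measurable_prod_test _ _ _ (fun z => refine (a z.1) (b z.2)) _ _ tg mr).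
  have F0 z : 0 <= F z by exact: prod_test_ge0.
  refine (etrans (@fubini_tonelli1 _ _ _ _ R P1 P2 F mF F0) _); rewrite /fubini_F.
  pose G k u := \int[gaussP (sd n / 2)%R]_v (g k.*2 (u / 2 - v)%R * g k.*2.+1 (u / 2 + v)%R).
  have mGk k : measurable_fun setT (fun z : R * R => g k.*2 (z.1 / 2 - z.2)%R * g k.*2.+1 (z.1 / 2 + z.2)%R).
    have m1 : measurable_fun setT (fun z : R * R => z.1 / 2)%R.
      by apply: measurable_funM => //; exact: measurable_fst.
    apply: emeasurable_funM.
      by apply: (measurableT_comp (tg _).1); apply: measurable_funB => //; exact: measurable_snd.
    by apply: (measurableT_comp (tg _).1); apply: measurable_funD => //; exact: measurable_snd.
  have tG : test_funs G.
    move=> k; split; last by move=> u; apply: integral_ge0 => v _; rewrite mule_ge0 ?(tg _).2.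
    apply: (@measurable_fun_fubini_tonelli_F _ _ _ _ _ (gaussP (sd n / 2)%R) _ (mGk k)).
    by move=> z; rewrite mule_ge0 ?(tg _).2.
  transitivity (\int[P1]_x \prod_(k < K) G k (a x k)).
    apply: eq_integral => x _.
    pose h k v := g k.*2 (a x k / 2 - v)%R * g k.*2.+1 (a x k / 2 + v)%R.
    have th : test_funs h.
      move=> k; split; last by move=> v; rewrite mule_ge0 ?(tg _).2.
      exact: (measurableT_comp (mGk k) (pair1_measurable (a x k))).
    rewrite -(hb K h th); apply: eq_integral => y _.
    rewrite /F (doub (fun k => g k (refine (a x) (b y) k))); apply: eq_bigr => k _.
    by rewrite /refine /h odd_double /= odd_double /= doubleK uphalf_double.
  rewrite (ha K G tG) (doub (fun k => \int[gaussP (sd n.+1)]_x g k x)).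
  apply: eq_bigr => k _.
  exact: (refine_integral n (tg k.*2).1 (tg k.*2.+1).1 (tg k.*2).2 (tg k.*2.+1).2).
move=> K g tg.
(* [even] treats an even number of factors, paired by parent interval; any product is padded with
   the constant 1 to reach that case. *)
pose g' k x := if (k < K)%N then g k x else 1.
have tg' : test_funs g'.
  move=> k; rewrite /g'; case: (k < K)%N; first exact: tg.
  by split => //; exact: measurable_cst.
have := even K g' tg'.
have ext (f f' : nat -> \bar R) : (forall k, (k < K)%N -> f' k = f k) -> (forall k, (K <= k)%N -> f' k = 1) ->
    \prod_(k < K.*2) f' k = \prod_(k < K) f k.
  move=> e1 e2; suff h j : \prod_(k < K + j) f' k = \prod_(k < K) f k by rewrite -addnn h.
  elim: j => [|j IH]; first by rewrite addn0; apply: eq_bigr => k _; exact: e1.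
  by rewrite addnS big_ord_recr /= IH e2 ?leq_addr // mule1.
rewrite (ext (fun k => \int[gaussP (sd n.+1)]_x g k x) (fun k => \int[gaussP (sd n.+1)]_x g' k x)); last 2 first.
- by move=> k kK; rewrite /g' kK.
- move=> k kK; rewrite /g' ltnNge kK /= integral_cst //= mul1e.
  exact: probability_setT.
move=> <-; apply: eq_integral => z _; symmetry.
apply: (ext (fun k => g k (refine (a z.1) (b z.2) k)) (fun k => g' k (refine (a z.1) (b z.2) k))).
- by move=> k kK; rewrite /g' kK.
- by move=> k kK; rewrite /g' ltnNge kK.
Qed.

(** Induction over all base spaces at once: the noise of the first level is absorbed into the base
    by a product, and the other levels act on the result. *)
Lemma levels_law n n0 d (T : measurableType d) (P : probability T R) (a : T -> nat -> R) K g :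
  iidlaw P a (gaussP (sd n0)) -> test_funs g ->
  \int[P]_w \int[coinP R]_x \prod_(k < K) g k (levels n0 n (a w) x k) =
  \prod_(k < K) \int[gaussP (sd (n0 + n))]_x g k x.
Proof.
elim: n n0 d T P a => [|n IH] n0 d T P a ia tg.
  rewrite addn0 -(ia.2 K g tg); apply: eq_integral => w _ /=.
  by rewrite integral_cst //= [X in _ * X](probability_setT (coinP R)) mule1.
pose a' (z : T * coinT) := refine (a z.1) (noise (sd n0 / 2) z.2).
have ia' : iidlaw (P \x coinP R) a' (gaussP (sd n0.+1)).
  exact: (refine_law ia (noise_law _)).
rewrite addnS -addSn -(IH n0.+1 _ _ (P \x coinP R) a' ia' tg).
pose F (z : (T * coinT) * coinT) := \prod_(k < K) g k (levels n0.+1 n (a' z.1) z.2 k).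
have mF : measurable_fun setT F.
  apply: (@measurable_prod_test _ _ _ (fun z => levels n0.+1 n (a' z.1) z.2) _ _ tg).
  apply: (@measurable_levels n0.+1 n _ _ (fun z : (T * coinT) * coinT => a' z.1) snd).
    by move=> j; exact: (measurableT_comp (ia'.1 j) measurable_fst).
  exact: measurable_snd.
have F0 z : 0 <= F z by exact: prod_test_ge0.
pose G (z : T * coinT) := \int[coinP R]_y F (z, y).
have mG : measurable_fun setT G.
  exact: (@measurable_fun_fubini_tonelli_F _ _ _ _ _ (coinP R) F mF F0).
have G0 z : 0 <= G z by exact: integral_ge0.
transitivity (\int[P]_w \int[coinP R]_x G (w, x)).
  apply: eq_integral => w _.
  have mFw : measurable_fun setT (fun z : coinT * coinT => F ((w, z.1), z.2)).
    apply: (measurableT_comp mF); apply/measurable_fun_pairP; split => /=.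
      exact: (measurableT_comp (pair1_measurable w) measurable_fst).
    exact: measurable_snd.
  exact: (coin_integral mFw (fun=> F0 _)).
exact: (esym (@fubini_tonelli1 _ _ _ _ R P (coinP R) G mG G0)).
Qed.

(** Increment of the path to be built over the dyadic interval from k 2^-n to (k+1) 2^-n. *)
Definition incr (n : nat) (x : coinT) : nat -> R :=
  levels 0 n (noise (sd 0) (evens x)) (odds x).

Lemma measurable_incr n k : measurable_fun setT (fun x => incr n x k).
Proof.
apply: (@measurable_levels 0%N n _ _ (fun x => noise (sd 0) (evens x)) odds).
  by move=> j; apply: measurable_noise; exact: measurable_evens.
exact: measurable_odds.
Qed.

Lemma incr_law n : iidlaw (coinP R) (incr n) (gaussP (sd n)).
Proof.
split; first exact: measurable_incr.
move=> K g tg; refine (etrans _ (levels_law n K (noise_law (sd 0)) tg)).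
pose F (z : coinT * coinT) := \prod_(k < K) g k (levels 0 n (noise (sd 0) z.1) z.2 k).
apply: (@coin_integral _ F); last by move=> z; exact: prod_test_ge0.
apply: (@measurable_prod_test _ _ _ (fun z => levels 0 n (noise (sd 0) z.1) z.2) _ _ tg).
apply: (@measurable_levels 0%N n _ _ (fun z : coinT * coinT => noise (sd 0) z.1) snd).
  by move=> j; apply: measurable_noise; exact: measurable_fst.
exact: measurable_snd.
Qed.

Lemma incr_add n x k : (incr n.+1 x k.*2 + incr n.+1 x k.*2.+1 = incr n x k)%R.
Proof.
rewrite /incr levelsS /refine odd_double /= odd_double /= doubleK uphalf_double.
by move: (levels _ _ _ _ _) (noise _ _ _) => u v; lra.
Qed.

End Levy.

(** * Uniform convergence of the dyadic approximations *)

Section PathLimit.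
Variable R : realType.
Local Notation e := (9 / 10 : R).

(** Geometric tail: for e = 9/10 the ratio e / (1 - e) is 9, so all changes after level n add up to
    at most 9 e^n. *)
Lemma geo_step (n m : nat) (u : nat -> R) :
  (forall k, (n <= k)%N -> `|u k.+1 - u k| <= e ^+ k.+1) -> (n <= m)%N ->
  `|u m - u n| <= 9 * e ^+ n - 9 * e ^+ m.
Proof.
move=> H /subnKC <-; elim: (m - n)%N => [|k IH].
  by rewrite addn0 !subrr normr0.
have h := H (n + k)%N (leq_addr _ _).
have -> : u (n + k.+1)%N - u n = (u (n + k).+1 - u (n + k)%N) + (u (n + k)%N - u n).
  by rewrite addnS; ring.
apply: (le_trans (ler_normD _ _)).
by move: h IH; rewrite addnS exprS; lra.
Qed.

Lemma geo_gt0 n : 0 < e ^+ n. Proof. by apply: exprn_gt0; lra. Qed.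

Lemma geo_cvg (n : nat) (u : nat -> R) :
  (forall k, (n <= k)%N -> `|u k.+1 - u k| <= e ^+ k.+1) -> cvgn u.
Proof.
move=> H.
have -> : u = (fun m => (u m - 9 * e ^+ m) + 9 * e ^+ m) by apply/funext => m; ring.
apply: is_cvgD; last first.
  apply: is_cvgMr; apply/cvg_ex; exists 0; apply: cvg_expr.
  by rewrite ger0_norm; lra.
apply/cvg_ex; suff : cvgn (fun k => u (k + n)%N - 9 * e ^+ (k + n)).
  by move=> /cvg_ex[l hl]; exists l; rewrite -(cvg_shiftn n).
apply: nondecreasing_is_cvgn.
  apply/nondecreasing_seqP => k.
  have := H (k + n)%N (leq_addl _ _); rewrite addSn ler_norml => /andP[h _].
  by move: h; rewrite exprS; lra.
exists (u n + 9 * e ^+ n) => _ [k _ <-] /=.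
have := geo_step H (leq_addl k n); rewrite ler_norml => /andP[_ h].
by have := geo_gt0 (k + n); lra.
Qed.

Lemma geo_lim (n : nat) (u : nat -> R) :
  (forall k, (n <= k)%N -> `|u k.+1 - u k| <= e ^+ k.+1) ->
  `|limn u - u n| <= 9 * e ^+ n.
Proof.
move=> H; have cu := geo_cvg H.
have b m : (n <= m)%N -> `|u m - u n| <= 9 * e ^+ n.
  by move=> nm; apply: (le_trans (geo_step H nm)); have := geo_gt0 m; lra.
have h1 : limn u <= u n + 9 * e ^+ n.
  apply: limr_le => //; exists n => // m /= nm.
  by have := b m nm; rewrite ler_norml => /andP[]; lra.
have h2 : u n - 9 * e ^+ n <= limn u.
  apply: limr_ge => //; exists n => // m /= nm.
  by have := b m nm; rewrite ler_norml => /andP[]; lra.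
by rewrite ler_norml; apply/andP; split; lra.
Qed.

End PathLimit.

Section BrownianPath.
Variable R : realType.
Local Notation e := (9 / 10 : R).
Local Notation P := (coinP R).

Definition idx (n : nat) (t : R) : nat := Num.truncn (t * 2 ^+ n).

(** Value at the last grid point before [t], without interpolation: continuity appears only in the
    limit. *)
Definition bstep (n : nat) (x : coinT) (t : R) : R := \sum_(k < idx n t) incr R n x k.

Lemma bstep_double n x K : \sum_(k < K.*2) incr R n.+1 x k = \sum_(k < K) incr R n x k.
Proof.
elim: K => [|K IH]; first by rewrite !big_ord0.
by rewrite doubleS !big_ord_recr /= IH -addrA incr_add.
Qed.

Lemma idxS n t : idx n.+1 t = (idx n t).*2 \/ idx n.+1 t = (idx n t).*2.+1.
Proof.
rewrite /idx exprS mulrCA; set y := t * 2 ^+ n.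
have [y0|y0] := leP 0 y; last first.
  have tr0 (z : R) : z < 0 -> Num.truncn z = 0%N.
    by move=> z0; apply/eqP; rewrite -leqn0 truncn_le_nat (lt_trans z0) ?ltr01.
  by left; rewrite !tr0 //; lra.
have /andP[] := truncn_itv y0; set N := Num.truncn y => h1.
rewrite -addn1 natrD => h2.
have E2 : N.*2%:R = 2 * N%:R :> R by rewrite -muln2 natrM mulrC.
have [h|h] := ltP y (N%:R + 2^-1); [left|right]; apply: truncn_def.
  by rewrite -(addn1 N.*2) natrD E2; apply/andP; split; lra.
by rewrite -(addn1 N.*2.+1) -(addn1 N.*2) !natrD E2; apply/andP; split; lra.
Qed.

(** The first 4^n intervals of length 2^-n cover [0, 2^n], so every bounded range of times is
    eventually included. The threshold e^n is summable, yet large against the deviation 2^(-n/2). *)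
Definition rough (n : nat) : set coinT :=
  [set x | exists k, (k < 4 ^ n)%N /\ e ^+ n < `|incr R n x k|].

Lemma incr_marginal n k (A : set R) : measurable A ->
  P [set x | A (incr R n x k)] = gaussP (sd R n) A.
Proof.
move=> mA.
have mS : measurable [set x | A (incr R n x k)].
  by rewrite -[X in measurable X]setTI; exact: (measurable_incr n k).
pose g j (y : R) : \bar R := if j == k then (\1_A y)%:E else 1%E.
have tg : test_funs g.
  move=> j; rewrite /g; case: (j == k); last by split => //; exact: measurable_cst.
  by split; [apply/measurable_EFinP; exact: measurable_indic|move=> y; rewrite lee_fin indicE].
have one (j : 'I_k) : nat_of_ord j == k = false by apply/negbTE; rewrite neq_ltn ltn_ord.
have := (incr_law R n).2 k.+1 g tg.
rewrite big_ord_recr /= big1 ?mul1e; last first.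
  move=> j _; rewrite /g one integral_cst //= mul1e; exact: probability_setT.
rewrite /g eqxx integral_indic // setIT => <-.
have PE : (\int[P]_x (\1_[set x | A (incr R n x k)] x)%:E = P [set x | A (incr R n x k)])%E.
  by rewrite integral_indic // setIT.
rewrite -PE.
apply: eq_integral => x _; rewrite big_ord_recr /= eqxx big1 ?mul1e //.
by move=> j _; rewrite one.
Qed.

(** An eighth power is ample: 4^n intervals times sd^8 = 16^-n remains summable after division by
    the eighth power of the threshold. *)
Lemma expR_ge_pow8 (y : R) : 0 <= y -> (y / 8) ^+ 8 <= expR y.
Proof.
move=> y0; have -> : expR y = expR (y / 8) ^+ 8 by rewrite -expRM_natl; congr expR; lra.
rewrite lerXn2r ?nnegrE ?expR_ge0 //; first lra.
by have := expR_ge1Dx (y / 8); lra.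
Qed.

Local Open Scope ereal_scope.

(** Exponential Markov bound at rates 1/s and -1/s, where the factor e^{-d/s} is weakened to (8 s /
    d)^8. *)
Lemma gauss_tail (s d : R) : (0 < s)%R -> (0 < d)%R ->
  gaussP s [set x | d < `|x|]%R <= ((8 * s / d) ^+ 8 * (2 * expR (1 / 2)))%:E.
Proof.
move=> s0 d0; set c := ((8 * s / d) ^+ 8)%R.
have c0 : (0 <= c)%R by rewrite exprn_ge0 // divr_ge0 ?mulr_ge0 // ltW.
have sn0 : (s != 0)%R by rewrite gt_eqF.
have mA : measurable [set x : R | (d < `|x|)%R].
  have := measurable_fun_ltr (measurable_cst d) (@normr_measurable R setT).
  by move=> /(_ measurableT [set true] I); rewrite setTI.
have mE (th : R) : measurable_fun setT (fun x : R => (expR (th * x))%:E).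
  apply/measurable_EFinP; apply: measurableT_comp => //; exact: measurable_funM.
have e0 (th x : R) : 0 <= (expR (th * x))%:E by rewrite lee_fin expR_ge0.
have PE : \int[gaussP s]_x (\1_[set x | (d < `|x|)%R] x)%:E = gaussP s [set x | (d < `|x|)%R].
  by rewrite integral_indic // setIT.
rewrite -PE.
apply: (@le_trans _ _ (\int[gaussP s]_x (c%:E * ((expR (s^-1 * x))%:E + (expR (- s^-1 * x))%:E)))).
  apply: ge0_le_integral => //.
  - by apply/measurable_EFinP; exact: measurable_indic.
  - by apply: emeasurable_funM => //; exact: emeasurable_funD.
  move=> x _; rewrite -EFinD -EFinM lee_fin indicE.
  have [|] := boolP (x \in _); last by move=> _; rewrite mulr_ge0 // addr_ge0 // expR_ge0.
  rewrite inE /= => dx.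
  have h1 : (1 <= c * expR (`|x| / s))%R.
    have q : ((d / s / 8) ^+ 8 <= expR (`|x| / s))%R.
      apply: le_trans (expR_ge_pow8 _); last by rewrite divr_ge0 // ltW.
      rewrite lerXn2r ?nnegrE ?divr_ge0 ?(ltW d0) ?(ltW s0) //.
      by rewrite !ler_pM2r ?invr_gt0 // ltW.
    apply: le_trans (ler_wpM2l c0 q); rewrite -exprMn.
    have -> : (8 * s / d * (d / s / 8) = 1)%R by field; rewrite sn0 gt_eqF.
    by rewrite expr1n.
  apply: (le_trans h1); rewrite ler_wpM2l //.
  have [x0|x0] := leP 0%R x.
    by rewrite ger0_norm // mulrC lerDl expR_ge0.
  by rewrite ltr0_norm // mulNr -mulrN mulrC lerDr expR_ge0.
rewrite ge0_integralZl //; last 2 first.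
- exact: emeasurable_funD.
- by move=> x _; rewrite adde_ge0.
rewrite ge0_integralD //.
have I (th : R) : (th ^+ 2 = (s ^+ 2)^-1)%R -> \int[gaussP s]_x (expR (th * x))%:E = (expR (1 / 2))%:E.
  move=> th2; rewrite integral_gaussP // normal_expR // th2; congr (expR _)%:E.
  by rewrite mulVf // expf_neq0.
rewrite !I ?sqrrN ?exprVn // -EFinD -EFinM lee_fin.
by have -> : (expR (1 / 2) + expR (1 / 2) = 2 * expR (1 / 2) :> R)%R by ring.
Qed.

Lemma measurable_rough n : measurable (rough n).
Proof.
have -> : rough n = \bigcup_(k in [set k | (k < 4 ^ n)%N]) [set x | (e ^+ n < `|incr R n x k|)%R].
  by apply/seteqP; split => x /= => [[k [h1 h2]]|[k h1 h2]]; exists k.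
apply: bigcup_measurable => k _.
have mk : measurable_fun setT (fun x => `|incr R n x k|%R).
  by apply: measurableT_comp => //; exact: measurable_incr.
have := measurable_fun_ltr (measurable_cst (e ^+ n)%R) mk.
by move=> /(_ measurableT [set true] I); rewrite setTI.
Qed.

Lemma rough_const n : (4 ^+ n * ((8 * sd R n / e ^+ n) ^+ 8 * (2 * expR (1 / 2))) <=
  8 ^+ 8 * (2 * expR (1 / 2)) * (6 / 10) ^+ n)%R.
Proof.
have s8 : (sd R n ^+ 8 = 16^-1 ^+ n)%R.
  have -> : (sd R n ^+ 8 = (sd R n ^+ 2) ^+ 4)%R by rewrite -exprM.
  by rewrite sd2 -exprVn -exprM mulnC exprM; congr (_ ^+ _)%R; field.
have E8 : ((8 * sd R n / e ^+ n) ^+ 8 = 8 ^+ 8 * (16^-1 / e ^+ 8) ^+ n)%R.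
  rewrite [LHS]exprMn [in LHS]exprMn s8 -mulrA; congr (_ * _)%R.
  rewrite [RHS]exprMn; congr (_ * _)%R; move: (e) => v.
  by rewrite -!exprVn -!exprM mulnC.
rewrite E8.
set a := (8 ^+ 8)%R; set b := (2 * expR (1 / 2))%R.
have b0 : (0 <= b)%R by rewrite mulr_ge0 ?expR_ge0.
have a0 : (0 <= a)%R by rewrite exprn_ge0.
(* From (9/10)^8 >= 42/100 the ratio 4 / (16 (9/10)^8) is below 6/10. *)
have e8 : (42 / 100 <= e ^+ 8)%R.
  have -> : (e ^+ 8 = (e ^+ 2) ^+ 2 * (e ^+ 2) ^+ 2)%R by rewrite -!exprM -exprD.
  have -> : (e ^+ 2 = 81 / 100)%R by rewrite expr2; lra.
  have -> : ((81 / 100) ^+ 2 = 6561 / 10000 :> R)%R by rewrite expr2; lra.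
  lra.
have q : (4 ^+ n * (16^-1 / e ^+ 8) ^+ n <= (6 / 10) ^+ n)%R.
  have e80 : (0 < e ^+ 8)%R by rewrite (lt_le_trans _ e8) //; lra.
  have h : (4 * (16^-1 / e ^+ 8) <= 6 / 10)%R.
    by rewrite mulrA ler_pdivrMr //; lra.
  rewrite -exprMn; apply: lerXn2r => //; rewrite nnegrE; last lra.
  by rewrite !mulr_ge0 ?invr_ge0 // ltW.
have -> : (4 ^+ n * (a * (16^-1 / e ^+ 8) ^+ n * b) = (4 ^+ n * (16^-1 / e ^+ 8) ^+ n) * (a * b))%R by ring.
by rewrite mulrC ler_wpM2l // mulr_ge0.
Qed.

Lemma rough_le n : P (rough n) <= ((8 ^+ 8 * (2 * expR (1 / 2))) * (6 / 10) ^+ n)%:E.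
Proof.
have c0 : (0 <= (8 : R) ^+ 8 * (2 * expR (1 / 2)))%R by rewrite !mulr_ge0 ?expR_ge0 ?exprn_ge0.
have mS k : measurable [set x | (e ^+ n < `|incr R n x k|)%R].
  have mk : measurable_fun setT (fun x => `|incr R n x k|%R).
    by apply: measurableT_comp => //; exact: measurable_incr.
  have := measurable_fun_ltr (measurable_cst (e ^+ n)%R) mk.
  by move=> /(_ measurableT [set true] I); rewrite setTI.
have mA : measurable [set y : R | (e ^+ n < `|y|)%R].
  have := measurable_fun_ltr (measurable_cst (e ^+ n)%R) (@normr_measurable R setT).
  by move=> /(_ measurableT [set true] I); rewrite setTI.
have -> : rough n = \big[setU/set0]_(k < (4 ^ n)%N) [set x | (e ^+ n < `|incr R n x k|)%R].
  rewrite -(bigcup_mkord _ (fun k => [set x | (e ^+ n < `|incr R n x k|)%R])).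
  by apply/seteqP; split => x /= => [[k [h1 h2]]|[k h1 h2]]; exists k.
apply: (le_trans (Boole_inequality P (A := fun k => [set x | (e ^+ n < `|incr R n x k|)%R]) _)) => //.
apply: (@le_trans _ _ (\sum_(k < (4 ^ n)%N) ((8 * sd R n / e ^+ n) ^+ 8 * (2 * expR (1 / 2)))%:E)).
  apply: lee_sum => k _.
  have E : P [set x | (e ^+ n < `|incr R n x k|)%R] <=
      ((8 * sd R n / e ^+ n) ^+ 8 * (2 * expR (1 / 2)))%:E.
    rewrite (incr_marginal n k mA).
    by apply: gauss_tail; [exact: sd_gt0|exact: geo_gt0].
  exact: E.
have hN (z : R) : (z *+ (4 ^ n)%N = 4 ^+ n * z)%R by rewrite -(mulr_natl z) natrX.
rewrite sumEFin lee_fin sumr_const card_ord hN.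
exact: rough_const.
Qed.

Definition bad : set coinT := lim_sup_set rough.

Lemma measurable_bad : measurable bad.
Proof.
apply: bigcapT_measurable => n; apply: bigcup_measurable => j _; exact: measurable_rough.
Qed.

Lemma bad_null : P bad = 0.
Proof.
apply: lim_sup_set_cvg0; first exact: measurable_rough.
pose C := (8 ^+ 8 * (2 * expR (1 / 2)) : R)%R.
apply: (@le_lt_trans _ _ (\sum_(n <oo) (C * (6 / 10) ^+ n)%:E)).
  by apply: lee_nneseries => [n _ _|n _]; [exact: measure_ge0|exact: rough_le].
have cg : series (geometric C (6 / 10)%R) @ \oo --> (C * (1 - 6 / 10)^-1)%R.
  by apply: cvg_geometric_series; rewrite ger0_norm; lra.
suff -> : \sum_(n <oo) (C * (6 / 10) ^+ n)%:E = (C * (1 - 6 / 10)^-1)%:E by rewrite ltry.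
apply/cvg_lim => //.
under eq_fun do rewrite sumEFin.
by apply: cvg_EFin; [exact: nearW|exact: cg].
Qed.

Local Close Scope ereal_scope.

Lemma idx_mono n (s t : R) : s <= t -> (idx n s <= idx n t)%N.
Proof. by move=> st; apply: le_truncn; rewrite ler_pM2r // exprn_gt0. Qed.

Lemma good_eventually x (T : R) : ~ bad x -> exists n0, forall n, (n0 <= n)%N ->
  (forall k, (k < 4 ^ n)%N -> `|incr R n x k| <= e ^+ n) /\ T <= 2 ^+ n.
Proof.
move=> gx.
have [n1 h1] : exists n, ~ (\bigcup_(j in [set j | (n <= j)%N]) rough j) x.
  by apply/existsNP => h; apply: gx => n _; exact: h.
exists (maxn n1 (Num.truncn T).+1) => n; rewrite geq_max => /andP[n1n Tn]; split.
  move=> k kn; rewrite leNgt; apply/negP => hk; apply: h1; exists n => //; by exists k.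
apply: (le_trans (ltW (truncnS_gt T))); rewrite -natrX ler_nat (leq_trans Tn) //.
exact/ltnW/ltn_expl.
Qed.

Lemma idx_lt n (t : R) : t < 2 ^+ n -> (idx n t < 4 ^ n)%N.
Proof.
move=> tn; rewrite /idx.
have [t0|t0] := leP 0 (t * 2 ^+ n).
  rewrite truncn_lt_nat //.
  have -> : (4 ^ n)%N%:R = 2 ^+ n * 2 ^+ n :> R by rewrite natrX -exprMn; congr (_ ^+ _); lra.
  by rewrite ltr_pM2r // exprn_gt0.
have -> : Num.truncn (t * 2 ^+ n) = 0%N.
  by apply/eqP; rewrite -leqn0 truncn_le_nat (lt_trans t0) ?ltr01.
by rewrite expn_gt0.
Qed.

(** Halving the mesh adds at most one increment of the finer level to the sum at a given time. *)
Lemma bstep_next n x t : (forall k, (k < 4 ^ n.+1)%N -> `|incr R n.+1 x k| <= e ^+ n.+1) ->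
  t < 2 ^+ n.+1 -> `|bstep n.+1 x t - bstep n x t| <= e ^+ n.+1.
Proof.
move=> h tn; have := idx_lt tn; rewrite /bstep.
case: (idxS n t) => ->; first by rewrite bstep_double subrr normr0 (ltW (geo_gt0 _ _)).
by move=> il; rewrite big_ord_recr /= bstep_double addrAC subrr add0r h // (ltn_trans _ il).
Qed.

(** The null set [bad] gets the zero path, because continuity is required for every outcome. *)
Definition bm (t : R) (x : coinT) : R := if x \in bad then 0 else limn (fun n => bstep n x t).

Lemma bstep_cvg x t : ~ bad x -> cvgn (fun n => bstep n x t).
Proof.
move=> gx; have [n0 h] := good_eventually (t + 1) gx.
apply: (@geo_cvg _ n0) => k nk; have [h1 h2] := h k.+1 (leqW nk).
by apply: bstep_next => //; lra.
Qed.

Lemma bm_cvg x t : ~ bad x -> bstep n x t @[n --> \oo] --> bm t x.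
Proof.
move=> gx; rewrite /bm ifF; last by apply/negbTE; rewrite notin_setE.
exact: bstep_cvg.
Qed.

Lemma bm0 x : bm 0 x = 0.
Proof.
rewrite /bm; case: ifP => // _; rewrite (_ : (fun n => _) = cst 0) ?lim_cst //.
by apply/funext => n; rewrite /bstep /idx mul0r truncn0 big_ord0.
Qed.

Lemma measurable_bstep n t : measurable_fun setT (fun x => bstep n x t).
Proof. by apply: measurable_sum => k; exact: measurable_incr. Qed.

Lemma measurable_bm t : measurable_fun setT (bm t).
Proof.
apply: (@measurable_fun_cvg _ _ _ _ (fun n x => if x \in bad then 0 else bstep n x t)).
  move=> n; apply: measurable_fun_ifT => //.
  - apply: (measurable_fun_bool true); rewrite setTI.
    rewrite (_ : _ @^-1` _ = bad); first exact: measurable_bad.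
    by apply/seteqP; split => x h; [exact: set_mem h|exact: mem_set h].
  - exact: measurable_bstep.
move=> x _; have [xb|xb] := boolP (x \in bad).
  by rewrite /bm xb; exact: cvg_cst.
by apply: bm_cvg; rewrite -notin_setE.
Qed.

Lemma bm_continuous x : continuous (fun t => bm t x).
Proof.
have [xb|/negP xb] := boolP (x \in bad).
  by move=> t; rewrite /bm xb; exact: cvg_cst.
have gx : ~ bad x by move=> h; apply: xb; apply/mem_set.
move=> t; apply/cvgrPdist_le => eps eps0.
have [n0 h] := good_eventually (t + 2) gx.
have geo0 : e ^+ n @[n --> \oo] --> 0 by apply: cvg_expr; rewrite ger0_norm; lra.
(* Two approximation errors 9 e^n and one increment e^n make 19 e^n, which must be at most eps. *)
have e20 : 0 < eps / 20 by rewrite divr_gt0.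
have [N _ hN] := cvgr_lt _ geo0 _ e20.
set n := maxn n0 N.
have en : e ^+ n < eps / 20 by apply: hN; exact: leq_maxr.
have hn m : (n <= m)%N -> _ := fun nm => h m (leq_trans (leq_maxl _ _) nm).
have close s : s < t + 1 -> `|bm s x - bstep n x s| <= 9 * e ^+ n.
  move=> st; rewrite /bm ifF; last exact/negP.
  apply: geo_lim => k nk; have [h1 h2] := hn k.+1 (leqW nk).
  by apply: bstep_next => //; lra.
have [h1 h2] := hn n (leqnn n).
have step s r : s <= r -> r < t + 1 -> r - s < 2 ^- n -> `|bstep n x r - bstep n x s| <= e ^+ n.
  move=> sr rt rs; rewrite /bstep.
  have p2 : 0 < 2 ^+ n :> R by rewrite exprn_gt0.
  have : idx n r = idx n s \/ idx n r = (idx n s).+1.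
    have h3 := idx_mono n sr.
    suff : (idx n r <= (idx n s).+1)%N.
      by rewrite leq_eqVlt ltnS => /orP[/eqP|h4]; [right|left; apply/eqP; rewrite eqn_leq h4].
    rewrite /idx truncn_le_nat.
    have := truncnS_gt (s * 2 ^+ n); rewrite -[in X in _ -> X]addn1 natrD => h4.
    have : (r - s) * 2 ^+ n < 1 by rewrite -ltr_pdivlMr // mul1r.
    by rewrite mulrBl; lra.
  case=> ->; first by rewrite subrr normr0 (ltW (geo_gt0 _ _)).
  have E : idx n r = (idx n s).+1 -> `|incr R n x (idx n s)| <= e ^+ n.
    move=> E; apply: h1; apply: leq_ltn_trans (idx_lt (_ : r < 2 ^+ n)); last lra.
    exact: idx_mono.
  rewrite big_ord_recr /= addrAC subrr add0r; apply: h1.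
  by apply: leq_ltn_trans (idx_lt (_ : r < 2 ^+ n)); [exact: idx_mono|lra].
have n20 : 0 < 2 ^- n :> R by rewrite invr_gt0 exprn_gt0.
exists (Num.min (2 ^- n) 1); first by rewrite /= lt_min n20 ltr01.
move=> s; rewrite /ball_ /= lt_min => /andP[st st1].
have g0 := geo_gt0 R n.
have b1 := close t ltac:(lra).
have sb : s < t + 1 by move: st1; rewrite ltr_norml => /andP[? ?]; lra.
have b2 := close s sb.
have b3 : `|bstep n x t - bstep n x s| <= e ^+ n.
  have [ts|ts] := leP t s.
    rewrite distrC; apply: step => //; move: st; rewrite ltr_norml => /andP[? ?]; lra.
  apply: step; [exact: ltW|lra|move: st; rewrite ltr_norml => /andP[? ?]; lra].
move: b1 b2 b3; rewrite !ler_norml => /andP[? ?] /andP[? ?] /andP[? ?].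
by apply/andP; split; lra.
Qed.

End BrownianPath.

(** * Gaussian convolution and sums over blocks of independent increments *)

Section RectMeasure.
Local Open Scope ereal_scope.
Context d1 d2 (T1 : measurableType d1) (T2 : measurableType d2) (R : realType).

(** [c] carries the weight of further events imposed together with the pair of variables. Division
    by [c], when it is not 0, reduces to uniqueness of the product measure. *)
Lemma rect_measure (m' : {measure set (T1 * T2) -> \bar R})
  (m1 : {sigma_finite_measure set T1 -> \bar R}) (m2 : {sigma_finite_measure set T2 -> \bar R}) (c : R) :
  (0 <= c)%R ->
  (forall A B, measurable A -> measurable B -> m' (A `*` B) = m1 A * m2 B * c%:E) ->
  forall X, measurable X -> m' X = (m1 \x m2) X * c%:E.
Proof.
move=> c0 H X mX; move: c0; rewrite le_eqVlt => /predU1P[c0|c0].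
  have m0 : m' setT = 0 by rewrite -setXTT H // -c0 mule0.
  rewrite -c0 mule0; apply: (@subset_measure0 _ _ _ m' X setT) => //.
have ci0 : (0 <= c^-1)%R by rewrite invr_ge0 ltW.
pose k : {nonneg R} := NngNum ci0.
rewrite (@product_measure_unique _ _ _ _ _ m1 m2 (mscale k m')) //.
  rewrite /mscale /= muleAC -EFinM mulVf ?mul1e //; exact: lt0r_neq0.
move=> A B mA mB; change (k%:num%:E * m' (A `*` B) = m1 A * m2 B).
rewrite H // muleCA -EFinM mulVf ?mule1 //.
exact: lt0r_neq0.
Qed.

End RectMeasure.

Section GaussConv.
Variable R : realType.
Local Open Scope ereal_scope.

Lemma gauss_conv (s t : R) B : (0 < s)%R -> (0 < t)%R -> measurable B ->
  (gaussP s \x gaussP t) [set z : R * R | B (z.1 + z.2)%R] =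
  gaussP (Num.sqrt (s ^+ 2 + t ^+ 2)) B.
Proof.
move=> s0 t0 mB.
set D := [set z | _].
have ms : measurable_fun setT (fun z : R * R => (z.1 + z.2)%R).
  by apply: measurable_funD; [exact: measurable_fst|exact: measurable_snd].
have mD : measurable D by rewrite -[X in measurable X]setTI; exact: ms.
pose F (z : R * R) : \bar R := (\1_D z)%:E.
have mF : measurable_fun setT F by apply/measurable_EFinP; exact: measurable_indic.
have F0 z : 0 <= F z by rewrite lee_fin indicE.
have E1 : \int[gaussP s \x gaussP t]_z F z = (gaussP s \x gaussP t) D.
  by rewrite /F integral_indic // setIT.
rewrite -E1.
refine (etrans (@fubini_tonelli1 _ _ _ _ R (gaussP s) (gaussP t) F mF F0) _).
refine (etrans (gaussP_shear s0 t0 mF F0) _) => /=.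
set S := Num.sqrt _.
have E2 : \int[gaussP S]_u (\1_B u)%:E = gaussP S B by rewrite integral_indic // setIT.
rewrite -E2; apply: eq_integral => u _.
transitivity (\int[gaussP (s * t / S)%R]_v (\1_B u)%:E).
  apply: eq_integral => v _; rewrite /F !indicE; congr (nat_of_bool _)%:R%:E.
  apply/idP/idP; rewrite !inE /D /= subrK //.
rewrite integral_cst //= [X in _ * X](probability_setT (gaussP _)) mule1 //.
Qed.

Lemma normal_pdf_le (s u x : R) : (0 < s)%R -> (s / 2 <= u <= 2 * s)%R ->
  (normal_pdf 0 u x <= 4 * normal_pdf 0 (2 * s) x)%R.
Proof.
move=> s0 /andP[su us].
have u0 : (0 < u)%R by rewrite (lt_le_trans _ su) // divr_gt0.
have S0 : (0 < 2 * s)%R by rewrite mulr_gt0.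
rewrite !normal_pdfE ?gt_eqF // mulrA; apply: ler_pM.
- by rewrite invr_ge0 sqrtr_ge0.
- by rewrite expR_ge0.
- rewrite /normal_peak.
  have -> : (4 * (Num.sqrt ((2 * s) ^+ 2 * pi *+ 2))^-1 = (Num.sqrt ((s / 2) ^+ 2 * pi *+ 2))^-1)%R.
    have -> : ((2 * s) ^+ 2 * pi *+ 2 = 4 ^+ 2 * ((s / 2) ^+ 2 * pi *+ 2))%R.
      by rewrite !mulr2n; field.
    rewrite sqrtrM ?sqr_ge0 // sqrtr_sqr ger0_norm // invfM mulrA divff ?mul1r //.
  have p0 : (0 < (s / 2) ^+ 2 * pi *+ 2 :> R)%R.
    by rewrite mulrn_wgt0 // mulr_gt0 ?pi_gt0 // exprn_gt0 // divr_gt0.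
  have p1 : (0 < u ^+ 2 * pi *+ 2 :> R)%R.
    by rewrite mulrn_wgt0 // mulr_gt0 ?pi_gt0 // exprn_gt0.
  rewrite lef_pV2 ?posrE ?sqrtr_gt0 //; apply: ler_wsqrtr.
  rewrite lerMn2r /= ler_pM2r ?pi_gt0 //; apply: lerXn2r; rewrite ?nnegrE ?divr_ge0 //; exact: ltW.
- rewrite /normal_fun ler_expR !mulNr lerN2 subr0.
  apply: ler_wpM2l; first exact: sqr_ge0.
  rewrite lef_pV2 ?posrE ?mulrn_wgt0 ?exprn_gt0 //.
  by rewrite lerMn2r /=; apply: lerXn2r; rewrite ?nnegrE //; exact: ltW.
Qed.

(** Used because grid times only converge to the prescribed times. Densities converge pointwise and
    are eventually dominated by 4 times the density with deviation 2 l. *)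
Lemma gaussP_cvg (s : nat -> R) (l : R) A : (0 < l)%R -> s @ \oo --> l -> measurable A ->
  gaussP (s n) A @[n --> \oo] --> gaussP l A.
Proof.
move=> l0 sl mA.
have bnd : \forall n \near \oo, (l / 2 <= s n <= 2 * l)%R.
  have h1 : (l / 2 < l)%R by lra.
  have h2 : (l < 2 * l)%R by lra.
  near=> n; apply/andP; split; apply: ltW; near: n.
    exact: cvgr_gt sl _ h1.
  exact: cvgr_lt sl _ h2.
have [N _ hN] := bnd.
rewrite -(cvg_shiftn N).
under eq_fun do rewrite (gaussPE _ mA).
rewrite (gaussPE _ mA) /normal_prob.
pose mu := @lebesgue_measure R.
have mpdf m a : measurable_fun A (fun x : R => (normal_pdf m a x)%:E).
  by apply: measurable_funTS; apply/measurable_EFinP; exact: measurable_normal_pdf.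
have := @dominated_convergence _ _ _ mu A mA
  (fun n (x : R) => (normal_pdf 0%R (s (n + N)%N) x)%:E) (fun x => (normal_pdf 0%R l x)%:E)
  (fun x => (4 * normal_pdf 0%R (2 * l)%R x)%:E).
case=> //.
- by move=> n; exact: mpdf.
- exact: mpdf.
- apply: aeW => x _; apply: cvg_EFin; first exact: nearW.
  have s0 n : (s (n + N)%N != 0)%R.
    by rewrite gt_eqF // (lt_le_trans _ (andP (hN (n + N)%N (leq_addl _ _))).1) // divr_gt0.
  rewrite normal_pdfE ?gt_eqF // /normal_pdf.
  under eq_fun do rewrite (negbTE (s0 _)).
  have sl' : s (n + N)%N @[n --> \oo] --> l by rewrite cvg_shiftn.
  have sl2 : (s (n + N)%N ^+ 2)%R @[n --> \oo] --> (l ^+ 2)%R.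
    by rewrite expr2; under eq_fun do rewrite expr2; exact: cvgM.
  have p0 : (0 < l ^+ 2 *+ 2)%R by rewrite mulrn_wgt0 // exprn_gt0.
  apply: cvgM; rewrite /normal_peak /normal_fun.
    apply: cvgV; first by rewrite gt_eqF // sqrtr_gt0 mulrn_wgt0 // mulr_gt0 ?pi_gt0 // exprn_gt0.
    apply: continuous_cvg; first exact: sqrt_continuous.
    rewrite mulr2n; under eq_fun do rewrite mulr2n.
    by apply: cvgD; apply: cvgMr_tmp.
  apply: continuous_cvg; first exact: continuous_expR.
  apply: cvgMl_tmp; apply: cvgV; first by rewrite gt_eqF.
  by rewrite mulr2n; under eq_fun do rewrite mulr2n; exact: cvgD.
- rewrite (_ : (fun x => _) = (fun x => 4%:E * (normal_pdf 0 (2 * l) x)%:E)); last first.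
    by apply/funext => x; rewrite EFinM.
  apply: integrableZl => //; apply: (@integrableS _ _ _ mu setT) => //.
  exact: integrable_normal_pdf.
- apply: aeW => x n _; rewrite gee0_abs ?lee_fin ?normal_pdf_ge0 //.
  by apply: normal_pdf_le => //; apply: hN; exact: leq_addl.
Unshelve. all: by end_near. Qed.

End GaussConv.

Section Independence.
Variable R : realType.
Local Open Scope ereal_scope.
Context d (T : measurableType d) (a : T -> nat -> R).
Hypothesis ma : forall k, measurable_fun setT (a^~ k).

Definition box (K : nat) (A : nat -> set R) : set T :=
  [set x | forall k, (k < K)%N -> A k (a x k)].

Lemma measurable_box K A : (forall k, measurable (A k)) -> measurable (box K A).
Proof.
move=> mA; have -> : box K A = \bigcap_(k in [set k | (k < K)%N]) (a^~ k @^-1` A k).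
  by apply/seteqP; split => x /= h k; exact: h.
by apply: fin_bigcap_measurable => [|k _]; [exact: finite_II|]; rewrite -[X in measurable X]setTI; exact: ma.
Qed.

Variables (P : probability T R) (s : R).
Hypothesis s0 : (0 < s)%R.
(** Independence of [C] from the first [i] variables; full sets [A k] show that [p] is the
    probability of [C]. *)
Definition indep_after (i : nat) (C : set T) (p : R) := measurable C /\ (0 <= p)%R /\
  forall A, (forall k, measurable (A k)) ->
   P (box i A `&` C) = (\prod_(k < i) gaussP s (A k)) * p%:E.

Lemma indep_after_sum i c (C : set T) p B : indep_after (i + c.+1) C p -> measurable B ->
  P ([set x | B (\sum_(k < c.+1) a x (i + k)%N)%R] `&` C) =
    gaussP (Num.sqrt (s ^+ 2 *+ c.+1)) B * p%:E /\
  indep_after i ([set x | B (\sum_(k < c.+1) a x (i + k)%N)%R] `&` C)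
    (fine (gaussP (Num.sqrt (s ^+ 2 *+ c.+1)) B) * p)%R.
Proof.
move=> iC mB.
have fin B' r : measurable B' -> gaussP r B' \is a fin_num by move=> ?; exact: fin_num_measure.
pose Y i c x := (\sum_(k < c.+1) a x (i + k)%N)%R.
have mY j e : measurable_fun setT (Y j e) by apply: measurable_sum => k; exact: ma.
(* The block is summed from its last term backwards: [e.+1] terms, starting at index [j], are
   already convolved. *)
have gen e : forall j, (j + e.+1 = i + c.+1)%N -> forall A B', (forall k, measurable (A k)) -> measurable B' ->
   P (box j A `&` ([set x | B' (Y j e x)] `&` C)) =
    (\prod_(k < j) gaussP s (A k)) * (gaussP (Num.sqrt (s ^+ 2 *+ e.+1)) B' * p%:E).
  elim: e => [|e IH] j je A B' mA mB'.
    pose A' k := if k == j then B' else A k.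
    have mA' k : measurable (A' k) by rewrite /A'; case: eqP.
    have -> : box j A `&` ([set x | B' (Y j 0%N x)] `&` C) = box (i + c.+1) A' `&` C.
      rewrite -je addn1 setIA; congr (_ `&` _); rewrite /Y; apply/seteqP; split => x /=.
        rewrite big_ord1 addn0 => -[h1 h2] k; rewrite ltnS leq_eqVlt /A'.
        by case: eqP => [-> //|_ /=]; exact: h1.
      move=> h; split; last by have := h j (ltnSn j); rewrite /A' eqxx big_ord1 addn0.
      by move=> k kj; have := h k (ltnW kj); rewrite /A' (ltn_eqF kj).
    rewrite iC.2.2 // -je addn1 big_ord_recr /= {2}/A' eqxx muleA mulr1n sqrtr_sqr gtr0_norm //.
    congr (_ * _ * _); by apply: eq_bigr => k _; rewrite /A' (ltn_eqF (ltn_ord k)).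
  have je' : (j.+1 + e.+1 = i + c.+1)%N by rewrite addSnnS.
  have mD : measurable (box j A `&` C) by apply: measurableI; [exact: measurable_box|exact: iC.1].
  have [Z ZE] := @mfun_exists _ _ T (R * R)%type (fun x => (a x j, Y j.+1 e x))
     (measurable_fun_pair (ma j) (mY j.+1 e)).
  set S := Num.sqrt (s ^+ 2 *+ e.+1).
  have S0 : (0 < S)%R by rewrite sqrtr_gt0 mulrn_wgt0 // exprn_gt0.
  set q := \prod_(k < j) gaussP s (A k).
  have qfin : q \is a fin_num by apply: prode_fin_num => k _; exact: fin.
  have q0 : 0 <= q by exact: prode_ge0.
  have cc : (0 <= fine q * p)%R by rewrite mulr_ge0 ?fine_ge0 // iC.2.1.
  have h := @rect_measure _ _ _ _ R (pushforward (mrestr P mD) Z) (gaussP s) (gaussP S) _ cc.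
  have mX : measurable [set z : R * R | B' (z.1 + z.2)%R].
    have ms : measurable_fun setT (fun z : R * R => (z.1 + z.2)%R).
      by apply: measurable_funD; [exact: measurable_fst|exact: measurable_snd].
    by rewrite -[X in measurable X]setTI; exact: ms.
  have mZ : measurable_fun setT Z by rewrite ZE; exact: (measurable_fun_pair (ma j) (mY j.+1 e)).
  have {}h := h mZ _ _ mX; rewrite gauss_conv // in h.
  have -> : box j A `&` ([set x | B' (Y j e.+1 x)] `&` C) =
     Z @^-1` [set z : R * R | B' (z.1 + z.2)%R] `&` (box j A `&` C).
    have YS x : Y j e.+1 x = (a x j + Y j.+1 e x)%R.
      rewrite /Y big_ord_recl /= addn0; congr (_ + _)%R; apply: eq_bigr => k _.
      by rewrite /bump leq0n add1n addnS addSn.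
    rewrite setICA; congr (_ `&` _); rewrite ZE.
    by apply/seteqP; split => x /=; rewrite YS.
  have sq : (Num.sqrt (s ^+ 2 + S ^+ 2) = Num.sqrt (s ^+ 2 *+ e.+2))%R.
    by rewrite sqr_sqrtr -?mulrS // mulrn_wge0 // sqr_ge0.
  rewrite -/S -sq.
  have -> : q * (gaussP (Num.sqrt (s ^+ 2 + S ^+ 2)) B' * p%:E) =
     gaussP (Num.sqrt (s ^+ 2 + S ^+ 2)) B' * (fine q * p)%:E.
    by rewrite EFinM fineK // muleCA.
  apply: h => A1 B1 mA1 mB1.
  pose A' k := if k == j then A1 else A k.
  have mA' k : measurable (A' k) by rewrite /A'; case: eqP.
  transitivity (P (box j.+1 A' `&` ([set x | B1 (Y j.+1 e x)] `&` C))).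
    change (P (Z @^-1` (A1 `*` B1) `&` (box j A `&` C)) =
      P (box j.+1 A' `&` ([set x | B1 (Y j.+1 e x)] `&` C))).
    congr (P _); rewrite !setIA; congr (_ `&` _); apply/seteqP; split => x /=; rewrite ZE /=.
      move=> [[h1 h2] h3]; split => // k; rewrite ltnS leq_eqVlt /A'.
      by case: eqP => [-> //|_ /=]; exact: h3.
    move=> [h3 h2]; split; last by move=> k kj; have := h3 k (ltnW kj); rewrite /A' (ltn_eqF kj).
    by split => //; have := h3 j (ltnSn j); rewrite /A' eqxx.
  rewrite (IH _ je' A' B1 mA' mB1) -/S big_ord_recr /= {2}/A' eqxx.
  have -> : \prod_(k < j) gaussP s (A' k) = q.
    by apply: eq_bigr => k _; rewrite /A' (ltn_eqF (ltn_ord k)).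
  rewrite EFinM fineK //; rewrite -!muleA; rewrite muleC -!muleA; congr (_ * _).
  by congr (_ * _); rewrite muleC.
have m1 : measurable ([set x | B (Y i c x)] `&` C).
  apply: measurableI; last exact: iC.1.
  by rewrite -[X in measurable X]setTI; exact: mY.
split; last split => //; last split.
- have := gen c i erefl (fun=> setT) B (fun=> measurableT) mB.
  rewrite big1 ?mul1e; last by move=> k _; exact: probability_setT.
  have -> : box i (fun=> setT) = setT by apply/seteqP; split.
  by rewrite setTI.
- by rewrite mulr_ge0 ?fine_ge0 // iC.2.1.
- by move=> A mA; rewrite (gen c i erefl A B mA mB) EFinM fineK // fin.
Qed.

End Independence.

(** * Finite-dimensional laws of the Brownian motion *)

Section BrownianLaw.
Variable R : realType.
Local Notation P := (coinP R).

Fixpoint gw (s : R) (l : seq (R * set R)) : R :=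
  match l with
  | [::] => 1
  | (t, A) :: l' => fine (gaussP (Num.sqrt (t - s)) A) * gw t l'
  end.

Lemma gw_ge0 s l : 0 <= gw s l.
Proof. by elim: l s => [|[t A] l IH] s //=; rewrite mulr_ge0 ?fine_ge0. Qed.

Lemma measurable_bev d (T : measurableType d) (B : R -> T -> R) s l :
  (forall t, measurable_fun setT (B t)) -> all_measurable l -> measurable (bev B s l).
Proof.
move=> mB; elim: l s => [|[t A] l IH] s //= [mA ml].
apply: measurableI; last exact: IH.
rewrite -[X in measurable X]setTI.
by apply: (measurable_funB (mB t) (mB s)).
Qed.

Lemma incr_box n K A : (forall k, measurable (A k)) ->
  P (box (incr R n) K A) = (\prod_(k < K) gaussP (sd R n) (A k))%E.
Proof.
move=> mA.
have mi := @measurable_incr R n.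
have mb : measurable (box (incr R n) K A) by exact: measurable_box.
pose g k (y : R) : \bar R := (\1_(A k) y)%:E.
have tg : test_funs g.
  move=> k; split; first by apply/measurable_EFinP; exact: measurable_indic.
  by move=> y; rewrite lee_fin indicE.
have := (incr_law R n).2 K g tg.
under [X in _ = X -> _]eq_bigr do rewrite /g integral_indic // setIT.
move=> <-.
have PE : (\int[P]_x (\1_(box (incr R n) K A) x)%:E = P (box (incr R n) K A))%E.
  by rewrite integral_indic // setIT.
rewrite -PE; apply: eq_integral => x _; rewrite /g prodEFin; congr EFin.
rewrite indicE; have [|] := boolP (x \in _).
  rewrite inE => h; rewrite big1 // => k _; rewrite indicE mem_set //; exact: h.
move=> /negP h; have [k /not_implyP [kK hk]] : exists k, ~ ((k < K)%N -> A k (incr R n x k)).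
  by apply/existsNP => h'; apply: h; rewrite inE.
by rewrite (bigD1 (Ordinal kK)) //= indicE memNset // mul0r.
Qed.

Fixpoint idx_path (n : nat) (s : R) (l : seq (R * set R)) : Prop :=
  match l with
  | [::] => True
  | (t, A) :: l' => (idx n s < idx n t)%N /\ idx_path n t l'
  end.

Fixpoint gwn (n : nat) (s : R) (l : seq (R * set R)) : R :=
  match l with
  | [::] => 1
  | (t, A) :: l' =>
     fine (gaussP (Num.sqrt (sd R n ^+ 2 *+ (idx n t - idx n s))) A) * gwn n t l'
  end.

Lemma bstep_law n s l : idx_path n s l -> all_measurable l ->
  indep_after (incr R n) P (sd R n) (idx n s) (bev (fun t x => bstep n x t) s l) (gwn n s l).
Proof.
elim: l s => [|[t A] l IH] s /=.
  move=> _ _; split=> //; split=> // A mA; rewrite setIT mule1; exact: incr_box.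
move=> [st pl] [mA ml].
pose c := (idx n t - idx n s).-1.
have cE : (idx n t - idx n s = c.+1)%N by rewrite /c prednK // subn_gt0.
have tE : idx n t = (idx n s + c.+1)%N by rewrite -cE subnKC // ltnW.
have h := IH t pl ml; rewrite tE in h.
have [_] := indep_after_sum (@measurable_incr R n) (sd_gt0 R n) h mA.
rewrite cE.
suff -> : [set x | A (\sum_(k < c.+1) incr R n x (idx n s + k))] =
    [set w | A (bstep n w t - bstep n w s)] by [].
apply/funext => x /=; congr (A _); rewrite /bstep.
by rewrite tE big_split_ord /= addrAC subrr add0r.
Qed.

(** Open half lines make the event stable under small perturbations of the path; the margin [e]
    gives the same stability to the complement. *)
Fixpoint shift_sets (l : seq (R * R)) (e : R) : seq (R * set R) :=
  match l with
  | [::] => [::]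
  | (t, z) :: l' => (t, `]z + e, +oo[%classic) :: shift_sets l' e
  end.

Lemma shift_measurable l e : all_measurable (shift_sets l e).
Proof. by elim: l => [|[t z] l IH] //=; split. Qed.

Lemma map_shift l e : map fst (shift_sets l e) = map fst l.
Proof. by elim: l => [|[t z] l IH] //=; rewrite IH. Qed.

Lemma idx_cvg (t : R) : 0 <= t -> (idx n t)%:R * 2 ^- n @[n --> \oo] --> t.
Proof.
move=> t0.
have h n : t - 2 ^- n <= (idx n t)%:R * 2 ^- n <= t.
  have p2 : 0 < 2 ^+ n :> R by rewrite exprn_gt0.
  have := @truncn_itv _ (t * 2 ^+ n) ltac:(by rewrite mulr_ge0 // ltW).
  rewrite -/(idx n t) -addn1 natrD => /andP[h1 h2].
  rewrite ler_pdivrMr // h1 andbT ler_pdivlMr // mulrBl mulVf ?gt_eqF //; lra.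
apply: (@squeeze_cvgr _ _ _ _ (fun n => t - 2 ^- n) (fun=> t)).
- by apply: nearW.
- rewrite -[X in _ --> X]subr0; apply: cvgB; first exact: cvg_cst.
  under eq_fun do rewrite -exprVn.
  by apply: cvg_expr; rewrite ger0_norm; lra.
- exact: cvg_cst.
Qed.

Lemma idx_path_near s l : 0 <= s -> path <%R s (map fst l) -> \forall n \near \oo, idx_path n s l.
Proof.
elim: l s => [|[t A] l IH] s s0 /=; first by move=> _; exact: nearW.
move=> /andP[st pl]; have t0 : 0 <= t by rewrite (le_trans s0) // ltW.
have := IH t t0 pl.
have st2 : s < (s + t) / 2 by lra.
have ts2 : (s + t) / 2 < t by lra.
have h1 : \forall n \near \oo, (idx n s)%:R * 2 ^- n < (s + t) / 2.
  by apply: (cvgr_lt _ (idx_cvg s0) _ st2).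
have h2 : \forall n \near \oo, (s + t) / 2 < (idx n t)%:R * 2 ^- n.
  by apply: (cvgr_gt _ (idx_cvg t0) _ ts2).
move=> h3; near=> n; split; last by near: n.
have p2 : 0 < 2 ^- n :> R by rewrite invr_gt0 exprn_gt0.
rewrite -(ltr_nat R) -(ltr_pM2r p2); apply: lt_trans (_ : (s + t) / 2 < _); near: n => //.
Unshelve. all: by end_near. Qed.

Lemma gwn_cvg s l : 0 <= s -> path <%R s (map fst l) -> all_measurable l ->
  gwn n s l @[n --> \oo] --> gw s l.
Proof.
elim: l s => [|[t A] l IH] s s0 /=; first by move=> _ _; exact: cvg_cst.
move=> /andP[st pl] [mA ml]; have t0 : 0 <= t by rewrite (le_trans s0) // ltW.
apply: cvgM; last exact: IH.
have c1 : (idx n t)%:R * 2 ^- n - (idx n s)%:R * 2 ^- n @[n --> \oo] --> t - s.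
  by apply: cvgB; exact: idx_cvg.
have c2 : Num.sqrt (sd R n ^+ 2 *+ (idx n t - idx n s)) @[n --> \oo] --> Num.sqrt (t - s).
  apply: continuous_cvg; first exact: sqrt_continuous.
  suff -> : (fun n => sd R n ^+ 2 *+ (idx n t - idx n s)) =
     (fun n => (idx n t)%:R * 2 ^- n - (idx n s)%:R * 2 ^- n) by [].
  by apply/funext => n; rewrite sd2 -mulr_natl natrB ?mulrBl // idx_mono // ltW.
have ts0 : 0 < Num.sqrt (t - s) by rewrite sqrtr_gt0 subr_gt0.
have := gaussP_cvg ts0 c2 mA.
rewrite -[X in _ --> X -> _]fineK; last exact: fin_num_measure.
exact: fine_cvg.
Qed.

(** Fatou's lemma for events: outcomes of [E] outside a null set lie eventually in [F n]. *)
Lemma prob_le_lim (E : set coinT) (F : nat -> set coinT) (v : nat -> R) (l : R) :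
  measurable E -> (forall n, measurable (F n)) ->
  (forall x, ~ bad R x -> E x -> \forall n \near \oo, F n x) ->
  (\forall n \near \oo, P (F n) = (v n)%:E) -> v @ \oo --> l -> (P E <= l%:E)%E.
Proof.
move=> mE mF EF PF vl.
pose G n := \bigcap_(k in [set k | (n <= k)%N]) F k.
have mG n : measurable (G n) by apply: bigcap_measurable; [exists n => /=|].
have mB := measurable_bad R.
have EG : E `<=` (\bigcup_n G n) `|` bad R.
  move=> x Ex; have [xb|xb] := pselect (bad R x); [by right|left].
  by have [N _ h] := EF x xb Ex; exists N => // k /= Nk; exact: h.
have mU : measurable (\bigcup_n G n) by exact: bigcup_measurable.
apply: (@le_trans _ _ (P (\bigcup_n G n))).
  apply: (@le_trans _ _ (P ((\bigcup_n G n) `|` bad R))).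
    by apply: le_measure; rewrite ?inE //; exact: measurableU.
  apply: (le_trans (measureU2 _ _ _)) => //.
  by rewrite [X in (_ + X)%E](bad_null R) adde0.
have ndG : nondecreasing_seq G.
  by move=> n m nm; apply/subsetPset => x Gx k /= mk; apply: Gx; rewrite /= (leq_trans nm).
have cG := @nondecreasing_cvg_mu _ _ _ P G mG mU ndG.
have cv : (v n)%:E @[n --> \oo] --> l%:E by apply: cvg_EFin; [exact: nearW|exact: vl].
apply: (@lee_cvg_to _ _ _ _ _ _ _ _ cG cv).
near=> n; have <- : P (F n) = (v n)%:E by near: n.
change (P (G n) <= P (F n))%E.
by apply: le_measure; rewrite ?inE // => x Gx; exact: (Gx n (leqnn n)).
Unshelve. all: by end_near. Qed.

Lemma bev_near (B : nat -> R -> coinT -> R) (C : R -> coinT -> R) x s l :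
  (forall t, B n t x @[n --> \oo] --> C t x) ->
  bev C s (shift_sets l 0) x -> \forall n \near \oo, bev (B n) s (shift_sets l 0) x.
Proof.
move=> BC; elim: l s => [|[t z] l IH] s /=; first by move=> _; exact: nearW.
rewrite in_itv /= andbT => -[h1 /IH h2].
have h3 : \forall n \near \oo, z + 0 < B n t x - B n s x.
  by apply: (cvgr_gt _ (cvgB (BC t) (BC s)) _ h1).
near=> n; split; last by near: n.
by rewrite in_itv /= andbT; near: n.
Unshelve. all: by end_near. Qed.

Lemma bevC_near (B : nat -> R -> coinT -> R) (C : R -> coinT -> R) x s l e : 0 < e ->
  (forall t, B n t x @[n --> \oo] --> C t x) ->
  ~ bev C s (shift_sets l 0) x -> \forall n \near \oo, ~ bev (B n) s (shift_sets l e) x.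
Proof.
move=> e0 BC; elim: l s => [|[t z] l IH] s //=.
rewrite in_itv /= andbT => /not_andP [h|/IH h2]; last first.
  by near=> n => -[_]; near: n.
have h1 : C t x - C s x < z + e.
  by move/negP: h; rewrite addr0 -leNgt => h; rewrite (le_lt_trans h) // ltrDl.
have h3 : \forall n \near \oo, B n t x - B n s x < z + e.
  by apply: (cvgr_lt _ (cvgB (BC t) (BC s)) _ h1).
near=> n; rewrite in_itv /= andbT => -[h4 _]; move: h4; apply/negP; rewrite -leNgt ltW //.
by near: n.
Unshelve. all: by end_near. Qed.

Lemma gw_shift_cvg s l : gw s (shift_sets l n.+1%:R^-1) @[n --> \oo] --> gw s (shift_sets l 0).
Proof.
elim: l s => [|[t z] l IH] s /=; first exact: cvg_cst.
apply: cvgM; last exact: IH.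
set r := Num.sqrt _.
pose F n : set R := `]z + n.+1%:R^-1, +oo[%classic.
have FU : \bigcup_n F n = `]z + 0, +oo[%classic.
  apply/seteqP; split => y; rewrite /F /=.
    move=> [n _] /=; rewrite !in_itv /= !andbT addr0 => h.
    by apply: lt_trans h; rewrite ltrDl invr_gt0.
  rewrite in_itv /= andbT addr0 => h.
  have [n hn] := @ltr_add_invr R z y h.
  by exists n => //=; rewrite in_itv /= andbT.
have ndF : nondecreasing_seq F.
  move=> n m nm; apply/subsetPset => y; rewrite /F /= !in_itv /= !andbT; apply: le_lt_trans.
  by rewrite lerD2l lef_pV2 ?posrE // ler_nat.
have := @nondecreasing_cvg_mu _ _ _ (gaussP r) F (fun=> measurable_itv _)
   (bigcup_measurable (fun _ _ => measurable_itv _)) ndF.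
rewrite FU -[X in _ --> X -> _]fineK; last exact: fin_num_measure.
exact: fine_cvg.
Qed.

Lemma bm_half_lines s l : 0 <= s -> path <%R s (map fst l) ->
  P (bev (@bm R) s (shift_sets l 0)) = (gw s (shift_sets l 0))%:E.
Proof.
move=> s0 pl.
pose B (n : nat) (t : R) (x : coinT) : R := bstep n x t.
have mbm t := @measurable_bm R t.
have mbs n t := @measurable_bstep R n t.
have mE := measurable_bev s mbm (shift_measurable l 0).
have near_law e : \forall n \near \oo, P (bev (B n) s (shift_sets l e)) = (gwn n s (shift_sets l e))%:E.
  have := @idx_path_near s (shift_sets l e) s0; rewrite map_shift => /(_ pl) h.
  near=> n.
  have ip : idx_path n s (shift_sets l e) by near: n.
  have [_ [_ /(_ (fun=> setT) (fun=> measurableT))]] := bstep_law ip (shift_measurable l e).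
  rewrite big1 ?mul1e; last by move=> k _; exact: probability_setT.
  by have -> : box (incr R n) (idx n s) (fun=> setT) = setT; [apply/seteqP|rewrite setTI].
have lim_law e : gwn n s (shift_sets l e) @[n --> \oo] --> gw s (shift_sets l e).
  by apply: gwn_cvg => //; [rewrite map_shift|exact: shift_measurable].
apply/eqP; rewrite eq_le; apply/andP; split.
  apply: (@prob_le_lim _ (fun n => bev (B n) s (shift_sets l 0)) _ _ mE _ _ (near_law 0) (lim_law 0)).
  - by move=> n; apply: measurable_bev => [t|]; [exact: mbs|exact: shift_measurable].
  - by move=> x xb; apply: bev_near => t; exact: bm_cvg.
(* The lower bound goes through the complement, with a margin that is sent to 0 afterwards. *)
have lower e : 0 < e -> ((gw s (shift_sets l e))%:E <= P (bev (@bm R) s (shift_sets l 0)))%E.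
  move=> e0.
  have h : (P (~` bev (@bm R) s (shift_sets l 0)) <= (1 - gw s (shift_sets l e))%:E)%E.
    apply: (@prob_le_lim _ (fun n => ~` bev (B n) s (shift_sets l e)) (fun n => 1 - gwn n s (shift_sets l e))).
    - exact: measurableC.
    - by move=> n; apply: measurableC; apply: measurable_bev => [t|]; [exact: mbs|exact: shift_measurable].
    - by move=> x xb; apply: bevC_near => // t; exact: bm_cvg.
    - have := near_law e; apply: filter_app; near=> n => E.
      have mEn : measurable (bev (B n) s (shift_sets l e)).
        by apply: measurable_bev => [t|]; [exact: mbs|exact: shift_measurable].
      by rewrite EFinB -E; exact: probability_setC.
    - by apply: cvgB; [exact: cvg_cst|exact: lim_law].
  have : (1 - P (bev (@bm R) s (shift_sets l 0)) <= (1 - gw s (shift_sets l e))%:E)%E.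
    by apply: le_trans h; rewrite (probability_setC P mE).
  have Pf : P (bev (@bm R) s (shift_sets l 0)) \is a fin_num by exact: fin_num_measure.
  rewrite -(fineK Pf) -EFinB !lee_fin; lra.
have Pf : P (bev (@bm R) s (shift_sets l 0)) \is a fin_num by exact: fin_num_measure.
rewrite -(fineK Pf) lee_fin.
have cg := @gw_shift_cvg s l.
have cvg_g : cvgn (fun n => gw s (shift_sets l n.+1%:R^-1)) by apply/cvg_ex; eexists; exact: cg.
rewrite -(cvg_lim _ cg) //.
apply: limr_le => //; apply: nearW => n.
by rewrite -lee_fin fineK //; apply: lower; rewrite invr_gt0.
Unshelve. all: by end_near. Qed.

(** Half lines are replaced by measurable sets one coordinate at a time; [D] records the coordinates
    already treated and [c] their weight. *)
Lemma half_lines_extend (ts : seq R) s (D : set coinT) (c : R) :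
  measurable D -> 0 <= c ->
  (forall zs, size zs = size ts ->
     P (D `&` bev (@bm R) s (shift_sets (zip ts zs) 0)) = (c * gw s (shift_sets (zip ts zs) 0))%:E) ->
  forall l, map fst l = ts -> all_measurable l -> P (D `&` bev (@bm R) s l) = (c * gw s l)%:E.
Proof.
elim: ts s D c => [|t ts IH] s D c mD c0 H.
  by move=> [|//] _ _; exact: (H [::]).
move=> [//|[t' A] l] [-> tl] /= [mA ml].
have mbm u := @measurable_bm R u.
have mY : measurable_fun setT (fun x => bm t x - bm s x) by exact: measurable_funB.
have mYA A' : measurable A' -> measurable [set x | A' (bm t x - bm s x)].
  by move=> mA'; rewrite -[X in measurable X]setTI; exact: mY.
have fin A' : measurable A' -> gaussP (Num.sqrt (t - s)) A' \is a fin_num by move=> ?; exact: fin_num_measure.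
have := IH t (D `&` [set x | A (bm t x - bm s x)]) (c * fine (gaussP (Num.sqrt (t - s)) A)).
rewrite setIA mulrA; apply => //.
- by apply: measurableI => //; exact: mYA.
- by rewrite mulr_ge0 ?fine_ge0.
move=> zs szs; rewrite -mulrA.
set C := bev _ t _.
have mC : measurable C by apply: measurable_bev => //; exact: shift_measurable.
have mDC : measurable (D `&` C) by exact: measurableI.
set w := gw t _.
have w0 : 0 <= c * w by rewrite mulr_ge0 // gw_ge0.
have [Z ZE] := mfun_exists mY.
have := @measure_eq_half_lines R (pushforward (mrestr P mDC) Z) (mscale (NngNum w0) (gaussP (Num.sqrt (t - s)))).
have mZ : measurable_fun setT Z by rewrite ZE.
move=> /(_ mZ) h.
have E A' : pushforward (mrestr P mDC) Z A' = P (D `&` [set x | A' (bm t x - bm s x)] `&` C).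
  change (P (Z @^-1` A' `&` (D `&` C)) = P (D `&` [set x | A' (bm t x - bm s x)] `&` C)).
  by rewrite ZE setICA setIA.
refine (etrans (esym (E A)) (etrans (h _ _ A mA) _)).
- apply: (@le_lt_trans _ _ 1%E); last by rewrite ltry.
  apply: (@le_trans _ _ (P (D `&` [set x | setT (bm t x - bm s x)] `&` C))); first by rewrite -E.
  apply: probability_le1.
  by apply: measurableI => //; apply: measurableI => //; exact: (mYA setT).
- move=> z; refine (etrans (E _) _).
  change (P (D `&` [set x | `]z, +oo[%classic (bm t x - bm s x)] `&` C) =
     ((c * w)%:E * gaussP (Num.sqrt (t - s)) `]z, +oo[%classic)%E).
  have := H (z :: zs) ltac:(by rewrite /= szs); rewrite /= addr0 -/C -/w setIA => ->.
  rewrite -[in RHS](fineK (fin _ (measurable_itv _))) -EFinM; congr EFin; ring.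
- change (((c * w)%:E * gaussP (Num.sqrt (t - s)) A)%E = (c * (fine (gaussP (Num.sqrt (t - s)) A) * w))%:E).
  by rewrite -{1}(fineK (fin A mA)) -EFinM; congr EFin; ring.
Qed.

Lemma bm_w_gw s (l : seq (R * set R)) : all_measurable l -> bm_w s l = (gw s l)%:E.
Proof.
elim: l s => [|[t A] l IH] s //= [mA ml]; rewrite IH // EFinM fineK; last exact: fin_num_measure.
by rewrite gaussPE.
Qed.

Theorem bm_law (l : seq (R * set R)) : path <%R 0 (map fst l) -> all_measurable l ->
  P (bev (@bm R) 0 l) = bm_w 0 l.
Proof.
move=> pl ml; rewrite bm_w_gw // -[X in X%:E]mul1r -[X in P X]setTI.
apply: (@half_lines_extend (map fst l)) => // zs szs.
rewrite setTI mul1r; apply: bm_half_lines => //.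
by rewrite -[map fst _]/(unzip1 _) unzip1_zip // szs.
Qed.

End BrownianLaw.

(** * Transition matrices and the uniformised Markov chain *)

Section ExpmxDerive.
Variables (R : realType) (m : nat).
Implicit Types A Q : 'M[R]_m.

Lemma mulmxij p q r (A : 'M[R]_(p, q)) (B : 'M[R]_(q, r)) i j :
  (A *m B) i j = \sum_k A i k * B k j.
Proof. by rewrite mxE. Qed.

Lemma scalemxij p q (A : 'M[R]_(p, q)) (c : R) i j : (c *: A) i j = c * A i j.
Proof. by rewrite mxE. Qed.

Lemma addmxij p q (A B : 'M[R]_(p, q)) i j : (A + B) i j = A i j + B i j.
Proof. by rewrite mxE. Qed.

Lemma expmx_is_derive A i j x :
  is_derive (x : R) (1 : R) (fun y : R => expmx (y *: A) i j) ((A *m expmx (x *: A)) i j).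
Proof.
have [K K0 hK] := c2fun_exp 1%:M A (delta_mx j (0 : 'I_1)) `|x|.
have E (B : 'M[R]_m) : (B *m (delta_mx j (0 : 'I_1) : 'cV[R]_m)) i 0 = B i j.
  by rewrite -colE mxE.
pose f2 := (A *m A *m expmx (x *: A)) i j.
set f := (fun y : R => _); set f1 := (_ *m _) i j.
have hf y : `|y| <= 1 -> `|f (x + y) - (f x + y * f1 + y ^+ 2 / 2 * f2)| <= K * `|y| ^+ 3.
  by move=> y1; have := hK x y (lexx _) y1 i; rewrite !mul1mx !E.
have lim : h^-1 *: (f (h *: 1 + x) - f x) @[h --> 0^'] --> f1.
  apply/cvgrPdist_lt => eps eps0.
  pose C := `|f2| + K + 1.
  have C0 : 0 < C by rewrite ltr_wpDl // addr_ge0.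
  exists (Num.min 1 (eps / C)); first by rewrite /= lt_min ltr01 divr_gt0.
  move=> h /=; rewrite sub0r normrN lt_min => /andP[h1 h2] hn0.
  have := hf h (ltW h1).
  rewrite [h *: 1]mulr1 (addrC h x) -[_ *: (_ - _)]/(h^-1 * (f (x + h) - f x)).
  move=> b; rewrite distrC.
  have -> : h^-1 * (f (x + h) - f x) - f1 =
     h^-1 * (f (x + h) - (f x + h * f1 + h ^+ 2 / 2 * f2)) + h / 2 * f2.
    by field.
  have h0 : 0 < `|h| by rewrite normr_gt0.
  apply: (@le_lt_trans _ _ (C * `|h|)); last by rewrite mulrC -ltr_pdivlMr.
  apply: (le_trans (ler_normD _ _)).
  rewrite !normrM normfV [`|2^-1|]ger0_norm ?invr_ge0 //.
  have b1 : `|h|^-1 * `|f (x + h) - (f x + h * f1 + h ^+ 2 / 2 * f2)| <= K * `|h|.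
    rewrite mulrC ler_pdivrMr //; apply: (le_trans b).
    by rewrite -mulrA ler_wpM2l // exprS -expr2 ler_piMl ?exprn_ge0 // ltW.
  apply: (le_trans (lerD b1 (lexx _))).
  by rewrite /C !mulrDl mul1r; have := mulr_ge0 (normr_ge0 f2) (normr_ge0 h); lra.
apply: DeriveDef; last by apply/cvg_lim => //; exact: lim.
by apply/cvg_ex; exists f1; exact: lim.
Qed.

Lemma expmx_comm A x : A *m expmx (x *: A) = expmx (x *: A) *m A.
Proof. by rewrite -(@expmx_intertwine _ _ _ (x *: A) (x *: A)) // -scalemxAl -scalemxAr. Qed.

(** The product e^{-xA} e^{Lx} e^{xQ} with A = Q + L has derivative 0, hence stays the identity. *)
Lemma expmx_shift Q (L t : R) : expmx (t *: (Q + L%:M)) = expR (L * t) *: expmx (t *: Q).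
Proof.
pose A := Q + L%:M.
pose g i j k (x : R) := expmx (x *: (- A)) i k * (expR (L * x) * expmx (x *: Q) k j).
have dg i j k (x : R) : is_derive x (1 : R) (g i j k)
   (expmx (x *: (- A)) i k * (expR (L * x) * (Q *m expmx (x *: Q)) k j + expmx (x *: Q) k j * (L * expR (L * x)))
    + (expR (L * x) * expmx (x *: Q) k j) * ((- A) *m expmx (x *: (- A))) i k).
  have d1 := expmx_is_derive (- A) i k x.
  have d2 := expmx_is_derive Q k j x.
  have d3 : is_derive x (1 : R) (fun y : R => expR (L * y)) (L * expR (L * x)).
    by apply: is_derive_eq; rewrite [in RHS]mulrC; congr (_ * _); rewrite [LHS]mulr1.
  have d4 := is_deriveM d3 d2.
  exact: (is_deriveM d1 d4).
pose G i j x := \sum_k g i j k x.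
have dG i j (x : R) : is_derive x (1 : R) (G i j) (0 : R).
  have -> : G i j = \sum_k g i j k by apply/funext => y; rewrite fct_sumE.
  apply: is_derive_eq.
  have -> : \sum_k (expmx (x *: (- A)) i k * (expR (L * x) * (Q *m expmx (x *: Q)) k j + expmx (x *: Q) k j * (L * expR (L * x)))
    + (expR (L * x) * expmx (x *: Q) k j) * ((- A) *m expmx (x *: (- A))) i k) =
    expR (L * x) * (expmx (x *: (- A)) *m Q *m expmx (x *: Q) + expmx (x *: (- A)) *m (L%:M) *m expmx (x *: Q) +
      (- A) *m expmx (x *: (- A)) *m expmx (x *: Q)) i j.
    rewrite -mulmxA mul_mx_scalar -scalemxAl !addmxij scalemxij !mulmxij !mulrDr !mulr_sumr -!big_split /=.
    by apply: eq_bigr => k _; ring.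
  rewrite (expmx_comm (- A) x); set E := expmx (x *: - A); set W := expmx (x *: Q).
  have -> : E *m Q *m W + E *m L%:M *m W + E *m - A *m W = 0.
    by rewrite mulmxN mulNmx /A mulmxDr mulmxDl subrr.
  by rewrite [X in _ * X]mxE mulr0.
have cG i j x : G i j x = G i j 0.
  by apply: is_derive_0_is_cst; exact: dG.
have key : expmx (t *: (- A)) *m (expR (L * t) *: expmx (t *: Q)) = 1%:M.
  apply/matrixP => i j; rewrite -[LHS]/(_ i j).
  have -> : (expmx (t *: (- A)) *m (expR (L * t) *: expmx (t *: Q))) i j = G i j t.
    by rewrite mulmxij; apply: eq_bigr => k _; rewrite /g scalemxij.
  rewrite cG /G /g; under eq_bigr do rewrite !scale0r mulr0 expR0 mul1r expmx0.
  by rewrite -[in RHS](mul1mx 1%:M) [RHS]mulmxij.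
have inv : expmx (t *: A) *m expmx (t *: (- A)) = 1%:M.
  by rewrite scalerN -scaleNr -expmxD subrr scale0r expmx0.
by rewrite -[LHS]mulmx1 -key mulmxA inv mul1mx.
Qed.

Lemma exprmx_ge0 A k : (forall i j, 0 <= A i j) -> forall i j, 0 <= (A ^+ k) i j.
Proof.
move=> A0; elim: k => [|k IH] i j; first by rewrite expr0 mxE.
by rewrite exprS [X in _ <= X]mxE; apply: sumr_ge0 => l _; rewrite mulr_ge0.
Qed.

Lemma expmx_ge0 A : (forall i j, 0 <= A i j) -> forall i j, 0 <= expmx A i j.
Proof.
move=> A0 i j; have h := @expmx_sum_cvg _ _ A i j.
rewrite -(cvg_lim _ h) //; apply: limr_ge; first by apply/cvg_ex; eexists; exact: h.
apply: nearW => N; rewrite /expmx_sum summxE; apply: sumr_ge0 => k _.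
by rewrite mxE mulr_ge0 ?invr_ge0 // exprmx_ge0.
Qed.

(** It exceeds every |Q i i|, so Q + L is a nonnegative matrix; the summand 1 keeps it positive even
    when [Q] is 0. *)
Definition unif_rate Q : R := 1 + mxabs Q.

Lemma unif_rate_gt0 Q : 0 < unif_rate Q.
Proof. by rewrite ltr_pwDl // mxabs_ge0. Qed.

Lemma unif_rate_ge Q : is_generator Q -> forall i j, 0 <= (Q + (unif_rate Q)%:M) i j.
Proof.
move=> [Qoff _] i j; rewrite !mxE; have [->|ij] := eqVneq i j.
  rewrite mulr1n; have := ler_mxabs Q j j; rewrite ler_norml => /andP[h _].
  by rewrite /unif_rate; lra.
by rewrite mulr0n addr0 Qoff.
Qed.

Lemma gen_expmx_ge0 Q (t : R) : is_generator Q -> 0 <= t -> forall i j, 0 <= expmx (t *: Q) i j.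
Proof.
move=> gQ t0 i j.
have := @expmx_ge0 (t *: (Q + (unif_rate Q)%:M)) _ i j.
rewrite expmx_shift scalemxij pmulr_rge0 ?expR_gt0 //; apply => k l.
by rewrite mxE mulr_ge0 // unif_rate_ge.
Qed.

Lemma gen_expmx_row Q (t : R) : is_generator Q -> forall i, \sum_j expmx (t *: Q) i j = 1.
Proof.
move=> [_ Qr] i.
have := @expmx_intertwine R m 1 (t *: Q) 0 (const_mx 1).
rewrite mulmx0 -scalemxAl.
have -> : Q *m const_mx 1 = 0 :> 'cV[R]_m.
  apply/matrixP => k l; rewrite !mxE -[RHS](Qr k); apply: eq_bigr => j _.
  by rewrite mxE mulr1.
rewrite scaler0 => /(_ erefl) /matrixP /(_ i 0).
rewrite expmx0 mulmx1 mulmxij [const_mx _ _ _]mxE => <-; apply: eq_bigr => j _.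
by rewrite -[LHS]mulr1; congr (_ * _); rewrite mxE.
Qed.

Lemma gen_expmx_le1 Q (t : R) : is_generator Q -> 0 <= t -> forall i j, expmx (t *: Q) i j <= 1.
Proof.
move=> gQ t0 i j; rewrite -(gen_expmx_row t gQ i) (bigD1 j) //= lerDl.
by apply: sumr_ge0 => k _; exact: gen_expmx_ge0.
Qed.

(** Uniformisation: jumps occur at the constant rate [unif_rate Q] and may leave the state
    unchanged, so that holding times do not depend on the state. *)
Definition jump Q : 'M[R]_m := (unif_rate Q)^-1 *: (Q + (unif_rate Q)%:M).

Lemma jump_ge0 Q : is_generator Q -> forall i j, 0 <= jump Q i j.
Proof.
move=> gQ i j; rewrite /jump mxE mulr_ge0 //; last exact: unif_rate_ge.
by rewrite invr_ge0 ltW // unif_rate_gt0.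
Qed.

Lemma jump_row Q : is_generator Q -> forall i, \sum_j jump Q i j = 1.
Proof.
move=> [_ Qr] i; under eq_bigr do rewrite /jump mxE.
rewrite -mulr_sumr; under eq_bigr do rewrite mxE.
rewrite big_split /= Qr add0r (bigD1 i) //= mxE eqxx mulr1n big1 ?addr0.
  by rewrite mulVf // gt_eqF // unif_rate_gt0.
by move=> j ji; rewrite mxE eq_sym (negbTE ji).
Qed.

Lemma continuous_expmx A i j : continuous (fun y : R => expmx (y *: A) i j).
Proof.
by move=> x; apply: differentiable_continuous; apply/derivable1_diffP; have [] := expmx_is_derive A i j x.
Qed.

(* First-jump decomposition of the transition function. *)
Lemma first_jump Q (t : R) i j : is_generator Q -> 0 < t ->
  (\int[lebesgue_measure]_(e in `[0%R, t])
     (unif_rate Q * expR (- unif_rate Q * e) * \sum_k jump Q i k * expmx ((t - e) *: Q) k j)%:E =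
   (expmx (t *: Q) i j - expR (- unif_rate Q * t) * (i == j)%:R)%:E)%E.
Proof.
move=> gQ t0; set L := unif_rate Q; pose A := Q + L%:M.
have L0 : L != 0 by rewrite gt_eqF // unif_rate_gt0.
pose f (e : R) := expR (- L * t) * (A *m expmx ((t - e) *: A)) i j.
pose F (e : R) := - expR (- L * t) * expmx ((t - e) *: A) i j.
have cf : continuous f.
  move=> e; apply: cvgMl_tmp.
  have -> : (fun e0 : R => (A *m expmx ((t - e0) *: A)) i j) =
     (fun e0 : R => \sum_k A i k * expmx ((t - e0) *: A) k j) by apply/funext => e0; rewrite mulmxij.
  rewrite mulmxij; apply: cvgr_sum => k; apply: cvgMl_tmp.
  apply: (@continuous_comp _ _ _ (fun y : R => t - y) (fun y => expmx (y *: A) k j)).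
    by apply: continuousB => //; exact: cvg_cst.
  exact: continuous_expmx.
have dF (e : R) : is_derive e (1 : R) F (f e).
  have d1 : is_derive e (1 : R) (fun y : R => t - y) (- 1).
    have d0 := is_deriveB (is_derive_cst t e 1) (is_derive_id e (1 : R)).
    by rewrite sub0r in d0.
  have d2 := @is_derive1_comp _ (fun y : R => expmx (y *: A) i j) (fun y : R => t - y) e _ _
    (expmx_is_derive A i j (t - e)) d1.
  have d3 := is_deriveZ (- expR (- L * t)) d2.
  apply: is_derive_eq d3 _.
  rewrite /f; set z := (A *m _) i j.
  by change (- expR (- L * t) * (z * -1) = expR (- L * t) * z); ring.
have cF : continuous F.
  by move=> x; apply: differentiable_continuous; apply/derivable1_diffP; have [] := dF x.
have -> : (\int[lebesgue_measure]_(e in `[0%R, t])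
     (L * expR (- L * e) * \sum_k jump Q i k * expmx ((t - e) *: Q) k j)%:E =
   \int[lebesgue_measure]_(e in `[0%R, t]) (f e)%:E)%E.
  apply: eq_integral => e _; congr EFin; rewrite /f mulmxij mulr_sumr mulr_sumr.
  apply: eq_bigr => k _; rewrite /A expmx_shift /jump -/L !scalemxij -/A.
  have -> : expR (- L * e) = expR (- L * t) * expR (L * (t - e)) by rewrite -expRD; congr expR; ring.
  by field.
rewrite (@continuous_FTC2 _ f F) //.
- rewrite -EFinB; congr EFin; rewrite /F subrr scale0r expmx0 subr0 /A expmx_shift scalemxij [1%:M i j]mxE.
  have -> : (1 *+ (i == j) : R) = (i == j)%:R by [].
  have e1 : expR (- L * t) * expR (L * t) = 1 by rewrite -expRD mulNr addNr expR0.
  set a := expR (- L * t) in e1 *; set b := expR (L * t) in e1 *.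
  set w := expmx _ i j; set d := (i == j)%:R.
  have -> : - a * d - - a * (b * w) = (a * b) * w - a * d by ring.
  by rewrite e1 mul1r.
- exact: continuous_subspaceT.
- split; first by move=> x _; have [] := dF x.
  + by apply: cvg_at_right_filter; exact: cF.
  + by apply: cvg_at_left_filter; exact: cF.
- by move=> x _; rewrite derive1E; have [_] := dF x.
Qed.

End ExpmxDerive.

(** * Paths of the uniformised chain *)

Section ChainPath.
Variables (R : realType) (m : nat) (Q : 'M[R]_m).
Hypothesis gQ : is_generator Q.
Local Notation L := (unif_rate Q).
Local Notation P := (coinP R).

Lemma expo_exists : exists mm : probability R R,
  forall A, measurable A -> mm A = exponential_prob L A.
Proof.
pose e : probability (measurableTypeR R) R :=
  exponential_distribution_exponential_prob__canonical__probability_measure_Probability (unif_rate_gt0 Q).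
exact: (@law_exists _ _ (measurableTypeR R) R R e id (@measurable_id _ _ _)).
Qed.

Definition expoP : probability R R := sval (cid expo_exists).

Lemma expoPE A : measurable A -> expoP A = exponential_prob L A.
Proof. by move: A; exact: (svalP (cid expo_exists)). Qed.

Definition hold_q : coinT -> R := sval (cid (quantile expoP)).

Lemma measurable_hold_q : measurable_fun setT hold_q.
Proof. by have [] := svalP (cid (quantile expoP)). Qed.

Lemma hold_q_law A : measurable A -> P (hold_q @^-1` A) = expoP A.
Proof. by have [_] := svalP (cid (quantile expoP)); apply. Qed.

(** The unit interval is cut at the cumulative sums of [p]; [i] is the default value outside it. *)
Lemma discrete_rv (p : 'I_m -> R) (i : 'I_m) : (forall k, 0 <= p k) -> \sum_k p k = 1 ->
  exists J : coinT -> 'I_m, forall k, measurable [set x | J x = k] /\ P [set x | J x = k] = (p k)%:E.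
Proof.
move=> p0 p1.
pose c (n : nat) : R := \sum_(k < m | (k < n)%N) p k.
have cS (k : 'I_m) : c k.+1 = c k + p k.
  rewrite /c (bigD1 k) //= addrC; congr (_ + _); apply: eq_bigl => l.
  by rewrite ltnS [RHS]ltn_neqAle andbC.
have cmono a b : (a <= b)%N -> c a <= c b.
  move=> ab; rewrite /c [leRHS](bigID (fun k : 'I_m => (k < a)%N)) /=.
  have -> : \sum_(k < m | (k < b)%N && (k < a)%N) p k = \sum_(k < m | (k < a)%N) p k.
    by apply: eq_bigl => k; case: (ltnP k a) => ka; rewrite ?andbF // (leq_trans ka ab).
  by rewrite lerDl sumr_ge0.
have c0 : c 0%N = 0 by rewrite /c big_pred0.
have cm : c m = 1 by rewrite -p1; apply: eq_bigl => k; rewrite ltn_ord.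
have uni (u : R) (k l : 'I_m) : c k <= u < c k.+1 -> c l <= u < c l.+1 -> k = l.
  move=> /andP[k1 k2] /andP[l1 l2]; apply/val_inj/eqP; rewrite eqn_leq; apply/andP; split.
    rewrite leqNgt; apply/negP => /(cmono _) h.
    by move: (lt_le_trans l2 (le_trans h k1)); rewrite ltxx.
  rewrite leqNgt; apply/negP => /(cmono _) h.
  by move: (lt_le_trans k2 (le_trans h l1)); rewrite ltxx.
have ex (u : R) : 0 <= u < 1 -> exists k : 'I_m, c k <= u < c k.+1.
  move=> /andP[u0 u1].
  have hex : exists n, u < c n by exists m; rewrite cm.
  have hn := ex_minnP hex; case: hn => n un min.
  case: n un min => [|n] un min; first by move: un; rewrite c0 ltNge u0.
  have nm : (n < m)%N.
    by rewrite ltnNge; apply/negP => mn; have := min m; rewrite cm u1 ltnNge mn => /(_ isT).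
  exists (Ordinal nm); rewrite /= un andbT leNgt; apply/negP => h.
  by have := min n h; rewrite ltnn.
pose j (u : R) := odflt i [pick k : 'I_m | c k <= u < c k.+1].
have jE u k : 0 <= u < 1 -> (j u = k) <-> (c k <= u < c k.+1).
  move=> u01; rewrite /j; case: pickP => [l hl|] /=.
    by split => [<- //|hk]; exact: uni hl hk.
  by have [l hl] := ex u u01 => /(_ l); rewrite hl.
have mj k : measurable [set u : R | j u = k].
  have msing (l : 'I_m) : measurable [set u : R | c l <= u < c l.+1].
    have -> : [set u : R | c l <= u < c l.+1] = `[c l, c l.+1[%classic.
      by apply/seteqP; split => u /=; rewrite in_itv.
    exact: measurable_itv.
  have -> : [set u : R | j u = k] = [set u | c k <= u < c k.+1] `|`
     ((if i == k then setT else set0) `&` ~` (\bigcup_(l in [set: 'I_m]) [set u : R | c l <= u < c l.+1])).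
    apply/seteqP; split => u /=; rewrite /j; case: pickP => [l hl|h] /=.
    - by move=> <-; left.
    - move=> ->; right; rewrite eqxx; split => //.
      by move=> -[l _] /=; rewrite (h l).
    - case=> [hk|[_]]; first exact: uni hl hk.
      by case; exists l.
    - by case=> [|[]]; [rewrite h|case: eqP].
  apply: measurableU => //; apply: measurableI; first by case: ifP.
  apply: measurableC; apply: fin_bigcup_measurable => [|l _] //; exact: finite_finset.
exists (j \o coinval R) => k; have mjk : measurable [set x : coinT | (j \o coinval R) x = k].
  rewrite -[X in measurable X]setTI.
  exact: (@measurable_coinval R measurableT _ (mj k)).
split => //.
rewrite -[[set _ | _]]/(coinval R @^-1` [set u | j u = k]) coinval_unif // /unif /mrestr.
have -> : [set u | j u = k] `&` @unit_itv _ = `[c k, c k.+1[%classic.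
  apply/seteqP; split => u /=; rewrite /unit_itv /= !in_itv /=.
    by move=> [h u01]; apply/jE.
  move=> h; have u01 : 0 <= u < 1.
    move/andP: h => [h1 h2]; rewrite (le_trans _ h1) ?(lt_le_trans h2) //.
      by rewrite -cm; exact: cmono.
    by rewrite -c0; exact: cmono.
  by split => //; apply/jE.
rewrite lebesgue_measure_itv /= lte_fin cS; case: ltP => h.
  by rewrite -EFinB addrAC subrr add0r.
by congr EFin; apply/eqP; rewrite eq_le p0 /=; move: h; rewrite gerDl.
Qed.

Definition next_state (i : 'I_m) : coinT -> 'I_m :=
  sval (cid (discrete_rv i (jump_ge0 gQ i) (jump_row gQ i))).

Lemma measurable_next i k : measurable [set x | next_state i x = k].
Proof. by have [] := svalP (cid (discrete_rv i (jump_ge0 gQ i) (jump_row gQ i))) k. Qed.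

Lemma next_law i k : P [set x | next_state i x = k] = (jump Q i k)%:E.
Proof. by have [] := svalP (cid (discrete_rv i (jump_ge0 gQ i) (jump_row gQ i))) k. Qed.

(** Each step takes half of the coins for the holding time and a quarter for the jump, and leaves an
    independent quarter for what follows. *)
Definition hold_time (x : coinT) : R := hold_q (evens x).
Definition later_coins (x : coinT) : coinT := odds (odds x).
Definition jump_step (i : 'I_m) (x : coinT) : 'I_m := next_state i (evens (odds x)).

Lemma measurable_hold : measurable_fun setT hold_time.
Proof. exact: (measurableT_comp measurable_hold_q measurable_evens). Qed.

Lemma measurable_rest : measurable_fun setT later_coins.
Proof. exact: (measurableT_comp measurable_odds measurable_odds). Qed.

Lemma measurable_step i k : measurable [set x | jump_step i x = k].
Proof.
have := measurableT_comp measurable_evens measurable_odds.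
by move=> /(_ measurableT _ (measurable_next i k)); rewrite setTI.
Qed.

(** Unbounded holding times force the jump times to diverge, and they have probability 1 by a simple
    product bound. *)
Definition good_seed (x : coinT) : Prop :=
  (forall n, 0 < hold_time (iter n later_coins x)) /\ (forall T : nat, exists n, T%:R < hold_time (iter n later_coins x)).

Lemma good_rest x : good_seed x -> 0 < hold_time x /\ good_seed (later_coins x).
Proof.
move=> [h1 h2]; split; first exact: (h1 0%N).
split => [n|T]; first by rewrite -iterSr; exact: h1.
have [n hn] := h2 (maxn T (Num.truncn (hold_time x)).+1).
have Tn : T%:R < hold_time (iter n later_coins x) by rewrite (le_lt_trans _ hn) // ler_nat leq_maxl.
case: n hn Tn => [|n] hn Tn; last by exists n; rewrite -iterSr.
move: hn => /=; rewrite ltNge (le_trans (ltW (truncnS_gt (hold_time x)))) //.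
by rewrite ler_nat leq_maxr.
Qed.

Fixpoint jump_time (x : coinT) (n : nat) : R :=
  if n is n'.+1 then hold_time x + jump_time (later_coins x) n' else 0.

Lemma jump_time_ge0 x n : good_seed x -> 0 <= jump_time x n.
Proof.
by elim: n x => [|n IH] x //= /good_rest [h gr]; rewrite addr_ge0 ?IH // ltW.
Qed.

Lemma jump_time_lt x n : good_seed x -> jump_time x n < jump_time x n.+1.
Proof.
elim: n x => [|n IH] x /good_rest [h gr]; first by rewrite /= addr0.
by rewrite -[ltLHS]/(hold_time x + jump_time (later_coins x) n) ltrD2l IH.
Qed.

Lemma jump_time_hold x n : good_seed x -> hold_time (iter n later_coins x) <= jump_time x n.+1.
Proof.
elim: n x => [|n IH] x gx; first by rewrite /= addr0.
have [h gr] := good_rest gx.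
by rewrite iterSr (le_trans (IH _ gr)) // -[leRHS]/(hold_time x + jump_time (later_coins x) n.+1) lerDr ltW.
Qed.

Lemma jump_time_unbounded x (T : R) : good_seed x -> exists n, T < jump_time x n.
Proof.
move=> gx; have [n hn] := gx.2 (Num.truncn T).+1; exists n.+1.
apply: (lt_le_trans (truncnS_gt T)); apply: (le_trans (ltW hn)).
exact: jump_time_hold.
Qed.

(** [n] is fuel, the number of jumps examined; it suffices as soon as [t] precedes the n-th jump
    time. *)
Fixpoint walk (n : nat) (i : 'I_m) (x : coinT) (t : R) : 'I_m :=
  if n is n'.+1 then
    if t < hold_time x then i else walk n' (jump_step i x) (later_coins x) (t - hold_time x)
  else i.

Lemma walk_stable n n' i x t : good_seed x -> t < jump_time x n -> t < jump_time x n' ->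
  walk n i x t = walk n' i x t.
Proof.
elim: n n' i x t => [|n IH] [|n'] i x t gx //=.
- by move=> t0 _; rewrite (lt_trans t0) // (good_rest gx).1.
- by move=> _ t0; rewrite (lt_trans t0) // (good_rest gx).1.
move=> t1 t2; case: ifP => // _; apply: IH; first exact: (good_rest gx).2.
  by rewrite ltrBlDl.
by rewrite ltrBlDl.
Qed.

(** Seeds that are not good get a constant path, so that piecewise constancy holds for every
    outcome. For good seeds the amount of fuel chosen is immaterial, by [walk_stable]. *)
Definition chain_path (i : 'I_m) (t : R) (x : coinT) : 'I_m :=
  match pselect (exists n, t < jump_time x n) with
  | left e => if `[< good_seed x >] then walk (sval (cid e)) i x t else i
  | right _ => i
  end.

Lemma chainE i t x n : good_seed x -> t < jump_time x n -> chain_path i t x = walk n i x t.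
Proof.
move=> gx tn; rewrite /chain_path; case: pselect => [e|]; last by case; exists n.
rewrite (asboolT gx); apply: walk_stable => //; exact: (svalP (cid e)).
Qed.

Lemma chain_bad i t x : ~ good_seed x -> chain_path i t x = i.
Proof. by move=> gx; rewrite /chain_path; case: pselect => // e; rewrite asboolF. Qed.

Lemma chain_rec i t x : good_seed x ->
  chain_path i t x = if t < hold_time x then i else chain_path (jump_step i x) (t - hold_time x) (later_coins x).
Proof.
move=> gx; have [h gr] := good_rest gx.
have [n hn] := jump_time_unbounded (t - hold_time x) gr.
rewrite (@chainE _ _ _ n.+1 gx) /=; last by rewrite -ltrBlDl.
by case: ifP => // _; rewrite (@chainE _ _ _ n gr).
Qed.

Lemma chain_const i x n t : good_seed x -> jump_time x n <= t < jump_time x n.+1 ->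
  chain_path i t x = chain_path i (jump_time x n) x.
Proof.
elim: n i x t => [|n IH] i x t gx; have [h gr] := good_rest gx.
  rewrite /= addr0 => /andP[t0 th]; rewrite !(chain_rec _ _ gx) th.
  by rewrite h.
rewrite -[jump_time x n.+1]/(hold_time x + jump_time (later_coins x) n).
rewrite -[jump_time x n.+2]/(hold_time x + jump_time (later_coins x) n.+1) => /andP[t1 t2].
rewrite !(chain_rec _ _ gx) !ltNge.
have hs : hold_time x <= hold_time x + jump_time (later_coins x) n by rewrite lerDl jump_time_ge0.
rewrite hs (le_trans hs t1) /= IH //; last first.
  by rewrite lerBrDl ltrBlDl t1 t2.
by congr (chain_path _ _ _); ring.
Qed.

Lemma chain_jumps i x : exists tau : nat -> R,
  tau 0%N = 0 /\ (forall n, tau n < tau n.+1) /\ (forall T, exists n, T < tau n) /\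
  (forall n t, tau n <= t < tau n.+1 -> chain_path i t x = chain_path i (tau n) x).
Proof.
have [gx|gx] := pselect (good_seed x).
  exists (jump_time x); split => //; split; first by move=> n; exact: jump_time_lt.
  split; first by move=> T; exact: jump_time_unbounded.
  by move=> n t; exact: chain_const.
exists (fun n => n%:R); split => //; split; first by move=> n; rewrite ltr_nat.
split; first by move=> T; exists (Num.truncn T).+1; exact: truncnS_gt.
by move=> n t _; rewrite !chain_bad.
Qed.

Lemma measurable_iter_rest n : measurable_fun setT (iter n later_coins).
Proof.
elim: n => [|n IH]; first exact: measurable_id.
exact: (measurableT_comp measurable_rest IH).
Qed.

Lemma measurable_good : measurable [set x | good_seed x].
Proof.
have mh n : measurable_fun setT (fun x => hold_time (iter n later_coins x)).
  exact: (measurableT_comp measurable_hold (measurable_iter_rest n)).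
have lt_meas n (c : R) : measurable [set x | c < hold_time (iter n later_coins x)].
  have := measurable_fun_ltr (measurable_cst c) (mh n).
  by move=> /(_ measurableT [set true] I); rewrite setTI.
have -> : [set x | good_seed x] = (\bigcap_n [set x | 0 < hold_time (iter n later_coins x)]) `&`
   (\bigcap_T \bigcup_n [set x | T%:R < hold_time (iter n later_coins x)]).
  apply/seteqP; split => x.
    move=> [h1 h2]; split => [n _|T _]; first exact: h1.
    by have [n hn] := h2 T; exists n.
  move=> [h1 h2]; split => [n|T]; first exact: h1.
  by have [n _ hn] := h2 T I; exists n.
apply: measurableI; first by apply: bigcapT_measurable => n; exact: lt_meas.
by apply: bigcapT_measurable => T; apply: bigcupT_measurable => n; exact: lt_meas.
Qed.

Lemma measurable_walk d (T : measurableType d) n i j (x : T -> coinT) (t : T -> R) :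
  measurable_fun setT x -> measurable_fun setT t ->
  measurable [set w | walk n i (x w) (t w) = j].
Proof.
elim: n i x t => [|n IH] i x t mx mt /=.
  have [->|ij] := pselect (i = j).
    by rewrite (_ : [set _ | _] = setT) //; apply/seteqP.
  by rewrite (_ : [set _ | _] = set0) //; apply/seteqP; split.
have mhx : measurable_fun setT (fun w => hold_time (x w)) by exact: (measurableT_comp measurable_hold mx).
have ml : measurable [set w | t w < hold_time (x w)].
  have := measurable_fun_ltr mt mhx.
  by move=> /(_ measurableT [set true] I); rewrite setTI.
have -> : [set w | (if t w < hold_time (x w) then i else walk n (jump_step i (x w)) (later_coins (x w)) (t w - hold_time (x w))) = j] =
   ([set w | t w < hold_time (x w)] `&` (if i == j then setT else set0)) `|`
   (~` [set w | t w < hold_time (x w)] `&`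
      \bigcup_(k in [set: 'I_m]) ([set w | jump_step i (x w) = k] `&`
        [set w | walk n k (later_coins (x w)) (t w - hold_time (x w)) = j])).
  apply/seteqP; split => w /=.
    case: ifP => [lt ->|lt h]; first by left; rewrite eqxx.
    by right; split => //; exists (jump_step i (x w)).
  by case=> [[->]|[/negP/negbTE -> [k _ [-> ->]]]] //; case: eqP.
apply: measurableU; apply: measurableI => //; first by case: ifP.
  exact: measurableC.
apply: fin_bigcup_measurable => [|k _]; first exact: finite_finset.
apply: measurableI.
  by have := mx measurableT _ (measurable_step i k); rewrite setTI.
apply: (IH k (fun w => later_coins (x w)) (fun w => t w - hold_time (x w))).
  exact: (measurableT_comp measurable_rest mx).
exact: measurable_funB.
Qed.

(** Joint in time and seed, because the renewal argument integrates over the time of the first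
    jump. *)
Lemma measurable_chain d (T : measurableType d) i j (x : T -> coinT) (t : T -> R) :
  measurable_fun setT x -> measurable_fun setT t ->
  measurable [set w | chain_path i (t w) (x w) = j].
Proof.
move=> mx mt.
have mg : measurable [set w | good_seed (x w)].
  by have := mx measurableT _ measurable_good; rewrite setTI.
have -> : [set w | chain_path i (t w) (x w) = j] =
  ([set w | good_seed (x w)] `&` \bigcup_N \bigcap_(n in [set n | (N <= n)%N])
     [set w | walk n i (x w) (t w) = j]) `|`
  (~` [set w | good_seed (x w)] `&` (if i == j then setT else set0)).
  have ev y s : good_seed y -> exists N, forall n, (N <= n)%N -> s < jump_time y n.
    move=> gy; have [N hN] := jump_time_unbounded s gy; exists N => n /subnK <-.
    elim: (n - N)%N => [//|k IHk]; rewrite addSn; apply: (lt_trans IHk); exact: jump_time_lt.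
  apply/seteqP; split => w /=.
    have [gx|gx] := pselect (good_seed (x w)); last by rewrite chain_bad // => ->; right; rewrite eqxx.
    have [N hN] := ev _ (t w) gx.
    move=> h; left; split => //; exists N => // n /= Nn.
    by rewrite -(chainE i gx (hN n Nn)).
  case=> [[gx [N _ h]]|[gx]]; last by rewrite chain_bad //; case: eqP.
  have [N' hN'] := ev _ (t w) gx.
  rewrite (chainE i gx (hN' (maxn N N') (leq_maxr _ _))).
  exact: (h (maxn N N') (leq_maxl _ _)).
apply: measurableU; apply: measurableI => //; last by case: ifP.
  apply: bigcupT_measurable => N; apply: bigcap_measurable; first by exists N => /=.
  by move=> n _; exact: measurable_walk.
exact: measurableC.
Qed.

End ChainPath.

Lemma measure_ord_partition d (T : measurableType d) (R : realType)
  (mu : {measure set T -> \bar R}) n (F : 'I_n -> set T) (A : set T) :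
  (forall x, A x <-> exists k, F k x) -> (forall k, measurable (F k)) ->
  (forall k l x, F k x -> F l x -> k = l) -> (mu A = \sum_(k < n) mu (F k))%E.
Proof.
move=> AE mF dF.
have -> : A = \big[setU/set0]_(k < n) F k.
  rewrite -bigcup_seq; apply/seteqP; split => x.
    by move/AE => [k Fk]; exists k => //=; rewrite mem_index_enum.
  by move=> [k _ Fk]; apply/AE; exists k.
apply: measure_semi_additive_ord => //.
- by move=> k l _ _ [x [Fk Fl]]; exact: dF Fk Fl.
- by apply: bigsetU_measurable => k _.
Qed.

(** * Finite-dimensional laws of the chain by a renewal equation *)

Section ChainLaw.
Variables (R : realType) (m : nat) (Q : 'M[R]_m).
Hypothesis gQ : is_generator Q.
Local Notation L := (unif_rate Q).
Local Notation P := (coinP R).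
Local Notation q := (hold_q Q).
Local Notation hold_time := (hold_time Q).
Local Notation jump_step := (jump_step gQ).
Local Notation next_state := (next_state gQ).
Local Notation good_seed := (good_seed Q).
Local Notation chain_path := (chain_path gQ).

Let L0 : 0 < L. Proof. exact: unif_rate_gt0. Qed.

Definition expo_density (x : R) : R := if 0 < x then L * expR (- L * x) else 0.

Lemma expo_density_ge0 x : 0 <= expo_density x.
Proof. by rewrite /expo_density; case: ifP => // _; rewrite mulr_ge0 ?expR_ge0 ?(ltW L0). Qed.

Lemma measurable_expo_density : measurable_fun setT expo_density.
Proof.
apply: measurable_fun_ifT => //.
  exact: measurable_fun_ltr.
by apply: measurable_funM => //; apply: measurableT_comp => //; exact: measurable_funM.
Qed.

Local Open Scope ereal_scope.

Lemma expo_nuE A : measurable A ->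
  exponential_prob L A = \int[lebesgue_measure]_(x in A) (expo_density x)%:E.
Proof.
move=> mA; rewrite /exponential_prob; apply: ae_eq_integral => //.
- apply: measurable_funTS; apply/measurable_EFinP; exact: measurable_exponential_pdf.
- apply: measurable_funTS; apply/measurable_EFinP; exact: measurable_expo_density.
exists [set (0%R : R)]; split => //; first exact: lebesgue_measure_set1.
move=> x /= h; apply: contrapT => x0; apply: h => _; congr EFin.
rewrite /expo_density; case: ltgtP => [h|h|h].
- by rewrite exponential_pdfE // ltW.
- by rewrite lt0_exponential_pdf.
- by case: x0.
Qed.

Lemma integral_expoP (f : R -> \bar R) : measurable_fun setT f -> (forall x, 0 <= f x) ->
  \int[expoP Q]_x f x = \int[lebesgue_measure]_x (f x * (expo_density x)%:E).
Proof.
move=> mf f0.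
pose e : probability (measurableTypeR R) R :=
  exponential_distribution_exponential_prob__canonical__probability_measure_Probability L0.
transitivity (\int[e]_x f x).
  exact: (esym (@integral_law _ _ (measurableTypeR R) R R e id (@measurable_id _ _ _) (expoP Q)
    (fun A mA => esym (expoPE Q mA)) f mf f0)).
apply: (@ge0_integral_density _ (measurableTypeR R) R lebesgue_measure e expo_density) => //.
- exact: expo_density_ge0.
- exact: measurable_expo_density.
- exact: expo_nuE.
Qed.

(** Serves to show that holding times are almost surely unbounded: the first n are all at most [T]
    with probability r^n. *)
Lemma hold_le_lt1 (T : R) : exists2 r : R, (0 <= r < 1)%R & (0 <= T)%R ->
  expoP Q [set x | (x <= T)%R] = r%:E /\ P [set x | (hold_time x <= T)%R] = r%:E.
Proof.
have mS (T' : R) : measurable [set x : R | (x <= T')%R].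
  have -> : [set x : R | (x <= T')%R] = `]-oo, T']%classic by apply/seteqP; split => x; rewrite /= in_itv.
  exact: measurable_itv.
have [T0|T0] := leP 0%R T; last by exists 0%R; rewrite ?lexx ?ltr01 // leNgt T0.
have e1 : expoP Q [set x | (x <= T)%R] = (1 - expR (- L * T))%:E.
  rewrite expoPE // /exponential_prob.
  have [T1|T1] := ltP 0%R T; last first.
    have -> : T = 0%R by apply/eqP; rewrite eq_le T0 T1.
    rewrite mulr0 expR0 subrr -[LHS]/(exponential_prob L _) expo_nuE; last exact: (mS 0%R).
    by apply: integral0_eq => x /= x0; rewrite /expo_density ltNge x0.
  rewrite EFinB -exponential_prob_itv0c // /exponential_prob.
  have -> : [set x : R | (x <= T)%R] = [set x | (x < 0)%R] `|` `[0%R, T]%classic.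
    apply/seteqP; split => x /=; rewrite in_itv /=.
      by move=> h; case: (ltP x 0%R) => x0; [left|right].
    by case=> [h|/andP[]//]; rewrite (le_trans (ltW h)).
  have mN : measurable [set x : R | (x < 0)%R].
    have -> : [set x : R | (x < 0)%R] = `]-oo, 0%R[%classic by apply/seteqP; split => x; rewrite /= in_itv.
    exact: measurable_itv.
  rewrite ge0_integral_setU //.
  - rewrite integral0_eq ?add0e // => x /= x0.
    by rewrite lt0_exponential_pdf.
  - by apply: measurable_funTS; apply/measurable_EFinP; exact: measurable_exponential_pdf.
  - by move=> x _; rewrite lee_fin exponential_pdf_ge0 // ltW.
  - rewrite disj_set2E; apply/eqP/seteqP; split => x //= [x0]; rewrite in_itv /= => /andP[x1 _].
    by move: (lt_le_trans x0 x1); rewrite ltxx.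
exists (1 - expR (- L * T))%R.
  by have := expR_gt0 (- L * T); have : (expR (- L * T) <= 1)%R; [rewrite -expR0 ler_expR mulNr oppr_le0 mulr_ge0 ?(ltW L0)|lra].
move=> _; split => //.
have := @coin_split R (q @^-1` [set x | (x <= T)%R]) setT.
rewrite preimage_setT setIT probability_setT mule1 hold_q_law // e1; apply => //.
by rewrite -[X in measurable X]setTI; exact: measurable_hold_q.
Qed.

Lemma coin_evens A : measurable A -> P (evens @^-1` A) = P A.
Proof.
by move=> mA; have := @coin_split R A setT mA measurableT; rewrite preimage_setT setIT probability_setT mule1.
Qed.

Lemma coin_odds A : measurable A -> P (odds @^-1` A) = P A.
Proof.
by move=> mA; have := @coin_split R setT A measurableT mA; rewrite preimage_setT setTI probability_setT mul1e.
Qed.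

Lemma coin_rest A : measurable A -> P (later_coins @^-1` A) = P A.
Proof.
move=> mA; have -> : later_coins @^-1` A = odds @^-1` (odds @^-1` A) by [].
by rewrite !coin_odds // -[X in measurable X]setTI; exact: measurable_odds.
Qed.

Lemma measurable_hold_le T : measurable [set x | (hold_time x <= T)%R].
Proof.
have := measurable_fun_ler (measurable_hold Q) (measurable_cst T).
by move=> /(_ measurableT [set true] I); rewrite setTI.
Qed.

Lemma measurable_rest_pre A n : measurable A -> measurable (iter n later_coins @^-1` A).
Proof. by move=> mA; rewrite -[X in measurable X]setTI; exact: (measurable_iter_rest n). Qed.

Lemma good_ae : P (~` [set x | good_seed x]) = 0.
Proof.
have sub : ~` [set x | good_seed x] `<=` (\bigcup_n (iter n later_coins @^-1` [set x | (hold_time x <= 0)%R])) `|`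
  (\bigcup_T \bigcap_n (iter n later_coins @^-1` [set x | (hold_time x <= T%:R)%R])).
  move=> x /= /not_andP[/existsNP[n /negP]|/existsNP[T hT]].
    by rewrite -leNgt => h; left; exists n.
  right; exists T => // n _ /=; rewrite leNgt; apply/negP => h; apply: hT; by exists n.
have m1 : measurable (\bigcup_n (iter n later_coins @^-1` [set x | (hold_time x <= 0)%R])).
  by apply: bigcupT_measurable => n; apply: measurable_rest_pre; exact: measurable_hold_le.
have m2 T : measurable (\bigcap_n (iter n later_coins @^-1` [set x | (hold_time x <= T%:R)%R])).
  by apply: bigcapT_measurable => n; apply: measurable_rest_pre; exact: measurable_hold_le.
have iterP n A : measurable A -> P (iter n later_coins @^-1` A) = P A.
  move=> mA; elim: n => [//|n IH].
  have -> : iter n.+1 later_coins @^-1` A = later_coins @^-1` (iter n later_coins @^-1` A).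
    by apply/seteqP; split => x /=; rewrite -iterSr.
  by rewrite coin_rest //; exact: measurable_rest_pre.
have z1 : P (\bigcup_n (iter n later_coins @^-1` [set x | (hold_time x <= 0)%R])) = 0.
  apply/eqP; rewrite eq_le measure_ge0 andbT.
  apply: (le_trans (generalized_Boole_inequality _ _ _)) => //.
    by move=> n; apply: measurable_rest_pre; exact: measurable_hold_le.
  rewrite eseries0 // => n _ _; refine (etrans (iterP n _ (measurable_hold_le 0%R)) _).
  have mS : measurable [set x : R | (x <= 0)%R].
    have -> : [set x : R | (x <= 0)%R] = `]-oo, 0%R]%classic by apply/seteqP; split => x; rewrite /= in_itv.
    exact: measurable_itv.
  have -> : [set x | (hold_time x <= 0)%R] = evens @^-1` (q @^-1` [set x | (x <= 0)%R]) by [].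
  rewrite coin_evens; last by rewrite -[X in measurable X]setTI; exact: measurable_hold_q.
  rewrite hold_q_law // expoPE // expo_nuE //.
  by apply: integral0_eq => x /= x0; rewrite /expo_density ltNge x0.
have z2 T : P (\bigcap_n (iter n later_coins @^-1` [set x | (hold_time x <= T%:R)%R])) = 0.
  have [r /andP[r0 r1] /(_ (ler0n _ T)) [_ hr]] := hold_le_lt1 T%:R.
  pose D n := [set x | forall k, (k < n)%N -> (hold_time (iter k later_coins x) <= T%:R)%R].
  have mD n : measurable (D n).
    have -> : D n = \bigcap_(k in [set k | (k < n)%N]) (iter k later_coins @^-1` [set x | (hold_time x <= T%:R)%R]).
      by apply/seteqP; split.
    apply: fin_bigcap_measurable => [|k _]; first exact: finite_II.
    by apply: measurable_rest_pre; exact: measurable_hold_le.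
  have PD n : P (D n) = (r ^+ n)%:E.
    elim: n => [|n IH].
      have -> : D 0%N = setT by apply/seteqP.
      by rewrite expr0 probability_setT.
    have -> : D n.+1 = evens @^-1` (q @^-1` [set x | (x <= T%:R)%R]) `&` odds @^-1` (odds @^-1` D n).
      apply/seteqP; split => x.
        by move=> h; split; [exact: (h 0%N)|move=> k kn; have := h k.+1 kn; rewrite iterSr].
      by move=> [h1 h2] [|k] kn //; rewrite iterSr; exact: h2.
    have mq : measurable (q @^-1` [set x | (x <= T%:R)%R]).
      rewrite -[X in measurable X]setTI; apply: measurable_hold_q => //.
      have -> : [set x : R | (x <= T%:R)%R] = `]-oo, T%:R]%classic by apply/seteqP; split => x; rewrite /= in_itv.
      exact: measurable_itv.
    have mo : measurable (odds @^-1` D n) by rewrite -[X in measurable X]setTI; exact: measurable_odds.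
    rewrite coin_split // coin_odds // IH exprS EFinM; congr (_ * _).
    by rewrite -coin_evens.
  apply/eqP; rewrite eq_le measure_ge0 andbT.
  have bn n : P (\bigcap_n (iter n later_coins @^-1` [set x | (hold_time x <= T%:R)%R])) <= (r ^+ n)%:E.
    rewrite -PD; apply: le_measure; rewrite ?inE; [exact: m2|exact: mD|].
    by move=> x h k _; exact: (h k I).
  have c0 : (r ^+ n)%:E @[n --> \oo] --> 0.
    apply: cvg_EFin; first exact: nearW.
    by apply: cvg_expr; rewrite ger0_norm.
  by rewrite -(cvg_lim _ c0) //; apply: lime_ge; [apply/cvg_ex; exists 0|exact: nearW].
apply: (@subset_measure0 _ _ _ P _ _ _ _ sub) => //.
- apply: measurableC; exact: measurable_good.
- by apply: measurableU => //; exact: bigcupT_measurable.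
apply/eqP; rewrite eq_le measure_ge0 andbT; apply: (le_trans (measureU2 _ _ _)) => //.
  exact: bigcupT_measurable.
rewrite [X in X + _]z1 add0e; apply: (le_trans (generalized_Boole_inequality _ _ _)) => //.
  exact: bigcupT_measurable.
by rewrite eseries0 // => n _ _; exact: z2.
Qed.

(* The chain_path as a function of its first holding time [e] and of the remaining coins [z]. *)
Definition chain2 (i : 'I_m) (e : R) (t : R) (z : coinT) : 'I_m :=
  if (t < e)%R then i else chain_path (next_state i (evens z)) (t - e)%R (odds z).

Lemma chain_chain2 i t x : good_seed x -> chain_path i t x = chain2 i (q (evens x)) t (odds x).
Proof. by move=> gx; rewrite (chain_rec gQ _ _ gx). Qed.

Lemma measurable_kev d (T : measurableType d) (kappa : R -> T -> 'I_m) l :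
  (forall t j, measurable [set w | kappa t w = j]) -> measurable (kev kappa l).
Proof. by move=> mk; elim: l => [|[t j] l IH] //=; apply: measurableI. Qed.

Lemma measurable_chain2 d (T : measurableType d) i j (e t : T -> R) (z : T -> coinT) :
  measurable_fun setT e -> measurable_fun setT t -> measurable_fun setT z ->
  measurable [set w | chain2 i (e w) (t w) (z w) = j].
Proof.
move=> me mt mz.
have ml : measurable [set w | (t w < e w)%R].
  by have := measurable_fun_ltr mt me => /(_ measurableT [set true] I); rewrite setTI.
have -> : [set w | chain2 i (e w) (t w) (z w) = j] =
   ([set w | (t w < e w)%R] `&` (if i == j then setT else set0)) `|`
   (~` [set w | (t w < e w)%R] `&`
      \bigcup_(k in [set: 'I_m]) ([set w | next_state i (evens (z w)) = k] `&`
        [set w | chain_path k (t w - e w)%R (odds (z w)) = j])).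
  apply/seteqP; split => w; rewrite /= /chain2.
    case: ifP => [lt ->|lt h]; first by left; rewrite eqxx.
    by right; split => //; exists (next_state i (evens (z w))).
  by case=> [[->]|[/negP/negbTE -> [k _ [-> ->]]]] //; case: eqP.
have mo : measurable_fun setT (fun w => odds (z w)) by exact: (measurableT_comp measurable_odds mz).
have mev : measurable_fun setT (fun w => evens (z w)) by exact: (measurableT_comp measurable_evens mz).
apply: measurableU; apply: measurableI => //; first by case: ifP.
  exact: measurableC.
apply: fin_bigcup_measurable => [|k _]; first exact: finite_finset.
apply: measurableI.
  by have := mev measurableT _ (measurable_next gQ i k); rewrite setTI.
by apply: measurable_chain => //; exact: measurable_funB.
Qed.

Definition up (t : R) (l : seq (R * 'I_m)) : seq (R * 'I_m) := [seq (p.1 + t, p.2)%R | p <- l].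

Definition hit2 i l (w : R * coinT) : \bar R := (\1_(kev (chain2 i w.1) l) w.2)%:E.

Lemma measurable_hit2_set i l : measurable [set w : R * coinT | kev (chain2 i w.1) l w.2].
Proof.
elim: l => [|[t j] l IH] /=; first by rewrite (_ : [set _ | _] = setT).
apply: (measurableI _ _ _ IH); apply: (@measurable_chain2 _ _ i j fst (fun=> t) snd) => //.
Qed.

Lemma measurable_hit2 i l : measurable_fun setT (hit2 i l).
Proof.
apply/measurable_EFinP.
have -> : (fun w : R * coinT => \1_(kev (chain2 i w.1) l) w.2) =
   \1_[set w : R * coinT | kev (chain2 i w.1) l w.2] :> (_ -> R).
  by apply/funext => w; rewrite !indicE; congr (nat_of_bool _)%:R; apply/idP/idP; rewrite !inE.
apply: measurable_indic; exact: measurable_hit2_set.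
Qed.

Lemma hit2_ge0 i l w : 0 <= hit2 i l w.
Proof. by rewrite lee_fin indicE. Qed.

(** Conditional probability of the event given that the first holding time is [e]. *)
Definition H i l (e : R) : \bar R := P (kev (chain2 i e) l).

Lemma mkev2 i l e : measurable (kev (chain2 i e) l).
Proof.
apply: measurable_kev => t j.
by apply: (@measurable_chain2 _ _ i j (fun=> e) (fun=> t) id).
Qed.

Lemma HE i l e : H i l e = \int[P]_z hit2 i l (e, z).
Proof. by rewrite /hit2 /= integral_indic ?setIT //; exact: mkev2. Qed.

Lemma measurable_H i l : measurable_fun setT (H i l).
Proof.
have -> : H i l = fun e => \int[P]_z hit2 i l (e, z) by apply/funext => e; exact: HE.
exact: (@measurable_fun_fubini_tonelli_F _ _ _ _ _ P _ (measurable_hit2 i l) (@hit2_ge0 i l)).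
Qed.

Lemma mkev_chain i l : measurable (kev (chain_path i) l).
Proof.
by apply: measurable_kev => t j; apply: (@measurable_chain _ _ _ gQ _ _ i j id (fun=> t)).
Qed.

(** Almost every seed is good, and there the path is a function of the first holding time and of the
    remaining coins, which are independent. *)
Lemma chain_prob i l : P (kev (chain_path i) l) = \int[expoP Q]_e H i l e.
Proof.
have mg := measurable_good Q.
pose A2 := [set x | kev (chain2 i (q (evens x))) l (odds x)].
have mqe : measurable_fun setT (fun x => q (evens x)) by exact: (measurableT_comp (measurable_hold_q Q) measurable_evens).
have mA2 : measurable A2.
  have mp : measurable_fun setT (fun x => (q (evens x), odds x)).
    exact: (measurable_fun_pair mqe measurable_odds).
  by rewrite -[X in measurable X]setTI; exact: (mp measurableT _ (measurable_hit2_set i l)).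
have eqg x : good_seed x -> kev (chain_path i) l x <-> A2 x.
  move=> gx; suff gen l' : kev (chain_path i) l' x <-> kev (chain2 i (q (evens x))) l' (odds x) by exact: gen.
  elim: l' => [|[t j] l' IH] //=.
  by rewrite (chain_chain2 _ _ gx); split => -[h1 /IH h2].
transitivity (P A2).
  rewrite -[kev _ _](setIT) -(setUv [set x | good_seed x]) setIUr -[A2 in RHS]setIT -(setUv [set x | good_seed x]) [in RHS]setIUr.
  have null C : measurable C -> P (C `&` ~` [set x | good_seed x]) = 0.
    move=> mC; apply: (@subset_measure0 _ _ _ P _ (~` [set x | good_seed x])) => //; last exact: good_ae.
    - by apply: measurableI => //; exact: measurableC.
    - exact: measurableC.
  have addn C : measurable C -> P ((C `&` [set x | good_seed x]) `|` (C `&` ~` [set x | good_seed x])) = P (C `&` [set x | good_seed x]).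
    move=> mC; rewrite measureU //.
    - by rewrite [X in _ + X](null _ mC) adde0.
    - exact: measurableI.
    - by apply: measurableI => //; exact: measurableC.
    - by rewrite setIACA setICr setI0.
  rewrite (addn _ (mkev_chain i l)) (addn _ mA2); congr (P _).
  by apply/seteqP; split => x [h gx]; split => //; apply/(eqg _ gx).
have PA : \int[P]_x (\1_A2 x)%:E = P A2 by rewrite integral_indic // setIT.
rewrite -PA.
transitivity (\int[P]_x hit2 i l (q (evens x), odds x)).
  apply: eq_integral => x _; rewrite /hit2 /= !indicE.
  by have -> : (x \in A2) = (odds x \in kev (chain2 i (q (evens x))) l) by apply/idP/idP; rewrite !inE.
refine (etrans (@ge0_integral_pair _ _ _ _ R _ _ P (expoP Q) P (fun x => q (evens x)) odds (hit2 i l) mqe measurable_odds _ (measurable_hit2 i l) (@hit2_ge0 i l)) _).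
  move=> A B mA mB.
  have mqA : measurable (q @^-1` A) by rewrite -[X in measurable X]setTI; exact: measurable_hold_q.
  have -> : (fun x => q (evens x)) @^-1` A = evens @^-1` (q @^-1` A) by [].
  by refine (etrans (@coin_split R _ _ mqA mB) _); congr (_ * _); exact: hold_q_law.
by apply: eq_integral => e _; rewrite HE.
Qed.

Section Renewal.
Variables (j : 'I_m) (l0 : seq (R * 'I_m)) (w : R).
Hypothesis l0_ge0 : all (fun p => 0 <= p.1)%R l0.
Hypothesis w01 : (0 <= w <= 1)%R.
Hypothesis l0_law : P (kev (chain_path j) l0) = w%:E.

Let l1 := (0%R, j) :: l0.
Let G k s := P (kev (chain_path k) (up s l1)).
Let rho (e : R) : R := (L * expR (- L * e))%R.

Let rho0 e : (0 <= rho e)%R. Proof. by rewrite mulr_ge0 ?expR_ge0 ?ltW. Qed.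

Let mrho : measurable_fun setT rho.
Proof. by apply: measurable_funM => //; apply: measurableT_comp => //; exact: measurable_funM. Qed.

Let G_ge0 k s : 0 <= G k s. Proof. exact: measure_ge0. Qed.

Let mG k : measurable_fun setT (G k).
Proof.
have mS l : measurable [set z : R * coinT | kev (chain_path k) (up z.1 l) z.2].
  elim: l => [|[t i] l IH] /=; first by rewrite (_ : [set _ | _] = setT).
  apply: (measurableI _ _ _ IH).
  apply: (@measurable_chain _ _ _ gQ _ _ k i snd (fun z : R * coinT => t + z.1)%R) => //.
  exact: measurable_funD.
pose F (z : R * coinT) : \bar R := (\1_[set z : R * coinT | kev (chain_path k) (up z.1 l1) z.2] z)%:E.
have mF : measurable_fun setT F by apply/measurable_EFinP; apply: measurable_indic; exact: mS.
have F0 z : 0 <= F z by rewrite lee_fin indicE.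
have -> : G k = fun s => \int[P]_x F (s, x).
  apply/funext => s; rewrite /G /F.
  have -> : \int[P]_x (\1_[set z : R * coinT | kev (chain_path k) (up z.1 l1) z.2] (s, x))%:E =
     \int[P]_x (\1_(kev (chain_path k) (up s l1)) x)%:E.
    apply: eq_integral => x _; rewrite !indicE.
    have -> // : ((s, x) \in [set z : R * coinT | kev (chain_path k) (up z.1 l1) z.2]) = (x \in kev (chain_path k) (up s l1)).
    by apply/idP/idP; rewrite !inE.
  by rewrite integral_indic ?setIT //; exact: mkev_chain.
exact: (@measurable_fun_fubini_tonelli_F _ _ _ _ _ P F mF F0).
Qed.

Let SG i t e := \sum_k (jump Q i k)%:E * G k (t - e)%R.

(** The first jump precedes all times of the list, so the chain restarts from the next state with
    its clock moved by [e]. *)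
Lemma H_before i (t e : R) : (0 <= t)%R -> (e <= t)%R -> H i (up t l1) e = SG i t e.
Proof.
move=> t0 et; rewrite /H /SG.
have kE z : kev (chain2 i e) (up t l1) z <-> kev (chain_path (next_state i (evens z))) (up (t - e)%R l1) (odds z).
  have al : all (fun p => 0 <= p.1)%R l1 by rewrite /= lexx.
  elim: l1 al => [|[s k] l IH] //= /andP[s0 al].
  have -> : chain2 i e (s + t) z = chain_path (next_state i (evens z)) (s + (t - e))%R (odds z).
    by rewrite /chain2 ltNge (le_trans et) ?lerDr //= addrA.
  by split => -[h1 /(IH al) h2].
pose D k := evens @^-1` [set x | next_state i x = k] `&` odds @^-1` (kev (chain_path k) (up (t - e)%R l1)).
have mD1 k : measurable [set x | next_state i x = k] by exact: measurable_next.
have mD k : measurable (D k).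
  apply: measurableI.
    by rewrite -[X in measurable X]setTI; exact: measurable_evens.
  by rewrite -[X in measurable X]setTI; apply: measurable_odds => //; exact: mkev_chain.
refine (etrans (@measure_ord_partition _ _ _ P m D _ _ mD _) _).
- by move=> z; rewrite kE; split => [h|[k [/= <-]]//]; exists (next_state i (evens z)).
- by move=> k l z [/= <- _] [/= <- _].
apply: eq_bigr => k _; refine (etrans (@coin_split R _ _ (mD1 k) (mkev_chain k (up (t - e)%R l1))) _).
by congr (_ * _); exact: next_law.
Qed.

(** Lack of memory: at time [t] the state is still [i] and the residual holding time is e - t. *)
Lemma H_after i (t e : R) : (0 <= t)%R -> (t < e)%R ->
  H i (up t l1) e = if i == j then H i l0 (e - t)%R else 0.
Proof.
move=> t0 te; rewrite /H.
have E z : kev (chain2 i e) (up t l0) z <-> kev (chain2 i (e - t)%R) l0 z.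
  elim: l0 => [|[s k] l IH] //=.
  have -> : chain2 i e (s + t)%R z = chain2 i (e - t)%R s z.
    by rewrite /chain2 ltrBrDr opprB addrA.
  by split => -[h1 /IH h2].
have i_e z : chain2 i e (0 + t)%R z = i by rewrite /chain2 add0r te.
case: eqP => ij; last first.
  suff -> : kev (chain2 i e) (up t l1) = set0 by rewrite measure0.
  by apply/seteqP; split => z //= [h]; exfalso; apply: ij; rewrite -(i_e z).
congr (P _); apply/seteqP; split => z /=.
  by move=> [_ /E].
by move=> /E h; split => //; rewrite i_e.
Qed.

Let K (t : R) (F : 'I_m -> R -> \bar R) i :=
  \int[lebesgue_measure]_(e in `[0%R, t]) ((rho e)%:E * \sum_k (jump Q i k)%:E * F k (t - e)%R).

Let mterm (t : R) (F : 'I_m -> R -> \bar R) i : (forall k, measurable_fun setT (F k)) ->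
  (forall k s, 0 <= F k s) ->
  measurable_fun setT (fun e : R => (rho e)%:E * \sum_k (jump Q i k)%:E * F k (t - e)%R).
Proof.
move=> mF F0; apply: emeasurable_funM; first exact/measurable_EFinP.
apply: emeasurable_sum => k; apply: measurable_funeM.
by apply: (measurableT_comp (mF k)); exact: measurable_funB.
Qed.

Let term0 (t : R) (F : 'I_m -> R -> \bar R) i e : (forall k s, 0 <= F k s) ->
  0 <= (rho e)%:E * \sum_k (jump Q i k)%:E * F k (t - e)%R.
Proof.
move=> F0; rewrite mule_ge0 ?lee_fin //; apply: sume_ge0 => k _.
by rewrite mule_ge0 // lee_fin jump_ge0.
Qed.

(** Either the first holding time e is at most [t] and the chain restarts at e, or e > t and the
    exponential density is e^{-Lt} times itself shifted by [t]. *)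
Lemma renewal i (t : R) : (0 <= t)%R ->
  G i t = K t G i + (expR (- L * t) * (i == j)%:R * w)%:E.
Proof.
move=> t0; rewrite /G chain_prob integral_expoP; last 2 first.
- exact: measurable_H.
- by move=> e; exact: measure_ge0.
pose A e := (if (0 < e <= t)%R then (rho e)%:E * SG i t e else 0).
pose B e := (expR (- L * t) * (i == j)%:R)%:E * (H i l0 (e - t)%R * (expo_density (e - t))%:E).
have AB e : H i (up t l1) e * (expo_density e)%:E = A e + B e.
  rewrite /A /B; have [et|te] := leP e t.
    have -> : expo_density (e - t) = 0%R by rewrite /expo_density subr_gt0 ltNge et.
    rewrite !mule0 adde0 andbT /expo_density; case: ifP => e0; last by rewrite mule0.
    by rewrite (H_before i t0 et) muleC.
  rewrite andbF add0e (H_after i t0 te) /expo_density subr_gt0 te (le_lt_trans t0 te).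
  have -> : (L * expR (- L * e) = expR (- L * t) * (L * expR (- L * (e - t))))%R.
    by rewrite mulrCA -expRD; congr (_ * expR _)%R; ring.
  case: (i == j); last by rewrite mulr0 mul0e mul0e.
  by rewrite mulr1 EFinM muleCA.
have mA : measurable_fun setT A.
  apply: measurable_fun_ifT; last exact: measurable_cst.
    by apply: measurable_and; [exact: measurable_fun_ltr|exact: measurable_fun_ler].
  exact: (mterm t i mG G_ge0).
have A0 e : 0 <= A e by rewrite /A; case: ifP => // _; exact: (term0 t i e G_ge0).
have mB0 : measurable_fun setT (fun e => H i l0 e * (expo_density e)%:E).
  apply: emeasurable_funM; first exact: measurable_H.
  by apply/measurable_EFinP; exact: measurable_expo_density.
have B00 e : 0 <= H i l0 e * (expo_density e)%:E.
  by rewrite mule_ge0 ?lee_fin ?expo_density_ge0 //; exact: measure_ge0.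
have c0 : (0 <= expR (- L * t) * (i == j)%:R)%R by rewrite mulr_ge0 ?expR_ge0.
have msh : measurable_fun setT (fun e : R => (e - t)%R) by exact: measurable_funB.
have mBt : measurable_fun setT (fun e : R => H i l0 (e - t)%R * (expo_density (e - t))%:E).
  exact: (measurableT_comp mB0 msh).
have mB : measurable_fun setT B by exact: measurable_funeM.
have B0 e : 0 <= B e by rewrite mule_ge0.
transitivity (\int[lebesgue_measure]_e (A e + B e)).
  by apply: eq_integral => e _; exact: AB.
rewrite (@ge0_integralD _ _ _ lebesgue_measure _ measurableT A B (fun e _ => A0 e) mA (fun e _ => B0 e) mB).
congr (_ + _).
  rewrite /K [RHS]integral_mkcond; apply: ae_eq_integral => //.
  - apply/(measurable_restrictT _ (measurable_itv _)); apply: measurable_funTS; exact: (mterm t i mG G_ge0).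
  exists [set (0%R : R)]; split => //; first exact: lebesgue_measure_set1.
  move=> x /= h; apply: contrapT => x0; apply: h => _.
  rewrite patchE mem_setE in_itv /= /A; case: (ltgtP 0%R x) => //= hx.
  by case: x0.
rewrite /B (@ge0_integralZl _ _ _ lebesgue_measure _ measurableT _ mBt _ (fun e _ => B00 _)); last first.
  by rewrite lee_fin.
have -> : \int[lebesgue_measure]_e (H i l0 (e - t)%R * (expo_density (e - t))%:E) =
    \int[lebesgue_measure]_e (H i l0 e * (expo_density e)%:E).
  exact: (@ge0_integral_translate R _ (- t)%R mB0 B00).
rewrite -(integral_expoP (measurable_H i l0)); last by move=> e; exact: measure_ge0.
rewrite -chain_prob.
case: eqP => [->|_]; first by rewrite l0_law -EFinM.
by rewrite mulr0 mul0e mul0r.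
Qed.

Let v k (s : R) : R := (expmx (s *: Q) k j * w)%R.

Lemma v_ge0 k s : (0 <= s)%R -> (0 <= v k s)%R.
Proof. by move=> s0; rewrite mulr_ge0 ?(andP w01).1 // gen_expmx_ge0. Qed.

Lemma v_le1 k s : (0 <= s)%R -> (v k s <= 1)%R.
Proof.
move=> s0; case/andP: w01 => w0 w1.
by rewrite -[1%R]mulr1 ler_pM // ?gen_expmx_ge0 // gen_expmx_le1.
Qed.

Let rho_int (t : R) : (0 < t)%R ->
  \int[lebesgue_measure]_(e in `[0%R, t]) (rho e)%:E = (1 - expR (- L * t))%:E.
Proof.
move=> t0; rewrite EFinB -exponential_prob_itv0c // /exponential_prob.
by apply: eq_integral => x; rewrite inE /= in_itv /= => /andP[x0 _]; rewrite exponential_pdfE.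
Qed.

Let mv k : measurable_fun setT (fun s => v k s).
Proof.
apply: measurable_funM => //; apply: continuous_measurable_fun; exact: continuous_expmx.
Qed.

Lemma v_renewal i (t : R) : (0 < t)%R ->
  \int[lebesgue_measure]_(e in `[0%R, t]) ((rho e)%:E * \sum_k (jump Q i k)%:E * (v k (t - e))%:E)
   + (expR (- L * t) * (i == j)%:R * w)%:E = (v i t)%:E.
Proof.
move=> t0; case/andP: w01 => w0 _.
have E e : (rho e)%:E * \sum_k (jump Q i k)%:E * (v k (t - e))%:E =
   (rho e * \sum_k jump Q i k * expmx ((t - e) *: Q) k j)%:E * w%:E.
  under eq_bigr do rewrite -EFinM.
  rewrite sumEFin -!EFinM; congr EFin; rewrite -[RHS]mulrA mulr_suml.
  by apply: congr1; apply: eq_bigr => k _; rewrite /v mulrA.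
under eq_integral do rewrite E.
rewrite ge0_integralZr //; last 2 first.
- apply: measurable_funTS; apply/measurable_EFinP; apply: measurable_funM => //.
  apply: measurable_sum => k; apply: measurable_funM => //.
  have mc : measurable_fun setT (fun y : R => expmx (y *: Q) k j).
    by apply: continuous_measurable_fun; exact: continuous_expmx.
  by apply: (measurableT_comp mc); exact: measurable_funB.
- move=> e; rewrite /= in_itv /= => /andP[e0 et]; rewrite lee_fin mulr_ge0 // sumr_ge0 // => k _.
  by rewrite mulr_ge0 ?jump_ge0 // gen_expmx_ge0 // subr_ge0.
have -> := first_jump i j gQ t0.
rewrite -EFinM -EFinD; congr EFin; rewrite /v; ring.
Qed.

(** The probability and the matrix exponential satisfy the same renewal equation, whose kernel has
    mass at most 1 - e^{-LT} on [0, T]. They differ by at most 1, and each use of the equation gains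
    this factor; two one-sided bounds avoid subtracting extended reals. *)
Lemma contraction n (T : R) i t : (0 <= t <= T)%R ->
  (v i t)%:E <= G i t + ((1 - expR (- L * T)) ^+ n)%:E /\
  G i t <= (v i t + (1 - expR (- L * T)) ^+ n)%:E.
Proof.
set r := (1 - expR (- L * T))%R => tT.
have r0 : (0 <= r)%R.
  case/andP: tT => t0 tT; rewrite subr_ge0 -expR0 ler_expR mulNr oppr_le0 mulr_ge0 ?(ltW L0) //.
  exact: le_trans tT.
elim: n i t tT => [|n IH] i t /andP[t0 tT].
  rewrite expr0; split.
    by rewrite (@le_trans _ _ 1%:E) ?lee_fin ?v_le1 // leeDr.
  rewrite (@le_trans _ _ 1%:E) ?lee_fin //; last by rewrite lerDr v_ge0.
  by apply: probability_le1; exact: mkev_chain.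
move: t0; rewrite le_eqVlt => /predU1P[t0|t0].
  have E : G i t = (v i t)%:E.
    rewrite -t0 renewal // /K set_itv1 integral_set1 add0e /v scale0r expmx0 mulr0 expR0 mul1r.
    by rewrite mxE.
  rewrite E -EFinD !lee_fin; split; rewrite lerDl exprn_ge0 //.
have rn0 : (0 <= r ^+ n)%R by exact: exprn_ge0.
have add_rn (F : 'I_m -> R -> \bar R) : (forall k, measurable_fun setT (F k)) -> (forall k s, 0 <= F k s) ->
   \int[lebesgue_measure]_(e in `[0%R, t]) ((rho e)%:E * \sum_k (jump Q i k)%:E * (F k (t - e)%R + (r ^+ n)%:E))
   = K t F i + ((1 - expR (- L * t)) * r ^+ n)%:E.
  move=> mF F0.
  have E e : (rho e)%:E * \sum_k (jump Q i k)%:E * (F k (t - e)%R + (r ^+ n)%:E) =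
     (rho e)%:E * (\sum_k (jump Q i k)%:E * F k (t - e)%R) + (rho e)%:E * (r ^+ n)%:E.
    rewrite -ge0_muleDr ?lee_fin //; last by apply: sume_ge0 => k _; rewrite mule_ge0 // lee_fin jump_ge0.
    congr (_ * _).
    under eq_bigr do rewrite ge0_muleDr ?lee_fin //.
    rewrite big_split /=; congr (_ + _).
    rewrite -ge0_sume_distrl; last by move=> k _; rewrite lee_fin jump_ge0.
    by rewrite sumEFin (jump_row gQ) mul1e.
  under eq_integral do rewrite E.
  rewrite ge0_integralD //.
  - congr (_ + _); rewrite ge0_integralZr ?lee_fin //; last 2 first.
    + by apply: measurable_funTS; exact/measurable_EFinP.
    + by move=> e _; rewrite lee_fin.
    by rewrite rho_int // -EFinM.
  - by move=> e _; exact: term0.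
  - by apply: measurable_funTS; exact: mterm.
  - by move=> e _; rewrite mule_ge0 ?lee_fin.
  - by apply: measurable_funTS; apply: emeasurable_funM => //; exact/measurable_EFinP.
have step_le : ((1 - expR (- L * t)) * r ^+ n <= r ^+ n.+1)%R.
  by rewrite exprS ler_wpM2r // lerB // ler_expR !mulNr lerN2 ler_wpM2l // ltW.
pose v' k s := if (0 <= s)%R then (v k s)%:E else 0.
have mv' k : measurable_fun setT (v' k).
  apply: measurable_fun_ifT => //; first exact: measurable_fun_ler.
  exact/measurable_EFinP.
have v'0 k s : 0 <= v' k s by rewrite /v'; case: ifP => // ?; rewrite lee_fin v_ge0.
have Kv : K t v' i + (expR (- L * t) * (i == j)%:R * w)%:E = (v i t)%:E.
  rewrite -v_renewal //; congr (_ + _); apply: eq_integral => e; rewrite inE /= in_itv /= => /andP[e0 et].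
  by congr (_ * _); apply: eq_bigr => k _; rewrite /v' subr_ge0 et.
have mplus (F : 'I_m -> R -> \bar R) : (forall k, measurable_fun setT (F k)) ->
   forall k, measurable_fun setT (fun s => F k s + (r ^+ n)%:E).
  by move=> mF k; apply: emeasurable_funD.
split.
  have -> : G i t + (r ^+ n.+1)%:E = (K t G i + (r ^+ n.+1)%:E) + (expR (- L * t) * (i == j)%:R * w)%:E.
    by rewrite (renewal i (ltW t0)) addeAC.
  rewrite -Kv; apply: leeD => //.
  apply: (@le_trans _ _ (K t G i + ((1 - expR (- L * t)) * r ^+ n)%:E)); last first.
    by apply: leeD => //; rewrite lee_fin.
  rewrite -add_rn //; apply: ge0_le_integral => //.
  - by move=> e _; exact: term0.
  - by apply: measurable_funTS; exact: mterm.
  - by apply: measurable_funTS; apply: (mterm t i (F := fun k s => G k s + (r ^+ n)%:E)); [exact: mplus|move=> k s; rewrite adde_ge0].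
  move=> e; rewrite /= in_itv /= => /andP[e0 et].
  rewrite lee_wpmul2l ?lee_fin //; apply: lee_sum => k _.
  rewrite lee_wpmul2l ?lee_fin ?jump_ge0 // /v' subr_ge0 et.
  by apply: (IH k (t - e)%R _).1; rewrite subr_ge0 et (le_trans _ tT) // gerBl.
have -> : (v i t + r ^+ n.+1)%:E = (K t v' i + (r ^+ n.+1)%:E) + (expR (- L * t) * (i == j)%:R * w)%:E.
  by rewrite EFinD -Kv addeAC.
rewrite (renewal i (ltW t0)); apply: leeD => //.
apply: (@le_trans _ _ (K t v' i + ((1 - expR (- L * t)) * r ^+ n)%:E)); last first.
  by apply: leeD => //; rewrite lee_fin.
rewrite -add_rn //; apply: ge0_le_integral => //.
- by move=> e _; exact: term0.
- by apply: measurable_funTS; exact: mterm.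
- by apply: measurable_funTS; apply: (mterm t i (F := fun k s => v' k s + (r ^+ n)%:E)); [exact: mplus|move=> k s; rewrite adde_ge0].
move=> e; rewrite /= in_itv /= => /andP[e0 et].
rewrite lee_wpmul2l ?lee_fin //; apply: lee_sum => k _.
rewrite lee_wpmul2l ?lee_fin ?jump_ge0 // /v' subr_ge0 et -EFinD.
by apply: (IH k (t - e)%R _).2; rewrite subr_ge0 et (le_trans _ tT) // gerBl.
Qed.

Lemma chain_step i t : (0 <= t)%R -> G i t = (v i t)%:E.
Proof.
move=> t0; set r := (1 - expR (- L * t))%R.
have r01 : (`|r| < 1)%R.
  have : (expR (- L * t) <= 1)%R by rewrite -expR0 ler_expR mulNr oppr_le0 mulr_ge0 // ltW.
  by move=> h; rewrite ger0_norm /r ?subr_ge0 // gtrBl expR_gt0.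
have c0 : (r ^+ n)%R @[n --> \oo] --> (0%R : R) by exact: cvg_expr.
have tt : (0 <= t <= t)%R by rewrite t0 lexx.
have Gf : G i t \is a fin_num by apply: fin_num_measure; exact: mkev_chain.
have h n := contraction n i tt.
have b n : (`|fine (G i t) - v i t| <= r ^+ n)%R.
  have [] := h n; rewrite -(fineK Gf) -EFinD !lee_fin => h1 h2.
  by rewrite ler_norml; apply/andP; split; rewrite -/r in h1 h2; lra.
rewrite -(fineK Gf); congr EFin; apply/eqP; rewrite -subr_eq0 -normr_le0.
rewrite -(cvg_lim _ c0) //; apply: limr_ge; first by apply/cvg_ex; exists 0%R.
exact: nearW.
Qed.

End Renewal.

Lemma markov_w_up s t i l : markov_w Q (s + t) i (up t l) = markov_w Q s i l.
Proof.
elim: l s i => [|[u k] l IH] s i //=; rewrite IH.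
by have -> : (u + t - (s + t) = u - s)%R by ring.
Qed.

Lemma markov_w01 s i l : path <=%R s (map fst l) -> (0 <= markov_w Q s i l <= 1)%R.
Proof.
elim: l s i => [|[u k] l IH] s i /=; first by rewrite ler01 lexx.
move=> /andP[su pl]; have /andP[h0 h1] := IH u k pl.
have us : (0 <= u - s)%R by rewrite subr_ge0.
rewrite mulr_ge0 ?gen_expmx_ge0 //= -[1%R]mulr1 ler_pM // ?gen_expmx_ge0 //.
exact: gen_expmx_le1.
Qed.

(** Induction on the length: times are translated so that the first one becomes 0, and [chain_step]
    supplies the first transition. *)
Theorem chain_law i l : path <=%R 0%R (map fst l) ->
  P (kev (chain_path i) l) = (markov_w Q 0 i l)%:E.
Proof.
elim: {l}(size l) {-2}l (erefl (size l)) i => [|n IH] [|[t j] l] //=.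
  by move=> _ i _; exact: probability_setT.
move=> [sl] i /andP[t0 pl].
pose l0 := up (- t) l.
have lE : l = up t l0.
  rewrite /l0 /up -map_comp -[LHS]map_id; apply: eq_map => -[s k] /=.
  by rewrite subrK.
have l1E : (t, j) :: l = up t ((0%R, j) :: l0) by rewrite /= add0r -lE.
have p0 : path <=%R 0%R (map fst l0).
  rewrite /l0 /up -map_comp.
  have -> : map (fst \o (fun p : R * 'I_m => ((p.1 - t)%R, p.2))) l = map (fun x => x - t)%R (map fst l).
    by rewrite -map_comp.
  have shift r s : path <=%R s r -> path <=%R (s - t)%R (map (fun x => x - t)%R r).
    by elim: r s => [|u r IHr] s //= /andP[su /IHr ->]; rewrite lerD2r su.
  by rewrite -(subrr t); exact: shift.
have l0_ge0 : all (fun p => 0 <= p.1)%R l0.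
  have := order_path_min le_trans p0; rewrite all_map.
  exact: sub_all.
have l0_law k : P (kev (chain_path k) l0) = (markov_w Q 0 k l0)%:E.
  by apply: IH => //; rewrite /l0 size_map.
rewrite -[X in P X]/(kev (chain_path i) ((t, j) :: l)) l1E.
refine (etrans (chain_step l0_ge0 (markov_w01 j p0) (l0_law j) i t0) _).
have -> : markov_w Q t j l = markov_w Q 0 j l0 by rewrite [in LHS]lE -(markov_w_up 0 t) add0r.
by rewrite subr0.
Qed.

End ChainLaw.

(** * Existence of free MMBMs *)

Section SwitchedPath.
Variables (R : realType) (m : nat) (mu sigma : 'I_m -> R) (tau : nat -> R)
  (k : R -> 'I_m) (b : R -> R).
Hypotheses (tau0 : tau 0%N = 0) (tauS : forall n, tau n < tau n.+1)
  (tau_infty : forall T, exists n, T < tau n)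
  (k_const : forall n t, tau n <= t < tau n.+1 -> k t = k (tau n)).

Let g i (u : R) := mu i * u + sigma i * b u.
Let term t n := g (k (tau n)) (Num.min t (tau n.+1)) - g (k (tau n)) (Num.min t (tau n)).

Let tau_le n n' : (n <= n')%N -> tau n <= tau n'.
Proof.
move=> /subnK <-; elim: (n' - n)%N => [//|d IH]; apply: (le_trans IH).
by rewrite addSn ltW.
Qed.

Let sum_stable t N N' : t <= tau N -> t <= tau N' -> \sum_(n < N) term t n = \sum_(n < N') term t n.
Proof.
wlog NN : N N' / (N <= N')%N => [hw h h'|].
  by case: (leqP N N') => [|/ltnW] NN; [exact: hw|symmetry; exact: hw].
move=> tN _; rewrite -(subnKC NN) big_split_ord /= [X in _ + X]big1 ?addr0 // => n _.
rewrite /term !min_l ?subrr //; apply: (le_trans tN); apply: tau_le; first exact: leq_addr.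
by rewrite -addnS leq_addr.
Qed.

(** A sum over the switching intervals truncated at t. When the phase is constant from s to t, every
    phase that contributes to x t - x s equals [k s], and the difference telescopes. *)
Lemma switched_path : exists x : R -> R, x 0 = 0 /\
  forall s t, 0 <= s <= t -> (forall u, s <= u < t -> k u = k s) ->
    x t - x s = mu (k s) * (t - s) + sigma (k s) * (b t - b s).
Proof.
pose N t := sval (cid (tau_infty t)).
have tN t : t <= tau (N t) by rewrite ltW //; exact: svalP (cid (tau_infty t)).
exists (fun t => \sum_(n < N t) term t n); split.
  rewrite big1 // => n _; have tn n' : 0 <= tau n' by rewrite -tau0; exact: tau_le.
  by rewrite /term !min_l ?tn // subrr.
move=> s t /andP[s0 st] kst.
rewrite (@sum_stable s (N s) (N t)) ?tN //; last exact: le_trans (tN t).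
rewrite -sumrB.
have E n : term t n - term s n = (g (k s) (Num.min t (tau n.+1)) - g (k s) (Num.min s (tau n.+1)))
    - (g (k s) (Num.min t (tau n)) - g (k s) (Num.min s (tau n))).
  have tn := tauS n.
  have [h|h] := leP (tau n.+1) s.
    have h' : tau n <= s by exact: le_trans (ltW tn) h.
    by rewrite /term !min_r ?(le_trans h st) ?(le_trans h' st) //; ring.
  have [h'|h'] := leP t (tau n).
    have h2 : t <= tau n.+1 by exact: le_trans h' (ltW tn).
    rewrite /term !min_l ?(le_trans st h') ?(le_trans st h2) //; ring.
  have -> : k s = k (tau n).
    case: (lerP s (tau n)) => h2.
      by rewrite (kst (tau n)) // h2 h'.
    by apply: k_const; rewrite (ltW h2) h.
  rewrite /term (min_l (ltW h)) (min_r (ltW h')); ring.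
under eq_bigr do rewrite E.
rewrite -(big_mkord xpredT (fun n => (g (k s) (Num.min t (tau n.+1)) - g (k s) (Num.min s (tau n.+1)))
    - (g (k s) (Num.min t (tau n)) - g (k s) (Num.min s (tau n))))).
rewrite (telescope_sumr (fun n => g (k s) (Num.min t (tau n)) - g (k s) (Num.min s (tau n)))) //.
rewrite tau0 !(min_l (tN t)) !(min_l (le_trans st (tN t))) !(min_r s0) !(min_r (le_trans s0 st)) subrr subr0 /g.
ring.
Qed.

End SwitchedPath.

Lemma kev_comp (R : realType) m (T T' : Type) (f : T -> T') (kappa : R -> T' -> 'I_m) l :
  kev (fun t w => kappa t (f w)) l = f @^-1` kev kappa l.
Proof. by elim: l => [|[t j] l IH] //=; rewrite IH. Qed.

Lemma bev_comp (R : realType) (T T' : Type) (f : T -> T') (B : R -> T' -> R) s l :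
  bev (fun t w => B t (f w)) s l = f @^-1` bev B s l.
Proof. by elim: l s => [|[t j] l IH] s //=; rewrite IH. Qed.

Theorem free_mmbm_exists (R : realType) m (Q : 'M[R]_m) (mu sigma : 'cV[R]_m) i :
  is_generator Q -> exists (d : measure_display) (Omega : measurableType d) (P : probability Omega R)
    (kappa : R -> Omega -> 'I_m) (B X : R -> Omega -> R), free_mmbm Q mu sigma i P kappa B X.
Proof.
move=> gQ.
pose kappa t (w : coinT * coinT) := chain_path gQ i t w.1.
pose B t (w : coinT * coinT) := bm t w.2 : R.
have hX w : exists x : R -> R, x 0 = 0 /\
  forall s t, 0 <= s <= t -> (forall u, s <= u < t -> kappa u w = kappa s w) ->
    x t - x s = mu (kappa s w) 0 * (t - s) + sigma (kappa s w) 0 * (B t w - B s w).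
  have [tau [t0 [tS [tI tC]]]] := chain_jumps gQ i w.1.
  exact: (switched_path (fun i => mu i 0) (fun i => sigma i 0) (B ^~ w) t0 tS tI tC).
exists _, (coinT * coinT)%type, (coinP R \x coinP R)%E, kappa, B, (fun t w => sval (cid (hX w)) t).
split.
  move=> t j; rewrite -[X in measurable X]setTI.
  have mc : measurable [set x | chain_path gQ i t x = j].
    exact: (@measurable_chain _ _ _ gQ _ _ i j id (fun=> t)).
  exact: (@measurable_fst _ _ _ _ measurableT _ mc).
split; first by move=> t; exact: (measurableT_comp (measurable_bm t) measurable_snd).
split; first by move=> w; exact: chain_jumps.
split; first by move=> w; split; [exact: bm0|exact: bm_continuous].
split.
  move=> lk lb pk pb ml.
  rewrite /kappa /B (kev_comp fst (chain_path gQ i)) (bev_comp snd (@bm R)).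
  have -> : fst @^-1` kev (chain_path gQ i) lk `&` snd @^-1` bev (@bm R) 0 lb =
     kev (chain_path gQ i) lk `*` bev (@bm R) 0 lb by [].
  refine (etrans (product_measure1E _ _ _ _) _).
  - exact: mkev_chain.
  - by apply: measurable_bev ml => t; exact: measurable_bm.
  by congr (_ * _)%E; [exact: chain_law|exact: bm_law].
split; first by move=> w; exact: (svalP (cid (hX w))).1.
by move=> w; exact: (svalP (cid (hX w))).2.
Qed.

(** * One step of the Euler chain *)

Section ExpBound.
Variable R : realType.

Lemma gauss_exp_bound (s : R) (l : seq (R * R)) (F : R -> R) : s != 0 ->
  measurable_fun setT F -> (forall x, 0 <= F x <= \sum_(p <- l) p.1 * expR (p.2 * x)) ->
  (\int[gaussP s]_x (F x)%:E <= (\sum_(p <- l) p.1 * expR (p.2 ^+ 2 * s ^+ 2 / 2))%:E)%E.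
Proof.
move=> s0 mF Fl.
have me (c : R) : measurable_fun setT (fun x : R => expR (c * x)).
  by apply: measurableT_comp => //; exact: measurable_funM.
have ie (c : R) : (\int[gaussP s]_x (expR (c * x))%:E = (expR (c ^+ 2 * s ^+ 2 / 2))%:E)%E.
  refine (etrans (integral_gaussP s _ _) _).
  - exact/measurable_EFinP.
  - by move=> x; rewrite lee_fin expR_ge0.
  exact: normal_expR.
have inte (p : R * R) : (gaussP s).-integrable setT (fun x => (p.1 * expR (p.2 * x))%:E).
  have : (gaussP s).-integrable setT (fun x => (expR (p.2 * x))%:E).
    apply/integrableP; split; first exact/measurable_EFinP.
    under eq_integral do rewrite gee0_abs ?lee_fin ?expR_ge0 //.
    by rewrite ie ltry.
  by move=> /(integrableZl measurableT p.1); apply: eq_integrable => // x _; rewrite EFinM.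
have [il E] : (gaussP s).-integrable setT (fun x => (\sum_(p <- l) p.1 * expR (p.2 * x))%:E) /\
   (\int[gaussP s]_x (\sum_(p <- l) p.1 * expR (p.2 * x))%:E =
   (\sum_(p <- l) p.1 * expR (p.2 ^+ 2 * s ^+ 2 / 2))%:E)%E.
  elim: l {Fl} => [|p l [IH1 IH2]].
    under eq_fun do rewrite big_nil; rewrite big_nil; split; first exact: integrable0.
    by rewrite integral0.
  have E x : (\sum_(p <- p :: l) p.1 * expR (p.2 * x))%:E =
     ((p.1 * expR (p.2 * x))%:E + (\sum_(p <- l) p.1 * expR (p.2 * x))%:E)%E.
    by rewrite big_cons EFinD.
  split.
    have -> : (fun x => (\sum_(q <- p :: l) q.1 * expR (q.2 * x))%:E) =
      (fun x => (p.1 * expR (p.2 * x))%:E) \+ (fun x => (\sum_(q <- l) q.1 * expR (q.2 * x))%:E).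
      by apply/funext => x; exact: E.
    exact: (integrableD measurableT (inte p) IH1).
  under eq_integral do rewrite E.
  rewrite integralD // IH2 big_cons EFinD; congr (_ + _)%E.
  under eq_integral do rewrite EFinM.
  rewrite integralZl ?ie -?EFinM //.
  apply/integrableP; split; first exact/measurable_EFinP.
  under eq_integral do rewrite gee0_abs ?lee_fin ?expR_ge0 //.
  by rewrite ie ltry.
rewrite -E; apply: ge0_le_integral => //.
- by move=> x _; rewrite lee_fin; have /andP[] := Fl x.
- exact/measurable_EFinP.
- by apply/measurable_EFinP; apply: measurable_sum => p; apply: measurable_funM.
by move=> x _; rewrite lee_fin; have /andP[] := Fl x.
Qed.

(** Hyperbolic sine, and below it hyperbolic cosine minus 1. They replace t and t^2/2 in Taylor
    bounds, so that a single bound holds for all increments, large ones included, and has an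
    explicit Gaussian expectation. *)
Definition sh (t : R) := (expR t - expR (- t)) / 2.
Definition ch1 (t : R) := (expR t + expR (- t)) / 2 - 1.

Lemma ch1_ge (t : R) : t ^+ 2 / 8 <= ch1 t.
Proof.
wlog t0 : t / 0 <= t => [h|].
  have [|/ltW t0] := leP 0 t; first exact: h.
  have e : ch1 (- t) = ch1 t by rewrite /ch1 opprK [expR (- t) + _]addrC.
  by rewrite -e -sqrrN; apply: h; rewrite oppr_ge0.
have e1 := expR_ge1Dx (t / 2); set a := expR (t / 2) in e1.
have a0 : 0 < a by exact: expR_gt0.
have aE : expR t = a ^+ 2 by rewrite expr2 /a -expRD; congr expR; field.
have -> : ch1 t = (a - a^-1) ^+ 2 / 2.
  rewrite /ch1 expRN aE; field; exact: lt0r_neq0.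
have h : t / 2 <= a - a^-1.
  have : a^-1 <= 1; last by lra.
  by rewrite invf_le1 //; lra.
have : (t / 2) ^+ 2 <= (a - a^-1) ^+ 2 by rewrite ler_sqr ?nnegrE //; lra.
lra.
Qed.

Lemma sh_le (t : R) : `|sh t| <= ch1 t + 1.
Proof.
have := expR_gt0 t; have := expR_gt0 (- t); rewrite /sh /ch1 => h1 h2.
by rewrite ler_norml; apply/andP; split; lra.
Qed.

Lemma expR_taylor : exists2 K : R, 0 <= K & forall t, `|t| <= 1 ->
  `|expR t - (1 + t + t ^+ 2 / 2)| <= K * `|t| ^+ 3.
Proof.
have [K K0 h] := c2fun_expR 1 (const_mx 1 : 'cV[R]_1) 0; exists K => // t t1.
have := h 0 t; rewrite normr0 => /(_ (lexx _) t1 0).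
by rewrite add0r !mxE mul1r mulr0 expR0 expr1n !mulr1.
Qed.

Lemma expR_first_order (lam : R) : exists2 K : R, 0 <= K & forall h, 0 <= h <= 1 ->
  `|expR (lam * h) - (1 + lam * h)| <= K * h ^+ 2.
Proof.
have [K K0 hK] := c2fun_expR lam (const_mx 1 : 'cV[R]_1) 0.
exists (K + lam ^+ 2 / 2) => [|h /andP[h0 h1]]; first by rewrite addr_ge0 // divr_ge0 ?sqr_ge0.
have := hK 0 h; rewrite normr0 ger0_norm // => /(_ (lexx _) h1 0).
rewrite add0r !mxE mulr0 expR0 !mulr1 => e.
have h3 : h ^+ 3 <= h ^+ 2 by apply: ler_wiXn2l.
have : K * h ^+ 3 <= K * h ^+ 2 by exact: ler_wpM2l.
move: e; rewrite !ler_norml => /andP[e1 e2] h4.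
have : 0 <= h ^+ 2 / 2 * lam ^+ 2 by rewrite mulr_ge0 ?divr_ge0 ?sqr_ge0.
by move=> h5; apply/andP; split; lra.
Qed.

End ExpBound.

Lemma second_difference_bound (R : realFieldType) (B K x xp xm d1 d2 : R) : 0 <= B ->
  `|x| <= B -> `|xm| <= B -> `|xp| <= B ->
  `|xm - (x + -1 * d1 + 1 / 2 * d2)| <= K -> `|xp - (x + 1 * d1 + 1 / 2 * d2)| <= K ->
  [/\ `|x| <= 4 * B + 2 * K, `|d1| <= 4 * B + 2 * K & `|d2| <= 4 * B + 2 * K].
Proof.
rewrite !ler_norml => B0 /andP[? ?] /andP[? ?] /andP[? ?] /andP[? ?] /andP[? ?].
by split; apply/andP; split; lra.
Qed.

Section OneStep.
Variables (R : realType) (m : nat) (Q : 'M[R]_m) (mu sigma : 'cV[R]_m).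
Hypothesis genQ : is_generator Q.
Variables (g g1 g2 : R -> 'cV[R]_m) (a b r M : R) (G : 'I_m -> R -> R).
Hypotheses (cg : c2fun g g1 g2) (ab : a <= b) (r0 : 0 < r).
Hypothesis mG : forall j, measurable_fun setT (G j).
Hypothesis G0 : forall j z, 0 <= G j z <= M.
Hypothesis Gg : forall j z, a - r <= z <= b + r -> G j z <= g z j 0.

Let M0 := `|a| + `|b|.
Let yM0 y : a <= y <= b -> `|y| <= M0.
Proof.
move=> /andP[ay yb]; have := ler_norm b; have := ler_norm (- a); rewrite normrN /M0 => h1 h2.
by have := normr_ge0 a; have := normr_ge0 b => h3 h4; rewrite ler_norml; apply/andP; split; lra.
Qed.

Lemma c2fun_bounded : exists2 B, 0 <= B & forall y j, a <= y <= b ->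
  [/\ `|g y j 0| <= B, `|g1 y j 0| <= B & `|g2 y j 0| <= B].
Proof.
have bnd j : exists2 B, 0 <= B & forall y, - M0 - 1 <= y <= M0 + 1 -> `|g y j 0| <= B.
  have M00 : 0 <= M0 by rewrite addr_ge0.
  have cj : continuous (fun y : R => g y j 0) by exact: c2fun_cont cg.
  have [||c _ hc] := @EVT_max R (fun y => `|g y j 0|) (- M0 - 1) (M0 + 1).
  - by lra.
  - apply: continuous_subspaceT => y; apply: continuous_comp; last exact: norm_continuous.
    exact: cj.
  by exists `|g c j 0| => // y hy; apply: hc; rewrite in_itv.
have [K K0 hK] := cg M0.
pose B0 := \sum_j sval (cid2 (bnd j)).
have B0P y j : - M0 - 1 <= y <= M0 + 1 -> `|g y j 0| <= B0.
  move=> hy; rewrite /B0 (bigD1 j) //=; case: (cid2 (bnd j)) => B /= Bp hB.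
  rewrite -[X in X <= _]addr0 lerD ?hB // sumr_ge0 // => k _.
  by case: (cid2 (bnd k)).
have B00 (j : 'I_m) : 0 <= B0 by apply: (le_trans (normr_ge0 (g 0 j 0))); apply: B0P; have : 0 <= M0 := addr_ge0 (normr_ge0 _) (normr_ge0 _); move=> h; apply/andP; split; lra.
exists (`|4 * B0 + 2 * K|) => // y j hy.
have b0 := B00 j; clear B00.
have yM := yM0 hy; have := yM; rewrite ler_norml => /andP[y1 y2].
have n1 : `|1 : R| <= 1 by rewrite normr1.
have n2 : `|- 1 : R| <= 1 by rewrite normrN1.
have := hK y 1 yM n1 j; have := hK y (- 1) yM n2 j.
rewrite normrN1 normr1 expr1n mulr1 sqrrN expr1n.
have i1 : - M0 - 1 <= y + 1 <= M0 + 1 by apply/andP; split; lra.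
have i2 : - M0 - 1 <= y - 1 <= M0 + 1 by apply/andP; split; lra.
have i3 : - M0 - 1 <= y <= M0 + 1 by apply/andP; split; lra.
have := B0P (y + 1) j i1; have := B0P (y - 1) j i2; have := B0P y j i3.
rewrite [X in _ -> _ -> _ -> _ -> _ -> [/\ _ <= X, _ <= X & _ <= X]]ger0_norm; last lra.
exact: second_difference_bound.
Qed.

(** For small |t| the cubic remainder is absorbed by eta ch1, as ch1 t >= t^2/8. For large |t| the
    bound [M] is absorbed by C ch1^2, as ch1 is bounded below there. The square makes the last term
    of order h^2 in expectation. *)
Lemma local_bound eta : 0 < eta -> exists2 C, 0 <= C & forall y t j, a <= y <= b ->
  G j (y + t) <= g y j 0 + g1 y j 0 * sh t + (g2 y j 0 + eta) * ch1 t + C * ch1 t ^+ 2.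
Proof.
move=> eta0.
have [B B0 hB] := c2fun_bounded.
have [K K0 hK] := cg M0.
have [K3 K30 hK3] := expR_taylor R.
pose D := K + 2 * B * K3.
have D0 : 0 <= D by rewrite addr_ge0 // !mulr_ge0.
(* Radius within which D |t|^3 <= eta t^2 / 8. *)
pose r' := Num.min (Num.min 1 r) (eta / (8 * (D + 1))).
have r'0 : 0 < r' by rewrite !lt_min ltr01 r0 divr_gt0 // mulr_gt0 //; lra.
have r'1 : r' <= 1 by rewrite !ge_min lexx.
have r'r : r' <= r by rewrite !ge_min lexx orbT.
have r'D : D * r' <= eta / 8.
  have : r' <= eta / (8 * (D + 1)) by rewrite !ge_min lexx !orbT.
  move=> h; apply: (@le_trans _ _ (D * (eta / (8 * (D + 1))))); first exact: ler_wpM2l.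
  have -> : D * (eta / (8 * (D + 1))) = eta / 8 * (D / (D + 1)) by field; rewrite lt0r_neq0 //; lra.
  by rewrite ler_piMr ?divr_ge0 ?(ltW eta0) // ler_pdivrMr; lra.
(* Lower bound of ch1 outside that radius. *)
pose u0 := r' ^+ 2 / 8.
have u00 : 0 < u0 by rewrite divr_gt0 // exprn_gt0.
have Cp : 0 <= (2 * B + `|M|) / u0 ^+ 2 + 2 * B / u0.
  apply: addr_ge0; apply: divr_ge0; rewrite ?sqr_ge0 ?(ltW u00) ?mulr_ge0 //.
  by rewrite addr_ge0 ?mulr_ge0.
exists ((2 * B + `|M|) / u0 ^+ 2 + 2 * B / u0) => [//|y t j hy].
have [bg bg1 bg2] := hB y j hy.
have u_ge := ch1_ge t; set u := ch1 t in u_ge *.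
have u_ge0 : 0 <= u by apply: le_trans u_ge; rewrite divr_ge0 ?sqr_ge0.
set C := (_ / _ + _).
have C0 : 0 <= C by [].
have [tr|tr] := leP `|t| r'.
  have t1 : `|t| <= 1 by exact: le_trans tr _.
  apply: (@le_trans _ _ (g (y + t) j 0)).
    apply: Gg; move: tr hy; rewrite ler_norml => /andP[? ?] /andP[? ?].
    by apply/andP; split; lra.
  have e0 := hK y t (yM0 hy) t1 j.
  have e1 := hK3 t t1; have e2 : `|expR (- t) - (1 + - t + (- t) ^+ 2 / 2)| <= K3 * `|t| ^+ 3.
    by rewrite -[`|t|]normrN; apply: hK3; rewrite normrN.
  set T := `|t| ^+ 3 in e0 e1 e2.
  have hs : `|sh t - t| <= K3 * T.
    by move: e1 e2; rewrite sqrrN /sh !ler_norml => /andP[? ?] /andP[? ?]; apply/andP; split; lra.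
  have hc : `|u - t ^+ 2 / 2| <= K3 * T.
    by move: e1 e2; rewrite sqrrN /u /ch1 !ler_norml => /andP[? ?] /andP[? ?]; apply/andP; split; lra.
  have p1 : `|g1 y j 0 * (sh t - t)| <= B * (K3 * T) by rewrite normrM ler_pM.
  have p2 : `|g2 y j 0 * (u - t ^+ 2 / 2)| <= B * (K3 * T) by rewrite normrM ler_pM.
  have p3 : D * T <= eta * u.
    have -> : T = `|t| * t ^+ 2 by rewrite /T exprS real_normK // num_real.
    rewrite mulrA; apply: (@le_trans _ _ (eta / 8 * t ^+ 2)).
      apply: ler_wpM2r; first exact: sqr_ge0.
      by apply: le_trans r'D; exact: ler_wpM2l.
    have -> : eta / 8 * t ^+ 2 = eta * (t ^+ 2 / 8) by field.
    by apply: ler_wpM2l => //; exact: ltW.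
  have p4 : 0 <= C * u ^+ 2 by rewrite mulr_ge0 ?sqr_ge0.
  move: e0 p1 p2; rewrite !ler_norml /D in p3 * => /andP[? ?] /andP[? ?] /andP[? ?]; lra.
have /andP[_ GM] := G0 j (y + t); apply: (le_trans GM).
have uu : u0 <= u.
  apply: le_trans u_ge; rewrite /u0 ler_pM2r // -[t ^+ 2]real_normK ?num_real //.
  by rewrite ler_sqr ?nnegrE ?(ltW tr) // ltW.
have q1 : 2 * B + `|M| <= (2 * B + `|M|) / u0 ^+ 2 * u ^+ 2.
  rewrite mulrAC ler_pdivlMr ?exprn_gt0 //; apply: ler_wpM2l; first by rewrite addr_ge0 ?mulr_ge0.
  by rewrite ler_sqr ?nnegrE // ltW.
have q2 : 2 * B * u <= 2 * B / u0 * u ^+ 2.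
  rewrite [2 * B / u0 * _]mulrAC ler_pdivlMr // -[2 * B * u * u0]mulrA; apply: ler_wpM2l; first by rewrite mulr_ge0.
  by rewrite expr2 ler_wpM2l.
have q3 : `|g1 y j 0 * sh t| <= B * (u + 1) by rewrite normrM ler_pM // sh_le.
have q4 : `|g2 y j 0 * u| <= B * u by rewrite normrM ler_pM // ger0_norm.
have q5 := ler_norm M.
have q6 : 0 <= eta * u by rewrite mulr_ge0 // ltW.
have -> : C * u ^+ 2 = (2 * B + `|M|) / u0 ^+ 2 * u ^+ 2 + 2 * B / u0 * u ^+ 2 by rewrite /C mulrDl.
move: bg q3 q4; rewrite !ler_norml => /andP[? ?] /andP[? ?] /andP[? ?]; lra.
Qed.

(* The exponential generating functions of the increment [mu i * h + sigma i * N (0, h)]. *)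
Let E i (k h : R) := expR ((k * mu i 0 + k ^+ 2 * sigma i 0 ^+ 2 / 2) * h).
Let Es i h := (E i 1 h - E i (- 1) h) / 2.
Let Ec i h := (E i 1 h + E i (- 1) h) / 2 - 1.
Let Ed i h := (E i 2 h + E i (- 2) h) / 4 + 3 / 2 - (E i 1 h + E i (- 1) h).

Lemma increment_bound eta C y h i j : 0 < h -> sigma i 0 != 0 ->
  (forall t, G j (y + t) <= g y j 0 + g1 y j 0 * sh t + (g2 y j 0 + eta) * ch1 t + C * ch1 t ^+ 2) ->
  (\int[gaussP (Num.sqrt h)]_x (G j (y + mu i 0 * h + sigma i 0 * x)%R)%:E <=
   (g y j 0 + g1 y j 0 * Es i h + (g2 y j 0 + eta) * Ec i h + C * Ed i h)%:E)%E.
Proof.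
move=> h0 s0 H.
pose c (k : R) := expR (k * mu i 0 * h).
pose G2 := g2 y j 0 + eta.
(* The bound as a list of pairs (coefficient, rate), coming from e^{kt} with k = 0, 1, -1, 2, -2;
   the last two arise from the square of ch1. *)
pose l : seq (R * R) := [:: (g y j 0 - G2 + 3 / 2 * C, 0); ((g1 y j 0 / 2 + G2 / 2 - C) * c 1, sigma i 0);
  ((- g1 y j 0 / 2 + G2 / 2 - C) * c (- 1), - sigma i 0);
  (C / 4 * c 2, 2 * sigma i 0); (C / 4 * c (- 2), - 2 * sigma i 0)].
have sq0 : Num.sqrt h != 0 by rewrite gt_eqF // sqrtr_gt0.
have mF : measurable_fun setT (fun x : R => G j (y + mu i 0 * h + sigma i 0 * x)).
  apply: (measurableT_comp (mG j)); apply: measurable_funD => //; exact: measurable_funM.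
have b0 x : 0 <= G j (y + mu i 0 * h + sigma i 0 * x) <= \sum_(p <- l) p.1 * expR (p.2 * x).
  apply/andP; split; first by have /andP[] := G0 j (y + mu i 0 * h + sigma i 0 * x).
  set t := mu i 0 * h + sigma i 0 * x.
  rewrite -addrA -/t; apply: (le_trans (H t)).
  rewrite le_eqVlt; apply/orP; left; apply/eqP; rewrite /l !big_cons big_nil /= mul0r expR0 mulr1 addr0.
  have e k z : k * mu i 0 * h + z * x = k * t -> c k * expR (z * x) = expR (k * t).
    by move=> <-; rewrite /c expRD.
  have t2 : expR (2 * t) = expR t ^+ 2 by rewrite expr2 -expRD; congr expR; ring.
  have tN2 : expR (- 2 * t) = expR (- t) ^+ 2 by rewrite expr2 -expRD; congr expR; ring.
  have e1 : c 1 * expR (sigma i 0 * x) = expR (1 * t) by apply: e; rewrite /t; ring.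
  have e2 : c (- 1) * expR (- sigma i 0 * x) = expR (- 1 * t) by apply: e; rewrite /t; ring.
  have e3 : c 2 * expR (2 * sigma i 0 * x) = expR (2 * t) by apply: e; rewrite /t; ring.
  have e4 : c (- 2) * expR (- 2 * sigma i 0 * x) = expR (- 2 * t) by apply: e; rewrite /t; ring.
  rewrite -![_ * c _ * _]mulrA e1 e2 e3 e4.
  rewrite mul1r mulN1r t2 tN2 /sh /ch1 -/G2.
  have h1 : expR t * expR (- t) = 1 by rewrite -expRD subrr expR0.
  have -> : ((expR t + expR (- t)) / 2 - 1) ^+ 2 = (expR t ^+ 2 + expR (- t) ^+ 2) / 4
     + (expR t * expR (- t)) / 2 + 1 - (expR t + expR (- t)) by field.
  by rewrite h1; field.
apply: (le_trans (gauss_exp_bound sq0 mF b0)).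
rewrite lee_fin le_eqVlt; apply/orP; left; apply/eqP.
rewrite /l !big_cons big_nil /= sqr_sqrtr ?(ltW h0) // expr0n /= !mul0r expR0 mulr1 addr0.
have e k z : z ^+ 2 = k ^+ 2 * sigma i 0 ^+ 2 -> c k * expR (z ^+ 2 * h / 2) = E i k h.
  by move=> ->; rewrite /c -expRD; congr expR; field.
have e1 : c 1 * expR (sigma i 0 ^+ 2 * h / 2) = E i 1 h by apply: e; ring.
have e2 : c (- 1) * expR ((- sigma i 0) ^+ 2 * h / 2) = E i (- 1) h by apply: e; ring.
have e3 : c 2 * expR ((2 * sigma i 0) ^+ 2 * h / 2) = E i 2 h by apply: e; ring.
have e4 : c (- 2) * expR ((- 2 * sigma i 0) ^+ 2 * h / 2) = E i (- 2) h by apply: e; ring.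
rewrite -![_ * c _ * _]mulrA e1 e2 e3 e4.
by rewrite /Es /Ec /Ed -/G2; field.
Qed.

Lemma oppmxij (A : 'M[R]_m) i j : (- A) i j = - A i j.
Proof. by rewrite mxE. Qed.

Lemma expmx_first_order : exists2 K, 0 <= K & forall h, 0 <= h <= 1 -> forall i j,
  `|expmx (h *: Q) i j - ((i == j)%:R + h * Q i j)| <= K * h ^+ 2.
Proof.
have [K K0 hK] := expmx_taylor Q.
exists (K + mxabs (Q *m Q)) => [|h /andP[h0 h1] i j]; first by rewrite addr_ge0 ?mxabs_ge0.
have := hK h; rewrite ger0_norm // => /(_ h1 i j).
rewrite addmxij oppmxij !addmxij !scalemxij [1%:M i j]mxE => e.
have h3 : h ^+ 3 <= h ^+ 2 by apply: ler_wiXn2l.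
have : K * h ^+ 3 <= K * h ^+ 2 by exact: ler_wpM2l.
have : `|h ^+ 2 / 2 * (Q *m Q) i j| <= h ^+ 2 * mxabs (Q *m Q).
  rewrite normrM ler_pM ?ler_mxabs // ger0_norm ?divr_ge0 ?sqr_ge0 //.
  have := sqr_ge0 h; lra.
move: e; rewrite !ler_norml => /andP[? ?] /andP[? ?] ?.
by apply/andP; split; lra.
Qed.

Lemma moments_first_order i : exists2 K, 0 <= K & forall h, 0 <= h <= 1 ->
  [/\ `|Es i h - mu i 0 * h| <= K * h ^+ 2, `|Ec i h - sigma i 0 ^+ 2 / 2 * h| <= K * h ^+ 2 &
      `|Ed i h| <= K * h ^+ 2].
Proof.
pose lam k := k * mu i 0 + k ^+ 2 * sigma i 0 ^+ 2 / 2.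
have [K1 K10 h1] := expR_first_order (lam 1).
have [K2 K20 h2] := expR_first_order (lam (- 1)).
have [K3 K30 h3] := expR_first_order (lam 2).
have [K4 K40 h4] := expR_first_order (lam (- 2)).
exists (K1 + K2 + K3 + K4) => [|h hh]; first by rewrite !addr_ge0.
have := h1 h hh; have := h2 h hh; have := h3 h hh; have := h4 h hh.
rewrite -/(E i 1 h) -/(E i (- 1) h) -/(E i 2 h) -/(E i (- 2) h) /lam /Es /Ec /Ed.
have p : 0 <= h ^+ 2 by exact: sqr_ge0.
have q1 : 0 <= K1 * h ^+ 2 by exact: mulr_ge0.
have q2 : 0 <= K2 * h ^+ 2 by exact: mulr_ge0.
have q3 : 0 <= K3 * h ^+ 2 by exact: mulr_ge0.
have q4 : 0 <= K4 * h ^+ 2 by exact: mulr_ge0.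
rewrite !ler_norml => /andP[a1 a2] /andP[b1 b2] /andP[c1 c2] /andP[d1 d2].
by split; apply/andP; split; lra.
Qed.

(** Multiplies the expansion of a transition probability by that of a Gaussian expectation,
    collecting all second order errors in one constant. *)
Lemma expansion_error (B K : R) : 0 <= B -> 0 <= K -> exists2 K', 0 <= K' & forall h d q p x T t : R,
  0 <= h <= 1 -> `|d| <= 1 -> `|q| <= B -> `|p| <= K * h ^+ 2 -> `|x| <= B -> `|T| <= B ->
  `|t| <= K * h ^+ 2 ->
  (d + h * q + p) * (x + h * T + t) <= d * x + h * (q * x + d * T) + K' * h ^+ 2.
Proof.
move=> B0 K0; exists (K + B * (B + K) + K * (2 * B + K)) => [|h d q p x T t hh d1 qB pK xB TB tK].
  by rewrite !addr_ge0 ?mulr_ge0 ?addr_ge0 ?mulr_ge0.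
case/andP: hh => h0 h1.
have p0 : 0 <= h ^+ 2 by exact: sqr_ge0.
have h2 : h ^+ 2 <= 1 by rewrite expr_le1.
have h21 : h ^+ 2 <= h by rewrite expr2 ler_piMr.
have tK' : `|t| <= K by apply: (le_trans tK); rewrite ler_piMr.
have e1 : `|d * t| <= K * h ^+ 2 by rewrite normrM -[K * _]mul1r ler_pM.
have e2 : `|(h * q) * (h * T + t)| <= h ^+ 2 * (B * (B + K)).
  have -> : h ^+ 2 * (B * (B + K)) = (h * B) * (h * (B + K)) by ring.
  rewrite normrM ler_pM //; first by rewrite normrM (ger0_norm h0) ler_wpM2l.
  apply: (le_trans (ler_normD _ _)); rewrite mulrDr lerD //.
    by rewrite normrM (ger0_norm h0) ler_wpM2l.
  by apply: (le_trans tK); rewrite mulrC ler_wpM2r.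
have e3 : `|p * (x + h * T + t)| <= (K * h ^+ 2) * (2 * B + K).
  rewrite normrM ler_pM //.
  apply: (le_trans (ler_normD _ _)); rewrite lerD //.
  apply: (le_trans (ler_normD _ _)); have -> : 2 * B = B + B by ring.
  by rewrite lerD // normrM -[B]mul1r ler_pM // ger0_norm.
move: e1 e2 e3; rewrite !ler_norml => /andP[_ e1] /andP[_ e2] /andP[_ e3].
have -> : (d + h * q + p) * (x + h * T + t) = d * x + h * (q * x + d * T) +
   (d * t + h * q * (h * T + t) + p * (x + h * T + t)) by ring.
lra.
Qed.

(** The generator is at most -2 delta. Of this, delta is the guaranteed loss; half of [delta] pays
    for the slack eta in the second derivative and the other half for the terms of order h^2. *)
Theorem one_step delta : 0 < delta -> (forall i, sigma i 0 != 0) ->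
  (forall y i, a <= y <= b -> genop Q sigma mu (g y) (g1 y) (g2 y) i <= - (2 * delta)) ->
  exists2 h0, 0 < h0 & forall h, 0 < h <= h0 -> forall y i, a <= y <= b ->
  (\sum_j (expmx (h *: Q) i j)%:E *
     \int[gaussP (Num.sqrt h)]_x (G j (y + mu i 0 * h + sigma i 0 * x)%R)%:E <=
   (g y i 0 - delta * h)%:E)%E.
Proof.
move=> delta0 s0 gen.
have [S S0 hS] : exists2 S, 0 < S & forall i, sigma i 0 ^+ 2 / 2 <= S.
  exists (1 + \sum_i sigma i 0 ^+ 2 / 2) => [|i].
    by rewrite ltr_wpDr // sumr_ge0 // => i _; rewrite divr_ge0 ?sqr_ge0.
  rewrite (bigD1 i) //=.
  have : 0 <= \sum_(k | k != i) sigma k 0 ^+ 2 / 2 by rewrite sumr_ge0 // => k _; rewrite divr_ge0 ?sqr_ge0.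
  lra.
(* Then eta sigma_i^2 / 2 <= eta S = delta / 2 in every phase. *)
pose eta := delta / (2 * S).
have eta0 : 0 < eta by rewrite divr_gt0 // mulr_gt0.
have [C C0 hC] := local_bound eta0.
have [B B0 hB] := c2fun_bounded.
have [K1 K10 hK1] := expmx_first_order.
pose Km i := sval (cid2 (moments_first_order i)).
have Km0 i : 0 <= Km i by rewrite /Km; case: cid2.
have KmP i := (svalP (cid2 (moments_first_order i))).2.
pose K2 := \sum_i Km i.
have KmK2 i : Km i <= K2.
  by rewrite /K2 (bigD1 i) //= lerDl sumr_ge0.
have K20 : 0 <= K2 by exact: sumr_ge0.
pose Bq := mxabs Q + B + B * \sum_i `|mu i 0| + (B + eta) * S.
have smu0 : 0 <= \sum_i `|mu i 0| by exact: sumr_ge0.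
have Be0 : 0 <= B + eta by rewrite addr_ge0 // ltW.
have S0' := ltW S0.
have Bq0 : 0 <= Bq by rewrite !addr_ge0 ?mxabs_ge0 ?mulr_ge0 ?addr_ge0 // ltW.
pose K3 := K1 + (B * K2 + (B + eta) * K2 + C * K2).
have K30 : 0 <= B * K2 + (B + eta) * K2 + C * K2.
  by rewrite !addr_ge0 ?mulr_ge0 ?addr_ge0 // ltW.
have K3p : 0 <= K3 by rewrite addr_ge0.
have [K' K'0 hK'] := expansion_error Bq0 K3p.
pose KK := K' *+ m + 1.
have KK0 : 0 < KK by rewrite ltr_wpDl // mulrn_wge0.
exists (Num.min 1 (delta / (2 * KK))) => [|h].
  by rewrite lt_min ltr01 divr_gt0 // mulr_gt0.
rewrite le_min => /and3P[h0 h1 hd] y i yab.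
have h01 : 0 <= h <= 1 by rewrite ltW.
have [m1 m2 m3] : [/\ `|Es i h - mu i 0 * h| <= K2 * h ^+ 2, `|Ec i h - sigma i 0 ^+ 2 / 2 * h| <= K2 * h ^+ 2 &
      `|Ed i h| <= K2 * h ^+ 2].
  have [b1 b2 b3] := KmP i h h01.
  have kk : Km i * h ^+ 2 <= K2 * h ^+ 2 by rewrite ler_wpM2r ?sqr_ge0.
  by split; [apply: (le_trans b1)|apply: (le_trans b2)|apply: (le_trans b3)].
pose T j := g1 y j 0 * mu i 0 + (g2 y j 0 + eta) * (sigma i 0 ^+ 2 / 2).
pose t j := g1 y j 0 * (Es i h - mu i 0 * h) + (g2 y j 0 + eta) * (Ec i h - sigma i 0 ^+ 2 / 2 * h) + C * Ed i h.
have bterm j : ((expmx (h *: Q) i j)%:E *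
     \int[gaussP (Num.sqrt h)]_x (G j (y + mu i 0 * h + sigma i 0 * x)%R)%:E <=
   ((i == j)%:R * g y j 0 + h * (Q i j * g y j 0 + (i == j)%:R * T j) + K' * h ^+ 2)%R%:E)%E.
  apply: (@le_trans _ _ ((expmx (h *: Q) i j) * (g y j 0 + h * T j + t j))%:E).
    rewrite EFinM; apply: lee_wpmul2l; first by rewrite lee_fin gen_expmx_ge0 // ltW.
    have := increment_bound h0 (s0 i) (fun t => hC y t j yab).
    by have -> // : g y j 0 + g1 y j 0 * Es i h + (g2 y j 0 + eta) * Ec i h + C * Ed i h = g y j 0 + h * T j + t j
      by rewrite /T /t; ring.
  rewrite lee_fin.
  have -> : expmx (h *: Q) i j = (i == j)%:R + h * Q i j + (expmx (h *: Q) i j - ((i == j)%:R + h * Q i j)) by ring.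
  have [bg bg1 bg2] := hB y j yab.
  have bg2e : `|g2 y j 0 + eta| <= B + eta.
    by apply: (le_trans (ler_normD _ _)); rewrite (ger0_norm (ltW eta0)) lerD2r.
  have p2 : 0 <= h ^+ 2 by exact: sqr_ge0.
  apply: hK' => //.
  - by case: eqP => _; rewrite ?normr1 ?normr0 ?ler01.
  - apply: (le_trans (ler_mxabs Q i j)); rewrite /Bq -!addrA lerDl !addr_ge0 ?mulr_ge0 ?addr_ge0 // ltW //.
  - by apply: (le_trans (hK1 h h01 i j)); rewrite ler_wpM2r // lerDl.
  - apply: (le_trans bg); rewrite /Bq.
    have := mxabs_ge0 Q; have : 0 <= B * \sum_i `|mu i 0| by rewrite mulr_ge0.
    have := mulr_ge0 Be0 S0'.
    lra.
  - apply: (le_trans (ler_normD _ _)).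
    have q1 : `|g1 y j 0 * mu i 0| <= B * \sum_i `|mu i 0|.
      rewrite normrM ler_pM // (bigD1 i) //= lerDl; exact: sumr_ge0.
    have q2 : `|(g2 y j 0 + eta) * (sigma i 0 ^+ 2 / 2)| <= (B + eta) * S.
      by rewrite normrM ler_pM // ger0_norm ?divr_ge0 ?sqr_ge0.
    have := mxabs_ge0 Q; rewrite /Bq; lra.
  have q1 : `|g1 y j 0 * (Es i h - mu i 0 * h)| <= B * (K2 * h ^+ 2) by rewrite normrM ler_pM.
  have q2 : `|(g2 y j 0 + eta) * (Ec i h - sigma i 0 ^+ 2 / 2 * h)| <= (B + eta) * (K2 * h ^+ 2) by rewrite normrM ler_pM.
  have q3 : `|C * Ed i h| <= C * (K2 * h ^+ 2) by rewrite normrM ler_pM // ger0_norm.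
  have q4 : 0 <= K1 * h ^+ 2 by rewrite mulr_ge0.
  apply: (le_trans (ler_normD _ _)); apply: (le_trans (lerD (ler_normD _ _) (lexx _))).
  rewrite /K3; lra.
apply: (@le_trans _ _ (\sum_j ((i == j)%:R * g y j 0 + h * (Q i j * g y j 0 + (i == j)%:R * T j) + K' * h ^+ 2)%R%:E)%E).
  by apply: lee_sum => j _; exact: bterm.
rewrite sumEFin lee_fin !big_split /= -mulr_sumr big_split /= sumr_const card_ord.
have dsum (F : 'I_m -> R) : \sum_j (i == j)%:R * F j = F i.
  rewrite (bigD1 i) //= eqxx mul1r big1 ?addr0 // => j ji.
  by rewrite eq_sym (negbTE ji) mul0r.
rewrite !dsum.
have gi := gen y i yab; rewrite /genop [(Q *m _) _ _]mxE in gi.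
have es : eta * (sigma i 0 ^+ 2 / 2) <= delta / 2.
  apply: (@le_trans _ _ (eta * S)); first by rewrite ler_wpM2l // ltW.
  by rewrite /eta le_eqVlt; apply/orP; left; apply/eqP; field; exact: lt0r_neq0.
have hK2 : K' *+ m * h <= delta / 2.
  apply: (@le_trans _ _ (KK * h)); first by rewrite ler_wpM2r ?(ltW h0) // lerDl.
  by rewrite mulrC -ler_pdivlMr //; move: hd; rewrite invfM mulrA.
have : h * (\sum_j Q i j * g y j 0 + T i + K' *+ m * h) <= h * (- delta).
  rewrite ler_wpM2l ?(ltW h0) // /T mulrDl.
  lra.
rewrite -mulrnAl expr2 mulrA; lra.
Qed.

End OneStep.

(** * Laws along the Euler chain *)

Section FiniteLaw.
Context d (T : measurableType d) d2 (T2 : measurableType d2) (R : realType).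
Variables (P : probability T R) (V : set T) (Y : T -> T2).
Hypotheses (mV : measurable V) (mY : measurable_fun setT Y).
Local Open Scope ereal_scope.

Lemma integral_mrestr (f : T -> \bar R) : measurable_fun setT f -> (forall x, 0 <= f x) ->
  \int[mrestr P mV]_x f x = \int[P]_(x in V) f x.
Proof.
move=> mf f0.
rewrite -[in LHS](setUv V) ge0_integral_setU //; last 3 first.
- exact: measurableC.
- by rewrite setUv.
- by apply/disj_setPCl.
rewrite [X in _ + X](_ : _ = 0) ?adde0.
  apply: eq_measure_integral => A mA AV; rewrite /mrestr; congr (P _).
  by apply/seteqP; split => x; [move=> []|move=> h; split => //; exact: AV].
apply: null_set_integral => //.
- exact: measurableC.
- exact: measurable_funTS.
by change (P (~` V `&` V) = 0); rewrite setICl measure0.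
Qed.

(** The law of [Y] restricted to the event [V], as a finite measure, so that product measures can be
    formed with it. *)
Lemma finite_law : exists nu : {finite_measure set T2 -> \bar R},
  (forall C, measurable C -> nu C = P (V `&` Y @^-1` C)) /\
  forall f : T2 -> \bar R, measurable_fun setT f -> (forall x, 0 <= f x) ->
    \int[nu]_y f y = \int[P]_(x in V) f (Y x).
Proof.
pose Y' : {mfun T >-> T2} :=
  HB.pack_for {mfun T >-> T2} Y (isMeasurableFun.Build _ _ _ _ _ mY).
have fin : fin_num_fun (pushforward (mrestr P mV) Y').
  move=> A mA; change (P (Y @^-1` A `&` V) \is a fin_num).
  apply: fin_num_measure; apply: measurableI => //.
  by rewrite -[X in measurable X]setTI; exact: mY.
pose nu : {finite_measure set T2 -> \bar R} :=
  HB.pack_for {finite_measure set T2 -> \bar R} (pushforward (mrestr P mV) Y')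
    (Measure_isFinite.Build _ _ _ (pushforward (mrestr P mV) Y') fin).
exists (nu mY mY mY mY); split; first by move=> C mC; rewrite setIC.
move=> f mf f0.
transitivity (\int[pushforward (mrestr P mV) Y']_y f y) => //.
rewrite ge0_integral_pushforward // preimage_setT.
refine (etrans (integral_mrestr _ _) _) => //.
exact: (measurableT_comp mf mY).
Unshelve. all: first [exact: mY|by move=> x; exact: f0|idtac].
Qed.

End FiniteLaw.

Section IntegralRect.
Context d (T : measurableType d) d1 (T1 : measurableType d1) d2 (T2 : measurableType d2) (R : realType).
Local Open Scope ereal_scope.

Lemma integral_rect (P : probability T R) (D : set T) (f : T -> T1) (g : T -> T2)
  (m1 : {sigma_finite_measure set T1 -> \bar R}) (m2 : {sigma_finite_measure set T2 -> \bar R})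
  (c : R) (F : T1 * T2 -> \bar R) : measurable D ->
  measurable_fun setT f -> measurable_fun setT g -> (0 <= c)%R ->
  (forall A B, measurable A -> measurable B ->
     P (D `&` (f @^-1` A `&` g @^-1` B)) = m1 A * m2 B * c%:E) ->
  measurable_fun setT F -> (forall z, 0 <= F z) ->
  \int[P]_(w in D) F (f w, g w) = c%:E * \int[m1]_x \int[m2]_y F (x, y).
Proof.
move=> mD mf mg c0 H mF F0.
have mfg : measurable_fun setT (fun w => (f w, g w)) by exact/measurable_fun_pairP.
have [nu [nuE nuI]] := finite_law P mD mfg.
rewrite -(nuI _ mF F0) -(@fubini_tonelli1 _ _ _ _ R m1 m2 F mF F0).
pose k : {nonneg R} := NngNum c0.
refine (etrans _ (@ge0_integral_mscale _ _ R (m1 \x m2) setT measurableT k F mF (fun x _ => F0 x))).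
apply: eq_measure_integral => A mA _.
transitivity ((m1 \x m2) A * c%:E); last by rewrite /mscale /= muleC.
apply: rect_measure => // A1 B1 mA1 mB1.
refine (etrans (nuE _ (measurableX mA1 mB1)) _); exact: H.
Qed.

Lemma pair_prob (P : probability T R) (D : set T) (f : T -> T1) (g : T -> T2)
  (m1 : {sigma_finite_measure set T1 -> \bar R}) (m2 : {sigma_finite_measure set T2 -> \bar R})
  (c : R) (E : set (T1 * T2)) : measurable D ->
  measurable_fun setT f -> measurable_fun setT g -> (0 <= c)%R ->
  (forall A B, measurable A -> measurable B ->
     P (D `&` (f @^-1` A `&` g @^-1` B)) = m1 A * m2 B * c%:E) ->
  measurable E ->
  P (D `&` [set w | E (f w, g w)]) = (m1 \x m2) E * c%:E.
Proof.
move=> mD mf mg c0 H mE.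
have mfg : measurable_fun setT (fun w => (f w, g w)) by exact/measurable_fun_pairP.
have [nu [nuE nuI]] := finite_law P mD mfg.
rewrite -[LHS](nuE _ mE); apply: rect_measure => // A1 B1 mA1 mB1.
refine (etrans (nuE _ (measurableX mA1 mB1)) _); exact: H.
Qed.

End IntegralRect.

(** * Markov property and supermartingale bounds of the Euler chain *)

Section Chain.
Variables (R : realType) (m : nat) (Q : 'M[R]_m) (mu sigma : 'cV[R]_m).
Context d (Omega : measurableType d).
Variables (P : probability Omega R) (kappa : R -> Omega -> 'I_m) (B : R -> Omega -> R) (i0 : 'I_m).
Variables (h : R) (Phi : R -> R) (I : set R).
Hypothesis gQ : is_generator Q.
Hypothesis h0 : 0 < h.
Hypothesis mk : forall t j, measurable [set w | kappa t w = j].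
Hypothesis mB : forall t, measurable_fun setT (B t).
Hypothesis law : forall (lk : seq (R * 'I_m)) (lb : seq (R * set R)),
  path <=%R 0 (map fst lk) -> path <%R 0 (map fst lb) -> all_measurable lb ->
  P (kev kappa lk `&` bev B 0 lb) = ((markov_w Q 0 i0 lk)%:E * bm_w 0 lb)%E.
Hypothesis mPhi : measurable_fun setT Phi.
Hypothesis mI : measurable I.

Let t (k : nat) : R := k%:R * h.

Definition euler_next (i : 'I_m) (y x : R) : R := Phi (y + mu i 0 * h + sigma i 0 * x).

Definition dB k w := B (t k.+1) w - B (t k) w.

Fixpoint euler k w : R :=
  if k is k'.+1 then euler_next (kappa (t k') w) (euler k' w) (dB k' w) else 0.

(** Positions 0 to k - 1 lie in [I] while position [k] is still free, so an exit at step [k] is a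
    subset of [alive k]. *)
Fixpoint alive k : set Omega :=
  if k is k'.+1 then alive k' `&` (euler k' @^-1` I) else setT.

Let tS k : t k < t k.+1.
Proof. by rewrite ltr_pM2r // ltr_nat. Qed.

Let tD k : t k.+1 - t k = h.
Proof. by rewrite /t -mulrBl -natrB ?subSnn ?mul1r. Qed.

Lemma measurable_switch d' (T' : measurableType d') (t0 : R) (F : 'I_m -> Omega -> T') :
  (forall i, measurable_fun setT (F i)) -> measurable_fun setT (fun w => F (kappa t0 w) w).
Proof.
move=> mF _ A mA; rewrite setTI.
have -> : (fun w => F (kappa t0 w) w) @^-1` A =
  \bigcup_(i in [set: 'I_m]) ([set w | kappa t0 w = i] `&` F i @^-1` A).
  apply/seteqP; split => w /=; first by move=> h1; exists (kappa t0 w).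
  by move=> [i _ [<-]].
apply: fin_bigcup_measurable => [|i _]; first exact: finite_finset.
by apply: measurableI => //; rewrite -[X in measurable X]setTI; exact: mF.
Qed.

Lemma measurable_dB k : measurable_fun setT (dB k).
Proof. exact: measurable_funB. Qed.

Lemma measurable_euler_next i : measurable_fun setT (fun z : R * R => euler_next i z.1 z.2).
Proof.
apply: (measurableT_comp mPhi); apply: measurable_funD.
  by apply: measurable_funD => //; exact: measurable_fst.
by apply: measurable_funM => //; exact: measurable_snd.
Qed.

Lemma measurable_euler k : measurable_fun setT (euler k).
Proof.
elim: k => [|k IH] /=; first exact: measurable_cst.
apply: (@measurable_switch _ _ (t k) (fun i w => euler_next i (euler k w) (dB k w))) => i.
exact: (measurableT_comp (measurable_euler_next i) (measurable_fun_pair IH (measurable_dB k))).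
Qed.

Lemma measurable_euler_pre k C : measurable C -> measurable (euler k @^-1` C).
Proof. by move=> mC; rewrite -[X in measurable X]setTI; exact: measurable_euler. Qed.

Lemma measurable_alive k : measurable (alive k).
Proof. by elim: k => [|k IH] //=; apply: measurableI => //; exact: measurable_euler_pre. Qed.

Definition site k i := alive k `&` [set w | kappa (t k) w = i].

Lemma measurable_site k i : measurable (site k i).
Proof. by apply: measurableI => //; exact: measurable_alive. Qed.

Local Open Scope ereal_scope.

Lemma bm_w_fin s (l : seq (R * set R)) : all_measurable l -> exists2 p, (0 <= p)%R & bm_w s l = p%:E.
Proof.
elim: l s => [|[u A] l IH] s /=; first by exists 1%R.
move=> [mA /IH-/(_ u) [p p0 ->]].
rewrite -gaussPE //; exists (fine (gaussP (Num.sqrt (u - s)) A) * p)%R.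
  by rewrite mulr_ge0 // fine_ge0.
by rewrite EFinM fineK // fin_num_measure.
Qed.

Lemma markov_w_ge0 s i l : path <=%R s (map fst l) -> (0 <= markov_w Q s i l)%R.
Proof. by move=> pl; have /andP[] := @markov_w01 R m Q gQ s i l pl. Qed.

(** Markov property at grid time k: given phase and position, later phases and Brownian increments
    have their original joint law. *)
Definition future k := forall i C lk lb,
  path <=%R (t k) (map fst lk) -> path <%R (t k) (map fst lb) -> all_measurable lb -> measurable C ->
  P (site k i `&` euler k @^-1` C `&` (kev kappa lk `&` bev B (t k) lb)) =
  P (site k i `&` euler k @^-1` C) * ((markov_w Q (t k) i lk)%:E * bm_w (t k) lb).

Lemma measurable_kev_bev lk lb s : all_measurable lb -> measurable (kev kappa lk `&` bev B s lb).
Proof.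
by move=> ml; apply: measurableI; [exact: measurable_kev|exact: measurable_bev].
Qed.

Lemma future_pair k i j (nu : {finite_measure set R -> \bar R}) D lk lb : future k ->
  measurable D -> (forall C, measurable C -> nu C = P (site k i `&` euler k @^-1` (D `&` C))) ->
  path <=%R (t k.+1) (map fst lk) -> path <%R (t k.+1) (map fst lb) -> all_measurable lb ->
  forall A C, measurable A -> measurable C ->
  P (site k i `&` euler k @^-1` D `&` (kev kappa ((t k.+1, j) :: lk) `&` bev B (t k.+1) lb) `&`
     (euler k @^-1` A `&` dB k @^-1` C)) =
  nu A * gaussP (Num.sqrt h) C *
    (expmx (h *: Q) i j * markov_w Q (t k.+1) j lk * fine (bm_w (t k.+1) lb))%:E.
Proof.
move=> fut mD nuE plk plb ml A C mA mC.
have [p p0 pE] := bm_w_fin (t k.+1) ml.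
rewrite nuE // pE /=.
transitivity (P (site k i `&` euler k @^-1` (D `&` A) `&`
   (kev kappa ((t k.+1, j) :: lk) `&` bev B (t k) ((t k.+1, C) :: lb)))).
  by congr (P _); apply/seteqP; split => w /=; tauto.
rewrite fut //=; last 3 first.
- by rewrite (ltW (tS k)).
- by rewrite tS.
- exact: measurableI.
rewrite tD pE -gaussPE // !EFinM -!muleA; congr (_ * _).
by rewrite [RHS]muleCA; congr (_ * _); rewrite [RHS]muleCA.
Qed.

Lemma alive_next k j C lk lb w :
  (site k.+1 j `&` euler k.+1 @^-1` C `&` (kev kappa lk `&` bev B (t k.+1) lb)) w <->
  exists i, (site k i `&` euler k @^-1` I `&` (kev kappa ((t k.+1, j) :: lk) `&` bev B (t k.+1) lb) `&`
    [set w | [set z : R * R | C (euler_next i z.1 z.2)] (euler k w, dB k w)]) w.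
Proof.
split; last by move=> [i] /= [[[[h1 h2] h3] [[h4 h5] h6]] h7]; rewrite h2.
by move=> /= [[[[h1 h2] h3] h4] [h5 h6]]; exists (kappa (t k) w).
Qed.

(** By [future_pair], position and next Brownian increment have a product law, whatever is imposed
    on the later future, so an event at step k + 1 is a set for a product measure. The same formula
    with empty lists identifies the common factor as its probability. *)
Lemma euler_future k : future k.
Proof.
elim: k => [|k IH] i C lk lb plk plb ml mC.
  have mw : markov_w Q 0 i0 ((0%R, i) :: lk) = ((i0 == i)%:R * markov_w Q 0 i lk)%R.
    by rewrite /= subr0 scale0r expmx0 mxE.
  rewrite /t mul0r in plk plb *.
  have [C0|C0] := pselect (C 0%R).
    have -> : site 0 i `&` euler 0 @^-1` C = [set w | kappa 0%R w = i].
      by apply/seteqP; split => w /=; rewrite /site /= /t mul0r; [move=> [[]]|].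
    have := @law ((0%R, i) :: lk) lb; rewrite mw /= lexx => /(_ plk plb ml).
    have := @law [:: (0%R, i)] [::]; rewrite /= lexx subr0 scale0r expmx0 [1%:M i0 i]mxE !setIT !mule1 mulr1.
    move=> /(_ isT isT Logic.I) ->; rewrite setIA => ->.
    by rewrite EFinM muleA.
  have -> : site 0 i `&` euler 0 @^-1` C = set0 by apply/seteqP; split => w //= [].
  by rewrite set0I measure0 mul0e.
have [p p0 pE] := bm_w_fin (t k.+1) ml.
have mE i' : measurable [set z : R * R | C (euler_next i' z.1 z.2)].
  by rewrite -[X in measurable X]setTI; exact: measurable_euler_next.
have muE := measurable_euler k.
have mV i' : measurable (site k i' `&` euler k @^-1` I).
  by apply: measurableI; [exact: measurable_site|exact: measurable_euler_pre].
pose nu i' := sval (cid (finite_law P (mV i') muE)).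
have nuE i' A : measurable A -> nu i' A = P (site k i' `&` euler k @^-1` (I `&` A)).
  by move=> mA; rewrite /nu; case: cid => n /= [nE _]; rewrite nE // -setIA.
have key l l' : path <=%R (t k.+1) (map fst l) -> path <%R (t k.+1) (map fst l') -> all_measurable l' ->
   P (site k.+1 i `&` euler k.+1 @^-1` C `&` (kev kappa l `&` bev B (t k.+1) l')) =
   (\sum_i' (nu i' \x gaussP (Num.sqrt h)) [set z : R * R | C (euler_next i' z.1 z.2)] * (expmx (h *: Q) i' i)%:E) *
     (markov_w Q (t k.+1) i l * fine (bm_w (t k.+1) l'))%:E.
  move=> pl pl' ml'.
  have [q q0 qE] := bm_w_fin (t k.+1) ml'.
  have p0' i' : (0 <= expmx (h *: Q) i' i)%R by rewrite gen_expmx_ge0 // ltW.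
  have w0' := markov_w_ge0 i pl.
  have mR j : measurable (kev kappa ((t k.+1, j) :: l) `&` bev B (t k.+1) l') by exact: measurable_kev_bev.
  rewrite (@measure_ord_partition _ _ _ P m (fun i' => site k i' `&` euler k @^-1` I `&`
     (kev kappa ((t k.+1, i) :: l) `&` bev B (t k.+1) l') `&`
    [set w | [set z : R * R | C (euler_next i' z.1 z.2)] (euler k w, dB k w)])); last 3 first.
  - by move=> w; exact: alive_next.
  - move=> i'; apply: measurableI; first by apply: measurableI.
    have mp := measurable_fun_pair muE (measurable_dB k).
    by rewrite -[X in measurable X]setTI; exact: (mp measurableT _ (mE i')).
  - by move=> i1 i2 w /= [[[[_ <-] _] _] _] [[[[_ <-] _] _] _].
  rewrite ge0_sume_distrl; last by move=> i' _; rewrite mule_ge0 // lee_fin.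
  apply: eq_bigr => i' _.
  have c0 : (0 <= expmx (h *: Q) i' i * markov_w Q (t k.+1) i l * fine (bm_w (t k.+1) l'))%R.
    by rewrite !mulr_ge0 // qE.
  have mD : measurable (site k i' `&` euler k @^-1` I `&` (kev kappa ((t k.+1, i) :: l) `&` bev B (t k.+1) l')).
    exact: measurableI.
  refine (etrans (pair_prob (m1 := nu i') (m2 := gaussP (Num.sqrt h)) mD muE (measurable_dB k) c0 _ (mE i')) _).
    move=> A1 C1 mA1 mC1; exact: (future_pair i IH mI (nuE i') pl pl' ml' mA1 mC1).
  by rewrite -muleA -EFinM mulrA.
have := key [::] [::] isT isT Logic.I; rewrite /= setIT mulr1 => E0.
rewrite setIT mule1 in E0.
by rewrite key // E0 pE EFinM.
Qed.

Definition weight k (G : 'I_m -> R -> R) := \sum_i \int[P]_(w in site k i) (G i (euler k w))%:E.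

Lemma weight_next k (G : 'I_m -> R -> R) : (forall i, measurable_fun setT (G i)) -> (forall i y, (0 <= G i y)%R) ->
  weight k.+1 G = \sum_i \int[P]_(w in site k i `&` euler k @^-1` I)
    \sum_j (expmx (h *: Q) i j)%:E * \int[gaussP (Num.sqrt h)]_x (G j (euler_next i (euler k w) x))%:E.
Proof.
move=> mG G0.
have muE := measurable_euler k.
have mV i : measurable (site k i `&` euler k @^-1` I).
  by apply: measurableI; [exact: measurable_site|exact: measurable_euler_pre].
have p0 i j : (0 <= expmx (h *: Q) i j)%R by rewrite gen_expmx_ge0 // ltW.
pose F i j (z : R * R) : \bar R := (G j (euler_next i z.1 z.2))%:E.
have mF i j : measurable_fun setT (F i j).
  by apply/measurable_EFinP; exact: (measurableT_comp (mG j) (measurable_euler_next i)).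
have F0 i j z : 0 <= F i j z by rewrite lee_fin.
pose H i j y := \int[gaussP (Num.sqrt h)]_x (F i j (y, x)).
have mH i j : measurable_fun setT (H i j).
  exact: (@measurable_fun_fubini_tonelli_F _ _ _ _ _ (gaussP (Num.sqrt h)) _ (mF i j) (F0 i j)).
have H0 i j y : 0 <= H i j y by apply: integral_ge0 => x _; exact: F0.
have mHY i j : measurable_fun setT (fun w => H i j (euler k w)) by exact: (measurableT_comp (mH i j) muE).
pose D i j := site k i `&` euler k @^-1` I `&` [set w | kappa (t k.+1) w = j].
have mD i j : measurable (D i j) by exact: measurableI.
have dE i j : \int[P]_(w in D i j) F i j (euler k w, dB k w) =
   (expmx (h *: Q) i j)%:E * \int[P]_(w in site k i `&` euler k @^-1` I) H i j (euler k w).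
  have [nu [nuE nuI]] := finite_law P (mV i) muE.
  rewrite -nuI //; apply: (integral_rect (m1 := nu) (m2 := gaussP (Num.sqrt h))) => //.
    exact: measurable_dB.
  move=> A C mA mC.
  have nuE' A' : measurable A' -> nu A' = P (site k i `&` euler k @^-1` (I `&` A')).
    by move=> mA'; rewrite nuE // -setIA.
  have := @future_pair k i j nu I [::] [::] (@euler_future k) mI nuE' isT isT Logic.I A C mA mC.
  by rewrite /= !setIT !mulr1.
have site_int j : \int[P]_(w in site k.+1 j) (G j (euler k.+1 w))%:E =
   \sum_i \int[P]_(w in D i j) F i j (euler k w, dB k w).
  have -> : site k.+1 j = \big[setU/set0]_(i <- index_enum 'I_m) D i j.
    rewrite -bigcup_seq; apply/seteqP; split => w.
      by move=> [[h1 h2] h3]; exists (kappa (t k) w) => //=; rewrite mem_index_enum.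
    by move=> [i _ [[[h1 h2] h3] h4]].
  rewrite ge0_integral_bigsetU //.
  - apply: eq_bigr => i _; apply: eq_integral => w; rewrite inE => -[[[_ /= h1] _] _].
    by rewrite /F /= h1.
  - exact: index_enum_uniq.
  - by move=> i1 i2 _ _ [w [[[[_ /= <-] _] _] [[[_ /= <-] _] _]]].
  - apply: measurable_funTS; apply/measurable_EFinP; apply: (measurableT_comp (mG j)).
    exact: (measurable_euler k.+1).
  - by move=> w _; rewrite lee_fin.
rewrite /weight; under eq_bigr do rewrite site_int.
rewrite exchange_big /=; apply: eq_bigr => i _.
rewrite ge0_integral_sum //.
- apply: eq_bigr => j _; rewrite dE ge0_integralZl ?lee_fin //.
  + by apply: measurable_funTS; exact: mHY.
  + by move=> w _; exact: H0.
- by move=> j; apply: measurable_funeM; apply: measurable_funTS; exact: mHY.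
- by move=> j w _; apply: mule_ge0; [rewrite lee_fin|exact: H0].
Qed.

Section Supermartingale.
Variables (G : 'I_m -> R -> R) (delta : R).
Hypotheses (mG : forall i, measurable_fun setT (G i)) (G0 : forall i y, (0 <= G i y)%R).
Hypothesis delta0 : (0 <= delta)%R.
Hypothesis one_step : forall k w i, I (euler k w) ->
  \sum_j (expmx (h *: Q) i j)%:E * \int[gaussP (Num.sqrt h)]_x (G j (euler_next i (euler k w) x))%:E <=
  (G i (euler k w) - delta * h)%:E.

Let mGY k i : measurable_fun setT (fun w => (G i (euler k w))%:E).
Proof. by apply/measurable_EFinP; exact: (measurableT_comp (mG i) (measurable_euler k)). Qed.

(** Supermartingale inequality with bookkeeping: the mass that leaves into [C] and the loss delta h
    on surviving paths are both paid out of the weight. *)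
Lemma weight_step k (C : set R) (c : 'I_m -> R) : measurable C -> I `&` C = set0 ->
  (forall i, (0 <= c i)%R) -> (forall i y, C y -> (c i <= G i y)%R) ->
  weight k.+1 G + \sum_i (c i)%:E * P (site k i `&` euler k @^-1` C) + (delta * h)%:E * P (alive k.+1) <= weight k G.
Proof.
move=> mC IC c0 cG.
have dh0 : (0 <= delta * h)%R by rewrite mulr_ge0 // ltW.
have mSI i : measurable (site k i `&` euler k @^-1` I).
  by apply: measurableI; [exact: measurable_site|exact: measurable_euler_pre].
have mSC i : measurable (site k i `&` euler k @^-1` C).
  by apply: measurableI; [exact: measurable_site|exact: measurable_euler_pre].
have -> : P (alive k.+1) = \sum_i P (site k i `&` euler k @^-1` I).
  apply: (@measure_ord_partition _ _ _ P m (fun i => site k i `&` euler k @^-1` I)) => //.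
  - move=> w; split => [[h1 h2]|[i [[h1 _] h2]]//]; exists (kappa (t k) w); by [].
  - by move=> i1 i2 w [[_ /= <-] _] [[_ /= <-] _].
rewrite weight_next // ge0_sume_distrr; last by move=> i _; exact: measure_ge0.
rewrite -!big_split /=; apply: lee_sum => i _.
have gi0 : forall w, 0 <= (G i (euler k w))%:E by move=> w; rewrite lee_fin.
apply: (@le_trans _ _ (\int[P]_(w in (site k i `&` euler k @^-1` I) `|` (site k i `&` euler k @^-1` C)) (G i (euler k w))%:E)); last first.
  apply: ge0_subset_integral => //.
  - exact: measurableU.
  - exact: measurable_site.
  - exact: measurable_funTS.
  - by move=> w [[]|[]].
rewrite ge0_integral_setU //; last 2 first.
- exact: measurable_funTS.
- rewrite disj_set2E; apply/eqP/seteqP; split => w //= [[_ h1] [_ h2]].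
  by have : (I `&` C) (euler k w) by []; rewrite IC.
rewrite addeAC; apply: leeD; last first.
  rewrite -integral_cst //; apply: ge0_le_integral => //.
  - by move=> w _; rewrite lee_fin.
  - exact: measurable_funTS.
  - by move=> w [_ h2]; rewrite lee_fin cG.
have S0 w : 0 <= \sum_j (expmx (h *: Q) i j)%:E * \int[gaussP (Num.sqrt h)]_x (G j (euler_next i (euler k w) x))%:E.
  apply: sume_ge0 => j _; apply: mule_ge0; first by rewrite lee_fin gen_expmx_ge0 // ltW.
  by apply: integral_ge0 => x _; rewrite lee_fin.
have mS : measurable_fun setT (fun w => \sum_j (expmx (h *: Q) i j)%:E * \int[gaussP (Num.sqrt h)]_x (G j (euler_next i (euler k w) x))%:E).
  apply: emeasurable_sum => j; apply: measurable_funeM.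
  have mF : measurable_fun setT (fun z : R * R => (G j (euler_next i z.1 z.2))%:E).
    by apply/measurable_EFinP; exact: (measurableT_comp (mG j) (measurable_euler_next i)).
  have F0 z : 0 <= (G j (euler_next i z.1 z.2))%:E by rewrite lee_fin.
  have mH := @measurable_fun_fubini_tonelli_F _ _ _ _ _ (gaussP (Num.sqrt h)) _ mF F0.
  exact: (measurableT_comp mH (measurable_euler k)).
rewrite -[(delta * h)%:E * _](@integral_cst _ _ _ P _ (mSI i)).
have dh0' w : (site k i `&` euler k @^-1` I) w -> 0 <= cst (delta * h)%:E w by rewrite lee_fin.
rewrite -(@ge0_integralD _ _ _ P _ (mSI i) _ _ (fun w _ => S0 w) (measurable_funTS mS) dh0' (measurable_cst _)).
apply: ge0_le_integral => //.
- by move=> w _; rewrite adde_ge0 // lee_fin.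
- by apply: emeasurable_funD => //; exact: measurable_funTS.
- exact: measurable_funTS.
move=> w [_ h2]; have h3 := @one_step k w i h2.
have h4 : (G i (euler k w) - delta * h)%:E + (delta * h)%:E = (G i (euler k w))%:E by rewrite -EFinD subrK.
by rewrite -h4; apply: leeD; [exact: h3|exact: lexx].
Qed.

Lemma weight0 : weight 0 G = (G i0 0)%:E.
Proof.
have site0 i : P (site 0 i) = ((i0 == i)%:R)%:E.
  have := @law [:: (0%R, i)] [::]; rewrite /= lexx subr0 scale0r expmx0 [1%:M i0 i]mxE !setIT !mule1 mulr1.
  move=> /(_ isT isT Logic.I) <-; congr (P _).
  by apply/seteqP; split => w /=; rewrite /site /= /t mul0r; [move=> []|].
rewrite /weight.
have intE i : \int[P]_(w in site 0 i) (G i (euler 0 w))%:E = (G i 0)%:E * ((i0 == i)%:R)%:E.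
  have ms := measurable_site 0 i.
  by refine (etrans (@integral_cst _ _ _ P _ ms (G i 0)%:E) _); congr (_ * _); exact: site0.
under eq_bigr do rewrite intE.
rewrite (bigD1 i0) //= eqxx mule1 big1 ?adde0 // => i ii0.
by rewrite eq_sym (negbTE ii0) mule0.
Qed.

Lemma weight_sum N (C : set R) (c : 'I_m -> R) : measurable C -> I `&` C = set0 ->
  (forall i, (0 <= c i)%R) -> (forall i y, C y -> (c i <= G i y)%R) ->
  \sum_(k < N) (\sum_i (c i)%:E * P (site k i `&` euler k @^-1` C) + (delta * h)%:E * P (alive k.+1)) <= (G i0 0)%:E.
Proof.
move=> mC IC c0 cG; apply: (@le_trans _ _ (weight N G +
  \sum_(k < N) (\sum_i (c i)%:E * P (site k i `&` euler k @^-1` C) + (delta * h)%:E * P (alive k.+1)))).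
  by rewrite leeDr // sume_ge0 // => i _; apply: integral_ge0 => w _; rewrite lee_fin.
elim: N => [|N IH]; first by rewrite big_ord0 adde0 weight0.
rewrite big_ord_recr /=; apply: le_trans IH.
rewrite addeCA [X in _ <= X]addeC; apply: leeD => //.
by rewrite addeA; exact: weight_step.
Qed.

Lemma alive_bound N : (delta * h * N%:R)%:E * P (alive N) <= (G i0 0)%:E.
Proof.
have mono k n : (k <= n)%N -> P (alive n) <= P (alive k).
  move=> kn; apply: le_measure; rewrite ?inE; [exact: measurable_alive|exact: measurable_alive|].
  rewrite -(subnK kn); elim: (n - k)%N => [//|e IH].
  by apply: subset_trans IH; rewrite addSn /=; exact: subIsetl.
have dh0 : (0 <= delta * h)%R by rewrite mulr_ge0 // ltW.
apply: le_trans (weight_sum N (C := set0) (c := fun=> 0%R) _ _ _ _) => //; last by rewrite setI0.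
rewrite EFinM -muleA [N%:R%:E * _]muleC muleA.
apply: (@le_trans _ _ (\sum_(k < N) ((delta * h)%:E * P (alive N)))).
  have aN : P (alive N) \is a fin_num by apply: fin_num_measure; exact: measurable_alive.
  rewrite -(fineK aN) -!EFinM sumEFin lee_fin sumr_const card_ord mulr_natr.
  by [].
apply: lee_sum => k _; rewrite big1 ?add0e; last by move=> i _; rewrite mul0e.
by apply: lee_wpmul2l; [rewrite lee_fin|exact: mono].
Qed.

(** The phase is read [s] after the exit: given the phase at the exit, its law is a row of
    e^{sQ}. *)
Definition exit_at s j (C : set R) k := alive k `&` euler k @^-1` C `&` [set w | kappa (t k + s)%R w = j].

Lemma exit_bound N s j (C : set R) : (0 <= s)%R -> measurable C -> I `&` C = set0 ->
  (forall i y, C y -> (expmx (s *: Q) i j <= G i y)%R) ->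
  \sum_(k < N) P (exit_at s j C k) <= (G i0 0)%:E.
Proof.
move=> s0 mC IC cG.
have c0 i : (0 <= expmx (s *: Q) i j)%R by rewrite gen_expmx_ge0.
apply: le_trans (weight_sum N mC IC c0 cG).
apply: lee_sum => k _.
apply: (@le_trans _ _ (\sum_i (expmx (s *: Q) i j)%:E * P (site k i `&` euler k @^-1` C))); last first.
  by rewrite leeDl // mule_ge0 // lee_fin mulr_ge0 // ltW.
rewrite (@measure_ord_partition _ _ _ P m (fun i => site k i `&` euler k @^-1` C `&` [set w | kappa (t k + s)%R w = j])); last 3 first.
- move=> w; split; first by move=> [[h1 h2] h3]; exists (kappa (t k) w).
  by move=> [i [[[h1 _] h2] h3]].
- move=> i; apply: measurableI => //.
  by apply: measurableI; [exact: measurable_site|exact: measurable_euler_pre].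
- by move=> i1 i2 w [[[_ /= <-] _] _] [[[_ /= <-] _] _].
apply: lee_sum => i _.
have := @euler_future k i C [:: ((t k + s)%R, j)] [::]; rewrite /= !setIT mule1 mulr1 andbT.
rewrite lerDl s0 => /(_ isT isT Logic.I mC) ->.
by rewrite muleC addrAC subrr add0r.
Qed.

End Supermartingale.

End Chain.

(** * Convergence of Euler paths *)

Section RealPaths.
Variable R : realType.
Implicit Types (f z : R -> R) (T : R).

(** Continuity on the half line: nothing is known at negative times, so the path is frozen there at
    its value at 0. *)
Definition cont0 z := continuous (fun t : R => z (Num.max t 0)).

Lemma cont0_near z t eps : cont0 z -> 0 <= t -> 0 < eps ->
  exists2 d, 0 < d & forall s, 0 <= s -> `|s - t| < d -> `|z s - z t| < eps.
Proof.
move=> cz t0 e0; have /cvgrPdist_lt /(_ _ e0) := cz t.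
rewrite max_l // => -[d /= d0 h]; exists d => // s s0 st.
by rewrite distrC; move: (h s); rewrite /ball_ /= max_l //; apply; rewrite distrC.
Qed.

Lemma heine z T eps : cont0 z -> 0 < eps -> exists2 d, 0 < d & forall s t, 0 <= s <= T -> 0 <= t <= T ->
  `|s - t| < d -> `|z s - z t| <= eps.
Proof.
move=> cz e0; have e2 : 0 < eps / 2 by rewrite divr_gt0.
pose P (d : R) (x : R) := forall t, 0 <= t -> 0 <= x -> `|x - t| < d -> `|z x - z t| <= eps.
have cov : \forall d \near (0 : R)^'+, `[0, T]%classic `<=` P d.
  have /compact_near_coveringP cv := @segment_compact R 0 T.
  apply: cv => x; rewrite /= in_itv /= => /andP[x0 xT].
  have [d d0 hd] := cont0_near cz x0 e2.
  have d2 : 0 < d / 2 by rewrite divr_gt0.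
  exists (ball x (d / 2), [set e | 0 < e < d / 2]) => [|[y e] /= [xy /andP[ep ed]] t t0 y0 yt].
    split; first exact: nbhsx_ballx.
    rewrite /=; near=> e; apply/andP; split; near: e; [exact: nbhs_right_gt|exact: nbhs_right_lt].
  have h1 := hd y y0; have h2 := hd t t0.
  have {}xy : `|x - y| < d / 2 by exact: xy.
  have b1 : `|y - x| < d by rewrite distrC (lt_trans xy) // ltr_pdivrMr // mulr2n mulrDr mulr1 ltrDl.
  have b2 : `|t - x| < d.
    move: xy yt; rewrite !ltr_norml => /andP[? ?] /andP[? ?]; apply/andP; split; lra.
  have {}h1 := h1 b1; have {}h2 := h2 b2.
  by move: h1 h2; rewrite !ltr_norml ler_norml => /andP[? ?] /andP[? ?]; apply/andP; split; lra.
have : \forall d \near (0 : R)^'+, 0 < d /\ `[0, T]%classic `<=` P d.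
  by apply: filterI => //; exact: nbhs_right_gt.
move=> /(@filter_ex _ _ _)[d [d0 hd]]; exists d => // s t /andP[s0 sT] /andP[t0 tT] st.
by apply: (hd s) => //=; rewrite in_itv /= s0 sT.
Unshelve. all: by end_near. Qed.

Lemma cont0_within z (a b : R) : 0 <= a -> cont0 z -> {within `[a, b], continuous z}.
Proof.
move=> a0 cz; apply: (@subspace_eq_continuous _ _ _ (fun t : R => z (Num.max t 0))).
  move=> t; rewrite inE /= in_itv /= => /andP[ta _]; rewrite max_l //; exact: le_trans ta.
exact: continuous_subspaceT.
Qed.

Lemma path_max z a b : 0 <= a -> a <= b -> cont0 z ->
  exists2 c, a <= c <= b & forall t, a <= t <= b -> z t <= z c.
Proof.
move=> a0 ab cz; have [c] := EVT_max ab (cont0_within (b := b) a0 cz).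
by rewrite in_itv /= => cab hc; exists c => // t tab; apply: hc; rewrite in_itv.
Qed.

Lemma path_min z a b : 0 <= a -> a <= b -> cont0 z ->
  exists2 c, a <= c <= b & forall t, a <= t <= b -> z c <= z t.
Proof.
move=> a0 ab cz; have [c] := EVT_min ab (cont0_within (b := b) a0 cz).
by rewrite in_itv /= => cab hc; exists c => // t tab; apply: hc; rewrite in_itv.
Qed.

Lemma cont0N z : cont0 z -> cont0 (fun t => - z t).
Proof. by move=> cz t; apply: cvgN; exact: cz. Qed.

Lemma cont0D y z : cont0 y -> cont0 z -> cont0 (fun t => y t + z t).
Proof. by move=> cy cz t; apply: cvgD; [exact: cy|exact: cz]. Qed.

Lemma continuous_cont0 z : continuous z -> cont0 z.
Proof.
move=> cz t; apply: (@continuous_comp _ _ _ (fun t : R => Num.max t 0) z); last exact: cz.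
by apply: continuous_max; [exact: cvg_id|exact: cvg_cst].
Qed.

Lemma grid_floor (h s : R) : 0 < h -> 0 <= s -> exists l : nat, l%:R * h <= s < l.+1%:R * h.
Proof.
move=> h0 s0; exists (Num.truncn (s / h)).
have /truncn_itv /andP[h1 h2] : 0 <= s / h by rewrite divr_ge0 // ltW.
by rewrite -ler_pdivlMr // h1 -ltr_pdivrMr.
Qed.

End RealPaths.

(** * Euler sums and Lindley recursion along one path *)

Section SwitchedEuler.
Variables (R : realType) (m : nat) (mu sigma : 'I_m -> R) (tau : nat -> R)
  (k : R -> 'I_m) (b x : R -> R).
Hypotheses (tau0 : tau 0%N = 0) (tauS : forall n, tau n < tau n.+1)
  (tau_infty : forall T, exists n, T < tau n)
  (k_const : forall n t, tau n <= t < tau n.+1 -> k t = k (tau n)).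
Hypothesis cb : continuous b.
Hypothesis x0 : x 0 = 0.
Hypothesis incr : forall s t, 0 <= s <= t -> (forall u, s <= u < t -> k u = k s) ->
  x t - x s = mu (k s) * (t - s) + sigma (k s) * (b t - b s).

Lemma tau_ge0 n : 0 <= tau n.
Proof. by elim: n => [|n IH]; [rewrite tau0|exact: le_trans IH (ltW (tauS n))]. Qed.

Lemma tau_bracket t : 0 <= t -> exists n, tau n <= t < tau n.+1.
Proof.
move=> t0; have [N] := tau_infty t; elim: N => [|N IH]; first by rewrite tau0 ltNge t0.
by move=> tS; have [h|h] := leP (tau N) t; [exists N; rewrite h|exact: IH].
Qed.

Let term (n : nat) (t : R) := mu (k (tau n)) * (Num.min t (tau n.+1) - Num.min t (tau n)) +
  sigma (k (tau n)) * (b (Num.min t (tau n.+1)) - b (Num.min t (tau n))).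
Let psi N t := \sum_(n < N) term n t.

Lemma switched_formula N t : 0 <= t -> t <= tau N -> x t = psi N t.
Proof.
move=> t0 tN.
have -> : x t = \sum_(n < N) (x (Num.min t (tau n.+1)) - x (Num.min t (tau n))).
  rewrite -(big_mkord xpredT (fun n => x (Num.min t (tau n.+1)) - x (Num.min t (tau n)))).
  rewrite (telescope_sumr (fun n => x (Num.min t (tau n)))) // tau0 (min_l tN) (min_r t0).
  by rewrite x0 subr0.
apply: eq_bigr => n _; rewrite /term.
have tn := tauS n; have tn0 := tau_ge0 n.
have [h|h] := leP t (tau n).
  by rewrite !min_l ?(le_trans h (ltW tn)) // !subrr !mulr0 addr0.
rewrite incr; first by [].
- by rewrite tn0 le_min (ltW h) (ltW tn).
by move=> u /andP[u1 u2]; apply: k_const; rewrite u1 (lt_le_trans u2) // ge_min lexx orbT.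
Qed.

Lemma switched_cont0 : cont0 x.
Proof.
move=> t; have [N hN] := tau_infty (Num.max t 0 + 1).
have cmin (c : R) : continuous (fun s : R => Num.min (Num.max s 0) c).
  move=> s; apply: (continuous_min (f := fun s : R => Num.max s 0) (g := fun=> c)); last exact: cvg_cst.
  by apply: continuous_max; [exact: cvg_id|exact: cvg_cst].
have cpsi : continuous (fun s : R => psi N (Num.max s 0)).
  move=> s; apply: (@cvgr_sum R R 'I_N (nbhs s) _ (index_enum 'I_N) (fun n r => term n (Num.max r 0))) => n.
  apply: cvgD; apply: cvgMl_tmp; apply: cvgB; try exact: cmin.
  - by apply: continuous_comp; [exact: cmin|exact: cb].
  - by apply: continuous_comp; [exact: cmin|exact: cb].
have E s : `|t - s| < 1 -> x (Num.max s 0) = psi N (Num.max s 0).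
  move=> st; apply: switched_formula; first by rewrite le_max lexx orbT.
  apply: (le_trans _ (ltW hN)); rewrite ge_max; apply/andP; split.
    apply: (@le_trans _ _ (t + 1)); last by rewrite lerD2r le_max lexx.
    by move: st; rewrite ltr_norml => /andP[? ?]; lra.
  have : 0 <= Num.max t 0 by rewrite le_max lexx orbT.
  lra.
have Et : x (Num.max t 0) = psi N (Num.max t 0) by apply: E; rewrite subrr normr0.
rewrite /continuous_at Et.
apply: cvg_trans (cpsi t); apply: near_eq_cvg.
by exists 1 => //= s st; rewrite E.
Qed.

Variable h0 : R.
Fixpoint walk_sum (h : R) n : R := if n is n'.+1 then
  walk_sum h n' + (mu (k (n'%:R * h)) * h + sigma (k (n'%:R * h)) * (b (n'.+1%:R * h) - b (n'%:R * h))) else 0.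

(** An Euler step is exact unless the phase switches strictly inside it, and a step with a switch
    costs at most [eta] by uniform continuity. With [T] before the N-th switching time, there are at
    most N such steps. *)
Lemma walk_sum_cvg T eps : 0 < eps -> exists2 h0, 0 < h0 & forall h, 0 < h <= h0 ->
  forall n, n%:R * h <= T -> `|walk_sum h n - x (n%:R * h)| <= eps.
Proof.
move=> e0; have [N hN] := tau_infty T.
pose eta := eps / (N.+1)%:R.
have eta0 : 0 < eta by rewrite divr_gt0 // ltr0n.
pose M := 1 + \sum_i (`|mu i| + `|sigma i|).
have Mi i : `|mu i| <= M /\ `|sigma i| <= M.
  have : `|mu i| + `|sigma i| <= \sum_i (`|mu i| + `|sigma i|).
    by rewrite [leRHS](bigD1 i) //= lerDl sumr_ge0 // => j _; rewrite addr_ge0.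
  have := normr_ge0 (mu i); have := normr_ge0 (sigma i); rewrite /M => *; split; lra.
have M0 : 0 < M by rewrite /M ltr_wpDr // sumr_ge0 // => i _; rewrite addr_ge0.
have e3 : 0 < eta / (3 * M) by rewrite divr_gt0 // mulr_gt0.
have e3' : 0 < eta / 3 by rewrite divr_gt0.
have [d1 d10 hd1] := heine T (continuous_cont0 cb) e3.
have [d2 d20 hd2] := heine T switched_cont0 e3'.
exists (Num.min (Num.min d1 d2 / 2) (eta / (3 * M))) => [|h].
  by rewrite lt_min e3 andbT divr_gt0 // lt_min d10.
rewrite le_min => /and3P[hp hd he].
have hd' : h < Num.min d1 d2.
  apply: (le_lt_trans hd); have : 0 < Num.min d1 d2 by rewrite lt_min d10.
  lra.
move: hd'; rewrite lt_min => /andP[hl1 hl2].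
have step n : n.+1%:R * h <= T -> `|(mu (k (n%:R * h)) * h + sigma (k (n%:R * h)) * (b (n.+1%:R * h) - b (n%:R * h)))
    - (x (n.+1%:R * h) - x (n%:R * h))| <= eta.
  move=> nT.
  have E : n.+1%:R * h - n%:R * h = h by rewrite -mulrBl -natrB ?subSnn ?mul1r.
  have i1 : 0 <= n.+1%:R * h <= T by rewrite nT mulr_ge0 // ltW.
  have i2 : 0 <= n%:R * h <= T.
    rewrite mulr_ge0 ?(ltW hp) //=; apply: le_trans nT; rewrite ler_wpM2r ?(ltW hp) // ler_nat //.
  have b1 := hd1 _ _ i1 i2; have b2 := hd2 _ _ i1 i2; rewrite !E gtr0_norm // in b1 b2.
  have {}b1 := b1 hl1; have {}b2 := b2 hl2.
  have [m1 m2] := Mi (k (n%:R * h)).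
  have p1 : `|mu (k (n%:R * h)) * h| <= eta / 3.
    have -> : eta / 3 = M * (eta / (3 * M)) by field; rewrite lt0r_neq0.
    by rewrite normrM ler_pM // gtr0_norm.
  have p2 : `|sigma (k (n%:R * h)) * (b (n.+1%:R * h) - b (n%:R * h))| <= eta / 3.
    have -> : eta / 3 = M * (eta / (3 * M)) by field; rewrite lt0r_neq0.
    by rewrite normrM ler_pM.
  move: p1 p2 b2; rewrite !ler_norml => /andP[? ?] /andP[? ?] /andP[? ?]; apply/andP; split; lra.
have main n j : n%:R * h <= T -> n%:R * h < tau j -> `|walk_sum h n - x (n%:R * h)| <= j%:R * eta.
  elim: n j => [|n IH] j nT nj.
    by rewrite mul0r x0 /= subrr normr0 mulr_ge0 // ltW.
  have nn : n%:R * h < n.+1%:R * h by rewrite ltr_pM2r // ltr_nat.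
  have nT' : n%:R * h <= T by rewrite (le_trans (ltW nn)).
  have n0 : 0 <= n%:R * h by rewrite mulr_ge0 // ltW.
  have [p /andP[p1 p2]] := tau_bracket n0.
  have [hp'|hp'] := leP (n.+1%:R * h) (tau p.+1).
    have E : x (n.+1%:R * h) - x (n%:R * h) = mu (k (n%:R * h)) * h + sigma (k (n%:R * h)) * (b (n.+1%:R * h) - b (n%:R * h)).
      rewrite incr.
      - by rewrite -mulrBl -natrB ?subSnn ?mul1r.
      - by rewrite n0 ltW.
      move=> u /andP[u1 u2]; rewrite (@k_const p u) ?(le_trans p1 u1) ?(lt_le_trans u2) //.
      by rewrite (@k_const p (n%:R * h)) ?p1 ?p2.
    rewrite /= -E.
    have -> : walk_sum h n + (x (n.+1%:R * h) - x (n%:R * h)) - x (n.+1%:R * h) = walk_sum h n - x (n%:R * h) by ring.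
    by apply: IH => //; exact: lt_trans nj.
  have pj : (p.+2 <= j)%N.
    rewrite ltnNge; apply/negP => jp.
    have : tau j <= tau p.+1.
      rewrite -(subnK jp); elim: (p.+1 - j)%N => [//|q IHq].
      by rewrite addSn (le_trans IHq) // ltW.
    by move=> /(lt_le_trans nj) /(lt_trans hp'); rewrite ltxx.
  have := IH p.+1 nT' p2; have := step n nT => s1 s2.
  apply: (@le_trans _ _ (p.+2%:R * eta)); last by rewrite ler_wpM2r ?(ltW eta0) // ler_nat.
  have -> : p.+2%:R * eta = p.+1%:R * eta + eta by rewrite -[p.+2]addn1 natrD mulrDl mul1r.
  rewrite /=; move: s1 s2; rewrite !ler_norml => /andP[? ?] /andP[? ?]; apply/andP; split; lra.
move=> n nT; apply: le_trans (main n N nT (le_lt_trans nT hN)) _.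
rewrite /eta mulrA ler_pdivrMr ?ltr0n // mulrC ler_wpM2l ?(ltW e0) // ler_nat //.
Qed.

Section Reflected.
Variable r : R -> R.
Hypotheses (r0 : r 0 = 0) (cr : continuous r).
Hypothesis rmono : forall s t, 0 <= s <= t -> r s <= r t.
Hypothesis rpos : forall t, 0 <= t -> 0 <= x t + r t.
Hypothesis rflat : forall s t, 0 <= s <= t -> (forall u, s <= u <= t -> 0 < x u + r u) -> r t = r s.

(** One half of the Skorokhod formula, from flatness: were [r] above both 0 and the running maximum
    of -x, it would cross an intermediate level, after which x + r stays positive and [r] cannot
    grow. *)
Lemma regulator_le t : 0 <= t -> exists2 s, 0 <= s <= t & r t <= Num.max 0 (- x s).
Proof.
move=> t0; have [s st hs] := path_max (lexx 0) t0 (cont0N switched_cont0).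
exists s => //; rewrite leNgt; apply/negP => H.
set M := Num.max 0 (- x s) in H.
have M0 : 0 <= M by rewrite le_max lexx.
pose v := (M + r t) / 2.
have [||u] := @IVT R r 0 t v t0.
- exact: continuous_subspaceT.
- by rewrite r0 min_l ?max_r /v; [apply/andP; split; lra|lra|lra].
rewrite in_itv /= => /andP[u0 ut] ru.
have : r t = r u.
  apply: rflat => [|w /andP[uw wt]]; first by rewrite u0.
  have rw := @rmono u w; rewrite u0 uw in rw; have {}rw := rw isT.
  have w0 : 0 <= w <= t by rewrite (le_trans u0 uw) wt.
  have := hs w w0.
  have : - x s <= M by rewrite le_max lexx orbT.
  rewrite /v in ru; lra.
rewrite ru /v; lra.
Qed.

Fixpoint lindley (h : R) n : R := if n is n'.+1 then
  Num.max (lindley h n' + (mu (k (n'%:R * h)) * h + sigma (k (n'%:R * h)) * (b (n'.+1%:R * h) - b (n'%:R * h)))) 0 else 0.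

(** Discrete Skorokhod formula: the regulator of the recursion is the running maximum of minus the
    walk. *)
Lemma lindley_sup h n : (forall l, (l <= n)%N -> - walk_sum h l <= lindley h n - walk_sum h n) /\
  (exists2 l, (l <= n)%N & lindley h n - walk_sum h n = - walk_sum h l).
Proof.
elim: n => [|n [IH1 [l ln IH2]]].
  by split => [l|]; [rewrite leqn0 => /eqP ->; rewrite /= subr0 oppr0|exists 0%N => //=; rewrite subr0 oppr0].
rewrite /=; set xi := (_ * h + _).
have E : Num.max (lindley h n + xi) 0 - (walk_sum h n + xi) =
  Num.max (lindley h n - walk_sum h n) (- (walk_sum h n + xi)).
  by rewrite addr_maxl sub0r; congr (Num.max _ _); ring.
rewrite E; split.
  move=> l'; rewrite leq_eqVlt => /predU1P[->|ln']; first by rewrite le_max lexx orbT.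
  by rewrite le_max IH1.
have [h1|h1] := leP (- (walk_sum h n + xi)) (lindley h n - walk_sum h n).
  by exists l; rewrite ?(leqW ln).
by exists n.+1.
Qed.

Lemma lindley_cvg T eps : 0 < eps -> exists2 h0, 0 < h0 & forall h, 0 < h <= h0 ->
  forall n, n%:R * h <= T -> `|lindley h n - (x (n%:R * h) + r (n%:R * h))| <= eps.
Proof.
move=> e0; have e3 : 0 < eps / 3 by rewrite divr_gt0.
have [h1 h10 H1] := walk_sum_cvg T e3.
have [d d0 hd] := heine T switched_cont0 e3.
exists (Num.min h1 (d / 2)) => [|h]; first by rewrite lt_min h10 divr_gt0.
rewrite le_min => /and3P[hp hh1 hd2] n nT.
have hh : 0 < h <= h1 by rewrite hp.
have n0 : 0 <= n%:R * h by rewrite mulr_ge0 // ltW.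
have lT l : (l <= n)%N -> l%:R * h <= n%:R * h by move=> ln; rewrite ler_wpM2r ?(ltW hp) // ler_nat.
have wl l : (l <= n)%N -> `|walk_sum h l - x (l%:R * h)| <= eps / 3.
  by move=> ln; apply: H1 => //; exact: le_trans (lT l ln) nT.
have [L1 [l ln L2]] := lindley_sup h n.
have wn := wl n (leqnn n).
have up : lindley h n - walk_sum h n <= r (n%:R * h) + eps / 3.
  have l0 : 0 <= l%:R * h by rewrite mulr_ge0 // ltW.
  have rl : r (l%:R * h) <= r (n%:R * h) by apply: rmono; rewrite l0 lT.
  have := rpos l0; have := wl l ln; rewrite L2 ler_norml => /andP[? ?]; lra.
have down : r (n%:R * h) <= lindley h n - walk_sum h n + 2 * (eps / 3).
  have [s /andP[s0 sn] rs] := regulator_le n0.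
  apply: (le_trans rs); rewrite ge_max; apply/andP; split.
    by have := L1 0%N (leq0n n); rewrite /= oppr0; lra.
  have [p /andP[p1 p2]] := grid_floor hp s0.
  have pn : (p <= n)%N.
    by rewrite -(ler_nat R) -(ler_pM2r hp) (le_trans p1).
  have p0 : 0 <= p%:R * h by rewrite mulr_ge0 // ltW.
  have i1 : 0 <= s <= T by rewrite s0 (le_trans sn).
  have i2 : 0 <= p%:R * h <= T by rewrite p0 (le_trans p1) // (le_trans sn).
  have sp : `|s - p%:R * h| < d.
    rewrite ger0_norm ?subr_ge0 //.
    have : p.+1%:R * h = p%:R * h + h by rewrite -[p.+1]addn1 natrD mulrDl mul1r.
    lra.
  have := hd _ _ i1 i2 sp; have := wl p pn; have := L1 p pn.
  rewrite !ler_norml => ? /andP[? ?] /andP[? ?]; lra.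
move: wn; rewrite !ler_norml => /andP[? ?]; apply/andP; split; lra.
Qed.

End Reflected.
End SwitchedEuler.

(** * First exits seen on a grid *)

Section ExitPath.
Variables (R : realType) (m : nat) (k : R -> 'I_m) (z : R -> R) (y : R -> nat -> R).
Variables (a b : R).
Hypotheses (ab : a < b) (z0 : a < z 0 < b).
Hypothesis k_right : forall t, 0 <= t -> exists2 d, 0 < d & forall u, t <= u < t + d -> k u = k t.
Hypothesis cz : cont0 z.
Hypothesis approx : forall T eps, 0 < eps -> exists2 h0, 0 < h0 & forall h, 0 < h <= h0 ->
  forall n, n%:R * h <= T -> `|y h n - z (n%:R * h)| <= eps.

Definition within c h n := forall l, (l < n)%N -> a + c < y h l < b - c.

(** The first grid time outside the shrunk interval falls between T - s and T, so the phase read [s]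
    later is the one on a right neighbourhood of T, namely [k T]. *)
Lemma exit_approx T j : 0 <= T -> z T = b -> (forall s, 0 <= s < T -> a < z s < b) -> k T = j ->
  exists2 s0, 0 < s0 & forall s, 0 < s <= s0 -> exists2 c0, 0 < c0 & forall c, 0 < c <= c0 ->
  exists2 h0, 0 < h0 & forall h, 0 < h <= h0 ->
  exists n, [/\ within c h n, b - c <= y h n <= b + c & k (n%:R * h + s) = j].
Proof.
move=> T0 zT zlt kT.
have Tp : 0 < T.
  rewrite lt_neqAle T0 andbT; apply/eqP => T00; move: z0.
  by rewrite T00 zT ltxx andbF.
have [d1 d10 hd1] := k_right T0.
have ba : 0 < b - a by rewrite subr_gt0.
have e1 : 0 < (b - a) / 2 by rewrite divr_gt0.
have [d2 d20 hd2] := cont0_near cz T0 e1.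
exists (Num.min (Num.min (d1 / 2) (d2 / 2)) T) => [|s]; first by rewrite !lt_min Tp !divr_gt0.
rewrite !le_min => /andP[sp /andP[/andP[sd1 sd2] sT]].
have Ts : 0 <= T - s by rewrite subr_ge0.
have [c1 /andP[c10 c1T] hc1] := path_min (lexx 0) Ts cz.
have [c2 /andP[c20 c2T] hc2] := path_max (lexx 0) Ts cz.
have i1 : a < z c1 < b by apply: zlt; rewrite c10 /=; lra.
have i2 : a < z c2 < b by apply: zlt; rewrite c20 /=; lra.
case/andP: i1 => i1 _; case/andP: i2 => _ i2.
(* On [0, T - s] the path keeps a distance 2 c from both levels, so the grid path cannot leave
   earlier; c is also small against the width, to tell the two ends apart. *)
exists (Num.min (Num.min ((z c1 - a) / 2) ((b - z c2) / 2)) ((b - a) / 4)) => [|c].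
  by rewrite !lt_min !divr_gt0 ?subr_gt0.
rewrite !le_min => /andP[cp /andP[/andP[ca cb] cab]].
have e2 : 0 < c / 2 by rewrite divr_gt0.
have [h1 h10 H1] := approx T e2.
have [d3 d30 hd3] := cont0_near cz T0 e2.
exists (Num.min h1 (d3 / 2)) => [|h]; first by rewrite lt_min h10 divr_gt0.
rewrite le_min => /and3P[hp hh1 hd].
have hh : 0 < h <= h1 by rewrite hp.
have [K /andP[K1 K2]] := grid_floor hp T0.
have grid0 n : 0 <= n%:R * h by rewrite mulr_ge0 // ltW.
have yK : b - c < y h K.
  have KS : K.+1%:R * h = K%:R * h + h by rewrite -[K.+1]addn1 natrD mulrDl mul1r.
  have : `|K%:R * h - T| < d3 by rewrite ler0_norm ?subr_le0 //; lra.
  move=> /(hd3 _ (grid0 K)); have := H1 h hh K K1.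
  rewrite zT ltr_norml ler_norml => /andP[? ?] /andP[? ?]; lra.
pose ex n := ~~ (a + c < y h n < b - c).
have exK : exists n, ex n by exists K; rewrite /ex [_ < b - c]ltNge (ltW yK) andbF.
pose n := ex_minn exK.
have [en nmin] : ex n /\ forall l, ex l -> (n <= l)%N by rewrite /n; case: ex_minnP.
have nK : (n <= K)%N by apply: nmin; rewrite /ex [_ < b - c]ltNge (ltW yK) andbF.
have nT : n%:R * h <= T by apply: le_trans K1; rewrite ler_wpM2r ?(ltW hp) // ler_nat.
have Hn := H1 h hh n nT.
have nTs : T - s < n%:R * h.
  rewrite ltNge; apply/negP => le; move: en; rewrite /ex.
  have in0 : 0 <= n%:R * h <= T - s by rewrite grid0.
  have := hc1 _ in0; have := hc2 _ in0; move: Hn; rewrite ler_norml => /andP[? ?] ? ?.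
  by move/negP; apply; apply/andP; split; lra.
exists n; split.
- move=> l ln; apply: contraT => el; move: (nmin l el); by rewrite leqNgt ln.
- have zb : z (n%:R * h) <= b.
    have [e|e] := eqVneq (n%:R * h) T; first by rewrite e zT.
    have /andP[_ /ltW //] : a < z (n%:R * h) < b.
    by apply: zlt; rewrite grid0 lt_neqAle e.
  have near : `|n%:R * h - T| < d2 by rewrite ler0_norm ?subr_le0 //; lra.
  have := hd2 _ (grid0 n) near; rewrite zT ltr_norml => /andP[z1 _].
  move: Hn en; rewrite /ex ler_norml negb_and -!leNgt => /andP[? ?] /orP[?|?]; apply/andP; split; lra.
by rewrite hd1 //; apply/andP; split; lra.
Qed.

Lemma within_approx T : 0 <= T -> (forall t, 0 <= t -> a < z t < b) ->
  exists2 c0, 0 < c0 & forall c, 0 < c <= c0 -> exists2 h0, 0 < h0 & forall h, 0 < h <= h0 ->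
  forall n, n%:R * h <= T -> a + c < y h n < b - c.
Proof.
move=> T0 zin.
have [c1 /andP[c10 _] hc1] := path_min (lexx 0) T0 cz.
have [c2 /andP[c20 _] hc2] := path_max (lexx 0) T0 cz.
have /andP[i1 _] := zin _ c10; have /andP[_ i2] := zin _ c20.
exists (Num.min ((z c1 - a) / 2) ((b - z c2) / 2)) => [|c]; first by rewrite !lt_min !divr_gt0 ?subr_gt0.
rewrite !le_min => /and3P[cp ca cb].
have e2 : 0 < c / 2 by rewrite divr_gt0.
have [h1 h10 H1] := approx T e2; exists h1 => // h hh n nT.
case/andP: (hh) => hp _.
have in0 : 0 <= n%:R * h <= T by rewrite nT mulr_ge0 // ltW.
have := hc1 _ in0; have := hc2 _ in0; have := H1 h hh n nT; rewrite ler_norml => /andP[? ?] ? ?.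
apply/andP; split; lra.
Qed.

Lemma first_exit t1 : 0 <= t1 -> ~~ (a < z t1 < b) -> exists T, [/\ 0 <= T, z T = a \/ z T = b &
  forall s, 0 <= s < T -> a < z s < b].
Proof.
move=> t10 ht1.
pose A := [set t | 0 <= t /\ ~~ (a < z t < b)].
have A1 : A t1 by [].
have hA : has_inf A by split; [exists t1|exists 0 => t []].
pose T := inf A.
have T0 : 0 <= T by apply: lb_le_inf; [exists t1|move=> t []].
have lt s : 0 <= s < T -> a < z s < b.
  move=> /andP[s0 sT]; apply: contraT => hs.
  have : T <= s by apply: ge_inf; [exact: hA.2|split].
  by rewrite leNgt sT.
exists T; split => //.
have le : a <= z T <= b.
  have [e|Tp] := eqVneq T 0; first by case/andP: z0 => h1 h2; rewrite e !ltW.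
  have Tp' : 0 < T by rewrite lt_neqAle eq_sym Tp.
  apply/andP; split; rewrite leNgt; apply/negP => H.
    have e0 : 0 < a - z T by lra.
    have [d d0 hd] := cont0_near cz T0 e0.
    pose s := T - Num.min (d / 2) T.
    have s0 : 0 <= s by rewrite subr_ge0 ge_min lexx orbT.
    have mp : 0 < Num.min (d / 2) T by rewrite lt_min Tp' divr_gt0.
    have md : Num.min (d / 2) T <= d / 2 by rewrite ge_min lexx.
    have sT : s < T by rewrite /s; lra.
    have : `|s - T| < d by rewrite ler0_norm /s; lra.
    move=> /(hd s s0); have /andP[h1 _] := lt s ltac:(by rewrite s0).
    by rewrite ltr_norml => /andP[? ?]; lra.
  have e0 : 0 < z T - b by lra.
  have [d d0 hd] := cont0_near cz T0 e0.
  pose s := T - Num.min (d / 2) T.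
  have s0 : 0 <= s by rewrite subr_ge0 ge_min lexx orbT.
  have mp : 0 < Num.min (d / 2) T by rewrite lt_min Tp' divr_gt0.
  have md : Num.min (d / 2) T <= d / 2 by rewrite ge_min lexx.
  have sT : s < T by rewrite /s; lra.
  have : `|s - T| < d by rewrite ler0_norm /s; lra.
  move=> /(hd s s0); have /andP[_ h1] := lt s ltac:(by rewrite s0).
  by rewrite ltr_norml => /andP[? ?]; lra.
case/andP: le => le1 le2.
have [e1|e1] := eqVneq (z T) a; first by left.
have [e2|e2] := eqVneq (z T) b; first by right.
exfalso.
have i1 : a < z T by rewrite lt_neqAle eq_sym e1.
have i2 : z T < b by rewrite lt_neqAle e2.
have e0 : 0 < Num.min (z T - a) (b - z T) by rewrite lt_min !subr_gt0 i1.
have [d d0 hd] := cont0_near cz T0 e0.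
have [t [t0 ht] tT] := inf_adherent d0 hA.
have Tt : T <= t by apply: ge_inf; [exact: hA.2|split].
have : `|t - T| < d by rewrite ger0_norm ?subr_ge0 // ltrBlDl.
move=> /(hd t t0); rewrite lt_min => /andP[g1 g2].
move/negP: ht; apply; move: g1 g2; rewrite !ltr_norml => /andP[? ?] /andP[? ?].
apply/andP; split; lra.
Qed.

End ExitPath.

(** * Exit probabilities as boundary values *)

Section Liminf.
Context d (T : measurableType d).

Definition liminfs (A : nat -> set T) := \bigcup_N \bigcap_(n in [set n | (N <= n)%N]) A n.

Lemma measurable_liminfs A : (forall n, measurable (A n)) -> measurable (liminfs A).
Proof. by move=> mA; apply: bigcupT_measurable => N; apply: bigcap_measurableType. Qed.

Context (R : realType) (P : probability T R).
Local Open Scope ereal_scope.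

Lemma liminfs_le A (x : \bar R) : (forall n, measurable (A n)) ->
  (exists N, forall n, (N <= n)%N -> P (A n) <= x) -> P (liminfs A) <= x.
Proof.
move=> mA [N hN].
pose F k := \bigcap_(n in [set n | (k <= n)%N]) A n.
have mF k : measurable (F k) by exact: bigcap_measurableType.
have cv : P \o F @ \oo --> P (liminfs A).
  apply: nondecreasing_cvg_mu => //; first exact: measurable_liminfs.
  by move=> k l kl; apply/subsetPset => w h n /= ln; apply: h; exact: leq_trans ln.
rewrite -(cvg_lim _ cv) //; apply: lime_le; first by apply/cvg_ex; exists (P (liminfs A)).
apply: nearW => k; apply: (@le_trans _ _ (P (A (maxn N k)))).
  apply: le_measure; rewrite ?inE //.
  by move=> w h; apply: h; exact: leq_maxr.
by apply: hN; exact: leq_maxl.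
Qed.

End Liminf.

Section ExitLaw.
Variables (R : realType) (m : nat).
Context d (Omega : measurableType d).
Variables (P : probability Omega R) (kappa : R -> Omega -> 'I_m) (z : R -> Omega -> R).
Variables (y : R -> nat -> Omega -> R) (a b : R) (F : bool -> 'I_m -> R -> R).
Hypotheses (ab : a < b) (z0 : forall w, a < z 0 w < b).
Hypothesis mk : forall t j, measurable [set w | kappa t w = j].
Hypothesis k_right : forall w t, 0 <= t ->
  exists2 e, 0 < e & forall u, t <= u < t + e -> kappa u w = kappa t w.
Hypothesis cz : forall w, cont0 (fun t => z t w).
Hypothesis my : forall h n, measurable_fun setT (y h n).
Hypothesis approx : forall w T eps, 0 < eps -> exists2 h0, 0 < h0 & forall h, 0 < h <= h0 ->
  forall n, n%:R * h <= T -> `|y h n w - z (n%:R * h) w| <= eps.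

Definition side (e : bool) := if e then b else a.

Definition stay (T c h : R) : set Omega :=
  [set w | forall n, n%:R * h <= T -> a + c < y h n w < b - c].

Definition cross e j (s c h : R) : set Omega := [set w | exists n,
  [/\ within (fun h n => y h n w) a b c h n, side e - c <= y h n w <= side e + c & kappa (n%:R * h + s) w = j]].

Definition exits e j : set Omega := [set w | exists T, [/\ 0 <= T, z T w = side e,
  forall s, 0 <= s < T -> a < z s w < b & kappa T w = j]].

Hypothesis stay_bound : forall eps, 0 < eps -> exists T : nat, exists2 c0, 0 < c0 & forall c, 0 < c <= c0 ->
  exists2 h0, 0 < h0 & forall h, 0 < h <= h0 -> (P (stay T%:R c h) <= eps%:E)%E.
Hypothesis cross_bound : forall e j s eps, 0 < s -> 0 < eps -> exists2 c0, 0 < c0 & forall c, 0 < c <= c0 ->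
  exists2 h0, 0 < h0 & forall h, 0 < h <= h0 -> (P (cross e j s c h) <= (F e j s + eps)%:E)%E.
Hypothesis F_cont : forall e j eps, 0 < eps -> exists2 s0, 0 < s0 & forall s, 0 < s <= s0 ->
  F e j s <= F e j 0 + eps.
Hypothesis F_sum : \sum_j F true j 0 + \sum_j F false j 0 = 1.

Let u (n : nat) : R := n.+1%:R^-1.

Lemma u_gt0 n : 0 < u n. Proof. by rewrite invr_gt0 ltr0n. Qed.

Lemma u_small x : 0 < x -> exists N, forall n, (N <= n)%N -> 0 < u n <= x.
Proof.
move=> x0; exists (Num.truncn x^-1) => n Nn; rewrite u_gt0 /= /u invf_ple ?posrE ?ltr0n //.
by rewrite ltW // (lt_le_trans (truncnS_gt _)) // ler_nat.
Qed.

Lemma measurable_inside h n (c1 c2 : R) : measurable [set w | c1 < y h n w < c2].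
Proof.
have -> : [set w | c1 < y h n w < c2] = y h n @^-1` `]c1, c2[%classic by apply/seteqP; split => w; rewrite /= in_itv.
by rewrite -[X in measurable X]setTI; apply: my.
Qed.

Lemma measurable_stay T c h : measurable (stay T c h).
Proof.
have -> : stay T c h = \bigcap_n (if n%:R * h <= T then [set w | a + c < y h n w < b - c] else setT).
  apply/seteqP; split => w hw n.
    by move=> _; case: ifP => // hn; exact: hw.
  by move=> hn; have := hw n Logic.I; rewrite hn.
by apply: bigcapT_measurable => n; case: ifP => // _; exact: measurable_inside.
Qed.

Lemma measurable_cross e j s c h : measurable (cross e j s c h).
Proof.
have -> : cross e j s c h = \bigcup_n ((\bigcap_l (if (l < n)%N then [set w | a + c < y h l w < b - c] else setT)) `&`
   y h n @^-1` `[side e - c, side e + c]%classic `&` [set w | kappa (n%:R * h + s) w = j]).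
  apply/seteqP; split => w.
    move=> [n [h1 h2 h3]]; exists n => //; split; last by [].
    split; last by rewrite /= in_itv.
    by move=> l _; case: ifP => // ln; exact: h1.
  move=> [n _ [[h1]]]; rewrite /= in_itv /= => h2 h3; exists n; split => //.
    by move=> l ln; have := h1 l Logic.I; rewrite ln.
apply: bigcupT_measurable => n; apply: measurableI => //; apply: measurableI.
  by apply: bigcapT_measurable => l; case: ifP => // _; exact: measurable_inside.
by rewrite -[X in measurable X]setTI; apply: my.
Qed.

(** The order of the lower limits, mesh inside margin inside delay, is that of the quantifiers in
    [cross_bound]; sequences 1/(n+1) keep the event measurable. *)
Definition cross_lim e j : set Omega :=
  liminfs (fun p => liminfs (fun q => liminfs (fun n => cross e j (u p) (u q) (u n)))).

Lemma measurable_cross_lim e j : measurable (cross_lim e j).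
Proof. by do 3!(apply: measurable_liminfs => ?); exact: measurable_cross. Qed.

Lemma cross_lim_le e j : (P (cross_lim e j) <= (F e j 0)%:E)%E.
Proof.
apply/lee_addgt0Pr => eps e0; rewrite -EFinD.
have e2 : 0 < eps / 2 by rewrite divr_gt0.
have [s0 s00 hs] := F_cont e j e2.
have [N hN] := u_small s00.
apply: liminfs_le => [p|]; first by do 2!(apply: measurable_liminfs => ?); exact: measurable_cross.
exists N => p /hN up.
have [c0 c00 hc] := cross_bound e j (u_gt0 p) e2.
have [N1 hN1] := u_small c00.
apply: liminfs_le => [q|]; first by apply: measurable_liminfs => ?; exact: measurable_cross.
exists N1 => q /hN1 uq.
have [h0 h00 hh] := hc _ uq.
have [N2 hN2] := u_small h00.
apply: liminfs_le => [n|]; first exact: measurable_cross.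
exists N2 => n /hN2 un; apply: (le_trans (hh _ un)).
by rewrite lee_fin; have := hs _ up; lra.
Qed.

Lemma liminf3 (Q : R -> R -> R -> Prop) :
  (exists2 s0, 0 < s0 & forall s, 0 < s <= s0 -> exists2 c0, 0 < c0 & forall c, 0 < c <= c0 ->
    exists2 h0, 0 < h0 & forall h, 0 < h <= h0 -> Q s c h) ->
  exists N, forall p, (N <= p)%N -> exists N1, forall q, (N1 <= q)%N -> exists N2, forall n, (N2 <= n)%N ->
    Q (u p) (u q) (u n).
Proof.
move=> [s0 s00 hs]; have [N hN] := u_small s00; exists N => p /hN /hs[c0 c00 hc].
have [N1 hN1] := u_small c00; exists N1 => q /hN1 /hc[h0 h00 hh].
by have [N2 hN2] := u_small h00; exists N2 => n /hN2 /hh.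
Qed.

Lemma exits_cross e j w : exits e j w ->
  exists2 s0, 0 < s0 & forall s, 0 < s <= s0 -> exists2 c0, 0 < c0 & forall c, 0 < c <= c0 ->
  exists2 h0, 0 < h0 & forall h, 0 < h <= h0 -> cross e j s c h w.
Proof.
move=> [T [T0 zT zin kT]]; case: e zT => zT.
  exact: (exit_approx ab (z0 w) (k_right w) (@cz w) (approx w) T0 zT zin kT).
have ab' : - b < - a by rewrite ltrN2.
have z0' : - b < - z 0 w < - a by rewrite !ltrN2 andbC.
have ap' S eps : 0 < eps -> exists2 h0, 0 < h0 & forall h, 0 < h <= h0 ->
  forall n, n%:R * h <= S -> `|- y h n w - - z (n%:R * h) w| <= eps.
  by move=> /(approx w S)[h0 h00 H]; exists h0 => // h hh n nS; rewrite -opprD normrN; exact: H.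
have zin' s : 0 <= s < T -> - b < - z s w < - a by move=> /zin; rewrite !ltrN2 andbC.
have zT' : - z T w = - a by rewrite zT.
have [s0 s00 hs] := @exit_approx R m (kappa^~ w) (fun t => - z t w) (fun h n => - y h n w) _ _ ab' z0'
  (k_right w) (cont0N (@cz w)) ap' T j T0 zT' zin' kT.
exists s0 => // s /hs[c0 c00 hc]; exists c0 => // c /hc[h0 h00 hh]; exists h0 => // h /hh[n [h1 h2 h3]].
exists n; split => //.
  by move=> l /h1 /andP[? ?]; apply/andP; split; lra.
by rewrite /side /=; move/andP: h2 => [? ?]; apply/andP; split; lra.
Qed.

Lemma exits_sub e j : exits e j `<=` cross_lim e j.
Proof.
move=> w /exits_cross /liminf3[N hN].
exists N => // p /hN[N1 hN1]; exists N1 => // q /hN1[N2 hN2]; by exists N2 => // n /hN2.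
Qed.

(** Both events locate the same first grid time outside the shrunk interval, and for c below half
    the width the two windows are disjoint. *)
Lemma cross_unique e j e' j' s c h w : 0 < c < (b - a) / 2 ->
  cross e j s c h w -> cross e' j' s c h w -> e = e' /\ j = j'.
Proof.
move=> cab [n [h1 h2 h3]] [n' [h1' h2' h3']].
have out e1 n1 n2 : side e1 - c <= y h n1 w <= side e1 + c ->
  within (fun h n => y h n w) a b c h n2 -> (n2 <= n1)%N.
  move=> hs hw; rewrite leqNgt; apply/negP => /hw; case: e1 hs => /=.
    by move=> /andP[hs _] /andP[_]; rewrite ltNge hs.
  by move=> /andP[_ hs] /andP[]; rewrite ltNge hs.
have nn : n = n' by apply/eqP; rewrite eqn_leq (out e' n' n) ?(out e n n').
subst n'; split; last by rewrite -h3 -h3'.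
move: h2 h2' cab; case: e {h1 h3}; case: e' {h1' h3'} => //= /andP[? ?] /andP[? ?] /andP[? ?]; exfalso; lra.
Qed.

Lemma exits_unique e j e' j' w : exits e j w -> cross_lim e' j' w -> e = e' /\ j = j'.
Proof.
move=> /exits_sub[N _ H] [N' _ H'].
have ba : 0 < (b - a) / 4 by rewrite divr_gt0 ?subr_gt0.
have [K hK] := u_small ba.
pose p := maxn N N'.
have [N1 _ H1] := H p (leq_maxl _ _); have [N1' _ H1'] := H' p (leq_maxr _ _).
pose q := maxn (maxn N1 N1') K.
have [N2 _ H2] := H1 q (leq_trans (leq_maxl _ _) (leq_maxl _ _)).
have [N2' _ H2'] := H1' q (leq_trans (leq_maxr _ _) (leq_maxl _ _)).
have /andP[uq1 uq2] := hK q (leq_maxr _ _).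
have cq : 0 < u q < (b - a) / 2 by apply/andP; split; lra.
exact: (cross_unique cq (H2 (maxn N2 N2') (leq_maxl _ _)) (H2' (maxn N2 N2') (leq_maxr _ _))).
Qed.

Definition never : set Omega := [set w | forall t, 0 <= t -> a < z t w < b].

(** Countably many grid conditions describe the event, which makes it measurable. *)
Lemma neverE : never = \bigcap_T \bigcup_q liminfs (fun n => stay T%:R (u q) (u n)).
Proof.
apply/seteqP; split => w.
  move=> hw T _.
  have [c0 c00 hc] := within_approx (@cz w) (approx w) (ler0n _ T) hw.
  have [N1 hN1] := u_small c00; exists N1 => //.
  have [h0 h00 hh] := hc _ (hN1 _ (leqnn _)).
  have [N2 hN2] := u_small h00; exists N2 => // n /hN2 /hh.
  by [].
move=> hw t t0; have [q _ [n0 _ hn]] := hw (Num.truncn t).+1 Logic.I.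
set T := (Num.truncn t).+1 in hn.
have tT : t < T%:R by exact: truncnS_gt.
have uq := u_gt0 q.
have key eps : 0 < eps -> a + u q - eps <= z t w <= b - u q + eps.
  move=> e0; have e2 : 0 < eps / 2 by rewrite divr_gt0.
  have [h0 h00 hh] := approx w T%:R e2.
  have [dd dd0 hd] := cont0_near (@cz w) t0 e2.
  have m0 : 0 < Num.min h0 (dd / 2) by rewrite lt_min h00 divr_gt0.
  have [K hK] := u_small m0.
  set n := maxn n0 K.
  have /andP[un0] := hK n (leq_maxr _ _); rewrite le_min => /andP[un1 un2].
  have [l /andP[l1 l2]] := grid_floor un0 t0.
  have lT : l%:R * u n <= T%:R by rewrite (le_trans l1) // ltW.
  have l0 : 0 <= l%:R * u n by rewrite mulr_ge0 // ltW.
  have uu : 0 < u n <= h0 by rewrite un0.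
  have lS : l.+1%:R * u n = l%:R * u n + u n by rewrite -[l.+1]addn1 natrD mulrDl mul1r.
  have dl : `|l%:R * u n - t| < dd by rewrite ler0_norm ?subr_le0 //; lra.
  have := hh _ uu l lT; have := hd _ l0 dl; have /andP[] := hn n (leq_maxl _ _) l lT.
  rewrite ltr_norml ler_norml => ? ? /andP[? ?] /andP[? ?]; apply/andP; split; lra.
have u2 : 0 < u q / 2 by rewrite divr_gt0.
by have /andP[? ?] := key _ u2; apply/andP; split; lra.
Qed.

Lemma measurable_never : measurable never.
Proof.
rewrite neverE; apply: bigcapT_measurable => T; apply: bigcupT_measurable => q.
by apply: measurable_liminfs => n; exact: measurable_stay.
Qed.

Lemma never_null : P never = 0.
Proof.
apply/eqP; rewrite eq_le measure_ge0 andbT; apply/lee_addgt0Pr => eps e0; rewrite add0e.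
have [T [c0 c00 hc]] := stay_bound e0.
have mS q : measurable (liminfs (fun n => stay T%:R (u q) (u n))).
  by apply: measurable_liminfs => n; exact: measurable_stay.
apply: (@le_trans _ _ (P (liminfs (fun q => liminfs (fun n => stay T%:R (u q) (u n)))))).
  apply: le_measure; rewrite ?inE; [exact: measurable_never|exact: measurable_liminfs|].
  move=> w hw.
  have [c1 c10 hc1] := within_approx (@cz w) (approx w) (ler0n _ T) hw.
  have [N1 hN1] := u_small c10; exists N1 => // q /hN1 /hc1[h0 h00 hh].
  have [N2 hN2] := u_small h00; exists N2 => // n /hN2 /hh.
  by [].
have [N1 hN1] := u_small c00.
apply: liminfs_le => //; exists N1 => q /hN1 /hc[h0 h00 hh].
have [N2 hN2] := u_small h00.
apply: liminfs_le => [n|]; first exact: measurable_stay.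
by exists N2 => n /hN2 /hh.
Qed.

(** Gives measurability: a path that leaves the interval does so at some end and phase, and
    [cross_lim] determines which. *)
Lemma exitsE e j : exits e j = cross_lim e j `&` ~` never.
Proof.
apply/seteqP; split => w.
  move=> ew; split; first exact: exits_sub.
  move: ew => [T [T0 zT _ _]] /(_ T T0); rewrite zT.
  by case: (e) => /=; rewrite ltxx ?andbF.
move=> [lw /existsNP[t /not_implyP[t0 /negP zt]]].
have [T [T0 zT zin]] := first_exit (z0 w) (@cz w) t0 zt.
have ew e' : z T w = side e' -> exits e j w.
  move=> zT'; have ew : exits e' (kappa T w) w by exists T.
  by have [E1 E2] := exits_unique ew lw; rewrite -E1 -E2.
by case: zT => [/(ew false)|/(ew true)].
Qed.

(** Paths that never leave have probability 0, so the exit probabilities sum to 1, and so do their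
    upper bounds. *)
Theorem exit_law e j : measurable (exits e j) /\ P (exits e j) = (F e j 0)%:E.
Proof.
have mE e' j' : measurable (exits e' j').
  by rewrite exitsE; apply: measurableI; [exact: measurable_cross_lim|apply: measurableC; exact: measurable_never].
split => //.
have leE e' j' : (P (exits e' j') <= (F e' j' 0)%:E)%E.
  apply: le_trans (cross_lim_le e' j'); apply: le_measure; rewrite ?inE //.
    exact: measurable_cross_lim.
  exact: exits_sub.
pose p e' j' := fine (P (exits e' j')).
have pE e' j' : P (exits e' j') = (p e' j')%:E by rewrite /p fineK //; exact: fin_num_measure.
have p_le e' j' : p e' j' <= F e' j' 0 by rewrite -lee_fin -pE.
pose U e' := \bigcup_(j' in [set: 'I_m]) exits e' j'.
have mU e' : measurable (U e') by apply: fin_bigcup_measurable => // ; exact: finite_finset.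
have PU e' : P (U e') = (\sum_j' p e' j')%:E.
  refine (etrans (@measure_ord_partition _ _ _ P m (exits e') _ _ (mE e') _) _).
  - by move=> w; split => [[j' _ h]|[j' h]]; exists j'.
  - by move=> k l w h1 h2; have [] := exits_unique h1 (exits_sub h2).
  - by rewrite -sumEFin; apply: eq_bigr => j' _; exact: pE.
have tot : (P (U true `|` U false) = 1)%E.
  have -> : U true `|` U false = ~` never.
    apply/seteqP; split => w.
      by case=> -[j' _]; rewrite exitsE => -[].
    move=> /existsNP[t /not_implyP[t0 /negP zt]].
    have [T [T0 zT zin]] := first_exit (z0 w) (@cz w) t0 zt.
    case: zT => zT; [right|left]; exists (kappa T w) => //; exists T; split => //.
  by rewrite probability_setC ?never_null ?sube0 //; exact: measurable_never.
have sum1 : \sum_j' p true j' + \sum_j' p false j' = 1.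
  apply: EFin_inj; rewrite EFinD -!PU -measureU //.
  apply/seteqP; split => w //= [[j1 _ h1] [j2 _ h2]].
  by have [] := exits_unique h1 (exits_sub h2).
have d0 e' j' : 0 <= F e' j' 0 - p e' j' by rewrite subr_ge0.
have sum0 : \sum_j' (F true j' 0 - p true j') + \sum_j' (F false j' 0 - p false j') = 0.
  have E e' : \sum_j' (F e' j' 0 - p e' j') = \sum_j' F e' j' 0 - \sum_j' p e' j' by exact: sumrB.
  by rewrite !E addrACA F_sum -opprD sum1 subrr.
have s0 e' : 0 <= \sum_j' (F e' j' 0 - p e' j') by exact: sumr_ge0.
have tight e' : \sum_j' (F e' j' 0 - p e' j') = 0.
  have := s0 true; have := s0 false; case: e'; lra.
have := tight e => /eqP; rewrite psumr_eq0 // => /allP /(_ j); rewrite mem_index_enum => /(_ isT) /eqP pz.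
by rewrite pE; congr EFin; lra.
Qed.

End ExitLaw.

Lemma lift_columns (F : fieldType) p q n (A : 'M[F]_(p, q)) (B : 'M[F]_(p, n)) :
  (forall k, exists v : 'cV[F]_q, A *m v = col k B) -> exists V : 'M[F]_(q, n), A *m V = B.
Proof.
move=> H; exists (\matrix_(i, k) sval (cid (H k)) i 0).
apply/matrixP => i k; have := svalP (cid (H k)) => /(congr1 (fun M : 'cV_p => M i 0)).
by rewrite !mxE => <-; apply: eq_bigr => l _; rewrite !mxE.
Qed.

Section Preliminaries.
Variable R : realType.

Definition fold_at0 (refl : bool) (y : R) : R := if refl then Num.max y 0 else y.

Lemma measurable_fold_at0 refl : measurable_fun setT (fold_at0 refl).
Proof. by rewrite /fold_at0; case: refl => //; apply: measurable_maxr. Qed.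

Lemma near_ball (x : R) (Pr : R -> Prop) : (\forall y \near x, Pr y) ->
  exists2 d, 0 < d & forall y, `|y - x| < d -> Pr y.
Proof.
by move=> [d /= d0 h]; exists d => // y xy; apply: h; rewrite /ball_ /= distrC.
Qed.

Lemma positive_lower_bound m (v : 'I_m -> R) : (forall i, 0 < v i) -> exists2 rho, 0 < rho & forall i, rho <= v i.
Proof.
move=> v0.
have : \forall e \near (0 : R)^'+, forall i, e < v i.
  by apply: filter_forall => i; exact: nbhs_right_lt.
have : \forall e \near (0 : R)^'+, 0 < e by exact: nbhs_right_gt.
move=> h1 h2; have [e [e0 he]] := filter_ex (filterI h1 h2).
by exists e => // i; exact: ltW.
Qed.

End Preliminaries.

(** * Perturbed solutions as test functions *)

Section Supersolution.
Variables (R : realType) (m : nat) (Q : 'M[R]_m) (mu sigma : 'cV[R]_m).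
Hypothesis gQ : is_generator Q.
Hypothesis s0 : forall i, sigma i 0 != 0.
Variables (refl : bool) (lo b : R).
Hypotheses (lob : lo < b) (lo0 : refl -> lo = 0).

Variables (f f1 f2 : R -> 'cV[R]_m).
Hypothesis cf : c2fun f f1 f2.
Hypothesis gf : forall x i, genop Q sigma mu (f x) (f1 x) (f2 x) i = 0.
Hypothesis f0 : forall y i, lo <= y <= b -> 0 <= f y i 0.
Hypothesis f10 : refl -> forall i, f1 0 i 0 = 0.
Hypothesis lob0 : lo <= 0 <= b.

(** A small barrier is added to the solution, and the sum is cut off to 0 away from the interval.
    The barrier gives a strict loss in the generator, strict dominance of the boundary values near
    both ends, and under reflection a negative slope at 0, so that folding a slightly negative level
    to 0 does not increase the value. *)
Lemma supersolution eps : 0 < eps -> exists G : 'I_m -> R -> R, exists delta h0 c0 : R,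
  [/\ forall i, measurable_fun setT (G i), forall i y, 0 <= G i y,
    [/\ 0 < delta, 0 < h0 & 0 < c0],
    forall h y i, 0 < h <= h0 -> lo <= y <= b ->
      (\sum_j (expmx (h *: Q) i j)%:E * \int[gaussP (Num.sqrt h)]_x (G j (euler_next mu sigma h (fold_at0 refl) i y x))%:E
       <= (G i y - delta * h)%:E)%E &
    [/\ forall y i, lo - c0 <= y <= lo + c0 -> f lo i 0 <= G i y,
        forall y i, b - c0 <= y <= b + c0 -> f b i 0 <= G i y &
        forall i, G i 0 <= f 0 i 0 + eps]].
Proof.
move=> eps0.
have [th th0 hth] := barrier_rate s0 mu.
have [rho rho0 hrho] := positive_lower_bound hth.
(* The barrier is at least 1 up to level b + 1 and at most [K] at 0, so that eta K = eps bounds the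
   perturbation there. *)
pose K := expR (th * (b + 1)) + 1.
have K0 : 0 < K by rewrite addr_gt0 ?expR_gt0.
pose eta := eps / K.
have eta0 : 0 < eta by rewrite divr_gt0.
pose g x := f x + eta *: barrier m th K x.
pose g1 x := f1 x + eta *: barrier1 m th x.
pose g2 x := f2 x + eta *: barrier2 m th x.
have cg : c2fun g g1 g2 by apply: c2funD cf _; apply: c2funZ; exact: c2fun_barrier.
have gE y i : g y i 0 = f y i 0 + eta * (K - expR (th * y)) by rewrite /g !mxE.
have bar y : y <= b + 1 -> 1 <= K - expR (th * y).
  by move=> yb; rewrite /K addrAC -[leLHS]add0r lerD2r subr_ge0 ler_expR ler_pM2l.
have gf_ge y i : y <= b + 1 -> f y i 0 + eta <= g y i 0.
  by move=> /bar hy; rewrite gE lerD2l -[leLHS]mulr1 ler_pM2l.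
have nearg p : p <= b -> exists2 e, 0 < e & forall y, `|y - p| < e -> forall i, f p i 0 < g y i 0.
  move=> pb; apply: near_ball.
  apply: (@filter_forall R 'I_m (fun i y => f p i 0 < g y i 0) (nbhs p) _) => i.
  have ci : continuous (fun y : R => g y i 0) by exact: c2fun_cont cg.
  have lt : f p i 0 < g p i 0.
    have pb1 : p <= b + 1 by lra.
    by have := gf_ge p i pb1; lra.
  exact: (cvgr_gt _ (ci p) _ lt).
have [d1 d10 hd1] := nearg lo (ltW lob).
have [d2 d20 hd2] := nearg b (lexx b).
have [r0 r00 hr0] : exists2 r0, 0 < r0 & refl -> forall z i, - r0 <= z <= 0 -> g 0 i 0 <= g z i 0.
  have [Kc Kc0 hK] := cg 0.
  pose B := mxabs (g2 0) + Kc + 1.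
  have B0 : 0 < B by rewrite ltr_wpDl // addr_ge0 ?mxabs_ge0.
  exists (Num.min 1 (eta * th / B)) => [|hr z i /andP[zr z0]].
    by rewrite lt_min ltr01 divr_gt0 // mulr_gt0.
  have z1 : `|z| <= 1.
    rewrite ler0_norm // lerNl; apply: le_trans zr; rewrite lerN2 ge_min lexx //.
  have zB : `|z| * B <= eta * th.
    rewrite -ler_pdivlMr // ler0_norm // lerNl; apply: le_trans zr; rewrite lerN2 ge_min lexx orbT //.
  have := hK 0 z; rewrite normr0 add0r => /(_ (lexx _) z1 i).
  have -> : g1 0 i 0 = - (eta * th).
    by rewrite /g1 !mxE f10 // mulr0 expR0 mulr1 add0r mulrN.
  have b2 : `|g2 0 i 0| <= mxabs (g2 0) by exact: ler_mxabs.
  have az : `|z| = - z by exact: ler0_norm.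
  have nz := normr_ge0 z.
  have z3 : `|z| ^+ 3 <= `|z| ^+ 2 by apply: ler_wiXn2l.
  have p1 : Kc * `|z| ^+ 3 <= Kc * `|z| ^+ 2 by exact: ler_wpM2l.
  have p2 : `|z| ^+ 2 / 2 * g2 0 i 0 >= - (`|z| ^+ 2 * mxabs (g2 0)).
    have q1 : `| `|z| ^+ 2 / 2 * g2 0 i 0| <= `|z| ^+ 2 * mxabs (g2 0).
      rewrite normrM ler_pM // ger0_norm ?divr_ge0 ?sqr_ge0 //.
      have := sqr_ge0 `|z|; lra.
    by move: q1; rewrite ler_norml => /andP[].
  have p3 : `|z| * (`|z| * B) <= `|z| * (eta * th) by exact: ler_wpM2l.
  have -> : z ^+ 2 = `|z| ^+ 2 by rewrite real_normK // num_real.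
  rewrite ler_norml => /andP[q1 _].
  have e1 : `|z| * (`|z| * B) = `|z| ^+ 2 * mxabs (g2 0) + Kc * `|z| ^+ 2 + `|z| ^+ 2 by rewrite /B; ring.
  have e2 : z * - (eta * th) = `|z| * (eta * th) by rewrite az; ring.
  have := sqr_ge0 `|z|; rewrite e1 in p3; rewrite e2 in q1; lra.
pose r := Num.min (Num.min (d1 / 2) (d2 / 2)) (Num.min r0 1).
have rp : 0 < r by rewrite !lt_min !divr_gt0 // r00 ltr01.
have rd1 : r <= d1 / 2 by rewrite !ge_min lexx.
have rd2 : r <= d2 / 2 by rewrite !ge_min lexx !orbT.
have rr0 : r <= r0 by rewrite !ge_min lexx !orbT.
have r1 : r <= 1 by rewrite !ge_min lexx !orbT.
have g_ge0 y i : lo - r <= y <= b + r -> 0 <= g y i 0.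
  move=> /andP[ya yb].
  have [h1|h1] := ltP y lo.
    have dy : `|y - lo| < d1 by rewrite ltr0_norm ?subr_lt0 //; lra.
    apply: (le_trans _ (ltW (hd1 y dy i))); apply: f0; rewrite lexx ltW //.
  have [h2|h2] := ltP b y.
    have dy : `|y - b| < d2 by rewrite gtr0_norm ?subr_gt0 //; lra.
    apply: (le_trans _ (ltW (hd2 y dy i))); apply: f0; rewrite lexx ltW //.
  have yb1 : y <= b + 1 by lra.
  have := gf_ge y i yb1; have := f0 i (y := y); rewrite h1 h2 => /(_ isT); lra.
pose G i z := if (lo - r <= z) && (z <= b + r) then g z i 0 else 0.
have mG i : measurable_fun setT (G i).
  apply: measurable_fun_ifT; last exact: measurable_cst.
    by apply: measurable_and; exact: measurable_fun_ler.
  apply: continuous_measurable_fun; exact: c2fun_cont cg.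
have G0 i z : 0 <= G i z by rewrite /G; case: ifP => // hz; exact: g_ge0.
have GE i z : lo - r <= z <= b + r -> G i z = g z i 0 by rewrite /G => ->.
have [Bg Bg0 hB] := c2fun_bounded (lo - r) (b + r) cg.
pose Gh j z := G j (fold_at0 refl z).
have mGh j : measurable_fun setT (Gh j) by exact: (measurableT_comp (mG j) (measurable_fold_at0 refl)).
have Gh0 j z : 0 <= Gh j z <= Bg.
  rewrite /Gh G0 /= /G; case: ifP => // hz.
  by have [h1 _ _] := hB _ j hz; apply: le_trans h1; exact: ler_norm.
have Ghg j z : lo - r <= z <= b + r -> Gh j z <= g z j 0.
  move=> hz; rewrite /Gh /fold_at0; case: (boolP refl) => hr; last by rewrite GE.
  have l0 := lo0 hr.
  have [zn|zp] := leP z 0; last by rewrite GE.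
  rewrite GE; first by apply: (hr0 hr); move: hz; rewrite l0 zn => /andP[? _]; apply/andP; split => //; lra.
  by case/andP: lob0 => ? ?; apply/andP; split; lra.
(* Half of a lower bound for the loss due to the barrier; e^{th y} is smallest at y = lo. *)
pose delta := eta * (th * expR (th * lo) * rho) / 2.
have pth : 0 < th * expR (th * lo) * rho by apply: mulr_gt0 => //; apply: mulr_gt0 => //; exact: expR_gt0.
have delta0 : 0 < delta by apply: divr_gt0 => //; exact: mulr_gt0.
have gen y i : lo <= y <= b -> genop Q sigma mu (g y) (g1 y) (g2 y) i <= - (2 * delta).
  move=> /andP[yl yb]; rewrite genopD genopZ gf genop_barrier // add0r mulrN lerN2.
  have -> : 2 * delta = eta * (th * expR (th * lo) * rho) by rewrite /delta; field.
  rewrite ler_pM2l // ler_pM //; first by rewrite mulr_ge0 ?expR_ge0 // ltW.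
  - exact: ltW.
  - by rewrite ler_pM2l // ler_expR ler_pM2l.
have [h0 h00 hh0] := one_step gQ cg rp mGh Gh0 Ghg delta0 s0 gen.
exists G, delta, h0, (r / 2); split => //.
- by split => //; rewrite divr_gt0.
- have lb := lob.
  move=> h y i hh hy; have := hh0 h hh y i hy; rewrite -GE //.
  by case/andP: hy => ? ?; apply/andP; split; lra.
have lb := lob.
split.
- move=> y i /andP[y1 y2]; rewrite GE; last by apply/andP; split; lra.
  by apply: ltW; apply: hd1; rewrite ltr_norml; apply/andP; split; lra.
- move=> y i /andP[y1 y2]; rewrite GE; last by apply/andP; split; lra.
  by apply: ltW; apply: hd2; rewrite ltr_norml; apply/andP; split; lra.
move=> i; rewrite GE; last by case/andP: lob0 => ? ?; apply/andP; split; lra.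
rewrite gE mulr0 expR0 lerD2l.
have -> : eps = eta * K by rewrite /eta mulfVK // lt0r_neq0.
by rewrite ler_pM2l // gerBl.
Qed.

End Supersolution.

(** * Exit laws of the free and of the regulated process *)

Section Model.
Variables (R : realType) (m : nat) (Q : 'M[R]_m) (mu sigma : 'cV[R]_m).
Hypothesis gQ : is_generator Q.
Hypothesis s0 : forall i, sigma i 0 != 0.
Variables (refl : bool) (a b : R).
Hypotheses (a0 : a < 0) (b0 : 0 < b).
Local Notation lo := (if refl then 0 else a).
Local Notation sol := (odesol Q sigma mu).
Local Notation sol1 := (odesol1 Q sigma mu).
Variable V : bool -> 'M[R]_(m + m, m).
Hypothesis V_ge0 : forall e (c : 'cV[R]_m), (forall i, 0 <= c i 0) ->
  forall y i, lo <= y <= b -> 0 <= sol (V e *m c) y i 0.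
Hypothesis V_refl : refl -> forall e c, sol1 (V e *m c) 0 = 0.
Hypothesis V_top : forall c, sol (V true *m c) b = c.
Hypothesis V_bot : ~~ refl -> forall c, sol (V false *m c) a = c.
(** Maps data at the end [e] to the value at 0 of the corresponding solution; its entries turn out
    to be the exit probabilities. *)
Let S e : 'M[R]_m := row_mx 1%:M 0 *m expmx (0 *: ode_mx Q sigma mu) *m V e.

Context d (Omega : measurableType d).
Variables (P : probability Omega R) (kappa : R -> Omega -> 'I_m) (B z : R -> Omega -> R) (i0 : 'I_m).
Hypothesis S_sum : \sum_j S true i0 j + \sum_j S false i0 j = 1.
Hypothesis mk : forall t j, measurable [set w | kappa t w = j].
Hypothesis mB : forall t, measurable_fun setT (B t).
Hypothesis law : forall (lk : seq (R * 'I_m)) (lb : seq (R * set R)),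
  path <=%R 0 (map fst lk) -> path <%R 0 (map fst lb) -> all_measurable lb ->
  P (kev kappa lk `&` bev B 0 lb) = ((markov_w Q 0 i0 lk)%:E * bm_w 0 lb)%E.
Hypothesis k_right : forall w t, 0 <= t ->
  exists2 e, 0 < e & forall u, t <= u < t + e -> kappa u w = kappa t w.
Hypothesis z0 : forall w, z 0 w = 0.
Hypothesis cz : forall w, cont0 (fun t => z t w).
Local Notation Phi := (fold_at0 refl).
Let y h n w := euler mu sigma kappa B h Phi n w.
Hypothesis approx : forall w T eps, 0 < eps -> exists2 h0, 0 < h0 & forall h, 0 < h <= h0 ->
  forall n, n%:R * h <= T -> `|y h n w - z (n%:R * h) w| <= eps.

Let lob : lo < b. Proof. by case: refl => //; exact: lt_trans b0. Qed.
Let lo0 : refl -> lo = 0. Proof. by move=> ->. Qed.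
Let lob0 : lo <= 0 <= b. Proof. by rewrite (ltW b0) andbT; case: refl => //; exact: ltW. Qed.

Let I c : set R := [set x | (a + c < x < b - c) && (lo <= x)].
Let my h n : measurable_fun setT (y h n).
Proof. by apply: measurable_euler => //; exact: measurable_fold_at0. Qed.

Let mI c : measurable (I c).
Proof.
have -> : I c = `]a + c, b - c[%classic `&` `[lo, +oo[%classic.
  by apply/seteqP; split => x; rewrite /I /= !in_itv /= andbT; [move=> /andP|move=> [-> ->]].
exact: measurableI.
Qed.

Let y_lo h n w c : 0 < c -> a + c < y h n w -> lo <= y h n w.
Proof.
move=> c0 ay; case E: refl; last by lra.
by case: n ay => [|n] _; rewrite /y /= // /euler_next /fold_at0 E le_max lexx orbT.
Qed.

Let aliveE h c n w : 0 < c -> (forall l, (l < n)%N -> a + c < y h l w < b - c) ->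
  alive mu sigma kappa B h Phi (I c) n w.
Proof.
move=> c0; elim: n => [//|n IH] H /=; split; first by apply: IH => l ln; apply: H; exact: leqW.
have yn := H n (ltnSn n); rewrite /I /= -/(y h n w) yn /=.
by apply: y_lo c0 _; case/andP: yn.
Qed.

Let C e c : set R := [set x | side a b e - c <= x <= side a b e + c].
Let mC e c : measurable (C e c).
Proof.
have -> : C e c = `[side a b e - c, side a b e + c]%classic by apply/seteqP; split => x; rewrite /= in_itv.
exact: measurable_itv.
Qed.

Let IC e c : I c `&` C e c = set0.
Proof.
apply/seteqP; split => x //=; rewrite /I /C /side /=; case: e => -[/andP[/andP[h1 h2] _] /andP[h3 h4]]; exfalso; lra.
Qed.

Let cross_le e j (s c h : R) (G : 'I_m -> R -> R) (delta h0 : R) : 0 < c -> 0 <= s -> 0 < h <= h0 ->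
  (forall i, measurable_fun setT (G i)) -> (forall i y, 0 <= G i y) -> 0 < delta ->
  (forall h y i, 0 < h <= h0 -> lo <= y <= b ->
      (\sum_j (expmx (h *: Q) i j)%:E * \int[gaussP (Num.sqrt h)]_x (G j (euler_next mu sigma h Phi i y x))%:E
       <= (G i y - delta * h)%:E)%E) ->
  (forall i x, C e c x -> expmx (s *: Q) i j <= G i x) ->
  (P (cross kappa y a b e j s c h) <= (G i0 0)%:E)%E.
Proof.
move=> c0 s00 hh mG G0 delta0 step CG.
have [hp hh0] := andP hh.
have os k w i : I c (y h k w) -> (\sum_j (expmx (h *: Q) i j)%:E * \int[gaussP (Num.sqrt h)]_x (G j (euler_next mu sigma h Phi i (y h k w) x))%:E
       <= (G i (y h k w) - delta * h)%:E)%E.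
  move=> /andP[/andP[_ yb] yl]; apply: step => //; rewrite yl /=; lra.
have mex k : measurable (exit_at mu sigma kappa B h Phi (I c) s j (C e c) k).
  apply: measurableI => //; apply: measurableI.
    by apply: measurable_alive => //; exact: measurable_fold_at0.
  by rewrite -[X in measurable X]setTI; exact: my.
apply: (@le_trans _ _ (P (\bigcup_k exit_at mu sigma kappa B h Phi (I c) s j (C e c) k))).
  apply: le_measure; rewrite ?inE; [exact: measurable_cross|exact: bigcupT_measurable|].
  move=> w [n [h1 h2 h3]]; exists n => //; split => //; split => //.
  exact: aliveE.
apply: (le_trans (generalized_Boole_inequality _ mex (bigcupT_measurable _ mex))).
apply: lime_le; first exact: is_cvg_nneseries.
apply: nearW => N; rewrite big_mkord.
exact: (exit_bound gQ hp mk mB law (measurable_fold_at0 refl) (mI c) mG G0 (ltW delta0) os N s00 (mC e c) (IC e c) CG).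
Qed.

Let sol_super e (c : 'cV[R]_m) (eps : R) : (forall i, 0 <= c i 0) -> 0 < eps ->
  exists G : 'I_m -> R -> R, exists delta h0 c0 : R,
  [/\ forall i, measurable_fun setT (G i), forall i y, 0 <= G i y,
    [/\ 0 < delta, 0 < h0 & 0 < c0],
    forall h y i, 0 < h <= h0 -> lo <= y <= b ->
      (\sum_j (expmx (h *: Q) i j)%:E * \int[gaussP (Num.sqrt h)]_x (G j (euler_next mu sigma h Phi i y x))%:E
       <= (G i y - delta * h)%:E)%E &
    [/\ forall y i, lo - c0 <= y <= lo + c0 -> sol (V e *m c) lo i 0 <= G i y,
        forall y i, b - c0 <= y <= b + c0 -> sol (V e *m c) b i 0 <= G i y &
        forall i, G i 0 <= sol (V e *m c) 0 i 0 + eps]].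
Proof.
move=> c0 eps0.
have f10 : refl -> forall i, sol1 (V e *m c) 0 i 0 = 0 by move=> hr i; rewrite V_refl // mxE.
have gf x i : genop Q sigma mu (sol (V e *m c) x) (sol1 (V e *m c) x) (odesol2 Q sigma mu (V e *m c) x) i = 0.
  exact: genop_odesol.
have f0 y' i : lo <= y' <= b -> 0 <= sol (V e *m c) y' i 0 by move=> hy; exact: V_ge0.
exact: (supersolution gQ s0 lob lo0 (c2fun_odesol Q sigma mu (V e *m c)) gf f0 f10 lob0 eps0).
Qed.

Let solE e c : sol (V e *m c) 0 = S e *m c.
Proof. by rewrite /S /odesol -!mulmxA. Qed.

Let F e j s := (S e *m expmx (s *: Q)) i0 j.

(** Since the phase is read [s] after the exit, the data at the end are column j of e^{sQ}; the
    delay disappears later by [F_cont]. *)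
Let cross_bound e j s eps : 0 < s -> 0 < eps -> exists2 c0, 0 < c0 & forall c, 0 < c <= c0 ->
  exists2 h0, 0 < h0 & forall h, 0 < h <= h0 -> (P (cross kappa y a b e j s c h) <= (F e j s + eps)%:E)%E.
Proof.
move=> sp eps0.
pose cv : 'cV[R]_m := col j (expmx (s *: Q)).
have cv0 i : 0 <= cv i 0 by rewrite mxE gen_expmx_ge0 // ltW.
have [G [delta [h0 [c0 [mG G0 [delta0 h00 c00] step [Glo Gb Gi]]]]]] := sol_super e cv0 eps0.
have Gi0 : G i0 0 <= F e j s + eps.
  apply: (le_trans (Gi i0)); rewrite solE lerD2r /F le_eqVlt; apply/orP; left; apply/eqP.
  by rewrite !mxE; apply: eq_bigr => k _; rewrite !mxE.
have bound c h : 0 < c -> 0 < h <= h0 -> (forall i x, C e c x -> expmx (s *: Q) i j <= G i x) ->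
  (P (cross kappa y a b e j s c h) <= (F e j s + eps)%:E)%E.
  move=> cp hh CG; apply: (le_trans (cross_le cp (ltW sp) hh mG G0 delta0 step CG)).
  by rewrite lee_fin.
have cvE i : expmx (s *: Q) i j = cv i 0 by rewrite [RHS]mxE.
case: e F cv0 Glo Gb Gi Gi0 bound => F' cv0 Glo Gb Gi Gi0 bound.
  exists c0 => // c /andP[cp cc]; exists h0 => // h hh; apply: bound => // i x; rewrite /C /= => /andP[? ?].
  have := Gb x i; rewrite V_top -cvE; apply; apply/andP; split; lra.
have [hr|hr] := boolP refl.
  (* Under reflection the negative level [a] is never approached, and the event is empty for small
     c. *)
  exists (- a / 2) => [|c /andP[cp cc]]; first by rewrite divr_gt0 // oppr_gt0.
  exists h0 => // h hh.
  have -> : cross kappa y a b false j s c h = set0.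
    apply/seteqP; split => w //= [n [_ /andP[_ yn] _]].
    have : 0 <= y h n w.
      by case: n {yn} => [|n]; rewrite /y /= // /euler_next /fold_at0 hr le_max lexx orbT.
    move: yn; rewrite /side => yn ?; lra.
  rewrite measure0 lee_fin; apply: le_trans Gi0; exact: G0.
exists c0 => // c /andP[cp cc]; exists h0 => // h hh; apply: bound => // i x; rewrite /C /= => /andP[? ?].
have := Glo x i; rewrite (negbTE hr) (V_bot hr) -cvE; apply; apply/andP; split; lra.
Qed.

(** With zero boundary data the test function is at most 1 at 0, and surviving paths lose delta h at
    each step, so survival up to time T has probability at most 1 / (delta T). *)
Let stay_bound eps : 0 < eps -> exists T : nat, exists2 c0, 0 < c0 & forall c, 0 < c <= c0 ->
  exists2 h0, 0 < h0 & forall h, 0 < h <= h0 -> (P (stay y a b T%:R c h) <= eps%:E)%E.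
Proof.
move=> eps0.
have z00 i : 0 <= (0 : 'cV[R]_m) i 0 by rewrite mxE.
have [G [delta [h0 [c0 [mG G0 [delta0 h00 c00] step [_ _ Gi]]]]]] := sol_super true z00 ltr01.
have G1 : G i0 0 <= 1 by have := Gi i0; rewrite solE mulmx0 mxE add0r.
pose T := (Num.truncn (delta * eps)^-1).+1.
have de0 : 0 < delta * eps by rewrite mulr_gt0.
have TT : 1 <= delta * eps * T%:R.
  by rewrite mulrC -ler_pdivrMr // mul1r ltW // truncnS_gt.
exists T, 1; first exact: ltr01.
move=> c /andP[cp _]; exists h0 => // h hh; have [hp _] := andP hh.
pose N := (Num.truncn (T%:R / h)).+1.
have NT : T%:R <= N%:R * h by rewrite -ler_pdivrMr // ltW // truncnS_gt.
have os k w i : I c (y h k w) -> (\sum_j (expmx (h *: Q) i j)%:E * \int[gaussP (Num.sqrt h)]_x (G j (euler_next mu sigma h Phi i (y h k w) x))%:E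
       <= (G i (y h k w) - delta * h)%:E)%E.
  move=> /andP[/andP[_ yb] yl]; apply: step => //; rewrite yl /=; lra.
have mA : measurable (alive mu sigma kappa B h Phi (I c) N).
  by apply: measurable_alive => //; exact: measurable_fold_at0.
have := alive_bound gQ hp mk mB law (measurable_fold_at0 refl) (mI c) mG G0 (ltW delta0) os N.
have PN : P (alive mu sigma kappa B h Phi (I c) N) \is a fin_num by exact: fin_num_measure.
rewrite -(fineK PN) -EFinM lee_fin => AB.
apply: (@le_trans _ _ (P (alive mu sigma kappa B h Phi (I c) N))).
  apply: le_measure; rewrite ?inE //; first exact: measurable_stay.
  move=> w sw; apply: aliveE => // l lN; apply: sw.
  by rewrite -ler_pdivlMr // -truncn_ge_nat // divr_ge0 // ltW.
rewrite -(fineK PN) lee_fin; set p := fine _ in AB *.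
have p0 : 0 <= p by rewrite fine_ge0.
have A1 : delta * T%:R * p <= 1.
  apply: le_trans (le_trans AB G1); rewrite ler_wpM2r // -mulrA ler_pM2l // mulrC //.
have T0 : 0 < delta * T%:R by rewrite mulr_gt0 // ltr0n.
rewrite -(ler_pM2l T0); apply: (le_trans A1).
by rewrite mulrAC.
Qed.

Let F_cont e j eps : 0 < eps -> exists2 s1, 0 < s1 & forall s, 0 < s <= s1 -> F e j s <= F e j 0 + eps.
Proof.
move=> eps0.
have FE : F e j = fun s => \sum_k S e i0 k * expmx (s *: Q) k j.
  by apply/funext => s; rewrite /F mulmxij.
have cF : F e j s @[s --> (0 : R)] --> F e j 0.
  rewrite FE; apply: (@cvgr_sum R R 'I_m (nbhs (0 : R)) _ (index_enum 'I_m) (fun k s => S e i0 k * expmx (s *: Q) k j)) => k.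
  by apply: cvgMl_tmp; exact: continuous_expmx.
have lt : F e j 0 < F e j 0 + eps by rewrite ltrDl.
have nr : \forall s \near (0 : R), F e j s < F e j 0 + eps by exact: (cvgr_lt _ cF _ lt).
have [r r0 hr] := near_ball nr.
exists (r / 2) => [|s /andP[sp sr]]; first by rewrite divr_gt0.
by apply: ltW; apply: hr; rewrite subr0 gtr0_norm //; lra.
Qed.

Theorem model_exit e j : measurable (exits kappa z a b e j) /\ P (exits kappa z a b e j) = (S e i0 j)%:E.
Proof.
have F0 e' j' : F e' j' 0 = S e' i0 j' by rewrite /F scale0r expmx0 mulmx1.
have zab w : a < z 0 w < b by rewrite z0 a0.
have Fs : \sum_j' F true j' 0 + \sum_j' F false j' 0 = 1.
  by rewrite -S_sum; congr (_ + _); apply: eq_bigr => j' _; rewrite F0.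
rewrite -F0.
exact: (exit_law (lt_trans a0 b0) zab mk k_right cz my approx stay_bound cross_bound F_cont Fs).
Qed.

End Model.

Lemma inf_first (R : realType) (D : set R) T : D T -> (forall s, D s -> T <= s) -> inf D = T.
Proof.
move=> DT lb; have hD : has_inf D by split; [exists T|exists T => s; exact: lb].
apply/eqP; rewrite eq_le; apply/andP; split; first by apply: ge_inf => //; exact: hD.2.
by apply: lb_le_inf; [exists T|move=> s; exact: lb].
Qed.

Lemma sum_entries (R : realType) m (A : 'M[R]_m) i : \sum_j A i j = (A *m (const_mx 1 : 'cV[R]_m)) i 0.
Proof. by rewrite mulmxij; apply: eq_bigr => j _; rewrite mxE mulr1. Qed.

Lemma mul_delta (R : realType) m (A : 'M[R]_m) i j : (A *m (delta_mx j 0 : 'cV[R]_m)) i 0 = A i j.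
Proof. by rewrite -colE mxE. Qed.

Section ConstantSolution.
Variables (R : realType) (m : nat) (Q : 'M[R]_m) (mu sigma : 'cV[R]_m).
Hypothesis gQ : is_generator Q.
Hypothesis s0 : forall i, sigma i 0 != 0.
Local Notation sol := (odesol Q sigma mu).
Local Notation sol1 := (odesol1 Q sigma mu).
Local Notation one := (const_mx 1 : 'cV[R]_m).

Lemma constant_solution v a b x : a < b -> sol v a = one \/ sol1 v a = 0 -> sol v b = one ->
  a <= x <= b -> sol v x = one.
Proof.
move=> ab va vb /andP[ax xb].
have ch := c2funD (c2fun_odesol Q sigma mu v) (c2fun_affine 0 (- one)).
have E y : y *: (0 : 'cV[R]_m) + - one = - one by rewrite scaler0 add0r.
have gh y i : a < y -> y < b -> genop Q sigma mu (sol v y + (y *: 0 + - one)) (sol1 v y + 0)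
    (odesol2 Q sigma mu v y + 0) i = 0.
  move=> _ _; rewrite genopD genop_odesol // add0r E /genop mulmxN (gen_const gQ).
  by rewrite oppr0 [(0 : 'cV_m) i 0]mxE !mulr0 !addr0.
have ha : sol v a + (a *: 0 + - one) = 0 \/ sol1 v a + 0 = 0.
  by case: va => ->; [left; rewrite E subrr|right; rewrite addr0].
have hb : sol v b + (b *: 0 + - one) = 0 by rewrite vb E subrr.
by have := max_principle_eq0 gQ s0 ch ab gh ha hb ax xb => /eqP; rewrite E subr_eq0 => /eqP.
Qed.

Lemma odesolB v v' x : sol (v - v') x = sol v x - sol v' x.
Proof. exact: mulmxBr. Qed.

Lemma odesol1B v v' x : sol1 (v - v') x = sol1 v x - sol1 v' x.
Proof. exact: mulmxBr. Qed.

Lemma dirichlet_columns a b (Ba Bb : 'M[R]_m) : a < b -> exists V : 'M[R]_(m + m, m),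
  forall c, sol (V *m c) a = Ba *m c /\ sol (V *m c) b = Bb *m c.
Proof.
move=> ab.
have [V] := @lift_columns _ _ _ _ (col_mx (row_mx 1%:M 0 *m expmx (a *: ode_mx Q sigma mu))
  (row_mx 1%:M 0 *m expmx (b *: ode_mx Q sigma mu))) (col_mx Ba Bb) (fun k =>
  let: ex_intro v (conj va vb) := odesol_bvp gQ s0 mu (usubmx (col k (col_mx Ba Bb))) (dsubmx (col k (col_mx Ba Bb))) ab in
  ex_intro _ v (etrans (mul_col_mx _ _ _) (etrans (f_equal2 col_mx va vb) (vsubmxK _)))).
rewrite mul_col_mx => /eq_col_mx[h1 h2]; exists V => c.
by rewrite /odesol !mulmxA h1 h2.
Qed.

Lemma neumann_columns b : 0 < b ->
  (forall j, exists v, sol v b = delta_mx j 0 /\ sol1 v 0 = 0) -> exists V : 'M[R]_(m + m, m),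
  forall c, sol (V *m c) b = c /\ sol1 (V *m c) 0 = 0.
Proof.
move=> b0 H.
have [|V] := @lift_columns _ _ _ _ (col_mx (row_mx 1%:M 0 *m expmx (b *: ode_mx Q sigma mu))
  (row_mx 0 1%:M *m expmx (0 *: ode_mx Q sigma mu))) (col_mx (1%:M : 'M[R]_m) (0 : 'M[R]_m)).
  move=> k; have [v [vb v0]] := H k; exists v.
  rewrite mul_col_mx -/(sol v b) -/(sol1 v 0) vb v0.
  apply/matrixP => i l; rewrite ord1 [RHS]mxE.
  by case: (split_ordP i) => p ->; rewrite ?col_mxEu ?col_mxEd !mxE ?eqxx ?andbT.
rewrite mul_col_mx => /eq_col_mx[h1 h2]; exists V => c.
by rewrite /odesol /odesol1 !mulmxA h1 h2 mul1mx mul0mx.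
Qed.

End ConstantSolution.

Section FreeModel.
Variables (R : realType) (m : nat) (Q : 'M[R]_m) (mu sigma : 'cV[R]_m).
Hypothesis gQ : is_generator Q.
Hypothesis s0 : forall i, sigma i 0 != 0.
Local Notation sol := (odesol Q sigma mu).
Local Notation sol1 := (odesol1 Q sigma mu).
Local Notation one := (const_mx 1 : 'cV[R]_m).
Context d (Omega : measurableType d).
Variables (P : probability Omega R) (kappa : R -> Omega -> 'I_m) (B X : R -> Omega -> R) (i0 : 'I_m).
Hypothesis model : free_mmbm Q mu sigma i0 P kappa B X.

Lemma free_k_right w t : 0 <= t ->
  exists2 e, 0 < e & forall u, t <= u < t + e -> kappa u w = kappa t w.
Proof.
move=> t0; have [_ [_ [jumps _]]] := model.
have [tau [tau0 [tauS [tauI tauC]]]] := jumps w.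
have [n /andP[n1 n2]] := tau_bracket tau0 tauI t0.
exists (tau n.+1 - t) => [|u /andP[u1 u2]]; first by rewrite subr_gt0.
rewrite (tauC n u) ?(tauC n t) ?n1 ?n2 //.
by rewrite (le_trans n1 u1) /=; move: u2; rewrite addrC subrK.
Qed.

Lemma free_cont0 w : cont0 (X ^~ w).
Proof.
have [_ [_ [jumps [Bc [_ [X0 Xi]]]]]] := model.
have [tau [tau0 [tauS [tauI tauC]]]] := jumps w.
exact: (@switched_cont0 R m (fun i => mu i 0) (fun i => sigma i 0) tau (kappa ^~ w) (B ^~ w) (X ^~ w)
  tau0 tauS tauI tauC (Bc w).2 (X0 w) (Xi w)).
Qed.

Lemma euler_walk h n w : euler mu sigma kappa B h (fold_at0 false) n w =
  walk_sum (fun i => mu i 0) (fun i => sigma i 0) (kappa ^~ w) (B ^~ w) h n.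
Proof. by elim: n => [//|n IH] /=; rewrite IH /euler_next /fold_at0 /dB addrA. Qed.

Lemma euler_lindley h n w : euler mu sigma kappa B h (fold_at0 true) n w =
  lindley (fun i => mu i 0) (fun i => sigma i 0) (kappa ^~ w) (B ^~ w) h n.
Proof. by elim: n => [//|n IH] /=; rewrite IH /euler_next /fold_at0 /dB addrA. Qed.

Lemma free_approx w T eps : 0 < eps -> exists2 h0, 0 < h0 & forall h, 0 < h <= h0 ->
  forall n, n%:R * h <= T -> `|euler mu sigma kappa B h (fold_at0 false) n w - X (n%:R * h) w| <= eps.
Proof.
move=> e0; have [_ [_ [jumps [Bc [_ [X0 Xi]]]]]] := model.
have [tau [tau0 [tauS [tauI tauC]]]] := jumps w.
have [h0 h00 H] := @walk_sum_cvg R m (fun i => mu i 0) (fun i => sigma i 0) tau (kappa ^~ w) (B ^~ w) (X ^~ w)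
  tau0 tauS tauI tauC (Bc w).2 (X0 w) (Xi w) T _ e0.
by exists h0 => // h hh n nT; rewrite euler_walk; exact: H.
Qed.

Theorem free_exit_law a b v j : a < 0 -> 0 < b -> sol v a = 0 -> sol v b = delta_mx j 0 ->
  measurable (exits kappa X a b true j) /\ P (exits kappa X a b true j) = (sol v 0 i0 0)%:E.
Proof.
move=> a0 b0 va vb; have ab := lt_trans a0 b0.
have [Vt hVt] := dirichlet_columns mu gQ s0 0 1%:M ab.
have [Vf hVf] := dirichlet_columns mu gQ s0 1%:M 0 ab.
pose V (e : bool) := if e then Vt else Vf.
have V_ge0 e (c : 'cV[R]_m) : (forall i, 0 <= c i 0) ->
   forall y i, (if false then 0 else a) <= y <= b -> 0 <= sol (V e *m c) y i 0.
  move=> c0 y i /andP[ay yb].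
  apply: (max_principle gQ s0 (mu := mu) (c2fun_odesol Q sigma mu (V e *m c)) ab) => //.
  - by move=> z k _ _; rewrite genop_odesol.
  - by left => k; case: e => /=; rewrite ?(hVt c).1 ?(hVf c).1 ?mul0mx ?mul1mx // mxE.
  - by move=> k; case: e => /=; rewrite ?(hVt c).2 ?(hVf c).2 ?mul0mx ?mul1mx // mxE.
(* Data 1 at both ends give the constant solution 1. *)
have S_sum : \sum_j (row_mx 1%:M 0 *m expmx (0 *: ode_mx Q sigma mu) *m V true) i0 j +
   \sum_j (row_mx 1%:M 0 *m expmx (0 *: ode_mx Q sigma mu) *m V false) i0 j = 1.
  rewrite !sum_entries.
  have E e : row_mx 1%:M 0 *m expmx (0 *: ode_mx Q sigma mu) *m V e *m one = sol (V e *m one) 0 by rewrite /odesol !mulmxA.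
  have D x : sol (V true *m one + V false *m one) x = sol (V true *m one) x + sol (V false *m one) x.
    exact: mulmxDr.
  have va1 : sol (V true *m one + V false *m one) a = one.
    by rewrite D (hVt one).1 (hVf one).1 mul0mx mul1mx add0r.
  have vb1 : sol (V true *m one + V false *m one) b = one.
    by rewrite D (hVt one).2 (hVf one).2 mul0mx mul1mx addr0.
  have a0b : a <= 0 <= b by rewrite !ltW.
  have := constant_solution gQ s0 ab (or_introl va1) vb1 a0b.
  rewrite D => /(congr1 (fun M : 'cV_m => M i0 0)); rewrite addmxij [one _ _]mxE => h1.
  by rewrite !E.
have [mk [mB [_ [_ [law [X0 _]]]]]] := model.
have V_refl : false -> forall e c, sol1 (V e *m c) 0 = 0 by [].
have V_top c : sol (V true *m c) b = c by rewrite (hVt c).2 mul1mx.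
have V_bot : ~~ false -> forall c, sol (V false *m c) a = c by move=> _ c; rewrite (hVf c).1 mul1mx.
have [mE PE] := @model_exit R m Q mu sigma gQ s0 false a b a0 b0 V V_ge0 V_refl V_top V_bot _ _ P kappa B X i0
  S_sum mk mB law free_k_right X0 free_cont0 free_approx true j.
split => //; rewrite PE; congr EFin.
have -> : v = V true *m delta_mx j 0.
  apply/eqP; rewrite -subr_eq0; apply/eqP; apply: (odesol_bvp_inj gQ s0 ab (mu := mu)).
    by rewrite odesolB va (hVt _).1 mul0mx subrr.
  by rewrite odesolB vb V_top subrr.
by rewrite /odesol [in RHS]mulmxA mul_delta.
Qed.

Section RegulatedModel.
Variables (R0 : R -> Omega -> R) (b : R).
Hypotheses (reg : regulator X R0) (b0 : 0 < b).
Hypothesis neumann : forall j, exists v, sol v b = delta_mx j 0 /\ sol1 v 0 = 0.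
Let Z t w := X t w + R0 t w.

Lemma reg_exit_law v j : sol v b = delta_mx j 0 -> sol1 v 0 = 0 ->
  P (exits kappa Z (- 1) b true j) = (sol v 0 i0 0)%:E.
Proof.
(* The regulated path is nonnegative, so any negative number can serve as lower end. *)
move=> vb v0; have a0 : - 1 < 0 :> R by rewrite oppr_lt0 ltr01.
have [Vt hVt] := neumann_columns b0 neumann.
pose V (e : bool) : 'M[R]_(m + m, m) := if e then Vt else 0.
have Vf c x : sol (V false *m c) x = 0 by rewrite /= mul0mx /odesol mulmx0.
have V_ge0 e (c : 'cV[R]_m) : (forall i, 0 <= c i 0) ->
   forall y i, (if true then 0 else - 1) <= y <= b -> 0 <= sol (V e *m c) y i 0.
  move=> c0 y i yab; case: e; last by rewrite Vf mxE.
  have [ay yb] : 0 <= y /\ y <= b by apply/andP.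
  apply: (max_principle gQ s0 (mu := mu) (c2fun_odesol Q sigma mu (V true *m c)) b0) => //.
  - by move=> z k _ _; rewrite genop_odesol.
  - by right => k; rewrite (hVt c).2 mxE.
  - by move=> k; rewrite (hVt c).1.
have S_sum : \sum_j (row_mx 1%:M 0 *m expmx (0 *: ode_mx Q sigma mu) *m V true) i0 j +
   \sum_j (row_mx 1%:M 0 *m expmx (0 *: ode_mx Q sigma mu) *m V false) i0 j = 1.
  rewrite !sum_entries.
  have E e : row_mx 1%:M 0 *m expmx (0 *: ode_mx Q sigma mu) *m V e *m one = sol (V e *m one) 0 by rewrite /odesol !mulmxA.
  have b01 : 0 <= (0 : R) <= b by rewrite lexx ltW.
  have := constant_solution gQ s0 b0 (or_intror (hVt one).2) (hVt one).1 b01.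
  move=> /(congr1 (fun M : 'cV_m => M i0 0)); rewrite [one _ _]mxE => h1.
  by rewrite !E Vf [(0 : 'cV_m) _ _]mxE addr0.
have [mk [mB [jumps [Bc [law [X0 Xi]]]]]] := model.
have V_refl : true -> forall e c, sol1 (V e *m c) 0 = 0.
  by move=> _ [] c; [exact: (hVt c).2|rewrite /= mul0mx /odesol1 mulmx0].
have V_top c : sol (V true *m c) b = c by rewrite (hVt c).1.
have V_bot : ~~ true -> forall c, sol (V false *m c) (- 1) = c by [].
have Z0 w : Z 0 w = 0 by rewrite /Z X0 (reg w).1 addr0.
have Zc w : cont0 (Z ^~ w).
  by apply: cont0D; [exact: free_cont0|apply: continuous_cont0; exact: (reg w).2.1].
have app w T eps : 0 < eps -> exists2 h0, 0 < h0 & forall h, 0 < h <= h0 ->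
  forall n, n%:R * h <= T -> `|euler mu sigma kappa B h (fold_at0 true) n w - Z (n%:R * h) w| <= eps.
  move=> e0; have [tau [tau0 [tauS [tauI tauC]]]] := jumps w.
  have [r0 [rc [rm [rp [rf _]]]]] := reg w.
  have [h0 h00 H] := @lindley_cvg R m (fun i => mu i 0) (fun i => sigma i 0) tau (kappa ^~ w) (B ^~ w) (X ^~ w)
    tau0 tauS tauI tauC (Bc w).2 (X0 w) (Xi w) (R0 ^~ w) r0 rc rm rp rf T _ e0.
  by exists h0 => // h hh n nT; rewrite euler_lindley; exact: H.
have [mE PE] := @model_exit R m Q mu sigma gQ s0 true (- 1) b a0 b0 V V_ge0 V_refl V_top V_bot _ _ P kappa B Z i0
  S_sum mk mB law free_k_right Z0 Zc app true j.
rewrite PE; congr EFin.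
have -> : v = V true *m delta_mx j 0.
  apply/eqP; rewrite -subr_eq0; apply/eqP; apply: (odesol_nbvp_inj gQ s0 b0 (mu := mu)).
    by rewrite odesol1B v0 (hVt _).2 subrr.
  by rewrite odesolB vb V_top subrr.
by rewrite /odesol [in RHS]mulmxA mul_delta.
Qed.

(** The path starts at 0 < b and stays nonnegative, so hitting [b] at a positive time is leaving
    ]-1, b[ at the top. *)
Lemma hit_exits j : hit_ev Z kappa b j = exits kappa Z (- 1) b true j.
Proof.
have [_ [_ [_ [_ [_ [X0 _]]]]]] := model.
have Z0 w : Z 0 w = 0 by rewrite /Z X0 (reg w).1 addr0.
have Zc w : cont0 (Z ^~ w).
  by apply: cont0D; [exact: free_cont0|apply: continuous_cont0; exact: (reg w).2.1].
have Zp w t : 0 <= t -> - 1 < Z t w.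
  by move=> t0; apply: (lt_le_trans _ ((reg w).2.2.2.1 t t0)); rewrite oppr_lt0 ltr01.
have first w T : 0 <= T -> Z T w = b -> (forall s, 0 <= s < T -> - 1 < Z s w < b) ->
   inf [set t | 0 < t /\ Z t w = b] = T.
  move=> T0 ZT Zin; apply: inf_first.
    split => //; rewrite lt_neqAle T0 andbT; apply/eqP => E; move: b0.
    by rewrite -ZT -E Z0 ltxx.
  move=> s [s1 Zs]; rewrite leNgt; apply/negP => sT.
  have : 0 <= s < T by rewrite ltW.
  by move=> /Zin; rewrite Zs ltxx andbF.
apply/seteqP; split => w.
  move=> [[t [t0 Zt]] kj].
  have zt : ~~ (- 1 < Z t w < b) by rewrite Zt ltxx andbF.
  have z01 : - 1 < Z 0 w < b by rewrite Z0 b0 oppr_lt0 ltr01.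
  have [T [T0 ZT Zin]] := first_exit z01 (@Zc w) (ltW t0) zt.
  case: ZT => ZT; first by have := Zp w T T0; rewrite ZT ltxx.
  by exists T; split => //; rewrite -kj (first w T T0 ZT Zin).
move=> [T [T0 ZT Zin kT]]; split; last by rewrite (first w T T0 ZT Zin).
exists T; split => //; rewrite lt_neqAle T0 andbT; apply/eqP => E; move: b0.
by have ZT' : Z T w = b := ZT; rewrite -ZT' -E Z0 ltxx.
Qed.

End RegulatedModel.

(** A path that reaches [y] has a finite minimum before that, so it leaves some bounded interval at
    the top. The offset [c] allows the intervals to be translated later. *)
Lemma level_exits y c j : 0 < y -> 0 <= c ->
  level_ev X kappa y j = \bigcup_N exits kappa X (- N.+1%:R - c) y true j.
Proof.
move=> y0 c0; have [_ [_ [_ [_ [_ [X0 _]]]]]] := model.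
have first w T a : 0 <= T -> X T w = y -> (forall s, 0 <= s < T -> a < X s w < y) ->
   inf [set t | 0 <= t /\ X t w = y] = T.
  move=> T0 XT Xin; apply: inf_first => // s [s1 Xs]; rewrite leNgt; apply/negP => sT.
  have : 0 <= s < T by rewrite s1.
  by move=> /Xin; rewrite Xs ltxx andbF.
apply/seteqP; split => w.
  move=> [[t [t0 Xt]] kj].
  have [u /andP[u0 ut] hu] := path_min (lexx 0) t0 (@free_cont0 w).
  pose N := Num.truncn (- X u w).
  have aN : - N.+1%:R - c < X u w.
    have : - X u w < N.+1%:R by exact: truncnS_gt.
    lra.
  have aN0 : - N.+1%:R - c < 0.
    have : 0 < N.+1%:R :> R by rewrite ltr0n.
    lra.
  have zt : ~~ (- N.+1%:R - c < X t w < y) by rewrite Xt ltxx andbF.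
  have z01 : - N.+1%:R - c < X 0 w < y by rewrite X0 y0 aN0.
  have [T [T0 XT Xin]] := first_exit z01 (@free_cont0 w) t0 zt.
  have Tt : T <= t.
    rewrite leNgt; apply/negP => tT; move: zt; have -> // : - N.+1%:R - c < X t w < y.
    by apply: Xin; rewrite t0.
  case: XT => XT.
    have T0t : 0 <= T <= t by rewrite T0.
    by have := hu T T0t; rewrite XT leNgt aN.
  by exists N => //; exists T; split => //; rewrite -kj (first w T _ T0 XT Xin).
move=> [N _ [T [T0 XT Xin kT]]]; split; first by exists T.
by rewrite (first w T _ T0 XT Xin).
Qed.

Lemma exits_mono y a a' j : a' <= a -> exits kappa X a y true j `<=` exits kappa X a' y true j.
Proof.
move=> aa w [T [T0 XT Xin kT]]; exists T; split => // s /Xin /andP[h1 ->].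
by rewrite (le_lt_trans aa).
Qed.

Lemma level_cvg y c j v : 0 < y -> 0 <= c ->
  (forall N, sol (v N) (- N.+1%:R - c) = 0 /\ sol (v N) y = delta_mx j 0) ->
  measurable (level_ev X kappa y j) /\
  ((sol (v N) 0 i0 0)%:E @[N --> \oo] --> P (level_ev X kappa y j))%E.
Proof.
move=> y0 c0 hv.
have aN0 N : - N.+1%:R - c < 0 :> R.
  have : 0 < N.+1%:R :> R by rewrite ltr0n.
  lra.
have H N := free_exit_law (aN0 N) y0 (hv N).1 (hv N).2.
have mE N : measurable (exits kappa X (- N.+1%:R - c) y true j) by have [] := H N.
rewrite (level_exits j y0 c0); split; first exact: bigcupT_measurable.
have -> : (fun N => (sol (v N) 0 i0 0)%:E) = P \o (fun N => exits kappa X (- N.+1%:R - c) y true j).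
  by apply/funext => N; rewrite /= (H N).2.
apply: nondecreasing_cvg_mu => //; first exact: bigcupT_measurable.
move=> N N' NN; apply/subsetPset; apply: exits_mono.
by rewrite lerD2r lerN2 ler_nat ltnS.
Qed.

End FreeModel.

(** * The quadratic equation from passage probabilities *)

Section Upward.
Variables (R : realType) (m : nat) (Q : 'M[R]_m) (mu sigma : 'cV[R]_m) (Uh : 'M[R]_m).
Hypothesis gQ : is_generator Q.
Hypothesis s0 : forall i, sigma i 0 != 0.
Hypothesis up : forall x : R, 0 <= x -> forall (i j : 'I_m) (d : measure_display)
  (Omega : measurableType d) (P : probability Omega R)
  (kappa : R -> Omega -> 'I_m) (B X : R -> Omega -> R),
  free_mmbm Q mu sigma i P kappa B X -> P (level_ev X kappa x j) = (expmx (x *: Uh) i j)%:E.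
Local Notation sol := (odesol Q sigma mu).
Local Notation sol1 := (odesol1 Q sigma mu).
Local Notation one := (const_mx 1 : 'cV[R]_m).

Lemma up_cvg i j y c v : 0 < y -> 0 <= c ->
  (forall N, sol (v N) (- N.+1%:R - c) = 0 /\ sol (v N) y = delta_mx j 0) ->
  sol (v N) 0 i 0 @[N --> \oo] --> expmx (y *: Uh) i j.
Proof.
move=> y0 c0 hv; have [d [T [P [kappa [B [X model]]]]]] := free_mmbm_exists mu sigma i gQ.
have [_] := level_cvg gQ s0 model y0 c0 hv.
by rewrite (up (ltW y0) j model) => /fine_cvg.
Qed.

Lemma up_substoch : substoch Uh.
Proof.
move=> x; rewrite le_eqVlt => /predU1P[<-|x0].
  rewrite scale0r expmx0; split => [i j|i].
    by rewrite mxE; case: eqP => _; rewrite ?ler01.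
  by rewrite sum_entries mul1mx mxE.
have ab N : - N.+1%:R - 0 < x by rewrite subr0 (lt_trans _ x0) // oppr_lt0 ltr0n.
have model i := free_mmbm_exists mu sigma i gQ.
have hv j : exists v : nat -> _, forall N, sol (v N) (- N.+1%:R - 0) = 0 /\ sol (v N) x = delta_mx j 0.
  by have [v vP] := choice (fun N => odesol_bvp gQ s0 mu 0 (delta_mx j 0) (ab N)); exists v.
split => [i j|i]; have [d [T [P [kappa [B [X mod]]]]]] := model i.
  by rewrite -lee_fin -(up (ltW x0) j mod).
have mL j : measurable (level_ev X kappa x j).
  by have [v vP] := hv j; have [] := level_cvg gQ s0 mod x0 (lexx 0) vP.
rewrite -lee_fin -sumEFin.
have -> : (\sum_j (expmx (x *: Uh) i j)%:E = P (\bigcup_(j in [set: 'I_m]) level_ev X kappa x j))%E.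
  symmetry; refine (etrans (@measure_ord_partition _ _ _ P m (level_ev X kappa x) _ _ mL _) _).
  - by move=> w; split => [[j _ h]|[j h]]; exists j.
  - by move=> k l w [_ <-] [_ <-].
  - by apply: eq_bigr => j _; rewrite -(up (ltW x0) j mod).
by apply: probability_le1; apply: fin_bigcup_measurable => //; exact: finite_finset.
Qed.

(** The equation is autonomous, so translating the level acts on the initial state. *)
Lemma sol_shift v x z : sol (expmx (x *: ode_mx Q sigma mu) *m v) z = sol v (z + x).
Proof. by rewrite /odesol expmxD !mulmxA. Qed.

Lemma odesolD v w x : sol (v + w) x = sol v x + sol w x.
Proof. exact: mulmxDr. Qed.

Lemma odesol_columns a b (V W : 'M[R]_(m + m, m)) v : a < b ->
  (forall c, sol (V *m c) a = 1%:M *m c /\ sol (V *m c) b = 0 *m c) ->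
  (forall c, sol (W *m c) a = 0 *m c /\ sol (W *m c) b = 1%:M *m c) ->
  v = V *m sol v a + W *m sol v b.
Proof.
move=> ab hV hW; apply/eqP; rewrite -subr_eq0; apply/eqP; apply: (odesol_bvp_inj gQ s0 ab (mu := mu)).
  by rewrite odesolB odesolD (hV _).1 (hW _).1 mul1mx mul0mx addr0 subrr.
by rewrite odesolB odesolD (hV _).2 (hW _).2 mul1mx mul0mx add0r subrr.
Qed.

Lemma odesol_columns_at a b (V W : 'M[R]_(m + m, m)) u w :
  (forall c, sol (V *m c) a = 1%:M *m c /\ sol (V *m c) b = 0 *m c) ->
  (forall c, sol (W *m c) a = 0 *m c /\ sol (W *m c) b = 1%:M *m c) ->
  sol (V *m u + W *m w) a = u /\ sol (V *m u + W *m w) b = w.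
Proof.
move=> hV hW; rewrite !odesolD (hV _).1 (hW _).1 (hV _).2 (hW _).2.
by rewrite !mul1mx !mul0mx addr0 add0r.
Qed.

(** On [-1, 0] the function e^{-x Uh} e_j is a pointwise limit of solutions whose lower ends tend to
    minus infinity. Solutions on [-1, 0] depend linearly on their two end values, so the limit is a
    solution too. Its equation at -1 is the quadratic equation applied to e^{Uh} e_j, and e^{Uh} is
    invertible. *)
Lemma up_quadsol : quadsol Q sigma mu (- Uh).
Proof.
have n10 : - 1 < 0 :> R by rewrite oppr_lt0 ltr01.
pose E := expmx (1 *: Uh).
suff key j : Uh *m Uh *m (E *m delta_mx j 0) = ode_zero Q sigma *m (E *m delta_mx j 0) +
   ode_one sigma mu *m (- (Uh *m (E *m delta_mx j 0))) :> 'cV_m.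
  have H : (Uh *m Uh) *m E = (ode_zero Q sigma + ode_one sigma mu *m (- Uh)) *m E.
    apply/matrixP => i j; rewrite -[LHS]mul_delta -[RHS]mul_delta -!mulmxA; congr (_ i 0).
    by rewrite mulmxA key !mulmxDl !mulmxN !mulNmx !mulmxA.
  rewrite /quadsol mulNmx mulmxN opprK.
  have Ei : E *m expmx ((- 1) *: Uh) = 1%:M.
    by have := expmx_inv_mul Uh (- 1); rewrite opprK.
  by rewrite -[LHS]mulmx1 -[RHS]mulmx1 -Ei !mulmxA H.
pose u x : 'cV[R]_m := expmx ((0 - x) *: Uh) *m delta_mx j 0.
(* The lower ends are -N - 2, so that a shift by x in [-1, 0] turns them into -N - 1 - c with c = 1
   + x >= 0. *)
have bot N : - N.+1%:R - 1 < 0 :> R.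
  have : 0 < N.+1%:R :> R by rewrite ltr0n.
  lra.
have [v vP] := choice (fun N => odesol_bvp gQ s0 mu 0 (delta_mx j 0) (bot N)).
have lim x i : - 1 <= x <= 0 -> sol (v N) x i 0 @[N --> \oo] --> u x i 0.
  move=> /andP[x1]; rewrite le_eqVlt => /predU1P[->|x0].
    have -> : (fun N => sol (v N) 0 i 0) = fun=> u 0 i 0; last exact: cvg_cst.
    by apply/funext => N; rewrite (vP N).2 /u subrr scale0r expmx0 mul1mx.
  have h N : sol (expmx (x *: ode_mx Q sigma mu) *m v N) (- N.+1%:R - (1 + x)) = 0 /\
     sol (expmx (x *: ode_mx Q sigma mu) *m v N) (- x) = delta_mx j 0.
    rewrite !sol_shift; have -> : - N.+1%:R - (1 + x) + x = - N.+1%:R - 1 by ring.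
    by rewrite addNr.
  have y0 : 0 < - x by rewrite oppr_gt0.
  have c0 : 0 <= 1 + x by lra.
  have := up_cvg (i := i) y0 c0 h.
  rewrite /u mul_delta sub0r.
  by under eq_fun do rewrite sol_shift add0r.
have [V1 h1] := dirichlet_columns mu gQ s0 1%:M 0 n10.
have [V2 h2] := dirichlet_columns mu gQ s0 0 1%:M n10.
pose vs := V1 *m u (- 1) + V2 *m u 0.

have rep w x i : sol w x i 0 = \sum_k (row_mx 1%:M 0 *m expmx (x *: ode_mx Q sigma mu) *m V1) i k * sol w (- 1) k 0 +
   \sum_k (row_mx 1%:M 0 *m expmx (x *: ode_mx Q sigma mu) *m V2) i k * sol w 0 k 0.
  rewrite [in LHS](odesol_columns w n10 h1 h2) odesolD addmxij.
  by move: (sol w (- 1)) (sol w 0) => c1 c2; rewrite /odesol !mulmxA !mulmxij.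
have vsE : sol vs (- 1) = u (- 1) /\ sol vs 0 = u 0.
  exact: odesol_columns_at.
have uE x : - 1 <= x <= 0 -> u x = sol vs x.
  move=> hx; apply/matrixP => i l; rewrite ord1.
  have c1 := lim x i hx.
  have c2 : sol (v N) x i 0 @[N --> \oo] --> sol vs x i 0.
    rewrite (rep vs) vsE.1 vsE.2; under eq_fun do rewrite rep.
    apply: cvgD.
      apply: (@cvgr_sum R nat 'I_m \oo _ (index_enum 'I_m) (fun k N => (row_mx 1%:M 0 *m expmx (x *: ode_mx Q sigma mu) *m V1) i k * sol (v N) (- 1) k 0)) => k.
      by apply: cvgMl_tmp; apply: lim; rewrite lexx ltW.
    apply: (@cvgr_sum R nat 'I_m \oo _ (index_enum 'I_m) (fun k N => (row_mx 1%:M 0 *m expmx (x *: ode_mx Q sigma mu) *m V2) i k * sol (v N) 0 k 0)) => k.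
    by apply: cvgMl_tmp; apply: lim; rewrite lexx ltW.
  by rewrite -(cvg_lim _ c1) // -(cvg_lim _ c2).
have cu := c2fun_rev 0 (c2fun_expW Uh (delta_mx j 0)).
have ch := c2funD cu (c2funN (c2fun_odesol Q sigma mu vs)).
have hz x : - 1 <= x -> x <= - 1 + 1 -> u x + - sol vs x = 0.
  by rewrite addNr => x1 x0; rewrite uE ?subrr // x1.
have [e1 e2] := c2fun_eq0 ch ltr01 hz.
have E1 : expmx ((0 - - 1) *: Uh) = E by rewrite sub0r opprK.
move: e1 e2; rewrite !E1 => /eqP; rewrite subr_eq0 => /eqP e1 /eqP; rewrite subr_eq0 => /eqP e2.
have e0 : E *m delta_mx j 0 = sol vs (- 1) by rewrite vsE.1 /u E1.
have s2 : odesol2 Q sigma mu vs (- 1) = ode_zero Q sigma *m sol vs (- 1) + ode_one sigma mu *m sol1 vs (- 1).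
  by rewrite /odesol2 -mulmxA odesol_state mul_row_col.
by rewrite [LHS]mulmxA e2 s2 -e0 -e1 ?mulNmx -?mulmxA.
Qed.

Lemma genop_rev u u1 u2 i : genop Q sigma (- mu) u (- u1) u2 i = genop Q sigma mu u u1 u2 i.
Proof. by rewrite /genop [(- mu) i 0]mxE [(- u1) i 0]mxE mulrNN. Qed.

Section Decay.
Variables (alpha : 'rV[R]_m) (Qs : 'M[R]_m).
Hypothesis alphaQ : alpha *m Q = 0.
Hypothesis alpha1 : \sum_i alpha 0 i = 1.
Hypothesis QsQ : Qs *m Q = 1%:M - one *m alpha.
Hypothesis Qs1 : Qs *m one = 0.

(** If Uh 1 = 0, every level would be reached with probability 1; but the solutions that converge to
    this probability become, after reversing the level, solutions with positive drift, which decay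
    uniformly. *)
Lemma up_transient : mean_drift alpha mu < 0 -> Uh *m one != 0.
Proof.
move=> drift; apply/eqP => U1.
have i : 'I_m.
  case: m alpha alpha1 => [a1|n _ _]; last exact: ord0.
  by rewrite big_ord0 => /eqP; rewrite eq_sym oner_eq0.
have drift' : 0 < mean_drift alpha (- mu).
  rewrite /mean_drift (eq_bigr (fun k => - (alpha 0 k * mu k 0))); last by move=> k _; rewrite mxE mulrN.
  by rewrite sumrN oppr_gt0.
have [th [C [th0 C0 decay]]] := dirichlet_decay gQ s0 alphaQ alpha1 QsQ Qs1 drift'.
(* At this level the decay bound is C e^{-C}, which is below 1. *)
pose x := C / th.
have x0 : 0 < x by rewrite divr_gt0.
have ab N : - N.+1%:R - 0 < x by rewrite subr0 (lt_trans _ x0) // oppr_lt0 ltr0n.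
have [V VP] := choice (fun N => dirichlet_columns mu gQ s0 0 1%:M (ab N)).
have hv j N : sol (V N *m delta_mx j 0) (- N.+1%:R - 0) = 0 /\ sol (V N *m delta_mx j 0) x = delta_mx j 0.
  by rewrite (VP N _).1 (VP N _).2 mul0mx mul1mx.
have lim : \sum_j sol (V N *m delta_mx j 0) 0 i 0 @[N --> \oo] --> \sum_j expmx (x *: Uh) i j.
  apply: (@cvgr_sum R nat 'I_m \oo _ (index_enum 'I_m) (fun j N => sol (V N *m delta_mx j 0) 0 i 0)) => j.
  exact: (up_cvg (i := i) x0 (lexx 0) (hv j)).
have le N : \sum_j sol (V N *m delta_mx j 0) 0 i 0 <= C * expR (- th * x).
  have -> : \sum_j sol (V N *m delta_mx j 0) 0 i 0 = sol (V N *m one) 0 i 0.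
    rewrite /odesol [in RHS]mulmxA -sum_entries; apply: eq_bigr => j _.
    by rewrite mulmxA mul_delta.
  pose b := x + N.+1%:R.
  have b0 : 0 < b by rewrite addr_gt0 // ltr0n.
  have [v' [v'0 v'b]] := odesol_bvp gQ s0 (- mu) one 0 b0.
  have cr := c2fun_rev x (c2fun_odesol Q sigma mu (V N *m one)).
  have ch := c2funD cr (c2funN (c2fun_odesol Q sigma (- mu) v')).
  have gh z k : 0 < z -> z < b -> genop Q sigma (- mu) (sol (V N *m one) (x - z) + - odesol Q sigma (- mu) v' z)
     (- sol1 (V N *m one) (x - z) + - odesol1 Q sigma (- mu) v' z)
     (odesol2 Q sigma mu (V N *m one) (x - z) + - odesol2 Q sigma (- mu) v' z) k = 0.
    by move=> _ _; rewrite genopD genopN genop_rev !genop_odesol // subrr.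
  have ha : sol (V N *m one) (x - 0) + - odesol Q sigma (- mu) v' 0 = 0 \/
     - sol1 (V N *m one) (x - 0) + - odesol1 Q sigma (- mu) v' 0 = 0.
    by left; rewrite subr0 (VP N _).2 mul1mx v'0 subrr.
  have hb : sol (V N *m one) (x - b) + - odesol Q sigma (- mu) v' b = 0.
    have -> : x - b = - N.+1%:R - 0 by rewrite /b; ring.
    by rewrite (VP N _).1 mul0mx v'b subrr.
  have xb : x <= b by rewrite lerDl.
  have := max_principle_eq0 gQ s0 ch b0 gh ha hb (ltW x0) xb.
  rewrite subrr => /eqP; rewrite subr_eq0 => /eqP ->.
  by apply: (decay b) => //; exact: ltW.
have : \sum_j expmx (x *: Uh) i j <= C * expR (- th * x).
  rewrite -(cvg_lim _ lim) //; apply: limr_le; first by apply/cvg_ex; exists (\sum_j expmx (x *: Uh) i j).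
  exact: nearW.
rewrite sum_entries expW_one // mxE.
have -> : - th * x = - C by rewrite /x; field; exact: lt0r_neq0.
rewrite expRN -ler_pdivrMr ?invr_gt0 ?expR_gt0 // invrK mul1r.
by have := expR_ge1Dx C; lra.
Qed.

End Decay.
End Upward.

Section Reflection.
Variables (R : realType) (m : nat) (Q : 'M[R]_m) (mu sigma : 'cV[R]_m).

(** Changing the sign of [sigma] along with [mu] keeps the Brownian motion itself, and the quadratic
    equation sees [sigma] only through its square. *)
Lemma free_mmbm_opp i (d : measure_display) (T : measurableType d) (P : probability T R)
    kappa (B X : R -> T -> R) : free_mmbm Q (- mu) (- sigma) i P kappa B X ->
  free_mmbm Q mu sigma i P kappa B (fun t w => - X t w).
Proof.
move=> [mk [mB [jumps [Bc [law [X0 Xi]]]]]]; do 6?[split=> //]; first by move=> w; rewrite X0 oppr0.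
move=> w s t st ks; have := Xi w s t st ks.
by rewrite [(- mu) _ _]mxE [(- sigma) _ _]mxE; lra.
Qed.

Lemma level_ev_opp (T : Type) (X : R -> T -> R) (kappa : R -> T -> 'I_m) y j :
  level_ev (fun t w => - X t w) kappa (- y) j = level_ev X kappa y j.
Proof.
have E w : [set t | 0 <= t /\ - X t w = - y] = [set t | 0 <= t /\ X t w = y].
  by apply/seteqP; split => t [t0 Xt]; split => //; [exact: oppr_inj|rewrite Xt].
rewrite /level_ev; apply/seteqP; split => w; rewrite /= E => -[[t Ht] kj]; split => //; exists t.
  by have : [set t | 0 <= t /\ - X t w = - y] t by []; rewrite E.
by have : [set t | 0 <= t /\ X t w = y] t by []; rewrite -E.
Qed.

Lemma ode_oneN : ode_one sigma (- mu) = - ode_one sigma mu.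
Proof.
apply/matrixP => i j; rewrite [LHS]mxE [RHS]mxE [ode_one _ _ _ _]mxE [(- mu) _ _]mxE.
by rewrite mulrN mulNrn.
Qed.

Lemma quadsolN W : quadsol Q sigma (- mu) (- W) <-> quadsol Q sigma mu W.
Proof. by rewrite /quadsol ode_oneN mulmxN mulNmx !mulmxN mulNmx !opprK. Qed.

Lemma quadsol_opp_sigma W : quadsol Q (- sigma) mu W <-> quadsol Q sigma mu W.
Proof.
rewrite /quadsol; have -> : ode_zero Q (- sigma) = ode_zero Q sigma.
  by apply/matrixP => i j; rewrite [LHS]mxE [RHS]mxE [(- sigma) _ _]mxE sqrrN.
have -> // : ode_one (- sigma) mu = ode_one sigma mu.
  by apply/matrixP => i j; rewrite [LHS]mxE [RHS]mxE [(- sigma) _ _]mxE sqrrN.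
Qed.

Lemma mean_driftN alpha : mean_drift alpha (- mu) = - mean_drift alpha mu.
Proof. by rewrite /mean_drift -sumrN; apply: eq_bigr => i _; rewrite mxE mulrN. Qed.

End Reflection.

Theorem theorem4p1 (R : realType) (m : nat) (Q : 'M[R]_m) (alpha : 'rV[R]_m)
  (mu sigma : 'cV[R]_m) (U Uh Qs : 'M[R]_m) (b : R) :
  is_generator Q -> irreducible_gen Q ->
  alpha *m Q = 0 -> \sum_i alpha 0 i = 1 -> (forall i, 0 <= alpha 0 i) ->
  (forall i, 0 < sigma i 0) ->
  is_subgenerator U -> is_subgenerator Uh ->
  (forall x : R, 0 <= x -> forall (i j : 'I_m) (d : measure_display)
      (Omega : measurableType d) (P : probability Omega R)
      (kappa : R -> Omega -> 'I_m) (B X : R -> Omega -> R),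
      free_mmbm Q mu sigma i P kappa B X ->
      P (level_ev X kappa (- x) j) = (expmx (x *: U) i j)%:E) ->
  (forall x : R, 0 <= x -> forall (i j : 'I_m) (d : measure_display)
      (Omega : measurableType d) (P : probability Omega R)
      (kappa : R -> Omega -> 'I_m) (B X : R -> Omega -> R),
      free_mmbm Q mu sigma i P kappa B X ->
      P (level_ev X kappa x j) = (expmx (x *: Uh) i j)%:E) ->
  Qs *m Q = 1%:M - (const_mx 1 : 'cV[R]_m) *m alpha -> Qs *m (const_mx 1 : 'cV[R]_m) = 0 ->
  0 < b ->
  let Eu := expmx (b *: U) in
  let Eh := expmx (b *: Uh) in
  let Dsig := diag_mx sigma^T in
  let M := block_mx 1%:M Eu Eh 1%:M in
  let sysS := fun L P : 'M[R]_m => row_mx L P *m M = Dsig *m row_mx (- (Uh *m Eh)) U in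
  let extra := fun L P : 'M[R]_m =>
    L *m (b *: (const_mx 1 : 'cV[R]_m) - Qs *m mu) - P *m Qs *m mu = sigma in
  let am := \sum_i alpha 0 i * mu i 0 in
  let good := fun L P => sysS L P /\ (am = 0 -> extra L P) in
  (exists L P : 'M[R]_m,
     good L P /\ (forall L' P', good L' P' -> L' = L /\ P' = P) /\
     is_subgenerator P /\ P \in unitmx /\
     (forall (i j : 'I_m) (d : measure_display)
        (Omega : measurableType d) (Pr : probability Omega R)
        (kappa : R -> Omega -> 'I_m) (B X R0 : R -> Omega -> R),
        free_mmbm Q mu sigma i Pr kappa B X -> regulator X R0 ->
        Pr (hit_ev (fun t w => X t w + R0 t w) kappa b j) =
          ((invmx (- P) *m L) i j)%:E)) /\
  (am != 0 ->
     M \in unitmx /\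
     (1%:M - Eu *m Eh) \in unitmx /\ (1%:M - Eh *m Eu) \in unitmx /\
     (U *m expmx ((- b) *: U) + Uh *m Eh) \in unitmx /\
     sysS (- (Dsig *m (U + Uh) *m Eh *m invmx (1%:M - Eu *m Eh)))
          (Dsig *m (U + Uh *m Eh *m Eu) *m invmx (1%:M - Eh *m Eu)) /\
     (forall (i j : 'I_m) (d : measure_display)
        (Omega : measurableType d) (Pr : probability Omega R)
        (kappa : R -> Omega -> 'I_m) (B X R0 : R -> Omega -> R),
        free_mmbm Q mu sigma i Pr kappa B X -> regulator X R0 ->
        Pr (hit_ev (fun t w => X t w + R0 t w) kappa b j) =
          ((Eh + (expmx ((- b) *: U) - Eh) *m
              invmx (U *m expmx ((- b) *: U) + Uh *m Eh) *m Uh *m Eh) i j)%:E)) /\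
  (am = 0 -> M \notin unitmx).
Proof.
move=> genQ irrQ alphaQ alpha1 alpha0 sigma_gt0 _ _ down up QsQ Qs1 b0 Eu Eh Dsig M sysS extra am good.
have s0 i : sigma i 0 != 0 by exact: lt0r_neq0.
have s0N i : (- sigma) i 0 != 0 by rewrite mxE oppr_eq0.
(* Downward passages are upward passages of the opposite process, so everything proved for [Uh]
   applies to [U]. *)
have upN x : 0 <= x -> forall (i j : 'I_m) (d : measure_display)
    (Omega : measurableType d) (P : probability Omega R)
    (kappa : R -> Omega -> 'I_m) (B X : R -> Omega -> R),
    free_mmbm Q (- mu) (- sigma) i P kappa B X -> P (level_ev X kappa x j) = (expmx (x *: U) i j)%:E.
  move=> x0 i j d T P kappa B X /free_mmbm_opp model.
  by rewrite -(down x x0 i j d T P kappa B _ model) level_ev_opp.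
have qUh := up_quadsol genQ s0 up.
have sUh := up_substoch genQ s0 up.
have qU : quadsol Q sigma mu U.
  by apply/quadsolN/quadsol_opp_sigma; exact: up_quadsol genQ s0N upN.
have sU := up_substoch genQ s0N upN.
have trUh := up_transient genQ s0 up alphaQ alpha1 QsQ Qs1.
have trU : 0 < mean_drift alpha mu -> U *m (const_mx 1 : 'cV[R]_m) != 0.
  move=> drift; apply: (up_transient genQ s0N upN alphaQ alpha1 QsQ Qs1).
  by rewrite mean_driftN oppr_lt0.
have rcU am0 : U *m (const_mx 1 : 'cV[R]_m) = 0 := substoch_recurrent genQ s0 alphaQ alpha1 QsQ Qs1 am0 qU sU.
have rcUh : mean_drift alpha mu = 0 -> Uh *m (const_mx 1 : 'cV[R]_m) = 0.
  move=> am0; apply: (substoch_recurrent (mu := - mu) genQ s0 alphaQ alpha1 QsQ Qs1) => //.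
    by rewrite mean_driftN am0 oppr0.
  by rewrite -[Uh]opprK; apply/quadsolN.
have m0 : (0 < m)%N.
  by rewrite lt0n; apply/eqP => m0; move: alpha1; rewrite big1 => [/eqP|[i im]]; [rewrite eq_sym oner_eq0|exfalso; move: im; rewrite m0].
have [L [P LP]] := dirichlet_neumann mu genQ sigma_gt0 b0.
have nm := DN_neumann genQ sigma_gt0 b0 LP.
have hit (i j : 'I_m) (d : measure_display) (Omega : measurableType d) (Pr : probability Omega R)
    (kappa : R -> Omega -> 'I_m) (B X R0 : R -> Omega -> R) :
    free_mmbm Q mu sigma i Pr kappa B X -> regulator X R0 ->
    Pr (hit_ev (fun t w => X t w + R0 t w) kappa b j) = ((invmx (- P) *m L) i j)%:E.
  move=> model reg; rewrite (hit_exits model reg b0).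
  have [v [vb v1 v0]] := nm j.
  rewrite (reg_exit_law genQ s0 model reg b0 _ vb v1); last by move=> k; have [w [wb w1 _]] := nm k; exists w.
  by rewrite v0 mxE.
split; [exists L, P|split=> [am0|am0]].
- split; first by split; [exact: DN_system sigma_gt0 qU qUh _ _ LP|exact: DN_extra genQ alphaQ alpha1 QsQ Qs1 _ _ LP].
  split; first by move=> L' P' [S' E']; eapply DN_unique; eassumption.
  split; first by eapply DN_subgenerator; eassumption.
  by split; [eapply DN_unit; eassumption|exact: hit].
- have [u1 u2 S1] := explicit_system genQ irrQ sigma_gt0 qU qUh sU sUh trU trUh b0 am0.
  split; first by eapply sysmx_unit; eassumption.
  split; first exact: u1.
  split; first exact: u2.
  split; first exact: exit_den_unit genQ irrQ sigma_gt0 qU qUh sU sUh trU trUh b0 am0.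
  split; first exact: S1.
  move=> i j d Omega Pr kappa B X R0 model reg; rewrite (hit i j d Omega Pr kappa B X R0 model reg).
  have <- // : Eh + (expmx ((- b) *: U) - Eh) *m invmx (U *m expmx ((- b) *: U) + Uh *m Eh) *m Uh *m Eh =
    invmx (- P) *m L.
  by eapply exit_formula; eassumption.
- by eapply sysmx_not_unit; eassumption.
Qed.
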